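(* Fix a prime $p>2$ and a nontrivial additive character $\psi:\mathbb{F}_p\to\mathbb{C}^\times$. Let $\Phi\in\mathcal{S}(\mathbb{R}^2)$ be a fixed Schwartz function whose Fourier transform $\hat\Phi(\tau,\sigma)$ is supported in the region $|\tau|+|\sigma|<2-2/p$. Then $$\lim_{d\to\infty,\ (d,p)=1}\ \big\langle W_2(f,\psi,\Phi)\big\rangle_{f\in\mathcal{AS}_d^0}=\iint_{\mathbb{R}^2}\Phi(t,s)\left(1-\left(\frac{\sin(\pi(t-s))}{\pi(t-s)}\right)^2\right)\mathrm{d}t\,\mathrm{d}s,$$ uniformly in $q$; i.e. for every $\varepsilon>0$ there is $d_0$ such that for every power $q$ of $p$ and every $d\ge d_0$ with $(d,p)=1$ the two sides differ by less than $\varepsilon$.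
   Context: $q$ denotes a power of $p$, $\mathbb{F}_q$ the field with $q$ elements, and $\mathrm{tr}_{q^r/p}:\mathbb{F}_{q^r}\to\mathbb{F}_p$ the trace map. For $f\in\mathbb{F}_q(x)\setminus\mathbb{F}_q$ not of the form $h^p-h$ with $h\in\mathbb{F}_q(x)$, define $$L(u,f,\psi)=\exp\Big(\sum_{r\ge1}\frac{u^r}{r}\sum_{\alpha\in\mathbb{F}_{q^r}\cup\{\infty\},\ f(\alpha)\neq\infty}\psi(\mathrm{tr}_{q^r/p}f(\alpha))\Big).$$ It is known that this is a polynomial in $u$ of degree $N=2\mathfrak{g}(C_f)/(p-1)$, where $C_f$ is the smooth projective model of $y^p-y=f(x)$ and $\mathfrak g$ denotes genus, all of whose roots have absolute value $q^{-1/2}$; write $L(u,f,\psi)=\prod_{i=1}^N(1-q^{1/2}\rho_i u)$ with $|\rho_i|=1$ and $\theta_i=\arg(\rho_i)/2\pi\in\mathbb{R}/\mathbb{Z}$. For $(d,p)=1$, $\mathcal{AS}_d^0=\{f=\sum_{i=0}^d a_ix^i\in\mathbb{F}_q[x]: a_d\ne0,\ a_i=0 \text{ whenever } i>0 \text{ and } p\mid i\}$; for such $f$ one has $N=d-1$. For $\Phi\in\mathcal S(\mathbb{R}^2)$, $\phi_N(t,s)=\sum_{m,n\in\mathbb{Z}}\Phi(N(t+m),N(s+n))$ and $W_2(f,\psi,\Phi)=\sum_{i\neq j}\phi_N(\theta_i,\theta_j)$ (sum over ordered pairs $1\le i,j\le N$). $\langle\cdot\rangle_{f\in S}$ denotes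 the average over the finite set $S$ with uniform weight. Fourier transform: $\hat\Phi(\tau,\sigma)=\iint\Phi(t,s)e^{-2\pi i(\tau t+\sigma s)}\mathrm dt\,\mathrm ds$. *)

(* Defs.v *)
From HB Require Import structures.
From mathcomp Require Import all_boot all_order all_algebra.
From mathcomp Require Import all_classical all_reals all_analysis.
From mathcomp Require Import complex.
Set Implicit Arguments. Unset Strict Implicit. Unset Printing Implicit Defensive.
Import Order.TTheory GRing.Theory Num.Theory.
Import numFieldNormedType.Exports.
Local Open Scope ring_scope.
Local Open Scope complex_scope.
Local Open Scope classical_set_scope.

Section Defs.
Variable R : realType.
Local Notation C := R[i].

Definition cexp (x : R) : C := cos x +i* sin x.

Definition mu2 := (@lebesgue_measure R \x @lebesgue_measure R)%E.

Definition intC (g : R -> R -> C) : C :=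
  (Rintegral mu2 setT (fun x : R * R => complex.Re (g x.1 x.2)))
  +i* (Rintegral mu2 setT (fun x : R * R => complex.Im (g x.1 x.2))).

Definition limC (u : nat -> C) : C :=
  (limn (fun n => complex.Re (u n))) +i* (limn (fun n => complex.Im (u n))).

Definition fourier2 (Phi : R -> R -> C) (tau sigma : R) : C :=
  intC (fun t s => Phi t s * cexp (- (2 * pi * (tau * t + sigma * s)))).

Definition pd (b : bool) (g : R -> R -> R) : R -> R -> R :=
  if b then fun t s => derive1 (fun t' => g t' s) t
  else fun t s => derive1 (fun s' => g t s') s.

Definition pdable (b : bool) (g : R -> R -> R) : Prop :=
  forall t s, if b then derivable (fun t' => g t' s) t 1
              else derivable (fun s' => g t s') s 1.

Fixpoint iter_pd (w : seq bool) (g : R -> R -> R) : R -> R -> R :=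
  if w is b :: w' then pd b (iter_pd w' g) else g.

Definition schwartz2R (g : R -> R -> R) : Prop :=
  forall w : seq bool,
    (forall b, pdable b (iter_pd w g)) /\
    (forall a b : nat, exists M : R, forall t s : R,
        `|t| ^+ a * `|s| ^+ b * `|iter_pd w g t s| <= M).

Definition schwartz2 (Phi : R -> R -> C) : Prop :=
  schwartz2R (fun t s => complex.Re (Phi t s)) /\
  schwartz2R (fun t s => complex.Im (Phi t s)).

(* phi_N(t,s) = sum_{m,n in Z} Phi(N(t+m), N(s+n)), as the limit of the
   square partial sums over m,n in [-M, M]. *)
Definition phiN (Phi : R -> R -> C) (N : nat) (t s : R) : C :=
  limC (fun M : nat =>
    \sum_(m < (2 * M).+1) \sum_(n < (2 * M).+1)
       Phi (N%:R * (t + (m%:R - M%:R))) (N%:R * (s + (n%:R - M%:R)))).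

Definition W2 (Phi : R -> R -> C) (N : nat) (th : 'I_N -> R) : C :=
  \sum_(i < N) \sum_(j < N | i != j) phiN Phi N (th i) (th j).

Definition sinc (x : R) : R := if x == 0 then 1 else sin (pi * x) / (pi * x).

Definition nontriv_add_char (p : nat) (psi : 'F_p -> C) : Prop :=
  (forall x, psi x != 0) /\
  (forall x y, psi (x + y) = psi x * psi y) /\
  (exists x, psi x != 1).

Record ext (F : finFieldType) (r : nat) := Ext {
  ext_fld :> finFieldType;
  ext_emb : {rmorphism F -> ext_fld};
  ext_card : #|ext_fld| = (#|F| ^ r)%N }.

Definition abs_trace (p : nat) (L : finFieldType) (x : L) : L :=
  \sum_(j < logn p #|L|) x ^+ (p ^ j).

Definition to_Fp (p : nat) (L : finFieldType) (y : L) : 'F_p :=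
  odflt 0 [pick k : 'F_p | (val k)%:R == y].

(* sum_{alpha in F_{q^r}} psi(tr_{q^r/p} f(alpha)) (f polynomial, so the
   point at infinity is excluded since f(oo) = oo).  The extension F_{q^r}
   is chosen by classical choice; the sum does not depend on the choice. *)
Definition expsum (p : nat) (psi : 'F_p -> C) (F : finFieldType)
    (f : {poly F}) (r : nat) : C :=
  match pselect (exists e : ext F r, True) with
  | left H => let e := projT1 (cid H) in
      \sum_(a : ext_fld e)
         psi (to_Fp p (abs_trace p (map_poly (ext_emb e) f).[a]))
  | right _ => 0
  end.

(* Coefficients of the formal power series
     L(u) = exp( sum_{r >= 1} S_r u^r / r ),
   computed with the standard recursion for the exponential of a power series:
     c_0 = 1,   n c_n = sum_{k=1}^{n} S_k c_{n-k}. *)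
Fixpoint Lseq (S : nat -> C) (n : nat) : seq C :=
  if n is n'.+1 then
    let s := Lseq S n' in
    rcons s ((n'.+1%:R)^-1 * \sum_(k < n'.+1) S k.+1 * nth 0 s (n' - k))
  else [:: 1].

Definition Lcoef (S : nat -> C) (n : nat) : C := nth 0 (Lseq S n) n.

Definition Lcoef_f (p : nat) (psi : 'F_p -> C) (F : finFieldType)
    (f : {poly F}) (n : nat) : C :=
  Lcoef (expsum psi f) n.

(* th : 'I_N -> R are normalized angles of the zeros of L(u,f,psi):
   L(u,f,psi) = prod_{i<N} (1 - q^{1/2} rho_i u),  rho_i = e^{2 pi i th_i},
   as an identity of formal power series (coefficientwise). *)
Definition is_angles (p : nat) (psi : 'F_p -> C) (F : finFieldType)
    (f : {poly F}) (N : nat) (th : 'I_N -> R) : Prop :=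
  forall n : nat,
    Lcoef_f psi f n =
    (\prod_(i < N) (1 - ((Num.sqrt (#|F|%:R : R))%:C * cexp (2 * pi * th i)) *: 'X))`_n.

(* A choice of such angles (they exist by Weil's theorem, and are unique up
   to permutation and integer translation; W2 is invariant under both). *)
Definition angles (p : nat) (psi : 'F_p -> C) (F : finFieldType)
    (f : {poly F}) (N : nat) : 'I_N -> R :=
  match pselect (exists th : 'I_N -> R, is_angles psi f th) with
  | left H => projT1 (cid H)
  | right _ => fun _ => 0
  end.

Definition ASd0 (p : nat) (F : finFieldType) (d : nat) : {set {ffun 'I_d.+1 -> F}} :=
  [set a : {ffun 'I_d.+1 -> F} | (a ord_max != 0) &&
     [forall i : 'I_d.+1, ((0 < i)%N && (p %| i)%N) ==> (a i == 0)]].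

Definition poly_of (F : finFieldType) (d : nat) (a : {ffun 'I_d.+1 -> F}) : {poly F} :=
  \poly_(i < d.+1) a (inord i).

Definition avgW2 (p : nat) (psi : 'F_p -> C) (Phi : R -> R -> C)
    (F : finFieldType) (d : nat) : C :=
  (#|ASd0 p F d|%:R)^-1 *
  \sum_(a in ASd0 p F d) W2 Phi (angles psi (poly_of a) (N:=d.-1)).

Definition rhs (Phi : R -> R -> C) : C :=
  intC (fun t s => Phi t s * (1 - (sinc (t - s)) ^+ 2)%:C).

End Defs.

(* Main.v *)
(** The Bombieri-Stepanov method bounds the sums of [psi (tr f)] over
    [F_(q ^ r)] by a constant times [q ^ (r / 2)]; Newton's identities and the
    absolute value of the last coefficient then place all inverse zeros of the
    L-function on the circle of radius [q ^ (1 / 2)], so that real angles exist.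
    Poisson summation, obtained from the Fejer kernel without Fourier inversion,
    writes [W_2] as a finite sum of [hat Phi (c / N, c' / N)] times products of
    power sums of the [rho_i], that is, of exponential sums of [f].

    Averaging over [AS_d^0] leaves the pairs of points [x], [y] of degrees
    dividing [m], [n] for which the power sums of exponent at most [N] of their
    conjugates agree up to a sign. For [P = prod (1 - x' 'X)] over the conjugates
    of [x], and [Q] similarly, this says ['X^N %| P' Q +- P Q'], so that [P Q] or
    [P / Q] is determined modulo ['X^N] by its coefficients of exponent divisible
    by [p]. Under the support condition [p (m + n) <= (2 p - 2) N - p g], such
    pairs with [P <> Q] number [O((m + n)^2 q ^ ((m + n - g) / 2))] besides a
    smaller term, so their contribution decays exponentially. The pairs with
    [P = Q] contribute [|c|]; subtracting the [N] of the terms [i = j] leaves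
    the Fejer weight [N - |c|], whose Fourier transform tends to [sinc ^ 2]. *)

Require Import Defs.
From HB Require Import structures.
From mathcomp Require Import all_boot all_order all_algebra all_fingroup all_solvable all_field.
From mathcomp Require Import zify ring lra.
Set Implicit Arguments. Unset Strict Implicit. Unset Printing Implicit Defensive.
Import Order.TTheory GRing.Theory Num.Theory.
Local Open Scope ring_scope.

(** * Stepanov's bound on Artin-Schreier curves *)

(** The threshold 2 - 2/p comes from a count of free coefficients. A polynomial of degree at most M
    = m + n whose derivative is divisible by ['X^N] keeps only its coefficients at multiples of p up
    to N and those beyond N, about N / p + M - N in number. Normalizing the power sums divides by q
    ^ (M / 2), so the off-diagonal pairs are harmless as long as N / p + M - N < M / 2, that is M <
    (2 - 2/p) N. Since q may stay bounded while d grows, a fixed saving in the exponent is not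
    enough: the gain has to be exponential in N. Compactness of the closed support turns the strict
    inequality into a gap 1 / G, hence into a saving q ^ (g / 2) with g = N %/ G, which beats the
    polynomial number of frequencies. Only q >= 3 is used to measure the decay, so all constants are
    independent of q. *)

Lemma stepanov_arith g P : (g ^ 2 + 3 * g + 2 <= P)%N ->
  (P * P.-1 + (P + 2 * g + 1) < (P - g) * (P + 2 * g + 1 - g))%N.
Proof.
move=> H; have [h eP] : exists h, P = (g + h.+1)%N by exists (P - g).-1; nia.
have -> : P.-1 = (g + h)%N by lia.
have -> : (P - g = h.+1)%N by lia.
have -> : (P + 2 * g + 1 - g = P + g + 1)%N by lia.
rewrite eP in H *; nia.
Qed.

Section Stepanov.
Variables (p : nat) (K : finFieldType) (f : {poly K}) (d : nat).
Hypotheses (p_pr : prime p) (pK : p \in [pchar K]).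
Hypotheses (szf : size f = d.+1) (cdp : coprime d p).

Definition as_curve : {set K * K} := [set z | z.2 ^+ p - z.2 == f.[z.1]].
Let Z := seq_sub (enum as_curve).
(** Functions are restricted to the rational points, so the spaces below are finite-dimensional and
    finally exhaust everything. The degree of a function survives only as its place in the
    filtration by weight. *)
Let vT := {ffun Z -> K^o}.

Definition as_mon (ij : nat * nat) : vT :=
  [ffun z => (val z).1 ^+ ij.1 * (val z).2 ^+ ij.2].
Let mu := as_mon.

(** The pole order at the unique point at infinity: x has a pole of order p there and y one of order
    d. *)
Definition as_wt (ij : nat * nat) : nat := (p * ij.1 + d * ij.2)%N.
Let mwt := as_wt.

Definition as_idx (W : nat) : seq (nat * nat) :=
  [seq ij <- [seq (i, j) | i <- iota 0 W.+1, j <- iota 0 W.+1] | (mwt ij < W)%N].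

Definition as_fun (W : nat) : {vspace vT} := <<map mu (as_idx W)>>%VS.

Lemma d_gt0 : (0 < d)%N.
Proof.
rewrite lt0n; apply: contraTneq cdp => ->; rewrite /coprime gcd0n.
by rewrite gtn_eqF // prime_gt1.
Qed.

Lemma as_wt_pos : (0 < p)%N. Proof. exact: prime_gt0. Qed.

Lemma mem_as_idx W ij : (ij \in as_idx W) = (mwt ij < W)%N.
Proof.
rewrite mem_filter andbC; case: ltnP => H; rewrite ?andbF // andbT.
apply/allpairsP; exists ij; rewrite !mem_iota /= !add0n; split=> //; last by case: (ij).
  by move: H (as_wt_pos); rewrite /mwt /as_wt; nia.
by move: H (d_gt0); rewrite /mwt /as_wt; nia.
Qed.

Lemma as_mon_in W ij : (mwt ij < W)%N -> mu ij \in as_fun W.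
Proof. by move=> H; apply/memv_span/map_f; rewrite mem_as_idx. Qed.

Lemma as_fun_sub W (U : {vspace vT}) :
  (forall ij, (mwt ij < W)%N -> mu ij \in U) -> (as_fun W <= U)%VS.
Proof.
move=> H; apply/span_subvP => v /mapP[ij]; rewrite mem_as_idx => Hij ->.
exact: H.
Qed.

Lemma as_fun_mono W W' : (W <= W')%N -> (as_fun W <= as_fun W')%VS.
Proof. by move=> H; apply: as_fun_sub => ij Hij; apply/as_mon_in/(leq_trans Hij). Qed.

Definition fmulf (u v : vT) : vT := [ffun z => (u z : K) * v z].

Lemma fmulf_linear u : linear (fmulf u).
Proof. by move=> a x y; apply/ffunP=> z; rewrite !ffunE mulrDr mulrCA. Qed.
HB.instance Definition _ u := GRing.isLinear.Build K vT vT *:%R (fmulf u) (fmulf_linear u).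

Lemma fmulfC u v : fmulf u v = fmulf v u.
Proof. by apply/ffunP=> z; rewrite !ffunE mulrC. Qed.

Lemma as_monM ij kl : fmulf (mu ij) (mu kl) = mu (ij.1 + kl.1, ij.2 + kl.2)%N.
Proof. by apply/ffunP=> z; rewrite !ffunE /= !exprD mulrACA. Qed.

Lemma as_fun_mulmon W ij u :
  u \in as_fun W -> fmulf (mu ij) u \in as_fun (W + mwt ij).
Proof.
move=> uW; pose h := linfun (fmulf (mu ij)).
suff: (h @: as_fun W <= as_fun (W + mwt ij))%VS.
  by move/subvP; apply; rewrite -[X in X \in _](lfunE (fmulf (mu ij))) memv_img.
rewrite limg_span; apply/span_subvP => v /mapP[w /mapP[kl]].
rewrite mem_as_idx => Hkl -> ->; rewrite lfunE /= as_monM; apply: as_mon_in.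
by move: Hkl; rewrite /mwt /as_wt /=; nia.
Qed.

Lemma as_funM W W' u v : u \in as_fun W.+1 -> v \in as_fun W'.+1 ->
  fmulf u v \in as_fun (W + W').+1.
Proof.
move=> uW vW; pose h := linfun (fmulf v).
suff: (h @: as_fun W.+1 <= as_fun (W + W').+1)%VS.
  by move/subvP; apply; rewrite fmulfC -[X in X \in _](lfunE (fmulf v)) memv_img.
rewrite limg_span; apply/span_subvP => w /mapP[w' /mapP[kl]].
rewrite mem_as_idx => Hkl -> ->; rewrite lfunE /= fmulfC.
have := as_fun_mulmon kl vW; apply/subvP/as_fun_mono; lia.
Qed.

Lemma curveP (z : Z) : (val z).2 ^+ p = (val z).2 + f.[(val z).1].
Proof.
have := valP z; rewrite mem_enum inE subr_eq => /eqP ->; exact: addrC.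
Qed.

Let c := lead_coef f.
Lemma lead_neq0 : c != 0. Proof. by rewrite lead_coef_eq0 -size_poly_gt0 szf. Qed.

(* y^p = c x^d + (lower weight) on the curve. *)
Lemma as_mon_red i j :
  mu (i, j + p)%N - c *: mu (i + d, j)%N \in as_fun (mwt (i, j + p)%N).
Proof.
have -> : mu (i, j + p)%N - c *: mu (i + d, j)%N =
   mu (i, j.+1) + \sum_(k < d) f`_k *: mu (i + k, j)%N.
  apply/ffunP=> z; rewrite !ffunE sum_ffunE /= exprD curveP horner_coef szf.
  under [X in _ = _ + X]eq_bigr => k _ do rewrite !ffunE /= exprD.
  rewrite big_ord_recr /= /c lead_coefE szf /= exprS !exprD /GRing.scale /=.
  set x := (ssval z).1; set y := (ssval z).2.
  have -> : \sum_(k < d) f`_k * (x ^+ i * x ^+ k * y ^+ j) =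
            x ^+ i * y ^+ j * \sum_(k < d) f`_k * x ^+ k.
    by rewrite mulr_sumr; apply: eq_bigr => k _; ring.
  ring.
apply: memvD.
  by apply: as_mon_in; rewrite /mwt /as_wt /=; have := d_gt0; have := prime_gt1 p_pr; nia.
apply: memv_suml => k _; apply/memvZ/as_mon_in; rewrite /mwt /as_wt /=.
by have := ltn_ord k; have := prime_gt0 p_pr; nia.
Qed.

Lemma as_mon_redn n i j :
  mu (i, j + p * n)%N - c ^+ n *: mu (i + d * n, j)%N \in as_fun (mwt (i, j + p * n)%N).
Proof.
elim: n i j => [|n IH] i j; first by rewrite !muln0 !addn0 expr0 scale1r subrr mem0v.
have -> : (j + p * n.+1 = j + p * n + p)%N by nia.
have H1 := as_mon_red i (j + p * n).
have H2 := IH (i + d)%N j.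
have -> : mu (i, j + p * n + p)%N - c ^+ n.+1 *: mu (i + d * n.+1, j)%N =
  (mu (i, j + p * n + p)%N - c *: mu (i + d, j + p * n)%N)
  + c *: (mu (i + d, j + p * n)%N - c ^+ n *: mu (i + d + d * n, j)%N).
  by rewrite scalerBr scalerA -exprS addrA subrK mulnS addnA.
apply: memvD => //; apply: memvZ; apply: subvP H2; apply: as_fun_mono.
by rewrite /mwt /as_wt /=; nia.
Qed.

(** As d is prime to p, equal weights force the exponents to differ by a multiple of (d, - p), and
    each factor [y ^+ p] can be traded for [c * x ^+ d] modulo lower weight. *)
Lemma as_mon_same ij kl : mwt ij = mwt kl -> (kl.2 <= ij.2)%N ->
  exists a : K, a != 0 /\ mu ij - a *: mu kl \in as_fun (mwt ij).
Proof.
case: ij kl => [i j] [k l] /=; rewrite /mwt /as_wt /= => e lj.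
have : (p %| d * (j - l))%N.
  have -> : (d * (j - l) = p * (k - i))%N by nia.
  exact: dvdn_mulr.
rewrite Gauss_dvdr 1?coprime_sym // => /dvdnP[n en].
have ej : (j = l + p * n)%N by lia.
have ek : (k = i + d * n)%N.
  apply/eqP; rewrite -(eqn_pmul2l (prime_gt0 p_pr)); apply/eqP; subst j; nia.
exists (c ^+ n); split; first by rewrite expf_neq0 // lead_neq0.
rewrite ek ej; exact: as_mon_redn.
Qed.

Lemma as_mon_same2 ij kl : mwt ij = mwt kl ->
  exists a : K, mu ij - a *: mu kl \in as_fun (mwt ij).
Proof.
move=> e; case: (leqP kl.2 ij.2) => H.
  by have [a [_ Ha]] := as_mon_same e H; exists a.
have [a [a0 Ha]] := as_mon_same (esym e) (ltnW H); exists a^-1.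
have -> : mu ij - a^-1 *: mu kl = - a^-1 *: (mu kl - a *: mu ij).
  by rewrite scalerBr !scaleNr opprK scalerA mulVf // scale1r addrC.
by rewrite e memvZ.
Qed.

Lemma dim_as_funS W : (\dim (as_fun W.+1) <= (\dim (as_fun W)).+1)%N.
Proof.
case: (boolP (has (fun ij => mwt ij == W) (as_idx W.+1))) => [/hasP[kl _ /eqP ekl]|/hasPn H].
  apply: (@leq_trans (\dim (as_fun W + <[mu kl]>)%VS)).
    apply/dimvS/as_fun_sub => ij; rewrite ltnS leq_eqVlt => /orP[/eqP e|lt].
      have [a Ha] := as_mon_same2 (etrans e (esym ekl)).
      rewrite -(subrK (a *: mu kl) (mu ij)); apply: memv_add; first by rewrite -e.
      by rewrite memvZ // memv_line.
    by apply: subvP (addvSl _ _) _ _; apply: as_mon_in.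
  apply: leq_trans (dimv_add_leqif _ _) _; rewrite dim_vline; lia.
apply: leqW; apply/dimvS/as_fun_sub => ij Hij; apply: as_mon_in.
rewrite -mem_as_idx in Hij; have := H _ Hij; rewrite mem_as_idx in Hij.
by rewrite neq_ltn => /orP[//|]; lia.
Qed.

Lemma dim_as_fun W : (\dim (as_fun W) <= W)%N.
Proof.
elim: W => [|W IH]; last exact: leq_trans (dim_as_funS W) _.
rewrite leqn0 dimv_eq0 -subv0; exact: as_fun_sub.
Qed.

Lemma as_fun_const (a : K) : [ffun=> a] \in as_fun 1.
Proof.
have -> : [ffun=> a] = a *: mu (0, 0)%N.
  by apply/ffunP=> z; rewrite !ffunE /= !expr0 mulr1 /GRing.scale /= mulr1.
by apply/memvZ/as_mon_in; rewrite /mwt /as_wt !muln0.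
Qed.

Definition isfun (u : vT) := exists W, u \in as_fun W.+1.

Lemma isfunD u v : isfun u -> isfun v -> isfun (u + v).
Proof.
move=> [W uW] [W' vW]; exists (maxn W W'); apply: memvD.
  by apply: subvP uW; apply: as_fun_mono; rewrite ltnS leq_maxl.
by apply: subvP vW; apply: as_fun_mono; rewrite ltnS leq_maxr.
Qed.

Lemma isfunM u v : isfun u -> isfun v -> isfun (fmulf u v).
Proof. by move=> [W uW] [W' vW]; exists (W + W')%N; exact: as_funM. Qed.

Lemma isfun_const (a : K) : isfun [ffun=> a].
Proof. by exists 0%N; exact: as_fun_const. Qed.

Lemma isfun_mon ij : isfun (mu ij).
Proof. by exists (mwt ij); exact: as_mon_in. Qed.

Lemma isfun_ind (g : Z -> K) (x0 : K) : isfun [ffun z => g z] ->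
  isfun [ffun z => (g z == x0)%:R : K].
Proof.
move=> gf.
have gx : isfun [ffun z => g z - x0].
  have -> : [ffun z => g z - x0] = [ffun z => g z] + [ffun=> - x0] :> vT.
    by apply/ffunP=> z; rewrite !ffunE.
  by apply: isfunD => //; exact: isfun_const.
have gn n : isfun [ffun z => (g z - x0) ^+ n].
  elim: n => [|n IH].
    have -> : [ffun z => (g z - x0) ^+ 0] = [ffun=> 1] :> vT.
      by apply/ffunP=> z; rewrite !ffunE.
    exact: isfun_const.
  have -> : [ffun z => (g z - x0) ^+ n.+1] =
     fmulf [ffun z => g z - x0] [ffun z => (g z - x0) ^+ n].
    by apply/ffunP=> z; rewrite !ffunE exprS.
  exact: isfunM.
have -> : [ffun z => (g z == x0)%:R : K] =
   [ffun=> 1] + fmulf [ffun=> -1] [ffun z => (g z - x0) ^+ #|K|.-1] :> vT.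
  apply/ffunP=> z; rewrite !ffunE; case: eqP => [->|/eqP ne].
    by rewrite subrr expr0n -subn1 subn_eq0 leqNgt finNzRing_gt1 /= mulr0 addr0.
  rewrite -subr_eq0 in ne.
  have -> : (g z - x0) ^+ #|K|.-1 = 1.
    apply: (mulfI ne); rewrite -exprS prednK ?expf_card ?mulr1 //.
    exact: ltnW (finNzRing_gt1 _).
  by rewrite mulr1 subrr.
by apply: isfunD (isfun_const _) _; apply: isfunM => //; exact: isfun_const.
Qed.

(** The indicator of a point is a polynomial in the coordinates, through [1 - u ^+ #|K|.-1]. Hence
    the filtration exhausts all functions on the points, and its final dimension counts them. *)
Lemma isfun_all : exists M0, forall M, (M0 <= M)%N -> as_fun M = fullv.
Proof.
have H (z0 : Z) : exists W, [ffun z => (z == z0)%:R : K^o] \in as_fun W.+1.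
  have := isfunM (@isfun_ind (fun z => (val z).1) (val z0).1 _)
                 (@isfun_ind (fun z => (val z).2) (val z0).2 _).
  have -> : fmulf [ffun z => ((val z).1 == (val z0).1)%:R : K]
                  [ffun z => ((val z).2 == (val z0).2)%:R : K]
     = [ffun z => (z == z0)%:R : K^o].
    apply/ffunP=> z; rewrite !ffunE -natrM mulnb -val_eqE /=.
    by case: (ssval z) (ssval z0) => [a b] [a' b'].
  apply.
    have -> : [ffun z : Z => (val z).1] = mu (1, 0)%N.
      by apply/ffunP=> z; rewrite !ffunE /= mulr1 expr1.
    exact: isfun_mon.
  have -> : [ffun z : Z => (val z).2] = mu (0, 1)%N.
    by apply/ffunP=> z; rewrite !ffunE /= mul1r expr1.
  exact: isfun_mon.
have [W HW] := fin_all_exists H.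
exists (\max_z W z).+1 => M HM; apply/eqP; rewrite eqEsubv subvf /=.
apply/subvP=> v _.
have -> : v = \sum_z0 v z0 *: [ffun z => (z == z0)%:R : K^o].
  apply/ffunP=> z; rewrite sum_ffunE (bigD1 z) //= !ffunE eqxx /GRing.scale /= mulr1.
  by rewrite big1 ?addr0 // => i ne; rewrite !ffunE eq_sym (negbTE ne) /GRing.scale /= mulr0.
apply: memv_suml => z0 _; apply/memvZ; apply: subvP (HW z0); apply: as_fun_mono.
by apply: leq_trans HM; rewrite ltnS; exact: leq_bigmax.
Qed.

Lemma dim_curve : \dim {: vT} = #|as_curve|.
Proof. by rewrite dimvf /dim /= card_seq_sub ?enum_uniq // -cardE muln1. Qed.

(** Bezout for p and d fixes j modulo p; from p d on, what remains is a nonnegative multiple of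
    p. *)
Lemma wt_repr n : (p * d <= n)%N -> exists ij, mwt ij = n /\ (ij.2 < p)%N.
Proof.
move=> H; have [km kn e _] := egcdnP p d_gt0.
rewrite (eqP cdp) in e.
pose j := ((n * km) %% p)%N.
have jp : (j < p)%N by rewrite ltn_mod prime_gt0.
have dj : (d * j <= n)%N by apply: leq_trans H; rewrite mulnC leq_mul2r ltnW ?orbT.
have : (p %| n - d * j)%N.
  rewrite -eqn_mod_dvd // -modnMmr /j modn_mod modnMmr mulnCA (mulnC d) e.
  by rewrite mulnDr muln1 mulnA modnMDl.
case/dvdnP=> i ei; exists (i, j); split=> //=.
by rewrite /mwt /as_wt /= [(p * i)%N]mulnC -ei subnK.
Qed.

Lemma wt_inj ij kl : (ij.2 < p)%N -> (kl.2 < p)%N -> mwt ij = mwt kl -> ij = kl.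
Proof.
wlog le: ij kl / (kl.2 <= ij.2)%N.
  move=> H a b e; case/orP: (leq_total kl.2 ij.2) => l; first exact: H.
  by apply/esym/H.
case: ij kl le => [i j] [k l] /= le jp lp; rewrite /mwt /as_wt /= => e.
have : (p %| d * (j - l))%N.
  have -> : (d * (j - l) = p * (k - i))%N by nia.
  exact: dvdn_mulr.
rewrite Gauss_dvdr 1?coprime_sym // => /dvdnP[n en].
have n0 : n = 0%N by case: n en => // n; nia.
have -> : j = l by lia.
have : (p * i = p * k)%N by nia.
by move/eqP; rewrite eqn_pmul2l ?prime_gt0 // => /eqP ->.
Qed.

(** This replaces the count of the zeros of a function by its poles. One coincidence in weight
    [mwt ij] propagates, by multiplication with monomials, to every weight from [mwt ij + p * d] on.
    The filtration stops growing there, although it must still reach all functions on the curve. *)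
Lemma card_curve_le ij : mu ij \in as_fun (mwt ij) -> (#|as_curve| <= mwt ij + p * d)%N.
Proof.
move=> Hij; set w := mwt ij.
have step W : (w + p * d <= W)%N -> (as_fun W.+1 <= as_fun W)%VS.
  move=> HW; apply: as_fun_sub => kl; rewrite ltnS leq_eqVlt => /orP[/eqP e|]; last exact: as_mon_in.
  have [e' [ee _]] := @wt_repr (W - w) ltac:(lia).
  have := as_fun_mulmon e' Hij; rewrite as_monM ee -/w subnKC; last by lia.
  move=> H1.
  have [|a Ha] := @as_mon_same2 kl ((e'.1 + ij.1)%N, (e'.2 + ij.2)%N).
    rewrite e; move: ee HW; rewrite /w /mwt /as_wt /=; nia.
  rewrite e in Ha; rewrite -(subrK (a *: mu (e'.1 + ij.1, e'.2 + ij.2)%N) (mu kl)).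
  by apply: memvD => //; apply: memvZ.
have all n : (as_fun (w + p * d + n) <= as_fun (w + p * d))%VS.
  elim: n => [|n IH]; first by rewrite addn0.
  by apply: subv_trans IH; rewrite addnS; apply: step; rewrite leq_addr.
have [M0 HM] := isfun_all.
rewrite -dim_curve -(HM (w + p * d + M0)%N) ?leq_addl //.
exact: leq_trans (dimvS (all M0)) (dim_as_fun _).
Qed.

Lemma not_free_dep (I : finType) (Fx : I -> vT) (U : {vspace vT}) :
  (forall x, Fx x \in U) -> (\dim U < #|I|)%N ->
  exists2 D : I -> K, \sum_x D x *: Fx x = 0 & exists x, D x != 0.
Proof.
move=> HU Hd; pose X := [tuple Fx (enum_val i) | i < #|I|].
have nf : ~~ free X.
  apply/negP; rewrite /free size_tuple => /eqP e.
  have : (\dim <<X>> <= \dim U)%N.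
    by apply/dimvS/span_subvP => v /mapP[x xS ->]; exact: HU.
  by rewrite e leqNgt Hd.
case: (boolP [exists k : {ffun 'I_#|I| -> K},
     (\sum_i k i *: X`_i == 0) && [exists i, k i != 0]]).
  move=> /existsP[k /andP[/eqP Hk /existsP[i Hi]]].
  exists (fun x => k (enum_rank x)); last by exists (enum_val i); rewrite enum_valK.
  rewrite -[RHS]Hk (reindex_onto (@enum_val _ I) enum_rank); last by move=> *; rewrite enum_rankK.
  apply: eq_big => j; first by rewrite enum_valK eqxx.
  by move=> _; rewrite enum_valK (nth_map j) ?size_enum_ord // nth_ord_enum.
move=> Hn; case/negP: nf; apply/freeP => k Hk i; apply/eqP; apply: contraNT Hn => ki.
apply/existsP; exists [ffun i => k i]; apply/andP; split.
  by under eq_bigr do rewrite ffunE; rewrite Hk.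
by apply/existsP; exists i; rewrite ffunE.
Qed.

Definition as_red W := [seq ij <- as_idx W | (ij.2 < p)%N].

Lemma size_as_red W : (W - p * d <= size (as_red W))%N.
Proof.
rewrite -(size_iota (p * d) (W - p * d)) -(size_map mwt (as_red W)).
apply: uniq_leq_size; first exact: iota_uniq.
move=> n; rewrite mem_iota => Hn; have [ij [e jp]] := @wt_repr n ltac:(lia).
by apply/mapP; exists ij => //; rewrite mem_filter jp mem_as_idx e; lia.
Qed.

Lemma uniq_as_red W : uniq (as_red W).
Proof.
by rewrite filter_uniq // filter_uniq // allpairs_uniq ?iota_uniq // => -[a b] [a' b'].
Qed.

Variables (P : nat).
Hypotheses (P_nat : p.-nat P) (cardK : #|K| = (P ^ 2)%N).

Lemma sum_expP (I : finType) (g : I -> K) : (\sum_i g i) ^+ P = \sum_i g i ^+ P.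
Proof.
have P0 : (0 < P)%N by case/andP: P_nat.
apply: (big_morph (fun x => x ^+ P)); last by rewrite expr0n gtn_eqF.
by move=> x y; apply: exprDn_pchar; rewrite (eq_pnat _ (pcharf_eq pK)).
Qed.

(** The products of the P-th power of a monomial in A with a monomial in B outnumber the dimension
    of the space that contains them, which gives a linear relation. Over a field of P ^ 2 elements
    raising to the power P is an involution; it moves the exponent P from the first factor to the
    second. The weights of the new products are pairwise distinct, so the leading monomial drops
    below its own weight and [card_curve_le] applies. *)
Theorem stepanov_bound : ((p * d) ^ 2 + 3 * (p * d) + 2 <= P)%N ->
  (#|as_curve| <= P ^ 2 + (2 * (p * d) + 2) * P)%N.
Proof.
set g := (p * d)%N => Pbig.
(* With this m, (P - g) (m - g) exceeds P (P - 1) + m once P is larger than g ^ 2 + 3 g + 1. *)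
pose m := (P + 2 * g + 1)%N.
pose A := seq_sub (as_red P); pose B := seq_sub (as_red m).
pose Fx (x : A * B) := mu (P * (val x.1).1 + (val x.2).1, P * (val x.1).2 + (val x.2).2)%N.
have AP (a : A) : (mwt (val a) < P)%N /\ ((val a).2 < p)%N.
  by have := valP a; rewrite mem_filter mem_as_idx => /andP[].
have BP (b : B) : (mwt (val b) < m)%N /\ ((val b).2 < p)%N.
  by have := valP b; rewrite mem_filter mem_as_idx => /andP[].
have HU x : Fx x \in as_fun (P * P.-1 + m).
  apply: as_mon_in; have [h1 _] := AP x.1; have [h2 _] := BP x.2.
  by move: h1 h2; rewrite /mwt /as_wt /=; nia.
have Hd : (\dim (as_fun (P * P.-1 + m)) < #|{: A * B}|)%N.
  apply: leq_ltn_trans (dim_as_fun _) _.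
  rewrite card_prod !card_seq_sub ?uniq_as_red //.
  apply: (@leq_trans ((P - g) * (m - g))); last by apply: leq_mul; exact: size_as_red.
  exact: stepanov_arith.
have [D HD [x0 Dx0]] := not_free_dep HU Hd.
pose w (x : A * B) := (mwt (val x.1) + P * mwt (val x.2))%N.
pose ex (x : A * B) := ((val x.1).1 + P * (val x.2).1, (val x.1).2 + P * (val x.2).2)%N.
have wE x : mwt (ex x) = w x by rewrite /w /mwt /as_wt /ex /=; lia.
have C0 : \sum_x (D x ^+ P) *: mu (ex x) = 0.
  apply/ffunP => z; rewrite sum_ffunE [RHS]ffunE.
  have P0 : (0 < P)%N by lia.
  suff /eqP : (\sum_i (D i ^+ P *: mu (ex i)) z : K) ^+ P = 0.
    by rewrite expf_eq0 P0 => /eqP.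
  rewrite sum_expP; have /ffunP/(_ z) := HD; rewrite sum_ffunE [X in _ = X]ffunE => HDz.
  rewrite -[RHS]HDz.
  have PP (a : K) : a ^+ (P * P) = a by rewrite mulnn -cardK expf_card.
  apply: eq_bigr => x _; rewrite !ffunE /GRing.scale /= exprMn -exprM PP; congr (_ * _).
  by rewrite exprMn -!exprM !mulnDl ![(P * _ * P)%N]mulnAC !exprD ![_ ^+ (P * P * _)]exprM !PP
     ![(_ * P)%N]mulnC.
case: (@arg_maxnP _ x0 (fun x => D x != 0) w Dx0) => x Dx xmax.
(* The weight of the first factor is below P, so Euclidean division of [w y] by P recovers both
   weights, and reduced monomials are determined by their weights. *)
have winj y : D y != 0 -> y != x -> (w y < w x)%N.
  move=> Dy; apply: contraNT; rewrite -leqNgt => le.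
  have e : w y = w x by apply/eqP; rewrite eqn_leq le andbT; exact: xmax.
  have [a1 a2] := AP y.1; have [b1 b2] := BP y.2.
  have [a1' a2'] := AP x.1; have [b1' b2'] := BP x.2.
  have P0 : (0 < P)%N by lia.
  have e1 : mwt (val y.1) = mwt (val x.1).
    have := congr1 (modn^~ P) e; rewrite /w ![(P * _)%N]mulnC !(addnC (mwt (val _.1))) !modnMDl.
    by rewrite !modn_small.
  have e2 : mwt (val y.2) = mwt (val x.2).
    by move: e; rewrite /w e1 => /addnI/eqP; rewrite eqn_pmul2l // => /eqP.
  apply/eqP; case: x y e1 e2 a2 b2 a2' b2' {Dx xmax Dy le e a1 b1 a1' b1'} => [xa xb] [ya yb] /=.
  by move=> e1 e2 a2 b2 a2' b2'; congr (_, _); apply/val_inj/wt_inj.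
have key : mu (ex x) \in as_fun (mwt (ex x)).
  have : (D x ^+ P) *: mu (ex x) \in as_fun (mwt (ex x)).
    move: C0; rewrite (bigD1 x) //= => /eqP; rewrite addr_eq0 => /eqP ->.
    rewrite memvN; apply: memv_suml => y ne; case: (eqVneq (D y) 0) => [->|Dy].
      by rewrite expr0n gtn_eqF ?scale0r ?mem0v //; lia.
    by apply/memvZ/as_mon_in; rewrite !wE; exact: winj.
  by move/(memvZ (D x ^+ P)^-1); rewrite scalerA mulVf ?scale1r ?expf_neq0.
apply: leq_trans (card_curve_le key) _; rewrite wE /w -/g.
have [h1 _] := AP x.1; have [h2 _] := BP x.2.
have h3 : (P * mwt (val x.2) <= P * (P + 2 * g))%N.
  by apply: leq_mul => //; move: h2; set v := mwt _; rewrite /m; lia.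
have h4 : (g <= P)%N by apply: leq_trans Pbig; lia.
apply: (@leq_trans (P + P * (P + 2 * g) + P)); last first.
  by rewrite mulnDr mulnn mulnDl [(P * (2 * g))%N]mulnC mul2n -addnn; lia.
by rewrite leq_add // leq_add // ltnW.
Qed.
End Stepanov.

(** * Power sums of conjugates *)

Definition eqm (K : fieldType) (n : nat) (A B : {poly K}) := 'X^n %| A - B.

Section Eqm.
Variable K : fieldType.
Implicit Types A B D E : {poly K}.

Lemma dvdXnP n A : reflect (forall i, (i < n)%N -> A`_i = 0) ('X^n %| A).
Proof.
apply: (iffP idP) => [/dvdpP[B ->] i lt|H]; first by rewrite coefMXn lt.
rewrite -(poly_take_drop n A).
have -> : take_poly n A = 0 by apply/polyP=> i; rewrite coef_take_poly coef0; case: ifP => // /H.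
by rewrite add0r dvdp_mull.
Qed.

Lemma eqmP n A B : reflect (forall i, (i < n)%N -> A`_i = B`_i) (eqm n A B).
Proof.
apply: (iffP (dvdXnP _ _)) => H i lt; first by apply/eqP; rewrite -subr_eq0 -coefB H.
by rewrite coefB H // subrr.
Qed.

Lemma eqm_refl n A : eqm n A A. Proof. by apply/eqmP. Qed.
Lemma eqm_sym n A B : eqm n A B -> eqm n B A.
Proof. by move/eqmP=> H; apply/eqmP=> i /H. Qed.
Lemma eqm_trans n B A D : eqm n A B -> eqm n B D -> eqm n A D.
Proof. by move=> /eqmP H /eqmP H'; apply/eqmP=> i lt; rewrite H ?H'. Qed.
Lemma eqmD n A B D E : eqm n A B -> eqm n D E -> eqm n (A + D) (B + E).
Proof. by move=> /eqmP H /eqmP H'; apply/eqmP=> i lt; rewrite !coefD H ?H'. Qed.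
Lemma eqmN n A B : eqm n A B -> eqm n (- A) (- B).
Proof. by move=> /eqmP H; apply/eqmP=> i lt; rewrite !coefN H. Qed.
Lemma eqmM n A B D E : eqm n A B -> eqm n D E -> eqm n (A * D) (B * E).
Proof.
move=> /eqmP H /eqmP H'; apply/eqmP=> i lt; rewrite !coefM; apply: eq_bigr => j _.
by rewrite H ?H' //; have := ltn_ord j; lia.
Qed.
Lemma eqmS n m A B : (n <= m)%N -> eqm m A B -> eqm n A B.
Proof. by move=> le /eqmP H; apply/eqmP=> i lt; apply: H; lia. Qed.
Lemma eqmX n k A B : eqm n A B -> eqm n (A ^+ k) (B ^+ k).
Proof. by move=> H; elim: k => [|k IH]; rewrite ?eqm_refl // !exprS; exact: eqmM. Qed.
Lemma eqm_size n A B : (size A <= n)%N -> (size B <= n)%N -> eqm n A B -> A = B.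
Proof.
move=> sA sB /eqmP H; apply/polyP=> i; case: (ltnP i n) => [/H //|le].
by rewrite !nth_default // (leq_trans _ le).
Qed.
End Eqm.

Section PowerSums.
Variables (p : nat) (K : fieldType).
Hypothesis pK : p \in [pchar K].
Variable e : nat.
Let E := (p ^ e)%N.
Implicit Types G H : {poly K}.

Let p_pr : prime p. Proof. exact: pcharf_prime pK. Qed.
Let E_gt0 : (0 < E)%N. Proof. by rewrite expn_gt0 prime_gt0. Qed.

Lemma pnatE (R : nzSemiRingType) : p \in [pchar R] -> ([pchar R]).-nat E.
Proof. by move=> pR; rewrite (eq_pnat _ (pcharf_eq pR)) pnatX pnat_id. Qed.

(* Modulo ['X^E], [G ^+ E.-1] is the inverse of [G]; the coefficients of
   [lps G] are then the power sums of the reciprocal roots of [G]. *)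
Definition lps G := - ('X * G^`() * G ^+ E.-1).

(** E is a power of the characteristic, so [G ^+ E] is 1 plus the E-th power of a multiple of
    ['X]. *)
Lemma unit_expE G : G`_0 = 1 -> eqm E (G ^+ E) 1.
Proof.
move=> G0.
have -> : G = 1 + 'X * drop_poly 1 G.
  rewrite -{1}(poly_take_drop 1 G) expr1 mulrC; congr (_ + _).
  apply/polyP=> i; rewrite coef_take_poly coef1; case: i => [|i] //=.
have pp : p \in [pchar {poly K}] by rewrite pchar_poly.
rewrite exprDn_pchar ?expr1n ?pnatE // exprMn /eqm addrC addKr.
exact: dvdp_mulr.
Qed.

Lemma expE_pred G : G ^+ E = G * G ^+ E.-1.
Proof. by rewrite -exprS prednK. Qed.

Lemma lps_mul G H : G`_0 = 1 -> H`_0 = 1 -> eqm E (lps (G * H)) (lps G + lps H).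
Proof.
move=> G0 H0.
have -> : lps (G * H) = lps G * H ^+ E + lps H * G ^+ E.
  rewrite /lps derivM exprMn !expE_pred; ring.
apply: eqmD; rewrite -[X in eqm _ _ X]mulr1; apply: eqmM (eqm_refl _ _) (unit_expE _) => //.
Qed.

Lemma lps_eqm n G H : (n <= E)%N -> eqm n.+1 G H -> eqm n.+1 (lps G) (lps H).
Proof.
move=> nE GH; apply: eqmN; apply: eqmM; last exact: eqmX.
apply/eqmP => i lt; rewrite !coefXM; case: i lt => // i lt /=.
by rewrite !coef_deriv; move/eqmP: GH => ->.
Qed.

(** [(1 - a *: 'X) ^+ E] equals 1 - a ^ E X ^ E, so the power [E.-1] is exactly the geometric series
    truncated at E. *)
Lemma coef_lps_lin a i : (0 < i)%N -> (i <= E)%N -> (lps (1 - a *: 'X))`_i = a ^+ i.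
Proof.
move=> i0 iE.
have pp : p \in [pchar {poly K}] by rewrite pchar_poly.
have H : (1 - a *: 'X) ^+ E.-1 = \poly_(j < E) a ^+ j.
  have nz : 1 - a *: 'X != 0 :> {poly K}.
    by apply/eqP=> /(congr1 (fun P : {poly K} => P`_0)); rewrite !coefE mulr0 subr0 => /eqP; rewrite oner_eq0.
  apply: (mulfI nz); rewrite -exprS prednK // -scaleN1r -['X]expr1.
  rewrite scalerA mulN1r exprDn_pchar ?pnatE // expr1n.
  rewrite exprZn expr1.
  have -> : (- a) ^+ E = - a ^+ E.
    have := exprDn_pchar a (- a) (pnatE pK); rewrite subrr expr0n gtn_eqF //=.
    by move/esym/eqP; rewrite addrC addr_eq0 => /eqP.
  apply/polyP=> j; rewrite mulrDl mul1r -scalerAl !coefD !coefZ coefXn coefXM !coef_poly coef1.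
  case: j => [|j] /=; first by rewrite E_gt0 !mulr0 eq_sym gtn_eqF // mulr0.
  rewrite add0r; case: (ltngtP j.+1 E) => [lt|lt|e1].
  - by rewrite mulr0 exprS mulNr subrr.
  - by rewrite !mulr0 addr0.
  - by rewrite -e1 mulr1 add0r exprS mulNr.
rewrite /lps H derivB derivC derivZ derivX sub0r mulrN mulNr opprK alg_polyC.
rewrite -mulrA coefXM; case: i i0 iE => // i _ iE /=.
by rewrite coefCM coef_poly iE exprS.
Qed.

Lemma lps0 G : (lps G)`_0 = 0.
Proof. by rewrite /lps -mulrA coefN coefXM /= oppr0. Qed.

Lemma lps1 : lps 1 = 0.
Proof. by rewrite /lps derivC mulr0 mul0r oppr0. Qed.

Lemma lps_prod (I : Type) (r : seq I) (a : I -> K) i : (0 < i)%N -> (i < E)%N ->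
  (lps (\prod_(j <- r) (1 - a j *: 'X)))`_i = \sum_(j <- r) a j ^+ i.
Proof.
move=> i0 iE.
have lin0 b : (1 - b *: 'X : {poly K})`_0 = 1 by rewrite !coefE mulr0 subr0.
have prod0 (s : seq I) : (\prod_(j <- s) (1 - a j *: 'X))`_0 = 1.
  by elim: s => [|x s IH]; rewrite ?big_nil ?coef1 // big_cons coef0M lin0 IH mulr1.
elim: r => [|x r IH]; first by rewrite !big_nil lps1 coef0.
rewrite !big_cons -IH.
have /eqmP -> // := lps_mul (lin0 (a x)) (prod0 r).
by rewrite coefD coef_lps_lin // ltnW.
Qed.

(** Multiplying by [G * H] clears the denominators of the logarithmic derivatives, because [G ^+ E]
    and [H ^+ E] are 1 modulo ['X^(n.+1)]. The factor ['X] in [lps] costs one unit of the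
    exponent. *)
Lemma lps_cross (eps : K) n G H : G`_0 = 1 -> H`_0 = 1 -> (n < E)%N ->
  (forall i, (0 < i <= n)%N -> (lps G)`_i + eps * (lps H)`_i = 0) ->
  'X^n %| G^`() * H + eps%:P * (G * H^`()).
Proof.
move=> G0 H0 nE HH.
have h0 : eqm n.+1 (lps G + eps%:P * lps H) 0.
  apply/eqmP=> i lt; rewrite coefD coefCM coef0.
  by case: (posnP i) => [->|i0]; rewrite ?lps0 ?mulr0 ?addr0 // HH // i0.
have h1 : eqm n.+1 (- ('X * (G^`() * H + eps%:P * (G * H^`())))) 0.
  have e1 : eqm n.+1 ((lps G + eps%:P * lps H) * (G * H)) 0.
    by have := eqmM h0 (eqm_refl n.+1 (G * H)); rewrite mul0r.
  apply: eqm_trans e1; apply: eqm_sym.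
  have -> : (lps G + eps%:P * lps H) * (G * H) =
     - ('X * G^`() * H) * G ^+ E + (- ('X * (eps%:P * (G * H^`())))) * H ^+ E.
    rewrite /lps !expE_pred; ring.
  have -> : - ('X * (G^`() * H + eps%:P * (G * H^`()))) =
     - ('X * G^`() * H) * 1 + (- ('X * (eps%:P * (G * H^`())))) * 1 by ring.
  by apply: eqmD; apply: eqmM (eqm_refl _ _) (eqmS nE (unit_expE _)).
apply/dvdXnP => i lt; move/eqmP: h1 => /(_ i.+1 lt).
by rewrite coefN coefXM /= coef0 => /eqP; rewrite oppr_eq0 => /eqP.
Qed.
End PowerSums.

Lemma map_lps (p e : nat) (K L : fieldType) (iota : {rmorphism K -> L}) (G : {poly K}) :
  map_poly iota (lps p e G) = lps p e (map_poly iota G).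
Proof. by rewrite /lps rmorphN !rmorphM rmorphXn /= map_polyX deriv_map. Qed.

(** * Frobenius, descent to the base field, and polynomials of conjugates *)

Section Frob.
Variables (p : nat) (F L : finFieldType) (iota : {rmorphism F -> L}).
Hypothesis pF : p \in [pchar F].
Let q := #|F|.

Let p_pr : prime p. Proof. exact: pcharf_prime pF. Qed.
Lemma pL : p \in [pchar L]. Proof. by rewrite (fmorph_pchar iota). Qed.

Lemma card_F : q = (p ^ logn p q)%N.
Proof. by have := card_pprimeChar pF. Qed.

Lemma frob_add i : {morph (fun x : L => x ^+ (q ^ i)) : x y / x + y}.
Proof.
move=> x y; apply: exprDn_pchar; rewrite (eq_pnat _ (pcharf_eq pL)).
by rewrite pnatX card_F pnatX pnat_id.
Qed.

Definition frob (x : L) := x ^+ q.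

Lemma frobD : {morph frob : x y / x + y}.
Proof. by have := frob_add 1; rewrite expn1. Qed.

Fact frob_zmod : zmod_morphism frob.
Proof.
move=> x y; have := frobD (x - y) y; rewrite subrK => ->; by rewrite addrK.
Qed.
Fact frob_monoid : monoid_morphism frob.
Proof. by split=> [|x y]; rewrite /frob ?expr1n ?exprMn. Qed.
HB.instance Definition _ := GRing.isZmodMorphism.Build L L frob frob_zmod.
HB.instance Definition _ := GRing.isMonoidMorphism.Build L L frob frob_monoid.

Fact frobm_ex : {f : {rmorphism L -> L} | forall x, f x = x ^+ q}.
Proof. by exists frob. Qed.
Definition frobm := sval frobm_ex.
Lemma frobmE x : frobm x = x ^+ q. Proof. exact: (svalP frobm_ex). Qed.

Lemma iter_frob i x : iter i frobm x = x ^+ (q ^ i).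
Proof. by elim: i => [|i IH]; rewrite ?expr1 // iterS IH frobmE -exprM expnSr. Qed.

Lemma frob_iota a : frobm (iota a) = iota a.
Proof. by rewrite frobmE -rmorphXn expf_card. Qed.

Lemma frob_fixed x : frobm x = x -> exists a, x = iota a.
Proof.
move=> fx; have := congr1 (map_poly iota) (finField_genPoly F).
rewrite rmorphB rmorphXn /= map_polyX rmorph_prod /= => e.
have : root (\prod_a map_poly iota ('X - a%:P)) x.
  by rewrite -e /root !hornerE -/q -frobmE fx subrr.
move=> H; have {}H : root (\prod_(a : F) ('X - (iota a)%:P)) x.
  by move: H; congr (is_true (root _ x)); apply: eq_bigr => a _; rewrite rmorphB /= map_polyX map_polyC.
move: H; rewrite -(big_map iota xpredT (fun z => 'X - z%:P)) root_prod_XsubC.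
by case/mapP=> a _ ->; exists a.
Qed.

(** A total retraction of [iota], with default value 0; it is meaningful on the elements fixed by
    Frobenius. *)
Definition fdown (x : L) : F := odflt 0 [pick a | iota a == x].

Lemma fdownK a : fdown (iota a) = a.
Proof.
by rewrite /fdown; case: pickP => [b /eqP/fmorph_inj //|/(_ a)]; rewrite eqxx.
Qed.

Lemma iota_fdown x : frobm x = x -> iota (fdown x) = x.
Proof. by case/frob_fixed=> a ->; rewrite fdownK. Qed.

Definition pdown (P : {poly L}) : {poly F} := \poly_(i < size P) fdown P`_i.

Lemma iota_pdown (P : {poly L}) : map_poly frobm P = P -> map_poly iota (pdown P) = P.
Proof.
move=> fP; apply/polyP=> i; rewrite coef_map coef_poly.
case: ltnP => [_|le]; last by rewrite raddf0 nth_default.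
by apply: iota_fdown; rewrite -{2}fP coef_map.
Qed.

Lemma map_iota_inj : injective (map_poly iota).
Proof. exact: map_poly_inj. Qed.

Definition frtr k (x : L) := \sum_(j < k) x ^+ (q ^ j).

(** The product runs over k powers of Frobenius with repetition, as a norm from the extension of
    degree k does. Factors [1 - y *: 'X] instead of ['X - y%:P] keep the constant term 1. *)
Definition frprod k (x : L) := \prod_(j < k) (1 - (x ^+ (q ^ j)) *: 'X).

Definition cpol k (x : L) : {poly F} := pdown (frprod k x).

Lemma frob_sum k x : x ^+ (q ^ k) = x -> frobm (frtr k x) = frtr k x.
Proof.
move=> fx; rewrite /frtr rmorph_sum /=; case: k fx => [|k] fx; first by rewrite !big_ord0.
rewrite big_ord_recr [RHS]big_ord_recl /= !frobmE -!exprM -!expnSr expn0 expr1 fx addrC.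
by congr (_ + _); apply: eq_bigr => i _; rewrite ?frobmE -exprM -expnSr.
Qed.

Lemma frob_prod k x : x ^+ (q ^ k) = x -> map_poly frobm (frprod k x) = frprod k x.
Proof.
move=> fx; rewrite /frprod rmorph_prod /=; case: k fx => [|k] fx; first by rewrite !big_ord0.
have E i : map_poly frobm (1 - (x ^+ (q ^ i)) *: 'X) = 1 - (x ^+ (q ^ i.+1)) *: 'X.
  by rewrite rmorphB /= rmorph1 linearZ /= map_polyX frobmE -exprM -expnSr.
under eq_bigr do rewrite E.
rewrite big_ord_recr [RHS]big_ord_recl /= fx expn0 expr1 mulrC.
by congr (_ * _).
Qed.

Lemma iota_cpol k x : x ^+ (q ^ k) = x -> map_poly iota (cpol k x) = frprod k x.
Proof. by move=> fx; apply/iota_pdown/frob_prod. Qed.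

Lemma iota_frtr k x : x ^+ (q ^ k) = x -> iota (fdown (frtr k x)) = frtr k x.
Proof. by move=> fx; apply/iota_fdown/frob_sum. Qed.

Lemma frtrX k (x : L) i : x ^+ (q ^ k) = x -> (x ^+ i) ^+ (q ^ k) = x ^+ i.
Proof. by move=> fx; rewrite exprAC fx. Qed.

Lemma cpol0 k x : x ^+ (q ^ k) = x -> (cpol k x)`_0 = 1.
Proof.
move=> fx; apply: (fmorph_inj iota); rewrite -(coef_map iota) iota_cpol // rmorph1 /frprod.
elim: k {fx} => [|k IH]; first by rewrite big_ord0 coef1.
by rewrite big_ord_recr coef0M IH mul1r !coefE mulr0 subr0.
Qed.

Lemma size_frprod k x : (size (frprod k x) <= k.+1)%N.
Proof.
rewrite /frprod; elim: k => [|k IH]; first by rewrite big_ord0 size_poly1.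
rewrite big_ord_recr /=; apply: leq_trans (size_polyMleq _ _) _.
have : (size (1 - x ^+ (q ^ k) *: 'X : {poly L})%R <= 2)%N.
  apply: leq_trans (size_polyD _ _) _; rewrite size_poly1 size_polyN geq_max /=.
  by apply: leq_trans (size_scale_leq _ _) _; rewrite size_polyX.
by move: IH; set a := size _; set b := size _; lia.
Qed.

Lemma size_cpol k x : (size (cpol k x) <= k.+1)%N.
Proof. exact: leq_trans (size_poly _ _) (size_frprod _ _). Qed.

Lemma lps_cpol e k x i : x ^+ (q ^ k) = x -> (0 < i)%N -> (i < p ^ e)%N ->
  (lps p e (cpol k x))`_i = fdown (frtr k (x ^+ i)).
Proof.
move=> fx i0 ie; apply: (fmorph_inj iota).
rewrite iota_frtr ?frtrX // -(coef_map iota) map_lps iota_cpol // lps_prod //; last exact: pL.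
by apply: eq_bigr => j _; rewrite exprAC.
Qed.

End Frob.

Section Orbits.
Variables (p : nat) (F L : finFieldType) (iota : {rmorphism F -> L}).
Hypothesis pF : p \in [pchar F].
Let q := #|F|.
Let fr : {rmorphism L -> L} := frobm iota pF.

Lemma iter_fr i x : iter i fr x = x ^+ (q ^ i). Proof. exact: iter_frob. Qed.

Definition deg (x : L) := fingraph.order fr x.
Definition conj (x : L) := fingraph.orbit fr x.

Lemma deg_gt0 x : (0 < deg x)%N. Proof. exact: fingraph.order_gt0. Qed.

Lemma fr_inj : injective fr. Proof. exact: fmorph_inj. Qed.

Lemma iter_deg x : iter (deg x) fr x = x. Proof. exact: iter_order fr_inj x. Qed.

Lemma iter_degM a x : iter (a * deg x) fr x = x.
Proof. by elim: a => [|a IH] //; rewrite mulSn iterD IH iter_deg. Qed.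

Lemma deg_dvd k x : (x ^+ (q ^ k) == x) = (deg x %| k)%N.
Proof.
rewrite -iter_fr; apply/eqP/idP => [H|/dvdnP[a ->]]; last exact: iter_degM.
move: H; rewrite {1}(divn_eq k (deg x)) addnC iterD iter_degM.
have lt : (k %% deg x < deg x)%N by rewrite ltn_mod deg_gt0.
move=> H; have := findex_iter lt; rewrite H findex0 => e.
by rewrite /dvdn -e.
Qed.

Lemma conjE x : conj x = [seq x ^+ (q ^ j) | j <- seq.iota 0 (deg x)].
Proof.
rewrite /conj /fingraph.orbit -/(deg x); apply: (@eq_from_nth _ 0) => [|i].
  by rewrite size_traject size_map size_iota.
rewrite size_traject => lt; rewrite (set_nth_default x) ?size_traject // nth_traject //.
by rewrite (nth_map 0%N) ?size_iota // nth_iota // iter_fr.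
Qed.

Lemma conj_prod (R : Type) (idx : R) (op : Monoid.law idx) (G : L -> R) x :
  \big[op/idx]_(y <- conj x) G y = \big[op/idx]_(j < deg x) G (x ^+ (q ^ j)).
Proof. by rewrite conjE big_map -/(index_iota _ _) -[deg x in LHS]subn0 big_mkord. Qed.

Lemma conj_self x : x \in conj x. Proof. exact: in_orbit. Qed.

Lemma conj_fr x y : y \in conj x -> fr y \in conj x.
Proof. exact: fingraph.mem_orbit. Qed.

Lemma conj_sym x y : (y \in conj x) = (x \in conj y).
Proof. by rewrite -!fconnect_orbit fconnect_sym //; exact: fr_inj. Qed.

Lemma conj_ind (P : L -> Prop) x : P x -> (forall y, P y -> P (fr y)) ->
  forall y, y \in conj x -> P y.
Proof.
move=> Px HP y; rewrite -fconnect_orbit => /iter_findex <-.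
by elim: (findex _ _ _) => //= n; exact: HP.
Qed.

Lemma root_fr (g : {poly F}) y : root (map_poly iota g) y -> root (map_poly iota g) (fr y).
Proof.
move=> H; have : map_poly fr (map_poly iota g) = map_poly iota g.
  by rewrite -map_poly_comp; apply: eq_map_poly => a /=; exact: frob_iota.
by move=> <-; rewrite /root horner_map (rootP H) raddf0.
Qed.

Definition mpol (x : L) := \prod_(y <- conj x) ('X - y%:P).
Definition opol (x : L) := \prod_(y <- conj x) (1 - y *: 'X).

Lemma mpol_dvd (g : {poly F}) x : root (map_poly iota g) x -> mpol x %| map_poly iota g.
Proof.
move=> rx; apply: uniq_roots_dvdp; last by rewrite uniq_rootsE orbit_uniq.
by apply/allP; apply: conj_ind => // y; exact: root_fr.
Qed.

Lemma perm_conj x : perm_eq (map fr (conj x)) (conj x).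
Proof.
apply: uniq_perm; rewrite ?map_inj_uniq ?orbit_uniq //; try exact: fr_inj.
have sub : {subset map fr (conj x) <= conj x} by move=> y /mapP[z zc ->]; exact: conj_fr.
have [] // := uniq_min_size _ sub; last by rewrite size_map.
by rewrite map_inj_uniq ?orbit_uniq //; exact: fr_inj.
Qed.

Lemma mpol_fr x : map_poly fr (mpol x) = mpol x.
Proof.
rewrite /mpol rmorph_prod /= -[RHS](perm_big _ (perm_conj x)) big_map.
by apply: eq_bigr => y _; rewrite rmorphB /= map_polyX map_polyC.
Qed.

Lemma opol_fr x : map_poly fr (opol x) = opol x.
Proof.
rewrite /opol rmorph_prod /= -[RHS](perm_big _ (perm_conj x)) big_map.
by apply: eq_bigr => y _; rewrite rmorphB /= rmorph1 linearZ /= map_polyX.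
Qed.

Lemma frprod_opol a x : frprod F (a * deg x) x = opol x ^+ a.
Proof.
rewrite /frprod /opol conj_prod; elim: a => [|a IH]; first by rewrite mul0n big_ord0.
rewrite exprSr -IH -!(big_mkord xpredT (fun j => 1 - x ^+ (#|F| ^ j) *: 'X)).
rewrite (big_cat_nat (n := (a * deg x)%N)) ?leq_mul2r ?leqnSn ?orbT //=; congr (_ * _).
rewrite -{1}[(a * deg x)%N]add0n big_addn mulSn addnK; apply: eq_big_nat => i _.
by rewrite -!iter_fr iterD iter_degM.
Qed.

Lemma opolE x : x != 0 ->
  exists2 c, c != 0 & opol x = c *: \prod_(y <- map (fun y => y^-1) (conj x)) ('X - y%:P).
Proof.
move=> x0; exists (\prod_(y <- conj x) (- y)).
  rewrite prodf_seq_neq0; apply/allP; apply: conj_ind => [|y] /=; first by rewrite oppr_eq0.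
  by rewrite !oppr_eq0 fmorph_eq0.
have nz y : y \in conj x -> y != 0.
  by move: y; apply: conj_ind => // y; rewrite fmorph_eq0.
rewrite big_map /opol.
elim: (conj x) nz => [|z s IH] nz; first by rewrite !big_nil scale1r.
rewrite !big_cons IH => [|y ys]; last by apply: nz; rewrite inE ys orbT.
have -> : 1 - z *: 'X = (- z) *: ('X - (z^-1)%:P).
  apply/polyP=> -[|[|i]]; rewrite !coefE /=.
  - by rewrite mulr0 subr0 sub0r mulrNN mulfV // nz ?inE ?eqxx.
  - by rewrite mulr1 sub0r subr0 mulr1.
  - by rewrite subr0 !mulr0 subr0.
by rewrite -[LHS]scalerAl -scalerAr scalerA.
Qed.

Lemma opol_dvd (g : {poly F}) x : x != 0 -> root (map_poly iota g) x^-1 ->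
  opol x %| map_poly iota g.
Proof.
move=> x0 rx; have [c c0 ->] := opolE x0; rewrite dvdpZl //.
apply: uniq_roots_dvdp; last first.
  by rewrite uniq_rootsE map_inj_uniq ?orbit_uniq //; exact: invr_inj.
apply/allP => z /mapP[y yc ->]; move: y yc; apply: conj_ind => // y.
by rewrite -(fmorphV fr); exact: root_fr.
Qed.

Definition opolF x : {poly F} := pdown iota (opol x).

Lemma iota_opolF x : map_poly iota (opolF x) = opol x.
Proof. by apply: (iota_pdown (pF := pF)); exact: opol_fr. Qed.

Lemma cpolE a x : cpol iota (a * deg x) x = opolF x ^+ a.
Proof.
apply: (map_iota_inj (iota := iota)); rewrite rmorphXn /= iota_opolF -frprod_opol.
by apply: (iota_cpol iota pF); apply/eqP; rewrite -/q deg_dvd dvdn_mull.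
Qed.

Lemma size_opolF x : x != 0 -> size (opolF x) = (deg x).+1.
Proof.
move=> x0; rewrite -(size_map_poly iota) iota_opolF; have [c c0 ->] := opolE x0.
by rewrite size_scale // size_prod_XsubC size_map size_orbit.
Qed.

Lemma opolF_root x : x != 0 -> root (map_poly iota (opolF x)) x^-1.
Proof.
move=> x0; rewrite iota_opolF; have [c c0 ->] := opolE x0.
by rewrite rootZ // root_prod_XsubC map_f // conj_self.
Qed.

(** A nonconstant factor vanishes at the inverse of some conjugate, and Frobenius then carries this
    root to the inverses of all conjugates. *)
Lemma opolF_irr x : x != 0 -> irreducible_poly (opolF x).
Proof.
move=> x0; split; first by rewrite size_opolF // ltnS deg_gt0.
move=> g sg gd; rewrite /eqp gd /= -(dvdp_map iota) iota_opolF.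
have [c c0 E] := opolE x0.
have gd' : map_poly iota g %| \prod_(y <- map (fun y => y^-1) (conj x)) ('X - y%:P).
  by rewrite -(dvdpZr _ _ c0) -E -iota_opolF dvdp_map.
have [m em] := dvdp_prod_XsubC gd'.
have : (0 < size (mask m [seq y^-1 | y <- conj x]))%N.
  rewrite lt0n; apply: contraNneq sg => s0; rewrite -(size_map_poly iota) (eqp_size em).
  by rewrite (size0nil s0) big_nil size_poly1.
case em' : (mask m _) em => [//|z s] em _.
have /mapP[y yc ez] : z \in [seq y^-1 | y <- conj x].
  by apply: (@mem_mask _ z m); rewrite em' mem_head.
have rz : root (map_poly iota g) y^-1.
  by rewrite (eqp_root em) big_cons rootM root_XsubC ez eqxx.
apply: opol_dvd => //.
have : x \in conj y by rewrite conj_sym.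
by move: (x); apply: conj_ind => // w; rewrite -(fmorphV fr); exact: root_fr.
Qed.

Lemma opolF_deriv x : x != 0 -> (opolF x)^`() != 0.
Proof.
move=> x0; apply/eqP => d0; have [c c0 E] := opolE x0.
have : separable_poly (opol x).
  rewrite E (eqp_separable (eqp_scale _ c0)) separable_prod_XsubC.
  by rewrite map_inj_uniq ?orbit_uniq //; exact: invr_inj.
rewrite separable_poly.unlock -iota_opolF deriv_map d0 rmorph0 coprimep0.
rewrite -size_poly_eq1 size_map_poly size_opolF //.
by have := deg_gt0 x; lia.
Qed.

Lemma opolF0 x : (opolF x)`_0 = 1.
Proof.
have : (cpol iota (1 * deg x) x)`_0 = 1.
  by apply: (cpol0 iota pF); apply/eqP; rewrite deg_dvd mul1n.
by rewrite cpolE expr1.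
Qed.

Definition mpolF x : {poly F} := pdown iota (mpol x).
Lemma iota_mpolF x : map_poly iota (mpolF x) = mpol x.
Proof. by apply: (iota_pdown (pF := pF)); exact: mpol_fr. Qed.
Lemma size_mpolF x : size (mpolF x) = (deg x).+1.
Proof. by rewrite -(size_map_poly iota) iota_mpolF size_prod_XsubC size_orbit. Qed.
Lemma mpolF_dvd (g : {poly F}) x : root (map_poly iota g) x -> mpolF x %| g.
Proof. by move/mpol_dvd; rewrite -iota_mpolF dvdp_map. Qed.
End Orbits.

(** * Extensions of given degree, splitting fields and embeddings *)

Lemma ext_exists (F : finFieldType) k : (0 < k)%N ->
  exists (L : finFieldType) (iota : {rmorphism F -> L}), #|L| = (#|F| ^ k)%N.
Proof.
move=> k0; pose q := #|F|; pose m := (q ^ k)%N.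
have q1 : (1 < q)%N := finNzRing_gt1 _.
have m1 : (1 < m)%N by rewrite -(exp1n k) ltn_exp2r.
pose Q (R : nzRingType) : {poly R} := 'X^m - 'X.
have Q0 : Q F != 0.
  by rewrite -size_poly_eq0 size_polyDl size_polyXn // size_polyN size_polyX.
have [L splitL] := FinSplittingFieldFor Q0.
rewrite [map_poly _ _]rmorphB rmorphXn /= map_polyX -/(Q L) in splitL.
pose Fm : finFieldType := FinFieldExtType L.
exists Fm, (in_alg L : {rmorphism F -> L}).
have /finField_galois_generator[/= a _ Da] : (1 <= {:L})%VS by apply: sub1v.
rewrite dimv1 expn1 in Da.
have [p p_pr pF] := finPcharP F.
have qL0 : q%:R = 0 :> L.
  have [n n0 eq] : exists2 n, (0 < n)%N & q = (p ^ n)%N.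
    by have := card_pprimeChar pF => e; exists (logn p #|F|) => //; apply: contraTT q1; rewrite -eqn0Ngt /q {2}e => /eqP ->.
  have pL' : p \in [pchar L] by rewrite pchar_lalg.
  by rewrite eq natrX (pcharf0 pL') expr0n gtn_eqF.
have [zs DQ defL] := splitL.
have Uzs : uniq zs.
  rewrite -separable_prod_XsubC -(eqp_separable DQ) separable_poly.unlock /Q.
  rewrite derivB derivXn derivX -mulr_natr /m.
  have -> : (q ^ k)%:R = 0 :> {poly L} by rewrite -polyC_natr natrX qL0 expr0n gtn_eqF.
  rewrite mulr0 sub0r.
  have -> : (-1 : {poly L}) = (-1) *: 1 by rewrite scaleN1r.
  by rewrite coprimepZr ?oppr_eq0 ?oner_eq0 // coprimep1.
suffices /eq_card -> : Fm =i zs.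
  apply: succn_inj; rewrite (card_uniqP _) //= -(size_prod_XsubC _ id).
  by rewrite -(eqp_size DQ) size_polyDl size_polyXn // size_polyN size_polyX.
(* The roots of 'X^m - 'X form the fixed field of the k-th power of Frobenius. Since they generate
   the splitting field, they are all of it. *)
pose Em := fixedSpace (a ^+ k)%g.
have in_zs : zs =i Em.
  move=> z; rewrite -root_prod_XsubC -(eqp_root DQ) (sameP fixedSpaceP eqP).
  rewrite /root !hornerE subr_eq0 /= /m; congr (_ == z).
  elim: (k) => [|i IHi]; first by rewrite gal_id.
  by rewrite expgSr expnSr exprM IHi galM ?Da ?memvf.
suffices defEm : Em = {:L}%VS by move=> z; rewrite in_zs defEm memvf.
apply/eqP; rewrite eqEsubv subvf -defL -[Em]subfield_closed agenvS //.
by rewrite subv_add sub1v; apply/span_subvP=> z; rewrite in_zs.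
Qed.

Lemma split_exists (F : finFieldType) (g : {poly F}) : g != 0 ->
  exists (L : finFieldType) (iota : {rmorphism F -> L}) (s : seq L),
    map_poly iota g %= \prod_(x <- s) ('X - x%:P).
Proof.
move=> g0; have [L [s e _]] := FinSplittingFieldFor g0.
by exists (FinFieldExtType L), (in_alg L : {rmorphism F -> L}), s.
Qed.

Section Embed.
Variables (p : nat) (F L1 L2 : finFieldType).
Variables (iota1 : {rmorphism F -> L1}) (iota2 : {rmorphism F -> L2}) (k : nat).
Hypotheses (pF : p \in [pchar F]) (card1 : #|L1| = (#|F| ^ k)%N).
Hypothesis roots2 : forall g : {poly F}, (1 < size g <= k.+1)%N ->
  exists y, root (map_poly iota2 g) y.

(** A generator of the multiplicative group is sent to a root of its minimal polynomial. Every
    element is a polynomial in the generator, and divisibility by the minimal polynomial makes its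
    image independent of the polynomial chosen. *)
Lemma embed_exists : exists j : {rmorphism L1 -> L2}, forall a, j (iota1 a) = iota2 a.
Proof.
have [th Hth] : exists th : L1, forall x, x != 0 -> exists i, x = th ^+ i.
  have /cyclicP[u Hu] := field_unit_group_cyclic [set: {unit L1}]%G.
  exists (val u) => x x0.
  have : finField_unit x0 \in <[u]>%g by rewrite -Hu inE.
  case/cycleP=> i /(congr1 val) e; exists i.
  by rewrite -FinRing.val_unitX -e.
pose m := mpolF iota1 pF th.
have k0 : (0 < k)%N.
  by rewrite lt0n; apply/eqP=> k0; have := finNzRing_gt1 L1; rewrite card1 k0.
have [th2 Hth2] : exists y, root (map_poly iota2 m) y.
  apply: roots2; rewrite size_mpolF !ltnS deg_gt0 /=; apply: dvdn_leq => //.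
  by rewrite -deg_dvd -card1 expf_card.
have wd (g h : {poly F}) : (map_poly iota1 g).[th] = (map_poly iota1 h).[th] ->
    (map_poly iota2 g).[th2] = (map_poly iota2 h).[th2].
  move=> e; have : m %| g - h.
    by apply: mpolF_dvd; rewrite /root rmorphB /= hornerD hornerN e subrr.
  rewrite -(dvdp_map iota2) => /(dvdp_trans _) H; apply/eqP; rewrite -subr_eq0.
  have : root (map_poly iota2 (g - h)) th2.
    by rewrite -dvdp_XsubCl; apply: H; rewrite dvdp_XsubCl.
  by rewrite /root rmorphB /= hornerD hornerN.
have [rep Hrep] : exists rep : L1 -> {poly F}, forall x, (map_poly iota1 (rep x)).[th] = x.
  apply: (@fin_all_exists L1 (fun=> {poly F}) (fun x g => (map_poly iota1 g).[th] = x)) => x; case: (eqVneq x 0) => [->|/Hth[i ->]].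
    by exists 0; rewrite rmorph0 horner0.
  by exists 'X^i; rewrite rmorphXn /= map_polyX hornerXn.
pose j x := (map_poly iota2 (rep x)).[th2].
have jz : zmod_morphism j.
  move=> x y; rewrite /j -hornerN -hornerD -rmorphB /=; apply: wd.
  by rewrite rmorphB /= hornerD hornerN !Hrep.
have jm : monoid_morphism j.
  split.
    by have := @wd (rep 1) 1; rewrite Hrep !rmorph1 !hornerC; apply.
  move=> x y; rewrite /j -hornerM -rmorphM /=; apply: wd.
  by rewrite rmorphM /= hornerM !Hrep.
pose mj := GRing.isZmodMorphism.Build L1 L2 j jz.
pose mm := GRing.isMonoidMorphism.Build L1 L2 j jm.
pose J : {rmorphism L1 -> L2} := HB.pack j mj mm.
exists J => a; rewrite /= /j -[RHS](hornerC _ th2) -(map_polyC iota2); apply: wd.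
by rewrite Hrep map_polyC hornerC.
Qed.
End Embed.

(** * The L-function as a sum over monic polynomials *)

(** Reversal with respect to a fixed degree n, so that factors ['X - a%:P] become [1 - a *: 'X] even
    for a = 0, where the degree drops. *)
Definition revp (K : fieldType) n (g : {poly K}) : {poly K} := \poly_(i < n.+1) g`_(n - i).

Section Rev.
Variable K : fieldType.

Lemma revp_lin n a (h : {poly K}) : (size h <= n.+1)%N ->
  revp n.+1 (('X - a%:P) * h) = (1 - a *: 'X) * revp n h.
Proof.
move=> sh; apply/polyP=> i; rewrite [LHS]coef_poly.
rewrite [in RHS]mulrBl mul1r -scalerAl [RHS]coefB coefZ coefXM coef_poly.
rewrite mulrBl coefB coefXM coefCM.
case: i => [|i] /=.
  rewrite subn0 /= mulr0 subr0 subn0 [h`_n.+1]nth_default ?mulr0 ?subr0 //.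
rewrite !ltnS subSS coef_poly ltnS; case: (ltngtP i n) => [lt|lt|->].
- by rewrite subn_eq0 leqNgt lt /= subnS.
- by rewrite mulr0 subr0.
- by rewrite subnn.
Qed.

Lemma revp_prod n (s : seq K) (h : {poly K}) : (size h <= n.+1)%N ->
  revp (size s + n) (\prod_(a <- s) ('X - a%:P) * h) =
  \prod_(a <- s) (1 - a *: 'X) * revp n h.
Proof.
move=> sh; elim: s => [|a s IH] /=; first by rewrite !big_nil !mul1r.
rewrite !big_cons -!mulrA addSn revp_lin ?IH //.
apply: leq_trans (size_polyMleq _ _) _; rewrite size_prod_XsubC; lia.
Qed.

Lemma prodX_dvdp (s : seq K) a (g : {poly K}) : uniq s ->
  (forall y, y \in s -> ('X - y%:P) ^+ a %| g) -> \prod_(y <- s) ('X - y%:P) ^+ a %| g.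
Proof.
elim: s => [|y s IH] /=; first by rewrite big_nil dvd1p.
move=> /andP[ys us] H; rewrite big_cons Gauss_dvdp ?H ?mem_head //=.
  by apply: IH => // z zs; apply: H; rewrite inE zs orbT.
rewrite big_seq; elim/big_rec: _ => [|z g' zs cop]; first exact: coprimep1.
rewrite coprimepMr cop andbT coprimep_expl // coprimep_expr // coprimep_XsubC2 //.
by rewrite subr_eq0; apply: contraNneq ys => <-.
Qed.
End Rev.

Section Monic.
Variable F : finFieldType.

(** The reversed monic polynomials of degree n, parametrized by their free coefficients. The orders
    of the coefficients in [Gof] and [monicof] are matched so that [revp n] maps one to the
    other. *)
Definition Gof n (g : {ffun 'I_n -> F}) : {poly F} := 1 + \sum_(i < n) g i *: 'X^(i.+1).
Definition monicof n (g : {ffun 'I_n -> F}) : {poly F} :=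
  'X^n + \sum_(i < n) g i *: 'X^(n.-1 - i).
Definition gof n (P : {poly F}) : {ffun 'I_n -> F} := [ffun i : 'I_n => P`_(n.-1 - i)].

Lemma coef_sumZX n (u : 'I_n -> F) (w : 'I_n -> nat) i (j : 'I_n) :
  injective w -> w j = i -> (\sum_(k < n) u k *: 'X^(w k))`_i = u j.
Proof.
move=> wi <-; rewrite coef_sum (bigD1 j) //= coefZ coefXn eqxx mulr1 big1 ?addr0 //.
move=> k kj; rewrite coefZ coefXn; case: eqP => [/wi e|]; rewrite ?mulr0 //.
by rewrite e eqxx in kj.
Qed.

Lemma coef_sumZX0 n (u : 'I_n -> F) (w : 'I_n -> nat) i :
  (forall j, w j != i) -> (\sum_(k < n) u k *: 'X^(w k))`_i = 0.
Proof.
move=> wi; rewrite coef_sum big1 // => k _; rewrite coefZ coefXn eq_sym (negbTE (wi k)).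
by rewrite mulr0.
Qed.

Lemma coef_Gof n (g : {ffun 'I_n -> F}) (i : 'I_n) : (Gof g)`_i.+1 = g i.
Proof. by rewrite coefD coef1 add0r (@coef_sumZX n _ _ _ i) // => a b [] /val_inj. Qed.

Lemma coef_Gof0 n (g : {ffun 'I_n -> F}) : (Gof g)`_0 = 1.
Proof. by rewrite coefD coef1 coef_sumZX0 ?addr0. Qed.

Lemma size_Gof n (g : {ffun 'I_n -> F}) : (size (Gof g) <= n.+1)%N.
Proof.
apply: leq_trans (size_polyD _ _) _; rewrite geq_max size_poly1 /=.
apply: leq_trans (size_sum _ _ _) _; apply/bigmax_leqP => i _.
by apply: leq_trans (size_scale_leq _ _) _; rewrite size_polyXn !ltnS.
Qed.

Lemma winj n : injective (fun i : 'I_n => n.-1 - i)%N.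
Proof. by move=> a b e; apply/val_inj; move: e (ltn_ord a) (ltn_ord b) => /=; lia. Qed.

Lemma coef_monicof n (g : {ffun 'I_n -> F}) (i : 'I_n) : (monicof g)`_(n.-1 - i) = g i.
Proof.
rewrite coefD coefXn (@coef_sumZX n _ _ _ i) //; last exact: winj.
by rewrite ltn_eqF ?add0r //; have := ltn_ord i; lia.
Qed.

Lemma coef_monicofn n (g : {ffun 'I_n -> F}) : (monicof g)`_n = 1.
Proof.
rewrite coefD coefXn eqxx coef_sumZX0 ?addr0 // => j.
by rewrite ltn_eqF //; have := ltn_ord j; lia.
Qed.

Lemma size_monicof n (g : {ffun 'I_n -> F}) : size (monicof g) = n.+1.
Proof.
rewrite /monicof size_polyDl size_polyXn // ltnS.
apply: leq_trans (size_sum _ _ _) _; apply/bigmax_leqP => i _.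
by apply: leq_trans (size_scale_leq _ _) _; rewrite size_polyXn; have := ltn_ord i; lia.
Qed.

Lemma monic_monicof n (g : {ffun 'I_n -> F}) : monicof g \is monic.
Proof. by rewrite monicE lead_coefE size_monicof coef_monicofn. Qed.

Lemma gofK n (P : {poly F}) : P \is monic -> size P = n.+1 -> monicof (gof n P) = P.
Proof.
move=> mP sP; apply/polyP => i; case: (ltngtP i n) => [lt|lt|->].
- have lt' : (n.-1 - i < n)%N by lia.
  have -> : i = (n.-1 - Ordinal lt')%N by rewrite /=; lia.
  by rewrite coef_monicof ffunE.
- by rewrite !nth_default ?size_monicof ?sP.
- by rewrite coef_monicofn; move: mP; rewrite monicE lead_coefE sP => /eqP.
Qed.

Lemma monicofK n (g : {ffun 'I_n -> F}) : gof n (monicof g) = g.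
Proof. by apply/ffunP=> i; rewrite ffunE coef_monicof. Qed.

Lemma revp_monicof n (g : {ffun 'I_n -> F}) : revp n (monicof g) = Gof g.
Proof.
apply/polyP => i; rewrite coef_poly; case: i => [|i].
  by rewrite subn0 coef_monicofn coef_Gof0.
rewrite ltnS; case: (ltnP i n) => [lt|ge].
  have -> : (n - i.+1 = n.-1 - Ordinal lt)%N by rewrite /=; lia.
  by rewrite coef_monicof -(coef_Gof g (Ordinal lt)).
by rewrite nth_default //; apply: leq_trans (size_Gof _) _.
Qed.
End Monic.

Section MulCount.
Variables (p : nat) (F L : finFieldType) (iota : {rmorphism F -> L}).
Hypothesis pF : p \in [pchar F].
Let q := #|F|.
Let fr := frobm iota pF.

Definition mprod k (x : L) := \prod_(a <- [seq x ^+ (q ^ j) | j <- seq.iota 0 k]) ('X - a%:P).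

Lemma mprod_mpol a x : mprod (a * deg iota pF x) x = mpol iota pF x ^+ a.
Proof.
rewrite /mprod /mpol conj_prod; elim: a => [|a IH]; first by rewrite mul0n big_nil.
rewrite mulSn addnC iotaD map_cat big_cat /= IH exprSr; congr (_ * _).
rewrite add0n -[X in seq.iota X]addn0 iotaDl -map_comp big_map -/(index_iota _ _).
rewrite -[deg _ _ _ in LHS]subn0 big_mkord; apply: eq_bigr => i _ /=.
by rewrite -!(iter_fr iota pF) subn0 addnC iterD iter_degM.
Qed.

Lemma mprod_fr k x : x ^+ (q ^ k) = x -> map_poly fr (mprod k x) = mprod k x.
Proof.
move=> /eqP; rewrite (deg_dvd iota pF) => /dvdnP[a ->]; rewrite mprod_mpol rmorphXn /=.
by rewrite mpol_fr.
Qed.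

Lemma size_mprod k x : size (mprod k x) = k.+1.
Proof. by rewrite size_prod_XsubC size_map size_iota. Qed.

Definition mprodF k x : {poly F} := pdown iota (mprod k x).
Lemma iota_mprodF k x : x ^+ (q ^ k) = x -> map_poly iota (mprodF k x) = mprod k x.
Proof. by move=> fx; apply: (iota_pdown (pF := pF)); exact: mprod_fr. Qed.
Lemma size_mprodF k x : x ^+ (q ^ k) = x -> size (mprodF k x) = k.+1.
Proof. by move=> fx; rewrite -(size_map_poly iota) iota_mprodF // size_mprod. Qed.
Lemma monic_mprodF k x : x ^+ (q ^ k) = x -> mprodF k x \is monic.
Proof. by move=> fx; rewrite -(map_monic iota) iota_mprodF // monic_prod_XsubC. Qed.

Lemma revp_mprodF k n (h : {poly F}) x : x ^+ (q ^ k) = x -> (size h <= n.+1)%N ->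
  revp (k + n) (mprodF k x * h) = cpol iota k x * revp n h.
Proof.
move=> fx sh; apply: (map_iota_inj (iota := iota)).
have mr m (g : {poly F}) : map_poly iota (revp m g) = revp m (map_poly iota g).
  apply/polyP=> i; rewrite coef_map [in LHS]coef_poly [RHS]coef_poly.
  by case: ifP => _; rewrite ?coef_map ?raddf0.
rewrite mr !rmorphM /= iota_mprodF // mr (iota_cpol iota pF) //.
have {1}-> : k = size [seq x ^+ (q ^ j) | j <- seq.iota 0 k] by rewrite size_map size_iota.
rewrite /mprod revp_prod ?size_map_poly //; congr (_ * _).
by rewrite big_map -/(index_iota _ _) -{1}[k]subn0 big_mkord.
Qed.

Lemma dvd_mpolX (g : {poly F}) a x : g != 0 ->
  (mpol iota pF x ^+ a %| map_poly iota g) = (a <= mup x (map_poly iota g))%N.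
Proof.
move=> g0; have g0' : map_poly iota g != 0 by rewrite map_poly_eq0.
rewrite mup_geq //; apply/idP/idP => [|H].
  apply: dvdp_trans; apply: dvdp_exp2r.
  by rewrite dvdp_XsubCl root_prod_XsubC conj_self.
rewrite /mpol -prodrXl; apply: prodX_dvdp; first exact: orbit_uniq.
apply: conj_ind => // y; rewrite -(dvdp_map fr) rmorphXn /= rmorphB /= map_polyX map_polyC.
congr (is_true (_ %| _)); rewrite -map_poly_comp; apply: eq_map_poly => b /=.
exact: frob_iota.
Qed.

Lemma dvd_count D c n : (0 < D)%N -> (D * c <= n)%N ->
  (\sum_(1 <= k < n.+1) ((D %| k) && (k %/ D <= c)) = c)%N.
Proof.
move=> D0 le; rewrite (big_cat_nat (n := (D * c).+1)) //= [X in (_ + X)%N]big1_seq; last first.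
  move=> k /andP[_]; rewrite mem_index_iota => /andP[lt _].
  by case: (boolP (D %| k)%N) => //= /dvdnP[a e]; rewrite e mulnK // leqNgt; nia.
rewrite addn0 -[RHS](mulKn c D0) divn_count_dvd; apply: eq_big_nat => k /andP[_ lt].
case: (boolP (D %| k)%N) => //= /dvdnP[a e]; rewrite e mulnK //.
by rewrite (_ : (a <= c)%N) //; nia.
Qed.

(** The polynomial form of the identity that the von Mangoldt function summed over the divisors of g
    gives its degree. A point x of degree D counts once for each k = a D such that [mpol x ^+ a]
    divides g, in all as often as x is a root of g. *)
Lemma mul_count n (g : {poly F}) (s : seq L) : g != 0 -> size s = n ->
  map_poly iota g = \prod_(y <- s) ('X - y%:P) ->
  (\sum_(1 <= k < n.+1) \sum_(x : L) ((x ^+ (q ^ k) == x) && (mprodF k x %| g)%R) = n)%N.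
Proof.
move=> g0 ss gs; rewrite exchange_big /=.
have cnt x : mup x (map_poly iota g) = count_mem x s by rewrite gs mu_prod_XsubC.
transitivity (\sum_(x : L) count_mem x s)%N; last first.
  have cE x : count_mem x s = (\sum_(y <- s) (y == x))%N.
    by elim: (s) => [|z s' IH]; rewrite ?big_nil // big_cons /= IH.
  rewrite -ss -sum1_size (eq_bigr _ (fun x _ => cE x)).
  rewrite exchange_big /=; apply: eq_bigr => y _; rewrite (bigD1 y) //= eqxx big1 // => x ne.
  by rewrite eq_sym (negbTE ne).
apply: eq_bigr => x _; have D0 := deg_gt0 iota pF x.
have le : (deg iota pF x * count_mem x s <= n)%N.
  have := dvd_mpolX (count_mem x s) x g0; rewrite cnt leqnn.
  move/(dvdp_leq (_ : map_poly iota g != 0)); rewrite map_poly_eq0 g0 => /(_ isT).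
  rewrite gs size_prod_XsubC -/(mpol iota pF x) -mprod_mpol size_mprod ss ltnS.
  by rewrite mulnC.
rewrite -[RHS](dvd_count D0 le); apply: eq_bigr => k _; congr nat_of_bool.
rewrite (deg_dvd iota pF); case: (boolP (_ %| k)%N) => //= dk.
rewrite -(dvdp_map iota) iota_mprodF; last by apply/eqP; rewrite (deg_dvd iota pF).
by rewrite -{1}(divnK dk) mprod_mpol dvd_mpolX // cnt.
Qed.
End MulCount.

Section Lrec.
Variables (p : nat) (F : finFieldType).
Hypothesis pF : p \in [pchar F].
Let q := #|F|.
Variable (C : fieldType) (Psi : F -> C).
Hypotheses (PsiD : forall x y, Psi (x + y) = Psi x * Psi y) (Psi0 : Psi 0 = 1).
Variables (f : {poly F}) (d e : nat).
Hypotheses (szf : size f = d.+1) (de : (d < p ^ e)%N).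

(** The constant coefficient of f contributes n times itself, the trace of a constant. This needs
    the degree n as separate data, since a root at 0 leaves no mark on the reversed polynomial G. *)
Definition lin_lps n (G : {poly F}) : F :=
  f`_0 *+ n + \sum_(1 <= i < d.+1) f`_i * (lps p e G)`_i.
Definition chi n (G : {poly F}) : C := Psi (lin_lps n G).

Lemma chi_mul n m (G H : {poly F}) : G`_0 = 1 -> H`_0 = 1 ->
  chi (n + m) (G * H) = chi n G * chi m H.
Proof.
move=> G0 H0; rewrite /chi -PsiD /lin_lps mulrnDr addrACA -big_split /=; congr (Psi (_ + _)).
apply: eq_big_nat => i /andP[_ id]; rewrite -mulrDr -coefD.
by have /eqmP -> // := lps_mul pF e G0 H0; lia.
Qed.

Lemma frtr_horner (L : finFieldType) (iota : {rmorphism F -> L}) k (x : L) :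
  x ^+ (q ^ k) = x ->
  fdown iota (frtr F k (map_poly iota f).[x]) = lin_lps k (cpol iota k x).
Proof.
move=> fx; apply: (fmorph_inj iota).
have fx' : (map_poly iota f).[x] ^+ (q ^ k) = (map_poly iota f).[x].
  have := iter_frob iota pF k (map_poly iota f).[x]; rewrite -/q => <-.
  rewrite -[in RHS]fx -(iter_frob iota pF) -/q.
  elim: k {fx} => //= k ->; rewrite -horner_map -map_poly_comp.
  by congr (_.[_]); apply: eq_map_poly => a /=; rewrite frob_iota.
rewrite (iota_frtr iota pF) //.
rewrite /lin_lps rmorphD rmorphMn rmorph_sum /=.
have -> : frtr F k (map_poly iota f).[x] = \sum_(i < d.+1) iota f`_i * frtr F k (x ^+ i).
  rewrite horner_coef size_map_poly szf /frtr.
  under eq_bigr => j _.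
    rewrite (big_morph _ (frob_add iota pF j) (_ : 0 ^+ (#|F| ^ j) = 0)); last first.
      by rewrite expr0n gtn_eqF // expn_gt0 (ltnW (finNzRing_gt1 _)).
    under eq_bigr => i _ do rewrite coef_map exprMn -(iter_frob iota pF j (iota _)).
    over.
  rewrite exchange_big /=; apply: eq_bigr => i _; rewrite mulr_sumr; apply: eq_bigr => j _.
  by congr (_ * _); elim: (nat_of_ord j) => //= m ->; rewrite frob_iota.
rewrite -(big_mkord xpredT (fun i => iota f`_i * frtr F k (x ^+ i))) big_nat_recl //=.
congr (_ + _).
  rewrite /frtr; under eq_bigr do rewrite expr0 expr1n.
  by rewrite sumr_const card_ord mulrnAr mulr1.
rewrite [in RHS]big_add1 /=; apply: eq_big_nat => i /andP[_ lt].
rewrite rmorphM (lps_cpol iota pF) //; last by lia.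
by rewrite (iota_frtr iota pF) // frtrX.
Qed.

Definition cn n : C := \sum_(g : {ffun 'I_n -> F}) chi n (Gof g).

Lemma cn0 : cn 0 = 1.
Proof.
rewrite /cn (eq_bigr (fun=> 1)) => [|g _].
  by rewrite sumr_const card_ffun card_ord expn0.
rewrite /chi /lin_lps mulr0n add0r big1_seq ?Psi0 // => i _.
by rewrite /Gof big_ord0 addr0 lps1 coef0 mulr0.
Qed.

Variable S : nat -> C.
Hypothesis S_ext : forall k, (0 < k)%N -> exists (L : finFieldType) (iota : {rmorphism F -> L}),
  #|L| = (q ^ k)%N /\ S k = \sum_(x : L) chi k (cpol iota k x).

Section Omega.
Variables (n : nat) (Om : finFieldType) (io : {rmorphism F -> Om}).
Hypothesis split_all : forall g : {ffun 'I_n -> F}, exists2 s : seq Om, size s = n &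
  map_poly io (monicof g) = \prod_(y <- s) ('X - y%:P).

Lemma Om_roots (g : {poly F}) : (1 < size g <= n.+1)%N -> exists y, root (map_poly io g) y.
Proof.
move=> /andP[g1 gn].
have g0 : g != 0 by rewrite -size_poly_gt0; apply: leq_trans g1.
pose h := (lead_coef g)^-1 *: g * 'X^(n.+1 - size g).
have lg : (lead_coef g)^-1 != 0 by rewrite invr_eq0 lead_coef_eq0.
have mh : h \is monic.
  by rewrite monicE lead_coefM lead_coefZ mulVf ?lead_coef_eq0 // lead_coefXn mulr1.
have sh : size h = n.+1.
  rewrite /h size_mul ?size_scale // ?size_polyXn ?scaler_eq0 ?negb_or ?lg ?g0 //.
    by rewrite addnS /= subnKC.
  by rewrite -size_poly_gt0 size_polyXn.
have [s _] := split_all (gof n h); rewrite (gofK mh sh) => e0.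
have gd : map_poly io g %| \prod_(y <- s) ('X - y%:P).
  rewrite -e0 dvdp_map /h -scalerAl dvdpZr //; exact: dvdp_mulr.
have [m em] := dvdp_prod_XsubC gd.
case ms: (mask m s) em => [|z s'] em.
  by move: g1; rewrite -(size_map_poly io) (eqp_size em) big_nil size_poly1.
by exists z; rewrite (eqp_root em) big_cons rootM root_XsubC eqxx.
Qed.

(** The sums [S k] are given in unrelated extensions. Embedding each of them in a single field where
    all monic polynomials of degree n split makes them comparable; by a count, the image is the set
    of fixed points of the k-th power of Frobenius. *)
Lemma S_Om k : (0 < k <= n)%N ->
  S k = \sum_(x : Om | x ^+ (q ^ k) == x) chi k (cpol io k x).
Proof.
move=> /andP[k0 kn]; have [L [iota [cL ->]]] := S_ext k0.
have [|j jE] := @embed_exists p F L Om iota io k pF cL.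
  by move=> g /andP[g1 gk]; apply: Om_roots; rewrite g1 (leq_trans gk).
have jfix x : (j x) ^+ (q ^ k) == j x by rewrite -rmorphXn -cL expf_card.
have jinj : injective j := fmorph_inj j.
have qk1 : (1 < q ^ k)%N by rewrite -(exp1n k) ltn_exp2r // finNzRing_gt1.
have img : [set x : Om | x ^+ (q ^ k) == x] = [set j x | x in [set: L]].
  apply/esym/eqP; rewrite eqEcard; apply/andP; split.
    by apply/subsetP=> y /imsetP[x _ ->]; rewrite inE.
  rewrite card_imset // cardsT cL.
  have nz : 'X^(q ^ k) - 'X != 0 :> {poly Om}.
    by rewrite -size_poly_eq0 size_polyDl size_polyXn // size_polyN size_polyX.
  have := max_poly_roots nz; rewrite size_polyDl ?size_polyXn ?size_polyN ?size_polyX //.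
  move=> /(_ (enum [set x : Om | x ^+ (q ^ k) == x])); rewrite -cardE ltnS; apply.
    by apply/allP=> y; rewrite mem_enum inE /root !hornerE subr_eq0.
  exact: enum_uniq.
transitivity (\sum_(x in [set x : Om | x ^+ (q ^ k) == x]) chi k (cpol io k x)); last first.
  by apply: eq_bigl => x; rewrite inE.
rewrite img big_imset /=; last by move=> x y _ _; exact: jinj.
apply: eq_big => [x|x _]; first by rewrite inE.
congr (chi k _); apply: (map_iota_inj (iota := io)).
rewrite (iota_cpol io pF) ?(eqP (jfix x)) //.
have -> : map_poly io (cpol iota k x) = map_poly j (map_poly iota (cpol iota k x)).
  by apply/polyP=> i; rewrite !coef_map /= jE.
rewrite (iota_cpol iota pF); last by rewrite -/q -cL expf_card.
rewrite /frprod rmorph_prod /=; apply: eq_bigr => i _.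
by rewrite rmorphB /= rmorph1 linearZ /= map_polyX rmorphXn.
Qed.

(** Multiplication by [mprodF io k x] maps the monic polynomials of degree n - k bijectively onto
    its monic multiples of degree n, and [chi] is multiplicative. *)
Lemma chi_reindex k x : (k <= n)%N -> x ^+ (q ^ k) = x ->
  chi k (cpol io k x) * cn (n - k) =
  \sum_(g : {ffun 'I_n -> F} | mprodF io k x %| monicof g) chi n (Gof g).
Proof.
move=> kn fx; rewrite /cn mulr_sumr.
have M1 := monic_mprodF io pF fx; have sM := size_mprodF io pF fx.
have sz (h : {ffun 'I_(n - k) -> F}) : size (mprodF io k x * monicof h) = n.+1.
  by rewrite size_monicM ?monic_neq0 ?monic_monicof // sM size_monicof /= addnS /= subnKC.
have mo (h : {ffun 'I_(n - k) -> F}) : mprodF io k x * monicof h \is monic.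
  by rewrite rpredM // monic_monicof.
rewrite (reindex_onto (fun h : {ffun 'I_(n - k) -> F} => gof n (mprodF io k x * monicof h))
   (fun g => gof (n - k) (monicof g %/ mprodF io k x))) /=; last first.
  move=> g /divpK; rewrite mulrC => dk.
  have dm : monicof g %/ mprodF io k x \is monic.
    by have := monic_monicof g; rewrite -{1}dk monicMl.
  rewrite gofK //; first by rewrite dk monicofK.
  by rewrite size_divp ?monic_neq0 // size_monicof sM /= subSn.
apply: eq_big => [h|h _].
  by rewrite gofK // dvdp_mulr // mulKp ?monic_neq0 // monicofK eqxx.
rewrite -chi_mul ?subnKC ?coef_Gof0 ?(cpol0 io pF) //; congr (chi n _).
rewrite -[RHS]revp_monicof gofK // -(revp_monicof h).
by rewrite -(revp_mprodF io pF) ?size_monicof // subnKC.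
Qed.

(** After exchanging the summations, each monic polynomial of degree n contributes its character
    value as often as [mul_count] says, that is n times. *)
Lemma Lrec_Om : n%:R * cn n = \sum_(1 <= k < n.+1) S k * cn (n - k).
Proof.
transitivity (\sum_(1 <= k < n.+1) \sum_(x : Om | x ^+ (q ^ k) == x)
    \sum_(g : {ffun 'I_n -> F} | mprodF io k x %| monicof g) chi n (Gof g)); last first.
  apply: eq_big_nat => k Hk; rewrite S_Om // mulr_suml; apply: eq_bigr => x /eqP fx.
  by rewrite chi_reindex //; case/andP: Hk.
under eq_bigr => k _.
  rewrite big_mkcond /=; under eq_bigr => x _ do rewrite -mulrb.
  over.
under eq_bigr => k _.
  under eq_bigr => x _.
    rewrite big_mkcond -sumrMnl; under eq_bigr => g _ do rewrite -mulrb -mulrnA.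
    over.
  rewrite exchange_big; over.
rewrite exchange_big /= /cn mulr_sumr; apply: eq_bigr => g _.
have [s ss gs] := split_all g.
have := mul_count pF (monic_neq0 (monic_monicof g)) ss gs => E.
rewrite -{1}E natr_sum mulr_suml; apply: eq_bigr => k _.
rewrite natr_sum mulr_suml; apply: eq_bigr => x _.
by rewrite mulr_natl mulnb andbC.
Qed.
End Omega.

Lemma Lrec n : (0 < n)%N -> n%:R * cn n = \sum_(1 <= k < n.+1) S k * cn (n - k).
Proof.
move=> n0; pose Pi := \prod_(g : {ffun 'I_n -> F}) monicof g.
have Pi0 : Pi != 0 by rewrite monic_neq0 // monic_prod // => g _; exact: monic_monicof.
have [Om [io [s Hs]]] := split_exists Pi0.
apply: (@Lrec_Om n Om io) => g.
have gd : map_poly io (monicof g) %| \prod_(y <- s) ('X - y%:P).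
  by rewrite -(eqp_dvdr _ Hs) dvdp_map /Pi (bigD1 g) //= dvdp_mulr.
have [m em] := dvdp_prod_XsubC gd.
have E : map_poly io (monicof g) = \prod_(y <- mask m s) ('X - y%:P).
  by apply/eqP; rewrite -eqp_monic ?map_monic ?monic_monicof ?monic_prod_XsubC.
exists (mask m s) => //; apply: succn_inj.
by rewrite -(size_prod_XsubC _ id) -E size_map_poly size_monicof.
Qed.
End Lrec.

(** * Additive characters, and from point counts to exponential sums *)

Section AddChar.
Variables (p : nat) (F : finFieldType) (C : numClosedFieldType) (Psi : F -> C).
Hypotheses (pF : p \in [pchar F]) (PsiD : forall x y, Psi (x + y) = Psi x * Psi y) (Psi0 : Psi 0 = 1).

Lemma PsiMn x n : Psi (x *+ n) = Psi x ^+ n.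
Proof. by elim: n => [|n IH]; rewrite ?mulr0n ?Psi0 // mulrS PsiD IH exprS. Qed.

Lemma Psi_norm x : `|Psi x| = 1.
Proof.
have p0 : (0 < p)%N := prime_gt0 (pcharf_prime pF).
have := congr1 Num.norm (PsiMn x p); rewrite (mulrn_pchar pF) Psi0 normr1 normrX => /esym/eqP.
by rewrite pexpr_eq1 // => /eqP.
Qed.

Lemma PsiN x : Psi (- x) = (Psi x)^*.
Proof.
have e : Psi (- x) * Psi x = 1 by rewrite -PsiD addNr Psi0.
have e2 : (Psi x)^* * Psi x = 1 by rewrite mulrC -normCK Psi_norm expr1n.
have nz : Psi x != 0 by rewrite -normr_eq0 Psi_norm oner_eq0.
by apply: (mulIf nz); rewrite e e2.
Qed.

Hypothesis Psi_nt : exists h, Psi h != 1.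

Lemma Psi_ntM c : c != 0 -> exists h, Psi (c * h) != 1.
Proof.
by move=> c0; have [h Hh] := Psi_nt; exists (c^-1 * h); rewrite mulrA divff ?mul1r.
Qed.

(** A sum that some permutation of its indices multiplies by a value other than 1 must vanish. Here
    [T h] shifts one parameter by h, and [c * h] runs over the whole field. *)
Lemma sum_shift0 (I : finType) (u : I -> C) (T : F -> I -> I) (c : F) (P : pred I) :
  c != 0 -> (forall h, injective (T h)) -> (forall h x, P (T h x) = P x) ->
  (forall h x, P x -> u (T h x) = Psi (c * h) * u x) -> \sum_(x | P x) u x = 0.
Proof.
move=> c0 Ti TP Hu; have [h Hh] := Psi_ntM c0.
have E : \sum_(x | P x) u x = Psi (c * h) * \sum_(x | P x) u x.
  rewrite {1}(reindex_inj (Ti h)) (eq_bigl P) => [|x]; last exact: TP.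
  by rewrite mulr_sumr; apply: eq_bigr => x; exact: Hu.
apply/eqP; have : (1 - Psi (c * h)) * \sum_(x | P x) u x == 0 by rewrite mulrBl mul1r -E subrr.
by rewrite mulf_eq0 subr_eq0 eq_sym (negbTE Hh).
Qed.

Lemma sum_Psi : \sum_x Psi x = 0.
Proof.
apply: (@sum_shift0 F Psi (fun h x => x + h) 1 xpredT); rewrite ?oner_eq0 //.
  by move=> h; exact: addIr.
by move=> h x _; rewrite PsiD mul1r mulrC.
Qed.
End AddChar.

Section Weil.
Variables (p : nat) (K : finFieldType) (C : numClosedFieldType) (Psi : K -> C).
Hypotheses (pK : p \in [pchar K]) (PsiD : forall x y, Psi (x + y) = Psi x * Psi y) (Psi0 : Psi 0 = 1).
Hypotheses (Psi_nt : exists h, Psi h != 1) (Psi_p : forall y, Psi (y ^+ p) = Psi y).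
Variables (f : {poly K}) (d P : nat).
Hypotheses (szf : size f = d.+1) (cdp : coprime d p) (P_nat : p.-nat P) (cardK : #|K| = (P ^ 2)%N).

(** The point counts Z b of the curves attached to f - b add up to the square of the field order,
    and weighted by Psi b they give the field order times the exponential sum. Their deficits from
    Stepanov's bound are nonnegative with a known total. Subtracting the bound is free because Psi
    sums to 0, so that total controls the exponential sum. *)
Lemma weil_stepanov : ((p * d) ^ 2 + 3 * (p * d) + 2 <= P)%N ->
  `|\sum_(x : K) Psi f.[x]| <= ((2 * (p * d) + 2) * P)%:R.
Proof.
move=> Pbig; set B := (2 * (p * d) + 2)%N.
have p_pr := pcharf_prime pK.
have d0 : (0 < d)%N.
  by rewrite lt0n; apply: contraTneq cdp => ->; rewrite /coprime gcd0n gtn_eqF // prime_gt1.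
have Q0 : (0 : C) < #|K|%:R by rewrite ltr0n ltnW // finNzRing_gt1.
pose Z b := #|as_curve p (f - b%:P)|.
have Zle b : (Z b <= P ^ 2 + B * P)%N.
  apply: (stepanov_bound p_pr pK (d := d)) => //.
  by rewrite size_polyDl // size_polyN size_polyC szf; case: (b == 0); rewrite //= ltnS.
have ZE b : (Z b)%:R = \sum_(z : K * K) (z.2 ^+ p - z.2 == (f - b%:P).[z.1])%:R :> C.
  rewrite /Z /as_curve -sum1_card natr_sum big_mkcond /=; apply: eq_bigr => z _.
  by rewrite inE; case: ifP.
have s1 : \sum_b (Z b)%:R = (#|K| ^ 2)%:R :> C.
  under eq_bigr => b _ do rewrite ZE.
  rewrite exchange_big /= (eq_bigr (fun=> 1)) => [|z _].
    by rewrite sumr_const card_prod mulnn.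
  rewrite (bigD1 (f.[z.1] - (z.2 ^+ p - z.2))) //= hornerD hornerN hornerC.
  rewrite opprB addrCA subrr addr0 eqxx big1 ?addr0 // => b nb.
  rewrite hornerD hornerN hornerC; case: eqP => // e; case/negP: nb.
  by rewrite e opprB addrCA subrr addr0.
have s2 : \sum_b Psi b * (Z b)%:R = #|K|%:R * \sum_(x : K) Psi f.[x].
  under eq_bigr => b _ do rewrite ZE mulr_sumr.
  rewrite exchange_big /= (eq_bigr (fun z : K * K => Psi f.[z.1])) => [|z _].
    rewrite -(pair_bigA _ (fun x y => Psi f.[x])) /= mulr_sumr; apply: eq_bigr => x _.
    by rewrite sumr_const mulr_natl.
  rewrite (bigD1 (f.[z.1] - (z.2 ^+ p - z.2))) //= hornerD hornerN hornerC.
  have -> : f.[z.1] - (f.[z.1] - (z.2 ^+ p - z.2)) = z.2 ^+ p - z.2 by ring.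
  rewrite opprB eqxx mulr1 big1 ?addr0; last first.
    move=> b nb; rewrite hornerD hornerN hornerC; case: eqP => [e|_]; last by rewrite mulr0.
    case/negP: nb; apply/eqP; have -> : b = f.[z.1] - (f.[z.1] - b) by ring.
    by rewrite -e; ring.
  have Pp : Psi (z.2 - z.2 ^+ p) = 1.
    by rewrite PsiD (PsiN pK PsiD Psi0) Psi_p -normCK (Psi_norm pK PsiD Psi0) expr1n.
  by rewrite PsiD Pp mulr1.
rewrite -(ler_pM2l Q0) -{1}[#|K|%:R]normr_nat -normrM -s2.
have -> : \sum_b Psi b * (Z b)%:R = \sum_b Psi b * ((Z b)%:R - (P ^ 2 + B * P)%:R).
  under [RHS]eq_bigr do rewrite mulrBr.
  by rewrite sumrB -mulr_suml (sum_Psi PsiD Psi_nt) mul0r subr0.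
apply: le_trans (ler_norm_sum _ _ _) _.
have -> : #|K|%:R * (B * P)%:R = \sum_b ((P ^ 2 + B * P)%:R - (Z b)%:R) :> C.
  rewrite sumrB s1 sumr_const -mulrnA -natrM -natrB; last by rewrite cardK; nia.
  by congr (_%:R); rewrite cardK; nia.
apply: ler_sum => b _; rewrite normrM (Psi_norm pK PsiD Psi0) mul1r distrC ger0_norm //.
by rewrite subr_ge0 ler_nat.
Qed.
End Weil.

(** * Vanishing of the high coefficients, and a Gauss sum for the last one *)

Section Vanish.
Variables (p : nat) (F : finFieldType) (C : numClosedFieldType) (Psi : F -> C).
Hypotheses (pF : p \in [pchar F]) (PsiD : forall x y, Psi (x + y) = Psi x * Psi y) (Psi0 : Psi 0 = 1).
Hypothesis Psi_nt : exists h, Psi h != 1.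
Let q := #|F|.
Variables (f : {poly F}) (m e : nat).
Local Notation d := m.+1.
Hypotheses (szf : size f = d.+1) (de : (d < p ^ e)%N) (cdp : coprime d p).
Local Notation chi := (chi p Psi f d e).
Local Notation cn := (cn p Psi f d e).
(** Adding h times 'X^d to G changes its d-th power sum by - d h, hence the argument of the
    character by - kap h. *)
Let kap : F := f`_d * d%:R.

Let p_pr : prime p. Proof. exact: pcharf_prime pF. Qed.
Lemma d_pos : (0 < d)%N. Proof. by []. Qed.

Lemma kap_neq0 : kap != 0.
Proof.
rewrite mulf_neq0 //; first by have := lead_coef_eq0 f; rewrite lead_coefE szf /= => ->; rewrite -size_poly_eq0 szf.
rewrite -(dvdn_pcharf pF) -prime_coprime // coprime_sym //.
Qed.

Lemma lps_top (h : F) : eqm d.+1 (lps p e (1 + h *: 'X^d)) (- ((h * d%:R) *: 'X^d)).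
Proof.
rewrite /lps; apply: eqmN.
have d0 := d_pos.
have -> : 'X * (1 + h *: 'X^d)^`() = (h * d%:R) *: 'X^d.
  rewrite derivD derivC add0r derivZ derivXn -scalerAr -mulr_natr mulrA -exprS prednK //.
  by rewrite [X in h *: X]mulr_natr -scaler_nat scalerA.
rewrite -[X in eqm _ _ X]mulr1 /eqm -mulrBr -mul_polyC -mulrA; apply: dvdp_mull.
rewrite exprSr dvdp_mul //.
have : eqm 1 ((1 + h *: 'X^d) ^+ (p ^ e).-1) (1 ^+ (p ^ e).-1).
  apply: eqmX; apply/eqmP => -[|//] _.
  by rewrite coefD coefZ coefXn mulr0 addr0.
by rewrite expr1n /eqm.
Qed.

Lemma chi_top n (G : {poly F}) (h : F) : G`_0 = 1 ->
  chi n (G + h *: 'X^d) = Psi (- kap * h) * chi n G.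
Proof.
move=> G0; have d0 := d_pos.
have H0 : (1 + h *: 'X^d)`_0 = 1 by rewrite coefD coef1 coefZ coefXn mulr0 addr0.
have E1 : eqm d.+1 (lps p e (G + h *: 'X^d)) (lps p e G - (h * d%:R) *: 'X^d).
  apply: (@eqm_trans _ _ (lps p e (G * (1 + h *: 'X^d)))).
    apply: lps_eqm (ltnW de) _; rewrite /eqm mulrDr mulr1 opprD addrACA subrr add0r.
    have -> : h *: 'X^d - G * (h *: 'X^d) = h%:P * ((1 - G) * 'X^d).
      by rewrite -!mul_polyC; ring.
    apply: dvdp_mull; rewrite exprS; apply: dvdp_mul => //.
    by apply/(@dvdXnP _ 1) => -[|//] _; rewrite coefB coef1 G0 subrr.
  apply: (@eqm_trans _ _ (lps p e G + lps p e (1 + h *: 'X^d))).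
    by apply: eqmS (lps_mul pF e G0 H0).
  by apply: eqmD (eqm_refl _ _) (lps_top h).
rewrite /chi -PsiD /lin_lps; congr (Psi _).
rewrite addrCA; congr (_ + _).
rewrite (eq_big_nat _ _ (F2 := fun i => f`_i * (lps p e G)`_i - f`_i * ((h * d%:R) * (i == d)%:R))).
  rewrite sumrB addrC; congr (_ + _).
  rewrite big_nat_recr //= eqxx mulr1 big1_seq ?add0r; last first.
    by move=> i /andP[_]; rewrite mem_index_iota => /andP[_ lt]; rewrite ltn_eqF // !mulr0.
  by rewrite /kap mulNr mulrAC mulrA mulrAC.
move=> i /andP[_ lt]; move/eqmP: E1 => -> //.
by rewrite coefB coefZ coefXn mulrBr.
Qed.

Definition addat n (j : 'I_n) (h : F) (g : {ffun 'I_n -> F}) : {ffun 'I_n -> F} :=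
  [ffun i => g i + (if i == j then h else 0)].

Lemma addat_inj n (j : 'I_n) h : injective (addat j h).
Proof. by move=> g g' /ffunP E; apply/ffunP=> i; have := E i; rewrite !ffunE => /addIr. Qed.

Lemma Gof_addat n (j : 'I_n) h g : Gof (addat j h g) = Gof g + h *: 'X^(j.+1).
Proof.
rewrite /Gof -addrA; congr (_ + _); rewrite [in RHS](bigD1 j) //= [in LHS](bigD1 j) //= ffunE eqxx.
rewrite scalerDl -!addrA; congr (_ + _); rewrite addrC; congr (_ + _).
by apply: eq_bigr => i ne; rewrite ffunE (negbTE ne) addr0.
Qed.

(** From n = d on, the coefficient of ['X^d] in G is a free parameter that enters through a
    nontrivial character. *)
Lemma cn_vanish n : (d <= n)%N -> cn n = 0.
Proof.
move=> dn; have d0 := d_pos.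
have lt : (d.-1 < n)%N by lia.
apply: (@sum_shift0 F C Psi Psi_nt _ _ (addat (Ordinal lt)) (- kap) xpredT) => //.
- by rewrite oppr_eq0 kap_neq0.
- exact: addat_inj.
by move=> h g _; rewrite Gof_addat /= chi_top // coef_Gof0.
Qed.

Definition mulg n (g h : {ffun 'I_n -> F}) : {ffun 'I_n -> F} :=
  [ffun i : 'I_n => (Gof g * Gof h)`_i.+1].

Lemma Gof_mulg n (g h : {ffun 'I_n -> F}) : eqm n.+1 (Gof (mulg g h)) (Gof g * Gof h).
Proof.
apply/eqmP => -[|i] lt; first by rewrite coef0M !coef_Gof0 mulr1.
by rewrite (coef_Gof _ (Ordinal (lt : i < n)%N)) ffunE.
Qed.

Lemma mulg_inj (g : {ffun 'I_d -> F}) : injective (mulg g).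
Proof.
move=> h h' E.
have : eqm d.+1 (Gof h) (Gof h').
  have iv (k : {ffun 'I_d -> F}) : eqm d.+1 (Gof g ^+ (p ^ e).-1 * (Gof g * Gof k)) (Gof k).
    rewrite mulrA -exprSr prednK ?expn_gt0 ?prime_gt0 // -[X in eqm _ _ X]mul1r.
    by apply: eqmM (eqm_refl _ _); apply: eqmS de (unit_expE pF e (coef_Gof0 g)).
  apply: (eqm_trans (eqm_sym (iv h))); apply: eqm_trans (iv h').
  apply: eqmM (eqm_refl _ _) _; apply: (eqm_trans (eqm_sym (Gof_mulg g h))).
  by rewrite E; exact: Gof_mulg.
move/(eqm_size (size_Gof h) (size_Gof h')) => GE.
by apply/ffunP => i; rewrite -!coef_Gof GE.
Qed.

Lemma chi_eqm n (G H : {poly F}) : eqm d.+1 G H -> chi n G = chi n H.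
Proof.
move=> GH; rewrite /chi /lin_lps; congr (Psi (_ + _)); apply: eq_big_nat => i /andP[_ lt].
by have /eqmP -> := lps_eqm (ltnW de) GH.
Qed.

Definition extg (n : nat) (g : {ffun 'I_n -> F}) (t : F) : {ffun 'I_n.+1 -> F} :=
  [ffun i => if unlift ord_max i is Some j then g j else t].

Lemma extg_max n (g : {ffun 'I_n -> F}) t : extg g t ord_max = t.
Proof. by rewrite ffunE unlift_none. Qed.

Lemma extg_lift n (g : {ffun 'I_n -> F}) t j : extg g t (lift ord_max j) = g j.
Proof. by rewrite ffunE liftK. Qed.

Lemma Gof_extg n (g : {ffun 'I_n -> F}) t : Gof (extg g t) = Gof g + t *: 'X^(n.+1).
Proof.
rewrite /Gof big_ord_recr /= -addrA extg_max; congr (_ + (_ + _)).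
apply: eq_bigr => j _; rewrite -(extg_lift g t j); congr (extg g t _ *: _).
by apply: val_inj; rewrite /= /bump leqNgt ltn_ord.
Qed.

Lemma sum_extg n (u : {ffun 'I_n.+1 -> F} -> C) :
  \sum_g u g = \sum_(g : {ffun 'I_n -> F}) \sum_t u (extg g t).
Proof.
rewrite pair_big /= (reindex (fun x : {ffun 'I_n -> F} * F => extg x.1 x.2)) //=.
exists (fun g => ([ffun j => g (lift ord_max j)], g ord_max)) => [[g t] _|g _] /=.
  by rewrite extg_max; congr (_, _); apply/ffunP=> j; rewrite ffunE extg_lift.
apply/ffunP=> i; case: (unliftP ord_max i) => [j ->|->]; first by rewrite extg_lift ffunE.
by rewrite extg_max.
Qed.

(** [Gam] is a Gauss sum on the group of polynomials with constant term 1 modulo ['X^(d.+1)]. The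
    factor in [tau] cancels the dependence on the top coefficient, so [Gam] is q times [cn m]. In
    its squared absolute value, the quotient h of two elements leaves a character sum over g that
    vanishes unless h = 1 + t 'X^d. Each of the q values of t then contributes q ^ d. *)
Lemma gauss_norm : `|cn m| ^+ 2 = (q ^ m)%:R.
Proof.
have q0 : (q%:R : C) != 0 by rewrite pnatr_eq0 -lt0n ltnW // finNzRing_gt1.
pose tau (g : {ffun 'I_d -> F}) := chi m (Gof g) * Psi (kap * g ord_max).
pose Gam := \sum_g tau g.
have GamE : Gam = q%:R * cn m.
  rewrite /Gam sum_extg /cn mulr_sumr; apply: eq_bigr => g _.
  rewrite (eq_bigr (fun=> chi m (Gof g))) ?sumr_const ?mulr_natl // => t _.
  rewrite /tau Gof_extg chi_top ?coef_Gof0 // extg_max mulrC mulrA -PsiD mulNr subrr.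
  by rewrite Psi0 mul1r.
have chin n G : chi n G * (chi n G)^* = 1 by rewrite -normCK /chi (Psi_norm pF PsiD Psi0) expr1n.
have tauE g h : tau (mulg g h) * (tau g)^* =
    chi 0 (Gof h) * Psi (kap * ((Gof g * Gof h)`_d - g ord_max)).
  have cm : chi m (Gof g * Gof h) = chi m (Gof g) * chi 0 (Gof h).
    by have := chi_mul pF PsiD szf de m 0 (coef_Gof0 g) (coef_Gof0 h); rewrite addn0.
  rewrite /tau (chi_eqm m (Gof_mulg g h)) cm.
  rewrite rmorphM /= ffunE /= mulrBr PsiD (PsiN pF PsiD Psi0).
  have -> : chi m (Gof g) * chi 0 (Gof h) * Psi (kap * (Gof g * Gof h)`_d) *
     ((chi m (Gof g))^* * (Psi (kap * g ord_max))^*) =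
     (chi m (Gof g) * (chi m (Gof g))^*) * (chi 0 (Gof h) *
     (Psi (kap * (Gof g * Gof h)`_d) * (Psi (kap * g ord_max))^*)) by ring.
  by rewrite chin mul1r.
have GG : Gam * Gam^* = (q ^ d.+1)%:R.
  rewrite /Gam rmorph_sum /= mulr_sumr.
  transitivity (\sum_g \sum_h tau (mulg g h) * (tau g)^*).
    by apply: eq_bigr => g _; rewrite mulr_suml (reindex_inj (@mulg_inj g)).
  under eq_bigr => g _ do under eq_bigr => h _ do rewrite tauE.
  rewrite exchange_big /=; under eq_bigr => h _ do rewrite -mulr_sumr.
  rewrite sum_extg (bigD1 [ffun=> 0]) //= [X in _ + X]big1 ?addr0.
    rewrite (eq_bigr (fun=> (q ^ d)%:R)) => [|t _].
      by rewrite sumr_const -mulrnA -expnSr.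
    have -> : Gof (extg ([ffun=> 0] : {ffun 'I_m -> F}) t) = 1 + t *: 'X^d.
      rewrite Gof_extg /Gof big1 ?addr0 // => i _; by rewrite ffunE scale0r.
    rewrite (eq_bigr (fun=> Psi (kap * t))) => [|g _].
      rewrite sumr_const card_ffun card_ord -[Psi _ *+ _]mulr_natr mulrA.
      have c01 : chi 0 1 = 1.
        by rewrite /chi /lin_lps mulr0n add0r big1_seq ?Psi0 // => i _; rewrite lps1 coef0 mulr0.
      by rewrite (chi_top 0 t (coef1 _ 0)) c01 mulr1 -PsiD mulNr addNr Psi0 mul1r.
    rewrite [Gof g * _]mulrDr mulr1 coefD -scalerAr coefZ coefMXn ltnn subnn coef_Gof0 mulr1.
    by rewrite (coef_Gof g ord_max) addrC addKr.
  move=> g' g'0; apply: big1 => t _.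
  have /existsP[j Hj] : [exists j, g' j != 0].
    by apply: contraNT g'0 => /existsPn H; apply/eqP/ffunP=> j; rewrite ffunE; apply/eqP; have := H j; rewrite negbK.
  set h := extg g' t.
  (* The coefficient of exponent m - j in g meets the coefficient of exponent j + 1 in h at exponent
     d; shifting it changes the argument of Psi by a nonzero multiple of the shift. *)
  have lt : (m - j.+1 < d)%N by lia.
  rewrite (@sum_shift0 F C Psi Psi_nt _ _ (addat (Ordinal lt)) (kap * g' j) xpredT) ?mulr0 //.
  - by rewrite mulf_neq0 ?kap_neq0.
  - exact: addat_inj.
  move=> s g _; rewrite -PsiD; congr (Psi _).
  rewrite Gof_addat mulrDl coefD -scalerAl coefZ coefXnM.
  have -> : (d < (Ordinal lt).+1)%N = false by rewrite /=; have := ltn_ord j; lia.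
  have -> : (d - (Ordinal lt).+1 = (lift ord_max j : 'I_d).+1)%N.
    by rewrite /= /bump leqNgt ltn_ord /=; have := ltn_ord j; lia.
  rewrite coef_Gof /h extg_lift ffunE.
  have -> : (ord_max == Ordinal lt) = false.
    by rewrite -val_eqE /=; have := ltn_ord j; lia.
  ring.
have : `|Gam| ^+ 2 = (q ^ d.+1)%:R by rewrite normCK.
rewrite GamE normrM exprMn normr_nat -natrX => H.
apply: (mulfI (_ : (q ^ 2)%:R != 0 :> C)); first by rewrite natrX expf_neq0.
by rewrite H -natrM -expnD; congr (_ ^ _)%:R; lia.
Qed.
End Vanish.

(** * The character composed with the absolute trace, and transitivity of traces *)

Section AbsTrace.
Variables (p : nat) (L : finFieldType).
Hypothesis pL : p \in [pchar L].
Let p_pr : prime p. Proof. exact: pcharf_prime pL. Qed.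
Let n := logn p #|L|.
Lemma cardL : #|L| = (p ^ n)%N. Proof. by have := card_pprimeChar pL. Qed.
Lemma logL_gt0 : (0 < n)%N.
Proof. by rewrite lt0n; apply/eqP=> n0; have := finNzRing_gt1 L; rewrite cardL n0. Qed.

Lemma expD_pX j (x y : L) : (x + y) ^+ (p ^ j) = x ^+ (p ^ j) + y ^+ (p ^ j).
Proof. by apply: exprDn_pchar; rewrite (eq_pnat _ (pcharf_eq pL)) pnatX pnat_id. Qed.

Lemma abs_traceD (x y : L) : abs_trace p (x + y) = abs_trace p x + abs_trace p y.
Proof. by rewrite /abs_trace -big_split; apply: eq_bigr => j _; exact: expD_pX. Qed.

Lemma abs_trace_p (x : L) : abs_trace p (x ^+ p) = abs_trace p x.
Proof.
rewrite /abs_trace -/n; case: n cardL => [|k] cL.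
  by have := finNzRing_gt1 L; rewrite cL.
rewrite big_ord_recr [RHS]big_ord_recl /= -exprM -expnS -cL expf_card addrC expn0 expr1.
by congr (_ + _); apply: eq_bigr => j _; rewrite -exprM -expnS.
Qed.

Lemma abs_trace_Xp (x : L) : (abs_trace p x) ^+ p = abs_trace p x.
Proof.
rewrite -[RHS]abs_trace_p /abs_trace.
rewrite (big_morph (fun y => y ^+ p) (id1 := 0) (op1 := +%R)); last first.
- by rewrite expr0n gtn_eqF // prime_gt0.
- by move=> a b; have := expD_pX 1 a b; rewrite expn1.
by apply: eq_bigr => j _; rewrite -!exprM mulnC.
Qed.

Lemma natF_inj (k l : 'F_p) : ((val k)%:R : L) = (val l)%:R -> k = l.
Proof.
have lp (m : 'F_p) : (val m < p)%N by apply: leq_trans (ltn_ord m) _; rewrite Fp_cast.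
wlog le : k l / (val l <= val k)%N.
  by move=> H; case/orP: (leq_total (val l) (val k)) => h E; [apply: H|apply/esym/H].
move=> E; apply: val_inj; apply/eqP; rewrite eqn_leq le andbT.
have : (val k - val l)%:R == 0 :> L by rewrite natrB // E subrr.
rewrite -(dvdn_pcharf pL) => dv; rewrite -subn_eq0; apply: contraTT dv => ne.
by rewrite gtnNdvd ?lt0n //; have := lp k; lia.
Qed.

Lemma to_FpK (k : 'F_p) : to_Fp p ((val k)%:R : L) = k.
Proof.
rewrite /to_Fp; case: pickP => [l /eqP/natF_inj //|/(_ k)]; by rewrite eqxx.
Qed.

Lemma prime_sub (y : L) : y ^+ p = y -> exists k : 'F_p, y = (val k)%:R.
Proof.
move=> yp; have nz : 'X^p - 'X != 0 :> {poly L}.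
  by rewrite -size_poly_eq0 size_polyDl size_polyXn // size_polyN size_polyX ltnS prime_gt1.
case: (boolP [exists k : 'F_p, y == (val k)%:R]) => [/existsP[k /eqP]|/existsPn H]; first by exists k.
pose s := y :: [seq ((val k)%:R : L) | k <- enum 'F_p].
have A : all (root ('X^p - 'X)) s.
  apply/allP=> z; rewrite inE /root !hornerE subr_eq0 => /orP[/eqP -> |/mapP[k _ ->]].
    by rewrite yp.
  by rewrite -(pFrobenius_autE pL) pFrobenius_aut_nat.
have U : uniq s.
  rewrite /= map_inj_uniq ?enum_uniq ?andbT; last exact: natF_inj.
  by apply/mapP=> -[k _ e]; have := H k; rewrite -e eqxx.
have := max_poly_roots nz A U; rewrite size_polyDl ?size_polyXn ?size_polyN ?size_polyX ?ltnS ?prime_gt1 //=.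
by rewrite size_map -cardE card_Fp // ltnn.
Qed.

Lemma natF_mod m : ((m %% (Zp_trunc (pdiv p)).+2)%:R : L) = m%:R.
Proof.
rewrite Fp_cast // [in RHS](divn_eq m p) natrD natrM (pcharf0 pL) mulr0 add0r //.
Qed.

Lemma natFD (k l : 'F_p) : ((val (k + l))%:R : L) = (val k)%:R + (val l)%:R.
Proof.
by rewrite -natrD -[RHS]natF_mod.
Qed.

Lemma to_FpD (x y : L) : x ^+ p = x -> y ^+ p = y ->
  to_Fp p (x + y) = to_Fp p x + to_Fp p y.
Proof.
by move=> /prime_sub[k ->] /prime_sub[l ->]; rewrite -natFD !to_FpK.
Qed.

Variables (C : numClosedFieldType) (psi : 'F_p -> C).
Hypotheses (psiD : forall x y, psi (x + y) = psi x * psi y) (psi0 : psi 0 = 1)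
  (psi_nt : exists x, psi x != 1).

Definition PsiL (x : L) : C := psi (to_Fp p (abs_trace p x)).

Lemma PsiLD x y : PsiL (x + y) = PsiL x * PsiL y.
Proof. by rewrite /PsiL abs_traceD to_FpD ?psiD ?abs_trace_Xp. Qed.

Lemma PsiL0 : PsiL 0 = 1.
Proof.
have : abs_trace p (0 : L) = (val (0 : 'F_p))%:R.
  rewrite /abs_trace big1 // => j _; rewrite expr0n gtn_eqF // expn_gt0 prime_gt0 //.
by rewrite /PsiL => ->; rewrite to_FpK.
Qed.

Lemma PsiL_p y : PsiL (y ^+ p) = PsiL y.
Proof. by rewrite /PsiL abs_trace_p. Qed.

(** The trace is a nonzero polynomial of degree p ^ (n - 1), below the number of elements, so it
    does not vanish identically. An integer multiple of a suitable element then has any prescribed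
    trace. *)
Lemma PsiL_nt : exists h, PsiL h != 1.
Proof.
have [z z0] : exists z : L, abs_trace p z != 0.
  case: (boolP [exists z : L, abs_trace p z != 0]) => [/existsP//|/existsPn H].
  pose T : {poly L} := \sum_(j < n) 'X^(p ^ j).
  have Tn : T`_(p ^ n.-1) = 1.
    rewrite /T; have := logL_gt0; case: (n) => // n' _.
    rewrite coef_sum big_ord_recr /= coefXn eqxx big1 ?add0r // => i _.
    by rewrite coefXn eqn_exp2l ?prime_gt1 // gtn_eqF.
  have T0 : T != 0 by apply/eqP=> T0; move: Tn; rewrite T0 coef0 => /eqP; rewrite eq_sym oner_eq0.
  have sT : (size T <= (p ^ n.-1).+1)%N.
    apply: leq_trans (size_sum _ _ _) _; apply/bigmax_leqP => i _.
    by rewrite size_polyXn ltnS leq_exp2l ?prime_gt1 //; have := ltn_ord i; lia.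
  have := @max_poly_roots _ T (enum L) T0; rewrite -cardE enum_uniq.
  have -> : all (root T) (enum L).
    apply/allP=> z _; rewrite /root /T horner_sum; under eq_bigr do rewrite hornerXn.
    by have := H z; rewrite negbK.
  move=> /(_ isT isT) => lt; have := leq_trans lt sT; rewrite ltnS cardL leq_exp2l ?prime_gt1 //.
  by have := logL_gt0; lia.
have [k Hk] := prime_sub (abs_trace_Xp z).
have k0 : k != 0 by apply: contraNneq z0 => k0; rewrite Hk k0.
have [x Hx] := psi_nt.
pose c := x / k; exists (z *+ val c).
have -> : PsiL (z *+ val c) = psi x; last by [].
rewrite /PsiL; have -> : abs_trace p (z *+ val c) = (abs_trace p z) *+ val c.
  elim: (val c) => [|m IH]; last by rewrite !mulrS abs_traceD IH.
  by rewrite !mulr0n /abs_trace big1 // => j _; rewrite expr0n gtn_eqF // expn_gt0 prime_gt0.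
rewrite Hk -[_ *+ _]mulr_natr -natrM.
have -> : (val k * val c)%:R = (val x)%:R :> L; last by rewrite to_FpK.
have -> : x = k * c by rewrite /c mulrC divfK.
by rewrite -[LHS]natF_mod.
Qed.
End AbsTrace.

Section Compat.
Variables (p : nat) (F L : finFieldType) (iota : {rmorphism F -> L}) (k : nat).
Hypotheses (pF : p \in [pchar F]) (cL : #|L| = (#|F| ^ k)%N).
Variables (C : numClosedFieldType) (psi : 'F_p -> C).
Let q := #|F|.
Let p_pr : prime p. Proof. exact: pcharf_prime pF. Qed.

Lemma to_Fp_iota x : to_Fp p (iota x) = to_Fp p x.
Proof.
rewrite /to_Fp; congr (odflt 0 _); apply: eq_pick => l.
by rewrite -(rmorph_nat iota) (inj_eq (fmorph_inj iota)).
Qed.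

(** Transitivity of the trace: the exponents q ^ i p ^ j, with i below k and j below the logarithm
    of q, run once over the powers of p that occur in the absolute trace of L. *)
Lemma PsiL_compat x : PsiL psi x = PsiL psi (fdown iota (frtr F k x)).
Proof.
rewrite /PsiL -(to_Fp_iota (abs_trace _ _)); congr (psi (to_Fp p _)).
have fx : x ^+ (#|F| ^ k) = x by rewrite -cL expf_card.
pose n := logn p q.
have qn : q = (p ^ n)%N := cardL pF.
have lL : logn p #|L| = (k * n)%N by rewrite cL lognX.
have ab (y : F) : iota (abs_trace p y) = \sum_(j < n) (iota y) ^+ (p ^ j).
  by rewrite /abs_trace rmorph_sum; apply: eq_bigr => j _; rewrite rmorphXn.
rewrite ab (iota_frtr iota pF) // /abs_trace lL /frtr -/q.
under [RHS]eq_bigr => j _.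
  rewrite (big_morph _ (expD_pX (pL iota pF) j) (_ : 0 ^+ (p ^ j) = 0)); last first.
    by rewrite expr0n gtn_eqF // expn_gt0 prime_gt0.
  over.
rewrite exchange_big /=; elim: (k) => [|m IH]; first by rewrite mul0n !big_ord0.
rewrite big_ord_recr /= -IH mulSn addnC -!(big_mkord xpredT (fun j => x ^+ (p ^ j))).
rewrite (big_cat_nat (n := (m * n)%N)) ?leq_addr //=; congr (_ + _).
rewrite -{1}[(m * n)%N]add0n big_addn addnC addnK big_mkord; apply: eq_bigr => j _.
by rewrite -exprM qn -expnM -expnD; congr (_ ^+ (_ ^ _)); lia.
Qed.
End Compat.

(** * Newton's identities and absolute values of the inverse zeros *)

Section Newton.
Variable C : fieldType.
Definition lprod (w : seq C) : {poly C} := \prod_(a <- w) (1 - a *: 'X).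

Lemma lprod0 w : (lprod w)`_0 = 1.
Proof.
rewrite /lprod; elim: w => [|a w IH]; first by rewrite big_nil coef1.
by rewrite big_cons coef0M IH !coefE mulr0 subr0 mul1r.
Qed.

Lemma newton_eqm (w : seq C) M :
  eqm M (- (lprod w)^`()) (lprod w * \poly_(k < M) \sum_(a <- w) a ^+ k.+1).
Proof.
elim: w => [|a w IH].
  rewrite /lprod big_nil derivC oppr0.
  have -> : \poly_(k < M) (\sum_(a <- [::]) a ^+ k.+1 : C) = 0.
    by apply/polyP=> i; rewrite coef_poly big_nil coef0; case: ifP.
  by rewrite mulr0 eqm_refl.
rewrite /lprod big_cons -/(lprod w) derivM derivB derivC derivZ derivX sub0r.
have -> : \poly_(k < M) (\sum_(b <- a :: w) b ^+ k.+1) =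
   \poly_(k < M) a ^+ k.+1 + \poly_(k < M) (\sum_(b <- w) b ^+ k.+1).
  by apply/polyP=> i; rewrite coefD !coef_poly big_cons; case: ifP; rewrite ?addr0.
have -> : - (- (a *: 1) * lprod w + (1 - a *: 'X) * (lprod w)^`()) =
   a%:P * lprod w + (1 - a *: 'X) * (- (lprod w)^`()).
  by rewrite alg_polyC; ring.
rewrite mulrDr; apply: eqmD; last by rewrite -mulrA; apply: eqmM (eqm_refl _ _) IH.
rewrite mulrAC; apply: eqmM (eqm_refl _ _).
apply/eqmP=> i lt; rewrite mulrBl mul1r -scalerAl coefB coefZ coefXM !coef_poly lt coefC.
case: i lt => [|i] lt /=; first by rewrite mulr0 subr0 expr1.
by rewrite (ltnW lt) -exprS subrr.
Qed.

Lemma newton (w : seq C) n :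
  n.+1%:R * (lprod w)`_n.+1 = - \sum_(k < n.+1) (\sum_(a <- w) a ^+ k.+1) * (lprod w)`_(n - k).
Proof.
have /eqmP/(_ n (ltnSn n)) := newton_eqm w n.+1.
rewrite coefN coef_deriv => E; rewrite mulr_natl -[LHS]opprK E; congr (- _).
rewrite coefM (reindex_inj rev_ord_inj) /=; apply: eq_bigr => k _.
have kn : (k <= n)%N by rewrite -ltnS.
by rewrite subSS subKn // coef_poly ltn_ord mulrC.
Qed.

Lemma newton_unique (w : seq C) (S : nat -> C) (c : nat -> C) :
  (forall n, c n = (lprod w)`_n) ->
  (forall n, (0 < n)%N -> n%:R * c n = \sum_(1 <= k < n.+1) S k * c (n - k)%N) ->
  forall n, (0 < n)%N -> S n = - \sum_(a <- w) a ^+ n.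
Proof.
move=> cE rec; elim/ltn_ind=> -[//|n] IH _.
have := rec n.+1 isT; rewrite cE newton big_nat_recr //= subnn cE lprod0 mulr1.
rewrite big_add1 /= big_mkord big_ord_recr /= subnn lprod0 mulr1 opprD.
have -> : \sum_(i < n) S i.+1 * c (n.+1 - i.+1)%N =
   - \sum_(i < n) (\sum_(a <- w) a ^+ i.+1) * (lprod w)`_(n - i).
  rewrite -sumrN; apply: eq_bigr => i _; rewrite IH ?ltnS // cE subSS mulNr //.
by move/addrI => <-.
Qed.
End Newton.

Section RootBound.
Variable C : numClosedFieldType.
Hypothesis archi : forall x : C, exists n : nat, `|x| <= n%:R.

Lemma bernoulli (h : C) t : 0 <= h -> 1 + h *+ t <= (1 + h) ^+ t.
Proof.
move=> h0; elim: t => [|t IH]; first by rewrite mulr0n addr0 expr0.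
have h1 : 0 <= 1 + h by rewrite addr_ge0.
rewrite exprS; apply: le_trans (ler_wpM2l h1 IH).
have -> : (1 + h) * (1 + h *+ t) = 1 + h *+ t.+1 + h * (h *+ t).
  by rewrite mulrS mulrDl mul1r mulrDr mulr1 !addrA; congr (_ + _); rewrite addrAC.
by rewrite lerDl mulr_ge0 // mulrn_wge0.
Qed.

Lemma geo_unbounded (r K : C) t0 : 0 <= r -> (forall t, (t0 <= t)%N -> r ^+ t <= K) -> r <= 1.
Proof.
move=> r0 H; rewrite real_leNgt ?ger0_real //; apply/negP => r1.
pose h := r - 1; have h0 : 0 < h by rewrite subr_gt0.
have rE : r = 1 + h by rewrite /h addrC subrK.
have [n Hn] := archi (K / h).
have K0 : 0 <= K by apply: le_trans (H t0 (leqnn _)); rewrite exprn_ge0.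
have Kh : 0 <= K / h by rewrite divr_ge0 // ltW.
have KH : K <= h *+ n.
  by move: Hn; rewrite (ger0_norm Kh) ler_pdivrMr // mulr_natl.
have Klt : K < 1 + h *+ (n + t0).
  by apply: (le_lt_trans KH); rewrite mulrnDr addrA ltr_wpDr ?mulrn_wge0 ?ltW // ltrDr.
have := le_trans (bernoulli (n + t0) (ltW h0)); rewrite -rE => /(_ _ (H _ (leq_addl _ _))).
by move=> /(lt_le_trans Klt); rewrite ltxx.
Qed.

(** The polynomial phi vanishes at all the other values of u. The corresponding fixed combination of
    shifted power sums isolates [v ^+ t], up to a nonzero constant, and inherits the growth bound in
    t. *)
Lemma power_sum_bound (u : seq C) (Q K : C) t0 : 0 < Q ->
  (forall t, (t0 <= t)%N -> `|\sum_(a <- u) a ^+ t| <= K * Q ^+ t) ->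
  forall a, a \in u -> `|a| <= Q.
Proof.
move=> Q0 H v vu.
pose phi := \prod_(b <- rem v (undup u)) ('X - b%:P).
have K0 : 0 <= K.
  by have := H t0 (leqnn _) => /(le_trans (normr_ge0 _)); rewrite pmulr_lge0 // exprn_gt0.
have phiv : phi.[v] != 0.
  rewrite -/(root phi v) root_prod_XsubC mem_rem_uniq ?undup_uniq // !inE eqxx //.
have phi0 b : b \in u -> b != v -> phi.[b] = 0.
  move=> bu bv; apply/eqP; rewrite -/(root phi b) root_prod_XsubC mem_rem_uniq ?undup_uniq //.
  by rewrite !inE bv mem_undup.
have E t : \sum_(a <- u) phi.[a] * a ^+ t = (count_mem v u)%:R * (phi.[v] * v ^+ t).
  rewrite (bigID (pred1 v)) /= [X in _ + X]big1_seq ?addr0; last first.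
    by move=> b /andP[bv bu]; rewrite phi0 // mul0r.
  rewrite (eq_bigr (fun=> phi.[v] * v ^+ t)) => [|b /eqP -> //].
  by rewrite big_const_seq iter_addr_0 mulr_natl.
have E2 t : \sum_(a <- u) phi.[a] * a ^+ t =
    \sum_(i < size phi) phi`_i * \sum_(a <- u) a ^+ (t + i).
  under eq_bigr => a _ do rewrite horner_coef mulr_suml.
  rewrite exchange_big /=; apply: eq_bigr => i _; rewrite mulr_sumr; apply: eq_bigr => a _.
  by rewrite exprD; ring.
pose K' := \sum_(i < size phi) `|phi`_i| * (K * Q ^+ i).
have B t : (t0 <= t)%N -> `|phi.[v]| * `|v| ^+ t <= K' * Q ^+ t.
  move=> t0t; rewrite -normrX -normrM.
  apply: (@le_trans _ _ `|(count_mem v u)%:R * (phi.[v] * v ^+ t)|).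
    rewrite [leRHS]normrM normr_nat ler_peMl // ler1n -has_count has_pred1 //.
  rewrite -E E2 /K' mulr_suml; apply: le_trans (ler_norm_sum _ _ _) _.
  apply: ler_sum => i _; rewrite normrM -!mulrA ler_wpM2l //.
  by apply: le_trans (H _ _) _; rewrite ?(leq_trans t0t) ?leq_addr // addnC exprD mulrA.
have nv : 0 < `|phi.[v]| by rewrite normr_gt0.
have r0 : 0 <= `|v| / Q by rewrite divr_ge0 // ltW.
have := @geo_unbounded (`|v| / Q) (K' / `|phi.[v]|) t0 r0.
rewrite ler_pdivrMr // mul1r; apply=> t tt.
rewrite ler_pdivlMr // expr_div_n mulrAC ler_pdivrMr ?exprn_gt0 // mulrC; exact: B.
Qed.

Lemma prod_eq_bound (w : seq C) (Q : C) : 0 < Q -> (forall a, a \in w -> 0 <= a <= Q) ->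
  \prod_(a <- w) a = Q ^+ size w -> forall a, a \in w -> a = Q.
Proof.
move=> Q0 H E a aw; apply/eqP; have /andP[a0 aQ] := H a aw.
apply: contraT => ne; have lt : a < Q by rewrite lt_neqAle ne.
move: E; rewrite (perm_big _ (perm_to_rem aw)) big_cons => E.
have le : \prod_(b <- rem a w) b <= Q ^+ size (rem a w).
  have : forall b, b \in rem a w -> 0 <= b <= Q by move=> b /mem_rem; exact: H.
  elim: (rem a w) => [|b s IH] Hs; first by rewrite big_nil.
  rewrite big_cons exprS; have /andP[b0 bQ] := Hs b (mem_head _ _).
  apply: ler_pM => //; last by apply: IH => c cs; apply: Hs; rewrite inE cs orbT.
  by rewrite big_seq prodr_ge0 // => c cs; have := Hs c; rewrite inE cs orbT => /(_ isT)/andP[].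
have : a * \prod_(b <- rem a w) b < Q ^+ size w.
  apply: le_lt_trans (ler_wpM2l a0 le) _.
  have -> : size w = (size (rem a w)).+1 by rewrite size_rem // prednK //; case: (w) aw.
  by rewrite exprS ltr_pM2r // exprn_gt0.
by rewrite E ltxx.
Qed.
End RootBound.

Section Roots.
Variables (p : nat) (F : finFieldType) (C : numClosedFieldType) (Psi : F -> C).
Hypothesis archi : forall x : C, exists n : nat, `|x| <= n%:R.
Hypotheses (pF : p \in [pchar F]) (PsiD : forall x y, Psi (x + y) = Psi x * Psi y) (Psi0 : Psi 0 = 1).
Hypothesis Psi_nt : exists h, Psi h != 1.
Let q := #|F|.
Variables (f : {poly F}) (m e : nat).
Hypotheses (szf : size f = m.+2) (de : (m.+1 < p ^ e)%N) (cdp : coprime m.+1 p).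
Variable S : nat -> C.
Hypothesis S_ext : forall k, (0 < k)%N -> exists (L : finFieldType) (iota : {rmorphism F -> L}),
  #|L| = (q ^ k)%N /\ S k = \sum_(x : L) chi p Psi f m.+1 e k (cpol iota k x).
Hypothesis S_bound : exists K t0, forall t, (t0 <= t)%N -> `|S (2 * t)| <= K * (q%:R : C) ^+ t.
Local Notation cn := (cn p Psi f m.+1 e).

Lemma lfun_roots : exists w : seq C, [/\ size w = m, forall a, a \in w -> `|a| ^+ 2 = q%:R
  & forall n, cn n = (lprod w)`_n].
Proof.
have q0 : (0 : C) < q%:R by rewrite ltr0n ltnW // finNzRing_gt1.
pose Lp := \poly_(n < m.+1) cn n.
have gn := gauss_norm pF PsiD Psi0 Psi_nt szf de cdp.
have cm0 : cn m != 0.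
  rewrite -normr_eq0; apply: contraTneq q0 => n0; move: gn; rewrite n0 expr0n /= => /esym/eqP.
  by rewrite natrX expf_eq0 => /andP[_ /eqP ->]; rewrite ltxx.
have sL : size Lp = m.+1 by rewrite size_poly_eq.
have L0 : Lp`_0 = 1 by rewrite coef_poly cn0.
have [r Lr] := closed_field_poly_normal Lp.
have sr : size r = m.
  apply: succn_inj; rewrite -sL Lr size_scale ?size_prod_XsubC //.
  by rewrite lead_coef_eq0 -size_poly_eq0 sL.
have r0 z : z \in r -> z != 0.
  move=> zr; apply/eqP => z0; have : root Lp z.
    by rewrite Lr rootZ ?lead_coef_eq0 -?size_poly_eq0 ?sL // root_prod_XsubC.
  by rewrite z0 /root horner_coef0 L0 oner_eq0.
pose w := [seq z^-1 | z <- r].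
have wE : lprod w = (\prod_(z <- r) (- z^-1)) *: \prod_(z <- r) ('X - z%:P).
  rewrite /lprod big_map; elim: (r) r0 => [|z s IH] Hs; first by rewrite !big_nil scale1r.
  rewrite !big_cons IH => [|y ys]; last by apply: Hs; rewrite inE ys orbT.
  have -> : 1 - z^-1 *: 'X = (- z^-1) *: ('X - z%:P).
    apply/polyP=> -[|[|i]]; rewrite !coefE /=.
    - by rewrite mulr0 subr0 sub0r mulrNN mulVf // Hs ?inE ?eqxx.
    - by rewrite mulr1 sub0r subr0 mulr1.
    - by rewrite subr0 !mulr0 subr0.
  by rewrite -[LHS]scalerAl -scalerAr scalerA.
have [c Lc] : exists c, Lp = c *: lprod w.
  exists (lead_coef Lp / \prod_(z <- r) (- z^-1)); rewrite wE scalerA divfK //.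
  by rewrite prodf_seq_neq0; apply/allP=> z zr; rewrite /= oppr_eq0 invr_eq0 r0.
have c1 : c = 1 by move: L0; rewrite Lc coefZ lprod0 mulr1.
rewrite c1 scale1r in Lc.
have cE n : cn n = (lprod w)`_n.
  rewrite -Lc coef_poly; case: ltnP => // le; exact: (cn_vanish pF PsiD Psi_nt szf de cdp).
have SE := newton_unique cE (Lrec pF PsiD szf de S_ext).
have sw : size w = m by rewrite size_map.
have wle a : a \in w -> `|a| ^+ 2 <= q%:R.
  move=> aw; rewrite -normrX.
  have [K [t0 HK]] := S_bound.
  (* The bound holds for even exponents only, Stepanov's argument requiring a field of square order,
     so it is applied to the squares of the inverse zeros. *)
  apply: (@power_sum_bound C archi [seq b ^+ 2 | b <- w] q%:R K t0.+1) => //; last first.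
    by apply: map_f.
  move=> t tt; have := HK t (ltnW tt); rewrite SE ?normrN; last by lia.
  move=> B; rewrite big_map; move: B; congr (is_true (`|_| <= _)).
  by apply: eq_bigr => b _; rewrite exprM.
exists w; split=> // a aw.
(* The product of the [|b| ^+ 2] is q ^ m by [gauss_norm], so no upper bound can be strict. This
   does the work of the functional equation. *)
apply: (@prod_eq_bound C [seq `|b| ^+ 2 | b <- w] q%:R q0) => //.
- by move=> b /mapP[b' b'w ->]; rewrite exprn_ge0 // wle.
- rewrite size_map sw big_map -natrX -gn cE.
  have -> : (lprod w)`_m = \prod_(b <- w) (- b).
    have -> : (lprod w)`_m = lead_coef (lprod w) by rewrite lead_coefE -Lc sL.
    rewrite /lprod lead_coef_prod !big_map; apply: eq_big_seq => z zr.
    rewrite lead_coefDr ?size_polyN ?size_scale ?size_polyX ?size_poly1 ?invr_eq0 ?r0 //.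
    by rewrite lead_coefN lead_coefZ lead_coefX mulr1.
  by rewrite normr_prod -prodrXl; apply: eq_bigr => b _; rewrite normrN.
- by apply: (map_f (fun b => `|b| ^+ 2)).
Qed.
End Roots.

(** * Counting pairs of points *)

Lemma leq_card_fiber (T D : finType) (A : {set T}) (g : T -> D) K :
  (forall y, (#|[set x in A | g x == y]| <= K)%N) -> (#|A| <= K * #|D|)%N.
Proof.
move=> H; rewrite -sum1_card (partition_big g xpredT) //= mulnC -sum_nat_const.
apply: leq_sum => y _; apply: leq_trans (H y); rewrite -sum1_card.
by apply: eq_leq; apply: eq_bigl => x; rewrite !inE.
Qed.

Lemma card_setU_leq (T : finType) (A B : {set T}) a b :
  (#|A| <= a)%N -> (#|B| <= b)%N -> (#|A :|: B| <= a + b)%N.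
Proof. by move=> ha hb; apply: leq_trans (leq_card_setU _ _) _; exact: leq_add. Qed.

Lemma size_mul_le (R : idomainType) (A B : {poly R}) m n :
  (size A <= m.+1)%N -> (size B <= n.+1)%N -> (size (A * B)%R <= (m + n).+1)%N.
Proof. by move=> sA sB; apply: leq_trans (size_polyMleq _ _) _; lia. Qed.

Section Data.
Variables (p N : nat) (F : finFieldType).
Hypothesis pF : p \in [pchar F].
Let q := #|F|.
Let p_pr : prime p. Proof. exact: pcharf_prime pF. Qed.

(** If ['X^N] divides the derivative of G, its coefficients of exponent from 1 to N live at
    multiples of p. They are recorded by [datp], and the coefficients beyond N by [datt]; together
    these determine G once its constant term is known. *)
Definition datp (G : {poly F}) : {ffun 'I_(N %/ p) -> F} := [ffun j : 'I_(N %/ p) => G`_(p * j.+1)].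
Definition datt n (G : {poly F}) : {ffun 'I_(n - N) -> F} := [ffun j : 'I_(n - N) => G`_(N.+1 + j)].

Lemma deriv_coef0 (G : {poly F}) i : 'X^N %| G^`() -> (0 < i <= N)%N -> ~~ (p %| i)%N -> G`_i = 0.
Proof.
move=> /dvdXnP H /andP[i0 iN] pi; have := H i.-1; rewrite coef_deriv prednK // => /(_ iN)/eqP.
by rewrite -mulr_natr mulf_eq0 -(dvdn_pcharf pF) (negbTE pi) orbF => /eqP.
Qed.

Lemma datp_eqm (G H : {poly F}) : G`_0 = H`_0 -> 'X^N %| G^`() -> 'X^N %| H^`() ->
  datp G = datp H -> eqm N.+1 G H.
Proof.
move=> e0 dG dH /ffunP e; apply/eqmP => i; rewrite ltnS => iN.
case: (posnP i) => [-> //|i0]; case: (boolP (p %| i)%N) => [/dvdnP[j ej]|pi].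
  have j0 : (0 < j)%N by case: j ej => // ej; rewrite ej in i0.
  have lt : (j.-1 < N %/ p)%N by rewrite prednK // leq_divRL ?prime_gt0 // -ej.
  by have := e (Ordinal lt); rewrite !ffunE /= prednK // mulnC -ej.
by rewrite !deriv_coef0 // i0.
Qed.

End Data.

Lemma datt_eq (N : nat) (F : finFieldType) n (G H : {poly F}) : (size G <= n.+1)%N -> (size H <= n.+1)%N ->
  eqm N.+1 G H -> datt N n G = datt N n H -> G = H.
Proof.
move=> sG sH /eqmP eq /ffunP e; apply/polyP => i; case: (ltnP i N.+1) => [/eq //|le].
case: (ltnP i n.+1) => [lt|ge]; last by rewrite !nth_default // (leq_trans _ ge).
have lt' : (i - N.+1 < n - N)%N by lia.
by have := e (Ordinal lt'); rewrite !ffunE /= subnKC.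
Qed.

Lemma card_dat (p N : nat) (F : finFieldType) n : #|{: {ffun 'I_(N %/ p) -> F} * {ffun 'I_(n - N) -> F}}| = (#|F| ^ (N %/ p + (n - N)))%N.
Proof. by rewrite card_prod !card_ffun !card_ord expnD. Qed.

Section OneField.
Variables (p N : nat) (F L : finFieldType) (iota : {rmorphism F -> L}) (m : nat).
Hypotheses (pF : p \in [pchar F]) (cL : #|L| = (#|F| ^ m)%N) (m0 : (0 < m)%N).
Let q := #|F|.
Let p_pr : prime p. Proof. exact: pcharf_prime pF. Qed.
Local Notation P := (cpol iota m).
Local Notation pi := (opolF iota pF).
Local Notation deg := (deg iota pF).

Lemma frob_top (x : L) : x ^+ (q ^ m) = x.
Proof. by rewrite -cL expf_card. Qed.

Lemma deg_dvdm x : (deg x %| m)%N.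
Proof. by rewrite -(deg_dvd iota pF) frob_top. Qed.

Lemma degM x : (m %/ deg x * deg x)%N = m.
Proof. by rewrite divnK // deg_dvdm. Qed.

Lemma cofac_gt0 x : (0 < m %/ deg x)%N.
Proof. by rewrite divn_gt0 ?deg_gt0 // dvdn_leq // deg_dvdm. Qed.

Lemma cpol_pi x : P x = pi x ^+ (m %/ deg x).
Proof. by rewrite -{1}(degM x) cpolE. Qed.

Lemma P0 x : (P x)`_0 = 1. Proof. by apply: (cpol0 iota pF); exact: frob_top. Qed.

Lemma card_frobfix k : (0 < k)%N -> (#|[set x : L | x ^+ (q ^ k) == x]| <= q ^ k)%N.
Proof.
move=> k0; have qk1 : (1 < q ^ k)%N by rewrite -(exp1n k) ltn_exp2r // finNzRing_gt1.
have nz : 'X^(q ^ k) - 'X != 0 :> {poly L}.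
  by rewrite -size_poly_eq0 size_polyDl size_polyXn // size_polyN size_polyX.
have := max_poly_roots nz; rewrite size_polyDl ?size_polyXn ?size_polyN ?size_polyX //.
move=> /(_ (enum [set x : L | x ^+ (q ^ k) == x])); rewrite -cardE ltnS; apply.
  by apply/allP=> y; rewrite mem_enum inE /root !hornerE subr_eq0.
exact: enum_uniq.
Qed.

Lemma card_deg k : (#|[set x : L | deg x == k]| <= q ^ k)%N.
Proof.
case: (posnP k) => [->|k0].
  by rewrite (_ : [set x | _] = set0) ?cards0 //; apply/setP=> x; rewrite !inE gtn_eqF // deg_gt0.
apply: leq_trans (card_frobfix k0); apply: subset_leq_card; apply/subsetP=> x; rewrite !inE => /eqP <-.
by rewrite (deg_dvd iota pF).
Qed.

Lemma card_invroot (G : {poly F}) n : G != 0 -> (size G <= n.+1)%N ->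
  (#|[set x : L | (x != 0%R) && root (map_poly iota G) x^-1]| <= n)%N.
Proof.
move=> G0 sG; set A := [set x | _].
have G0' : map_poly iota G != 0 by rewrite map_poly_eq0.
have := max_poly_roots G0' (rs := [seq x^-1 | x <- enum A]).
rewrite size_map -cardE size_map_poly map_inj_uniq ?enum_uniq; last exact: invr_inj.
move=> H; rewrite -ltnS; apply: leq_trans sG; apply: H => //.
by apply/allP=> y /mapP[x]; rewrite mem_enum inE => /andP[_ r] ->.
Qed.

Lemma root_cpol x : x != 0 -> root (map_poly iota (P x)) x^-1.
Proof.
move=> x0; rewrite cpol_pi rmorphXn /= /root horner_exp expf_eq0 cofac_gt0 /=.
exact: opolF_root.
Qed.

Lemma nz0 (G : {poly F}) : G`_0 = 1 -> G != 0.
Proof. by move=> G0; apply: contraTneq (oner_neq0 F) => GE; rewrite -G0 GE coef0 eqxx. Qed.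

Lemma card_cpol_fiber (G : {poly F}) : (#|[set x : L | (x != 0%R) && (P x == G)]| <= m)%N.
Proof.
case: (set_0Vmem [set x : L | (x != 0) && (P x == G)]) => [->|[x0]]; first by rewrite cards0.
rewrite inE => /andP[_ /eqP GE].
have G0 : G != 0 by apply: nz0; rewrite -GE P0.
have sG : (size G <= m.+1)%N by rewrite -GE (size_cpol iota pF).
apply: leq_trans (card_invroot G0 sG); apply: subset_leq_card; apply/subsetP=> x.
by rewrite !inE => /andP[xn /eqP <-]; rewrite xn root_cpol.
Qed.

(** The degenerate points: P is 1 or a p-th power, its derivative is 0, and a divisibility condition
    on the derivative gives no information. *)
Definition Zt : {set L} := [set x : L | (x == 0) || (p %| m %/ deg x)%N].

Lemma card_Zt : (#|Zt| <= q ^ (m %/ p))%N.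
Proof.
have q0 : (0 < q)%N := ltnW (finNzRing_gt1 _).
case: (boolP (p %| m)%N) => [pm|npm].
  have mp0 : (0 < m %/ p)%N by rewrite divn_gt0 ?prime_gt0 // dvdn_leq.
  apply: leq_trans (card_frobfix mp0); apply: subset_leq_card; apply/subsetP=> x.
  rewrite !inE => /orP[/eqP ->|H]; first by rewrite expr0n gtn_eqF // expn_gt0 q0.
  rewrite (deg_dvd iota pF); case/dvdnP: H => c ec; have := degM x; rewrite ec => <-.
  by rewrite mulnAC mulnK ?prime_gt0 // dvdn_mull.
have : (#|Zt| <= 1)%N.
  rewrite -(cards1 (0 : L)); apply: subset_leq_card; apply/subsetP=> x; rewrite !inE => /orP[//|H].
  by case/negP: npm; rewrite -(degM x) dvdn_mulr.
by move/leq_trans; apply; rewrite expn_gt0 q0.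
Qed.

Lemma Zt_deriv x : x \in Zt -> (P x)^`() = 0.
Proof.
rewrite inE => /orP[/eqP ->|H].
  suff -> : P 0 = 1 by rewrite derivC.
  apply: (map_iota_inj (iota := iota)); rewrite (iota_cpol iota pF) ?frob_top // rmorph1 /frprod.
  rewrite big1 // => i _; rewrite expr0n gtn_eqF ?scale0r ?subr0 // expn_gt0.
  by rewrite (ltnW (finNzRing_gt1 _)).
rewrite cpol_pi deriv_exp -mulr_natr -polyC_natr.
by move: H; rewrite (dvdn_pcharf pF) => /eqP ->; rewrite mulr0.
Qed.

Lemma NZt x : x \notin Zt -> x != 0 /\ ((m %/ deg x)%:R : F) != 0.
Proof. by rewrite inE negb_or => /andP[-> H]; rewrite -(dvdn_pcharf pF). Qed.

Lemma coprimeXn n (G : {poly F}) : G`_0 = 1 -> coprimep 'X^n G.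
Proof.
move=> G0; apply: coprimep_expl; rewrite coprimep_sym.
have := coprimep_XsubC G 0; rewrite subr0 => ->; rewrite /root horner_coef0 G0.
exact: oner_neq0.
Qed.

Lemma pi0 x : (pi x)`_0 = 1. Proof. exact: opolF0. Qed.

Lemma piX0 x k : (pi x ^+ k)`_0 = 1.
Proof. by elim: k => [|k IH]; rewrite ?coef1 // exprS coef0M IH pi0 mulr1. Qed.

(** Away from [Zt], the derivative of P is that of the reversed minimal polynomial times a factor
    prime to ['X], and the latter derivative is nonzero of degree below deg x. *)
Lemma single_deg x : x \notin Zt -> 'X^N %| (P x)^`() -> (N < deg x)%N.
Proof.
move=> /NZt[x0 a0]; rewrite cpol_pi deriv_exp -mulr_natr -polyC_natr.
rewrite -mulrA mulrC -mulrA Gauss_dvdpr; last by apply: coprimeXn; rewrite piX0.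
rewrite mul_polyC dvdpZr //.
move=> H; have := dvdp_leq (opolF_deriv iota pF x0) H; rewrite size_polyXn.
move=> /leq_trans; apply; have := size_opolF iota pF x0 => s.
have := lt_size_deriv (_ : pi x != 0); rewrite -size_poly_gt0 s => /(_ isT).
by rewrite ltnS.
Qed.

Definition sgl : {set L} := [set x : L | (x \notin Zt) && ('X^N %| (P x)^`())].

Lemma card_sgl : (#|sgl| <= m * q ^ (N %/ p + (m - N)))%N.
Proof.
rewrite -(card_dat p N F m).
apply: (@leq_card_fiber _ _ _ (fun x => (datp p N (P x), datt N m (P x)))) => -[y1 y2].
case: (set_0Vmem [set x in sgl | (datp p N (P x), datt N m (P x)) == (y1, y2)]) => [->|[x1]].
  by rewrite cards0.
rewrite !inE => /andP[/andP[x1z x1d] /eqP e1].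
apply: leq_trans (card_cpol_fiber (P x1)); apply: subset_leq_card; apply/subsetP=> x.
rewrite !inE => /andP[/andP[xz xd] /eqP]; rewrite -e1 => -[ep et].
rewrite negb_or in xz; case/andP: xz => -> _ /=; apply/eqP.
apply: datt_eq et; rewrite ?(size_cpol iota pF) //.
by apply: (datp_eqm pF) => //; rewrite !P0.
Qed.

Lemma sgl_empty : (m <= N)%N -> sgl = set0.
Proof.
move=> mN; apply/setP=> x; rewrite inE in_set0; apply/negP => /andP[xz xd].
have := single_deg xz xd; have := dvdn_leq m0 (deg_dvdm x); lia.
Qed.

Definition cond1 : {set L} := [set x : L | 'X^N %| (P x)^`()].

Lemma card_cond1 g : (2 < p)%N -> (p * (m + g) <= (2 * p - 2) * N)%N ->
  (#|cond1| <= q ^ (m %/ 3) + m * q ^ ((m - g) %/ 2))%N.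
Proof.
move=> p2 Hg; have q0 : (0 < q)%N := ltnW (finNzRing_gt1 _).
have sub : cond1 \subset Zt :|: sgl.
  by apply/subsetP=> x; rewrite !inE => xd; rewrite xd andbT orbN.
apply: leq_trans (subset_leq_card sub) _; apply: card_setU_leq.
  by apply: leq_trans card_Zt _; apply: leq_pexp2l => //; apply: leq_div2l.
case: (leqP m N) => [/sgl_empty ->|Nm]; first by rewrite cards0.
apply: leq_trans card_sgl _; apply: leq_mul => //; apply: leq_pexp2l => //; rewrite leq_divRL //.
(* Here the threshold enters: N %/ p + (m - N) free coefficients stay below m / 2 by the margin g /
   2. *)
have := leq_trunc_div N p; set r := (N %/ p)%N => Hr.
suff : (2 * (r + (m - N)) + g <= m)%N by lia.
rewrite -(leq_pmul2l (prime_gt0 p_pr)); nia.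
Qed.
End OneField.

(** * Pairs of points in two extensions *)

Section TwoFields.
Variables (p N e : nat) (F L1 L2 : finFieldType).
Variables (iota1 : {rmorphism F -> L1}) (iota2 : {rmorphism F -> L2}) (m n : nat).
Hypotheses (pF : p \in [pchar F]) (p2 : (2 < p)%N).
Hypotheses (cL1 : #|L1| = (#|F| ^ m)%N) (m0 : (0 < m)%N).
Hypotheses (cL2 : #|L2| = (#|F| ^ n)%N) (n0 : (0 < n)%N).
Hypotheses (Ne : (N < p ^ e)%N).
Variable eps : F.
Hypothesis Heps : (eps == 1) || (eps == -1).
Let q := #|F|.
Let p_pr : prime p. Proof. exact: pcharf_prime pF. Qed.
Local Notation P := (cpol iota1 m).
Local Notation Q := (cpol iota2 n).
Local Notation pi := (opolF iota1 pF).
Local Notation ka := (opolF iota2 pF).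
Local Notation deg1 := (deg iota1 pF).
Local Notation deg2 := (deg iota2 pF).
Local Notation Z1 := (Zt iota1 m pF).
Local Notation Z2 := (Zt iota2 n pF).
Local Notation E := (p ^ e)%N.

(** For eps = 1 or -1, the logarithmic derivative of A B ^ eps multiplied by A B. *)
Definition cross (A B : {poly F}) := A^`() * B + eps%:P * (A * B^`()).
Definition cond (x : L1) (y : L2) := 'X^N %| cross (P x) (Q y).

Lemma epsN0 : eps != 0.
Proof. by case/orP: Heps => /eqP ->; rewrite ?oppr_eq0 oner_neq0. Qed.

Lemma crossX (A B : {poly F}) a b : A`_0 = 1 -> B`_0 = 1 -> (0 < a)%N -> (0 < b)%N ->
  'X^N %| cross (A ^+ a) (B ^+ b) ->
  'X^N %| (a%:R : F)%:P * (A^`() * B) + (eps * b%:R)%:P * (A * B^`()).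
Proof.
move=> A0 B0 a0 b0.
have X0 (G : {poly F}) k : G`_0 = 1 -> (G ^+ k)`_0 = 1.
  by move=> G0; elim: k => [|k IH]; rewrite ?coef1 // exprS coef0M IH G0 mulr1.
have -> : cross (A ^+ a) (B ^+ b) = (A ^+ a.-1 * B ^+ b.-1) *
   ((a%:R : F)%:P * (A^`() * B) + (eps * b%:R)%:P * (A * B^`())).
  rewrite /cross !deriv_exp -[_ *+ a]mulr_natr -[_ *+ b]mulr_natr -!polyC_natr polyCM.
  have -> : A ^+ a = A * A ^+ a.-1 by rewrite -exprS prednK.
  have -> : B ^+ b = B * B ^+ b.-1 by rewrite -exprS prednK.
  ring.
by rewrite Gauss_dvdpr // coprimeXn // coef0M !X0 // mulr1.
Qed.

Lemma cond_pi x y : cond x y -> 'X^N %| ((m %/ deg1 x)%:R : F)%:P * ((pi x)^`() * ka y)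
  + (eps * (n %/ deg2 y)%:R)%:P * (pi x * (ka y)^`()).
Proof.
rewrite /cond (cpol_pi iota1 pF cL1) (cpol_pi iota2 pF cL2); apply: crossX; rewrite ?opolF0 //.
  exact: cofac_gt0.
exact: cofac_gt0.
Qed.

Lemma condZ1 x y : x \in Z1 -> cond x y -> 'X^N %| (Q y)^`().
Proof.
move=> xZ; rewrite /cond /cross (Zt_deriv cL1 xZ) mul0r add0r mul_polyC dvdpZr ?epsN0 //.
by rewrite Gauss_dvdpr // coprimeXn // (P0 iota1 pF cL1).
Qed.

Lemma condZ2 x y : y \in Z2 -> cond x y -> 'X^N %| (P x)^`().
Proof.
move=> yZ; rewrite /cond /cross (Zt_deriv cL2 yZ) !mulr0 addr0.
by rewrite Gauss_dvdpl // coprimeXn // (P0 iota2 pF cL2).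
Qed.

(** With a common reversed minimal polynomial, the condition says that a + eps b times that
    polynomial and its derivative is divisible by ['X^N], where a and b are the multiplicities. A
    nonzero scalar would force N < deg x <= (m + n) / 2. A zero scalar means a = b with eps = -1, or
    else a + b >= 3, since p divides a + b for eps = 1. *)
Lemma conj_case x y : (m + n < 2 * N)%N -> x \notin Z1 -> y \notin Z2 -> cond x y -> pi x = ka y ->
  (m = n /\ eps = -1) \/ (3 * deg1 x <= m + n)%N.
Proof.
move=> mn /NZt[x0 a0] /NZt[y0 b0] /cond_pi H xy.
have dxy : deg1 x = deg2 y by apply: succn_inj; rewrite -!size_opolF // xy.
have e1 := degM iota1 pF cL1 x; have e2 := degM iota2 pF cL2 y.
move: H a0 b0 e1 e2; rewrite -xy -dxy.
set a := (m %/ deg1 x)%N; set b := (n %/ deg1 x)%N; set k := deg1 x => H a0 b0 e1 e2.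
have k0 : (0 < k)%N := deg_gt0 iota1 pF x.
have {}H : 'X^N %| (a%:R + eps * b%:R)%:P * (pi x * (pi x)^`()).
  by move: H; congr (is_true (_ %| _)); rewrite polyCD; ring.
have ab0 : a%:R + eps * b%:R = 0 :> F.
  apply/eqP; apply: contraT => nz; move: H; rewrite mul_polyC dvdpZr //.
  rewrite Gauss_dvdpr; last by rewrite coprimeXn // opolF0.
  move/(dvdp_leq (opolF_deriv iota1 pF x0)); rewrite size_polyXn => le.
  have := lt_size_deriv (_ : pi x != 0); rewrite -size_poly_gt0 size_opolF // => /(_ isT) lt.
  have : (N < k)%N by apply: leq_trans le _; rewrite -ltnS.
  have a1 : (0 < a)%N := cofac_gt0 iota1 pF cL1 m0 x.
  have b1 : (0 < b)%N by rewrite /b /k dxy; exact: cofac_gt0.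
  have h1 : (k <= a * k)%N by rewrite leq_pmull.
  have h2 : (k <= b * k)%N by rewrite leq_pmull.
  by move: mn h1 h2; rewrite e1 e2; clear; lia.
have a1 : (0 < a)%N := cofac_gt0 iota1 pF cL1 m0 x.
have b1 : (0 < b)%N by rewrite /b /k dxy; exact: cofac_gt0.
case/orP: Heps => /eqP He; rewrite He ?mul1r ?mulN1r in ab0.
  right; have : (p %| a + b)%N by rewrite (dvdn_pcharf pF) natrD ab0.
  move/(dvdn_leq (ltn_addr b a1)) => le; rewrite -e1 -e2 -mulnDl leq_mul2r.
  by rewrite (leq_trans p2 le) orbT.
case: (eqVneq a b) => [eab|nab]; first by left; split=> //; rewrite -e1 -e2 eab.
right; rewrite -e1 -e2 -mulnDl leq_mul2r; apply/orP; right.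
by move: nab a1 b1; clear; lia.
Qed.

Lemma pi_coprime x y : x != 0 -> y != 0 -> pi x != ka y -> coprimep (pi x) (ka y).
Proof.
move=> x0 y0 xy.
have [_ irr] := opolF_irr iota1 pF x0; have [sy irry] := opolF_irr iota2 pF y0.
rewrite /coprimep; apply: contraT => sg.
have g1 := irr _ sg (dvdp_gcdl _ _); have g2 := irry _ sg (dvdp_gcdr _ _).
have : pi x %= ka y by apply: eqp_trans g2; rewrite eqp_sym.
case/eqpP=> -[c1 c2] /= /andP[c10 c20] E1.
have : (c1 *: pi x)`_0 = (c2 *: ka y)`_0 by rewrite E1.
rewrite !coefZ !opolF0 !mulr1 => ec; rewrite ec in E1.
by case/negP: xy; apply/eqP; apply: (scalerI c20).
Qed.

(** The combination is nonzero, because [pi x] is prime to [ka y] and does not divide its own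
    derivative, and its degree is below deg x + deg y. *)
Lemma nonconj_case x y : x \notin Z1 -> y \notin Z2 -> cond x y -> pi x != ka y ->
  (N < deg1 x + deg2 y)%N.
Proof.
move=> /NZt[x0 a0] /NZt[y0 b0] /cond_pi H xy.
set W := (X in _ %| X) in H.
have cop := pi_coprime x0 y0 xy.
have W0 : W != 0.
  apply/eqP => W0; have : pi x %| (((m %/ deg1 x)%:R : F)%:P * (pi x)^`()) * ka y.
    have -> : (((m %/ deg1 x)%:R : F)%:P * (pi x)^`()) * ka y =
        W - pi x * ((eps * (n %/ deg2 y)%:R)%:P * (ka y)^`()) by rewrite /W; ring.
    by rewrite W0 sub0r dvdpNr dvdp_mulr.
  rewrite Gauss_dvdpl // mul_polyC dvdpZr // => /(dvdp_leq (opolF_deriv iota1 pF x0)).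
  rewrite leqNgt lt_size_deriv // -size_poly_gt0 size_opolF //.
have := dvdp_leq W0 H; rewrite size_polyXn => /leq_trans; apply.
have s1 := size_opolF iota1 pF x0; have s2 := size_opolF iota2 pF y0.
have d1 : (size (pi x)^`() <= deg1 x)%N.
  by rewrite -ltnS -s1; apply: lt_size_deriv; rewrite -size_poly_gt0 s1.
have d2 : (size (ka y)^`() <= deg2 y)%N.
  by rewrite -ltnS -s2; apply: lt_size_deriv; rewrite -size_poly_gt0 s2.
apply: leq_trans (size_polyD _ _) _; rewrite geq_max !mul_polyC.
apply/andP; split; apply: leq_trans (size_scale_leq _ _) _;
  apply: leq_trans (size_polyMleq _ _) _.
  by rewrite s2 addnS /= leq_add2r.
by rewrite s1 addSn /= leq_add2l.
Qed.

(** The sets that will cover the off-diagonal pairs: [C0], [C1] and [C1'] serve pairs with a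
    degenerate point, [Cc] pairs of conjugate points of small degree, [C11p] and [C11m] pairs of
    points of full degree, [C3] and [C3'] pairs where one point has a degree l at most half its
    level. *)
Definition C0 : {set L1 * L2} := setX Z1 Z2.
Definition C1 : {set L1 * L2} := setX Z1 (sgl N iota2 n pF).
Definition C1' : {set L1 * L2} := setX (sgl N iota1 m pF) Z2.
Definition Cc : {set L1 * L2} :=
  [set z | [&& z.1 != 0, z.2 != 0, pi z.1 == ka z.2 & (deg1 z.1 <= (m + n) %/ 3)%N]].
Definition C11p : {set L1 * L2} :=
  [set z | [&& z.1 != 0, z.2 != 0 & 'X^N %| (P z.1 * Q z.2)^`()]].
Definition C11m : {set L1 * L2} :=
  [set z | [&& z.1 != 0, z.2 != 0, deg1 z.1 == m, deg2 z.2 == n, pi z.1 != ka z.2,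
     eps == -1 & cond z.1 z.2]].
Definition C3 l : {set L1 * L2} :=
  [set z | [&& z.1 != 0, z.2 != 0, deg2 z.2 == l & cond z.1 z.2]].
Definition C3' l : {set L1 * L2} :=
  [set z | [&& z.1 != 0, z.2 != 0, deg1 z.1 == l & cond z.1 z.2]].

Lemma card_C0 : (#|C0| <= q ^ (m %/ p + n %/ p))%N.
Proof. by rewrite cardsX expnD leq_mul // card_Zt. Qed.

Lemma card_C1 : (#|C1| <= q ^ (m %/ p) * (n * q ^ (N %/ p + (n - N))))%N.
Proof. by rewrite cardsX leq_mul // ?card_Zt ?card_sgl. Qed.

Lemma card_C1' : (#|C1'| <= (m * q ^ (N %/ p + (m - N))) * q ^ (n %/ p))%N.
Proof. by rewrite cardsX leq_mul // ?card_Zt ?card_sgl. Qed.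

Lemma card_pair_le (A : {set L1 * L2}) (A1 : {set L1}) (A2 : {set L2}) a b :
  A \subset setX A1 A2 -> (#|A1| <= a)%N -> (#|A2| <= b)%N -> (#|A| <= a * b)%N.
Proof.
by move=> s h1 h2; apply: leq_trans (subset_leq_card s) _; rewrite cardsX leq_mul.
Qed.

(** The data determine P Q, and the inverses of x and of y are among its at most m + n roots. *)
Lemma card_C11p : (#|C11p| <= (m + n) ^ 2 * q ^ (N %/ p + (m + n - N)))%N.
Proof.
rewrite -(card_dat p N F (m + n)).
pose R (z : L1 * L2) := P z.1 * Q z.2.
have R0 z : (R z)`_0 = 1 by rewrite coef0M (P0 iota1 pF cL1) (P0 iota2 pF cL2) mulr1.
have sR z : (size (R z) <= (m + n).+1)%N.
  apply: leq_trans (size_polyMleq _ _) _.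
  by have := size_cpol iota1 pF m z.1; have := size_cpol iota2 pF n z.2; lia.
apply: (@leq_card_fiber _ _ _ (fun z => (datp p N (R z), datt N (m + n) (R z)))) => -[y1 y2].
case: (set_0Vmem [set z in C11p | (datp p N (R z), datt N (m + n) (R z)) == (y1, y2)]) => [->|[z1]].
  by rewrite cards0.
rewrite !inE => /andP[/and3P[_ _ d1] /eqP e1]; rewrite -mulnn.
apply: (@card_pair_le _ [set x : L1 | (x != 0) && root (map_poly iota1 (R z1)) x^-1]
                        [set y : L2 | (y != 0) && root (map_poly iota2 (R z1)) y^-1]); last 2 first.
- by apply: card_invroot => //; apply: nz0; exact: R0.
- by apply: card_invroot => //; apply: nz0; exact: R0.
apply/subsetP=> z; rewrite !inE => /andP[/and3P[zx zy d] /eqP]; rewrite -e1 => -[ep et].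
have -> : R z1 = R z.
  apply/esym; apply: datt_eq et; rewrite ?sR //.
  by apply: (datp_eqm pF) => //; rewrite !R0.
rewrite zx zy /= /R !rmorphM /= !rootM.
by rewrite (root_cpol iota1 pF cL1 m0 zx) (root_cpol iota2 pF cL2 n0 zy) orbT.
Qed.

(* [P] times the power [eps] of [Q], the inverse of [Q] being [Q ^+ E.-1]. *)
Definition Hpol z : {poly F} := if eps == 1 then P z.1 * Q z.2 else P z.1 * Q z.2 ^+ E.-1.
Definition Ipol (y : L2) : {poly F} := if eps == 1 then Q y ^+ E.-1 else Q y.

Lemma E_gt1 : (1 < E)%N \/ N = 0%N.
Proof. by move: Ne; case: E => [|[|k]]; [|case: (N); right|left]. Qed.

Lemma Hpol0 z : (Hpol z)`_0 = 1.
Proof.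
have X0 (G : {poly F}) k : G`_0 = 1 -> (G ^+ k)`_0 = 1.
  by move=> G0; elim: k => [|k IH]; rewrite ?coef1 // exprS coef0M IH G0 mulr1.
by rewrite /Hpol; case: ifP => _; rewrite coef0M (P0 iota1 pF cL1) ?X0 ?(P0 iota2 pF cL2) // mulr1.
Qed.

Lemma Hpol_deriv z : cond z.1 z.2 -> 'X^N %| (Hpol z)^`().
Proof.
rewrite /cond /cross /Hpol; case: ifP => [/eqP ->|ne].
  by rewrite derivM polyC1 mul1r mulrC.
have eN : eps = -1 by move: Heps; rewrite ne => /eqP.
case: E_gt1 => [E1|->]; last by move=> _; rewrite expr0 dvd1p.
rewrite eN derivM deriv_exp -[_ *+ E.-1]mulr_natr.
have -> : (E.-1%:R : {poly F}) = -1.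
  rewrite -subn1 natrB 1?ltnW // natrX.
  have -> : (p%:R : {poly F}) = 0 by apply: pcharf0; rewrite pchar_poly.
  case: (e) E1 => [//|k] _; by rewrite exprS mul0r sub0r.
have -> : Q z.2 ^+ E.-1 = Q z.2 * Q z.2 ^+ E.-2 by rewrite -exprS; congr (_ ^+ _); lia.
have -> : (P z.1)^`() * (Q z.2 * Q z.2 ^+ E.-2) +
   P z.1 * ((Q z.2)^`() * Q z.2 ^+ E.-2 * -1) =
   ((P z.1)^`() * Q z.2 + (-1)%:P * (P z.1 * (Q z.2)^`())) * Q z.2 ^+ E.-2.
  by rewrite polyCN polyC1; ring.
by move=> H; apply: dvdp_mulr.
Qed.

Lemma Hpol_inv z : eqm N.+1 (Hpol z * Ipol z.2) (P z.1).
Proof.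
have u : eqm N.+1 (Q z.2 ^+ E) 1 by apply: eqmS Ne (unit_expE pF e (P0 iota2 pF cL2 z.2)).
have E0 : (0 < E)%N by rewrite expn_gt0 prime_gt0.
have -> : Hpol z * Ipol z.2 = P z.1 * Q z.2 ^+ E.
  have -> : Q z.2 ^+ E = Q z.2 * Q z.2 ^+ E.-1 by rewrite -exprS prednK.
  by rewrite /Hpol /Ipol; case: ifP => _; ring.
by rewrite -[X in eqm _ _ X]mulr1; apply: eqmM (eqm_refl _ _) u.
Qed.

(** There are at most q ^ l choices of y. For fixed y, the data of P Q ^ eps determine P modulo
    ['X^(N.+1)] after multiplication by the known [Ipol y], so only the coefficients of P beyond N
    remain free. *)
Lemma card_C3 l : (#|C3 l| <= m * (q ^ l * q ^ (N %/ p + (m - N))))%N.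
Proof.
pose D := ({ffun 'I_(N %/ p) -> F} * {ffun 'I_(m - N) -> F})%type.
have cut : (#|C3 l| <= \sum_(y : L2 | deg2 y == l) m * #|{: D}|)%N.
  rewrite -sum1_card (partition_big (fun z : L1 * L2 => z.2) (fun y => deg2 y == l)) /=; last first.
    by move=> z; rewrite inE => /and4P[].
  apply: leq_sum => y _.
  have -> : (\sum_(i in C3 l | i.2 == y) 1 = #|[set z in C3 l | z.2 == y]|)%N.
    by rewrite -sum1_card; apply: eq_bigl => z; rewrite !inE.
  apply: (@leq_card_fiber _ _ _ (fun z => (datp p N (Hpol z), datt N m (P z.1)))) => -[y1 y2].
  set A := [set z in _ | _].
  case: (set_0Vmem A) => [->|[z1]]; first by rewrite cards0.
  rewrite !inE => /andP[/andP[/and4P[_ _ _ c1] /eqP z1y] /eqP e1].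
  rewrite -[m]muln1; apply: (@card_pair_le _ [set x : L1 | (x != 0) && (P x == P z1.1)] [set y]);
    last 2 first.
  - exact: (card_cpol_fiber iota1 pF cL1 m0).
  - by rewrite cards1.
  apply/subsetP=> z; rewrite !inE => /andP[/andP[/and4P[zx _ _ c] /eqP zy] /eqP].
  rewrite -e1 => -[ep et]; rewrite zx zy eqxx andbT /=; apply/eqP.
  apply: datt_eq et; rewrite ?(size_cpol iota1 pF) //.
  apply: eqm_trans (Hpol_inv z1); apply: (eqm_trans (eqm_sym (Hpol_inv z))).
  rewrite zy z1y; apply: eqmM (eqm_refl _ _).
  by apply: (datp_eqm pF); rewrite ?Hpol0 ?Hpol_deriv.
apply: leq_trans cut _; rewrite sum_nat_const mulnCA leq_mul // card_dat leq_mul //.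
apply: leq_trans (card_deg iota2 pF l); apply: eq_leq; apply: eq_card => y; rewrite inE.
by [].
Qed.

(** Once [datp] has fixed P / Q modulo ['X^(N.+1)], a reference pair (P0, Q0) is chosen. The
    difference P0 Q - P Q0 then vanishes up to exponent N and has only m + n - N free coefficients.
    It determines P and Q: for two solutions, Q - Q1 is divisible by Q0, which is prime to P0, and
    by ['X], hence by a polynomial of degree n + 1. *)
Lemma card_C11m : (#|C11m| <= (m * n) * q ^ (N %/ p + (m + n - N)))%N.
Proof.
rewrite -(card_dat p N F (m + n)).
pose ref h := [pick z in C11m | datp p N (Hpol z) == h].
pose Dz z := if ref (datp p N (Hpol z)) is Some z0 then P z0.1 * Q z.2 - P z.1 * Q z0.2 else 0.
apply: (@leq_card_fiber _ _ _ (fun z => (datp p N (Hpol z), datt N (m + n) (Dz z)))) => -[y1 y2].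
case: (set_0Vmem [set z in C11m | (datp p N (Hpol z), datt N (m + n) (Dz z)) == (y1, y2)]) => [->|[z1]].
  by rewrite cards0.
rewrite inE => /andP[z1C /eqP[h1 v1]].
have [z0 z0C [hz0 refz]] : exists2 z0, z0 \in C11m & datp p N (Hpol z0) = y1 /\ ref y1 = Some z0.
  rewrite /ref; case: pickP => [z0 /andP[zc /eqP h]|/(_ z1)]; first by exists z0.
  by rewrite z1C h1 eqxx.
move: (z0C); rewrite inE => /and5P[x0 y0 /eqP d1 /eqP d2 /and3P[ne /eqP eN c0]].
have e1 : (eps == 1) = false.
  rewrite eN; apply/negbTE; rewrite eq_sym -subr_eq0 opprK -(natrD _ 1 1) -(dvdn_pcharf pF).
  by rewrite gtnNdvd.
have PQ0 z : z \in C11m -> datp p N (Hpol z) = y1 ->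
    eqm N.+1 (P z0.1 * Q z.2 - P z.1 * Q z0.2) 0.
  rewrite inE => /and5P[_ _ _ _ /and3P[_ _ cz]] hz.
  have HH : eqm N.+1 (Hpol z) (Hpol z0).
    by apply: (datp_eqm pF); rewrite ?Hpol0 ?Hpol_deriv // hz.
  have i0 := Hpol_inv z0; have iz := Hpol_inv z; rewrite /Ipol e1 in i0 iz.
  rewrite -(subrr (Hpol z * Q z0.2 * Q z.2)); apply: eqmD.
    apply: eqm_trans (eqmM (eqm_sym i0) (eqm_refl _ _)) _.
    by apply: eqmM (eqm_refl _ _); apply: eqmM (eqm_sym HH) (eqm_refl _ _).
  apply: eqmN; apply: eqm_trans (eqmM (eqm_sym iz) (eqm_refl _ _)) _.
  by rewrite mulrAC eqm_refl.
have DzE z : z \in C11m -> datp p N (Hpol z) = y1 -> Dz z = P z0.1 * Q z.2 - P z.1 * Q z0.2.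
  by move=> zc hz; rewrite /Dz hz refz.
have sz z : (size (P z0.1 * Q z.2 - P z.1 * Q z0.2)%R <= (m + n).+1)%N.
  apply: leq_trans (size_polyD _ _) _; rewrite size_polyN geq_max.
  by apply/andP; split; apply: size_mul_le; rewrite (size_cpol _ pF).
have P0E : P z0.1 = pi z0.1 by rewrite (cpol_pi iota1 pF cL1) d1 divnn m0 expr1.
have Q0E : Q z0.2 = ka z0.2 by rewrite (cpol_pi iota2 pF cL2) d2 divnn n0 expr1.
have cop : coprimep (Q z0.2) (P z0.1).
  by rewrite P0E Q0E coprimep_sym; exact: pi_coprime.
apply: (@card_pair_le _ [set x : L1 | (x != 0) && (P x == P z1.1)] [set y : L2 | (y != 0) && (Q y == Q z1.2)]);
  last 2 first.
- exact: (card_cpol_fiber iota1 pF cL1 m0).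
- exact: (card_cpol_fiber iota2 pF cL2 n0).
apply/subsetP=> z; rewrite inE => /andP[zC /eqP[hz vz]].
have DD : P z0.1 * Q z.2 - P z.1 * Q z0.2 = P z0.1 * Q z1.2 - P z1.1 * Q z0.2.
  have et : datt N (m + n) (P z0.1 * Q z.2 - P z.1 * Q z0.2) =
            datt N (m + n) (P z0.1 * Q z1.2 - P z1.1 * Q z0.2) by rewrite -!DzE // vz v1.
  apply: datt_eq et; rewrite ?sz //.
  exact: eqm_trans (PQ0 z zC hz) (eqm_sym (PQ0 z1 z1C h1)).
have Qd : Q z0.2 %| Q z.2 - Q z1.2.
  rewrite -(Gauss_dvdpr _ cop) mulrBr.
  have -> : P z0.1 * Q z.2 - P z0.1 * Q z1.2 = (P z.1 - P z1.1) * Q z0.2.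
    have := congr1 (fun A => A + P z.1 * Q z0.2 - P z0.1 * Q z1.2) DD.
    rewrite subrK => ->; ring.
  exact: dvdp_mull.
have Qd2 : Q z0.2 * 'X %| Q z.2 - Q z1.2.
  rewrite Gauss_dvdp ?Qd /=; last by rewrite coprimep_sym -['X]expr1 coprimeXn // (P0 iota2 pF cL2).
  by apply/(@dvdXnP _ 1) => -[|//] _; rewrite coefB !(P0 iota2 pF cL2) subrr.
have QQ : Q z.2 = Q z1.2.
  apply/eqP; rewrite -subr_eq0; apply: contraT => nz.
  have := dvdp_leq nz Qd2; rewrite size_mulX; last by apply: nz0; rewrite (P0 iota2 pF cL2).
  rewrite Q0E (size_opolF iota2 pF y0) d2 ltnNge => /negP[]; apply: leq_trans (size_polyD _ _) _.
  by rewrite size_polyN geq_max !(size_cpol iota2 pF).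
have PP : P z.1 = P z1.1.
  have Q0n : Q z0.2 != 0 by apply: nz0; rewrite (P0 iota2 pF cL2).
  by apply: (mulIf Q0n); move: DD; rewrite QQ => /addrI/oppr_inj.
move: zC; rewrite !inE => /and5P[zx zy _ _ _].
by rewrite zx zy PP QQ !eqxx.
Qed.

Lemma card_Cc : (#|Cc| <= (m + n) ^ 2 * q ^ ((m + n) %/ 3))%N.
Proof.
set t := ((m + n) %/ 3)%N.
have q0 : (0 < q)%N := ltnW (finNzRing_gt1 _).
have cut : (#|Cc| <= \sum_(x : L1 | deg1 x <= t) m)%N.
  rewrite -sum1_card (partition_big (fun z : L1 * L2 => z.1) (fun x => deg1 x <= t)%N) /=; last first.
    by move=> z; rewrite inE => /and4P[].
  apply: leq_sum => x _.
  have -> : (\sum_(i in Cc | i.1 == x) 1 = #|[set z in Cc | z.1 == x]|)%N.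
    by rewrite -sum1_card; apply: eq_bigl => z; rewrite !inE.
  have nzp : pi x != 0 by apply: nz0; exact: opolF0.
  have sp : (size (pi x) <= m.+1)%N.
    case: (eqVneq x 0) => [x0|x0]; last by rewrite (size_opolF iota1 pF x0) ltnS dvdn_leq // deg_dvdm.
    have := size_cpol iota1 pF (1 * deg1 x) x; rewrite cpolE expr1 mul1n => /leq_trans; apply.
    by rewrite ltnS dvdn_leq // deg_dvdm.
  rewrite -[m]mul1n; apply: (@card_pair_le _ [set x] [set y : L2 | (y != 0) && root (map_poly iota2 (pi x)) y^-1]);
    last 2 first.
  - by rewrite cards1.
  - exact: card_invroot.
  apply/subsetP=> z; rewrite !inE => /andP[/and4P[zx zy /eqP e0 _] /eqP ex].
  by rewrite ex eqxx zy /= -ex e0 opolF_root.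
apply: leq_trans cut _; rewrite sum_nat_const.
have cx : (#|[pred x : L1 | deg1 x <= t]| <= t * q ^ t)%N.
  have -> : (#|[pred x : L1 | deg1 x <= t]| = \sum_(x : L1 | deg1 x <= t) 1)%N by rewrite sum1_card.
  rewrite (partition_big (fun x => inord (deg1 x) : 'I_t.+1) (fun k => 0 < k)%N) /=; last first.
    by move=> x le; rewrite inordK // deg_gt0.
  apply: (@leq_trans (\sum_(k < t.+1 | 0 < k) q ^ t)%N).
    apply: leq_sum => k _; apply: (@leq_trans (q ^ k)); last by apply: leq_pexp2l => //; rewrite -ltnS.
    apply: leq_trans (card_deg iota1 pF k); rewrite -sum1_card.
    rewrite [leqLHS](eq_bigl (fun x => (deg1 x <= t)%N && (deg1 x == k))) => [|x]; last first.
      by case: leqP => //= le; rewrite -val_eqE /= inordK.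
    rewrite [leqRHS](eq_bigl (fun x => deg1 x == k)) => [|x]; last by rewrite inE.
    rewrite [leqRHS]big_mkcond [leqLHS]big_mkcond; apply: leq_sum => x _.
    by case: (deg1 x == k); case: (deg1 x <= t)%N.
  rewrite big_mkcond big_ord_recl /= add0n sum_nat_const card_ord //.
have tm : (t <= m + n)%N by exact: leq_div.
rewrite -mulnn; apply: (@leq_trans (t * q ^ t * m)); first by rewrite leq_mul2r cx orbT.
by rewrite mulnAC leq_mul2r leq_mul ?orbT // leq_addr.
Qed.
End TwoFields.

Lemma cond_sym (p N : nat) (F L1 L2 : finFieldType) (iota1 : {rmorphism F -> L1})
  (iota2 : {rmorphism F -> L2}) m n (eps : F) (x : L1) (y : L2) :
  (eps == 1) || (eps == -1) ->
  cond N iota1 iota2 m n eps x y -> cond N iota2 iota1 n m eps y x.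
Proof.
move=> He; have ee : eps%:P * eps%:P = 1 :> {poly F}.
  by rewrite -polyCM; case/orP: He => /eqP ->; rewrite ?mulrNN mul1r.
rewrite /cond /cross => H.
have := dvdp_mull (eps%:P) H; congr (is_true (_ %| _)).
rewrite mulrDr [X in _ + X]mulrA ee mul1r addrC; congr (_ + _); first exact: mulrC.
by rewrite [X in _ * X]mulrC.
Qed.

Lemma degenerate_exponent_le p N m n g : (2 < p)%N -> (p * (m + n + g) <= (2 * p - 2) * N)%N -> (N < n)%N ->
  (m %/ p + (N %/ p + (n - N)) <= (m + n - g) %/ 2)%N.
Proof.
move=> p2 H Nn; rewrite leq_divRL //.
have h1 := leq_trunc_div N p; have h2 := leq_trunc_div m p.
move: h1 h2; set r := (N %/ p)%N; set s := (m %/ p)%N => h1 h2.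
have p0 : (0 < p)%N by lia.
suff : (p * (2 * (s + (r + (n - N))) + g) <= p * (m + n))%N by rewrite leq_pmul2l //; lia.
have [n' en] : exists n', n = (N + n')%N by exists (n - N)%N; lia.
have -> : (n - N = n')%N by lia.
have h3 : (2 * m <= p * m)%N by nia.
rewrite mulnBl in H; rewrite en in H *; rewrite !mulnDr in H *; nia.
Qed.

Lemma coprime_exponent_le p N M g : (2 < p)%N -> (p * (M + g) <= (2 * p - 2) * N)%N -> (N < M)%N ->
  (N %/ p + (M - N) <= (M - g) %/ 2)%N.
Proof.
move=> p2 H NM; have := @degenerate_exponent_le p N 0 M g p2; rewrite add0n => /(_ H NM).
by rewrite div0n add0n.
Qed.

Lemma truncated_exponent_le p N m n g l : (2 < p)%N -> (p * (m + n + g) <= (2 * p - 2) * N)%N ->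
  (2 * l <= n)%N -> (N < m + l)%N -> (l + (N %/ p + (m - N)) <= (m + n - g) %/ 2)%N.
Proof.
move=> p2 H ln Nml; rewrite leq_divRL //.
have h1 := leq_trunc_div N p; move: h1; set r := (N %/ p)%N => h1.
have p0 : (0 < p)%N by lia.
suff : (p * (2 * (l + (r + (m - N))) + g) <= p * (m + n))%N by rewrite leq_pmul2l //; lia.
have hl : (p * (2 * l) <= p * n)%N by rewrite leq_mul2l ln orbT.
have hN : (p * N.+1 <= p * (m + l))%N by rewrite leq_mul2l Nml orbT.
rewrite mulnBl in H; case: (leqP N m) => [le|gt].
  have [m' em] : exists m', m = (N + m')%N by exists (m - N)%N; lia.
  have -> : (m - N = m')%N by lia.
  rewrite em in H *; rewrite !mulnDr in H hl *; nia.
(* No coefficient of P is free in this case; the room comes from N < m + l and 2 l <= n, which give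
   N + l < m + n. *)
have -> : (m - N = 0)%N by lia.
rewrite mulnS !mulnDr in H hl hN *; nia.
Qed.

Lemma card_bigcup_le (T : finType) (I : finType) (A : I -> {set T}) (P : pred I) K :
  (forall i, P i -> (#|A i| <= K)%N) -> (#|\bigcup_(i | P i) A i| <= #|I| * K)%N.
Proof.
move=> H; rewrite -sum_nat_const.
apply: (@leq_trans (\sum_(i | P i) K)%N); last first.
  by rewrite [leqLHS]big_mkcond; apply: leq_sum => i _; case: ifP.
elim/big_ind2: _ => [|A1 k1 A2 k2 h1 h2|i /H //]; first by rewrite cards0.
by apply: leq_trans (leq_card_setU _ _) _; exact: leq_add.
Qed.

Section Main.
Variables (p N e : nat) (F L1 L2 : finFieldType).
Variables (iota1 : {rmorphism F -> L1}) (iota2 : {rmorphism F -> L2}) (m n : nat).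
Hypotheses (pF : p \in [pchar F]) (p2 : (2 < p)%N).
Hypotheses (cL1 : #|L1| = (#|F| ^ m)%N) (m0 : (0 < m)%N).
Hypotheses (cL2 : #|L2| = (#|F| ^ n)%N) (n0 : (0 < n)%N).
Hypotheses (Ne : (N < p ^ e)%N).
Variable eps : F.
Hypothesis Heps : (eps == 1) || (eps == -1).
Let q := #|F|.

Definition off_diag : {set L1 * L2} :=
  [set z | cond N iota1 iota2 m n eps z.1 z.2 &&
     ~~ [&& eps == -1, m == n & opolF iota1 pF z.1 == opolF iota2 pF z.2]].

(** Two of the seven covering sets have exponent (m + n) / 3 and five have (m + n - g) / 2, whence
    the constants 2 and 5. For nonconjugate nondegenerate points, multiplicities of at least 2 on
    both sides would contradict N < deg x + deg y, so at least one of the two points has full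
    degree. *)
Theorem card_off_diag g : (p * (m + n + g) <= (2 * p - 2) * N)%N ->
  (#|off_diag| <= 2 * (m + n) ^ 2 * q ^ ((m + n) %/ 3) + 5 * (m + n) ^ 2 * q ^ ((m + n - g) %/ 2))%N.
Proof.
move=> Hg; have q0 : (0 < q)%N := ltnW (finNzRing_gt1 _).
have p0 : (0 < p)%N by lia.
have mnN : (m + n < 2 * N)%N by rewrite -(ltn_pmul2l p0); nia.
set X := ((m + n - g) %/ 2)%N; set M2 := ((m + n) ^ 2)%N.
pose A1 := C0 iota1 iota2 m n pF.
pose A2 := if (N < n)%N then C1 N iota1 iota2 m n pF else set0.
pose A3 := if (N < m)%N then C1' N iota1 iota2 m n pF else set0.
pose A4 := Cc iota1 iota2 m n pF.
pose A5 := if (N < m + n)%N then (if eps == 1 then C11p N iota1 iota2 m n else C11m N iota1 iota2 m n pF eps) else set0.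
pose A6 := \bigcup_(l < n | ((2 * l <= n) && (N < m + l))%N) C3 N iota1 iota2 m n pF eps l.
pose A7 := \bigcup_(l < m | ((2 * l <= m) && (N < n + l))%N) C3' N iota1 iota2 m n pF eps l.
have cover : off_diag \subset A1 :|: A4 :|: (A2 :|: A3 :|: A5 :|: A6 :|: A7).
  apply/subsetP=> -[x y]; rewrite inE /= => /andP[cxy nd].
  have dx := dvdn_leq m0 (deg_dvdm iota1 pF cL1 x).
  case: (boolP (x \in Zt iota1 m pF)) => xZ; case: (boolP (y \in Zt iota2 n pF)) => yZ.
  - by apply/setUP; left; apply/setUP; left; rewrite inE /= xZ yZ.
  - have sg : y \in sgl N iota2 n pF by rewrite inE yZ (condZ1 cL1 Heps xZ cxy).
    have Nn : (N < n)%N.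
      by rewrite ltnNge; apply/negP => /(sgl_empty iota2 pF cL2 n0) E; rewrite E inE in sg.
    by rewrite !in_setU /A2 Nn [(x, y) \in C1 _ _ _ _ _ _]inE /= xZ sg ?orbT.
  - have sg : x \in sgl N iota1 m pF by rewrite inE xZ (condZ2 cL2 yZ cxy).
    have Nn : (N < m)%N.
      by rewrite ltnNge; apply/negP => /(sgl_empty iota1 pF cL1 m0) E; rewrite E inE in sg.
    by rewrite !in_setU /A3 Nn [(x, y) \in C1' _ _ _ _ _ _]inE /= yZ sg ?orbT.
  have [x0 _] := NZt xZ; have [y0 _] := NZt yZ.
  case: (eqVneq (opolF iota1 pF x) (opolF iota2 pF y)) => [exy|ne].
    case: (conj_case p2 cL1 m0 cL2 n0 Heps mnN xZ yZ cxy exy) => [[emn eN]|le].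
      by case/negP: nd; rewrite eN emn exy !eqxx.
    apply/setUP; left; apply/setUP; right; rewrite inE /= x0 y0 exy eqxx /=.
    by rewrite leq_divRL // mulnC.
  have lt := nonconj_case cL1 m0 cL2 n0 xZ yZ cxy ne.
  have e1 := degM iota1 pF cL1 x; have e2 := degM iota2 pF cL2 y.
  have a1 := cofac_gt0 iota1 pF cL1 m0 x; have b1 := cofac_gt0 iota2 pF cL2 n0 y.
  have k1 := deg_gt0 iota1 pF x; have k2 := deg_gt0 iota2 pF y.
  move: e1 e2 a1 b1; set a := (m %/ _)%N; set b := (n %/ _)%N => e1 e2 a1 b1.
  case: (leqP 2 a) => a2; case: (leqP 2 b) => b2.
  - have h1 : (2 * deg iota1 pF x <= m)%N by rewrite -e1 leq_mul2r a2 orbT.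
    have h2 : (2 * deg iota2 pF y <= n)%N by rewrite -e2 leq_mul2r b2 orbT.
    by move: h1 h2 lt mnN; clear; lia.
  - have h1 : (2 * deg iota1 pF x <= m)%N by rewrite -e1 leq_mul2r a2 orbT.
    have h2 : deg iota2 pF y = n by rewrite -e2 (_ : b = 1%N) ?mul1n //; move: b1 b2; clear; lia.
    have lm : (deg iota1 pF x < m)%N by move: h1 k1; clear; lia.
    apply/setUP; right; apply/setUP; right; apply/bigcupP; exists (Ordinal lm) => /=.
      by rewrite h1 addnC -h2 lt.
    by rewrite inE /= x0 y0 eqxx cxy.
  - have h2 : (2 * deg iota2 pF y <= n)%N by rewrite -e2 leq_mul2r b2 orbT.
    have h1 : deg iota1 pF x = m by rewrite -e1 (_ : a = 1%N) ?mul1n //; move: a1 a2; clear; lia.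
    have lm : (deg iota2 pF y < n)%N by move: h2 k2; clear; lia.
    apply/setUP; right; apply/setUP; left; apply/setUP; right; apply/bigcupP; exists (Ordinal lm) => /=.
      by rewrite h2 -h1 lt.
    by rewrite inE /= x0 y0 eqxx cxy.
  have h1 : deg iota1 pF x = m by rewrite -e1 (_ : a = 1%N) ?mul1n //; move: a1 a2; clear; lia.
  have h2 : deg iota2 pF y = n by rewrite -e2 (_ : b = 1%N) ?mul1n //; move: b1 b2; clear; lia.
  apply/setUP; right; apply/setUP; left; apply/setUP; left; apply/setUP; right.
  rewrite /A5 -h1 -h2 lt h1 h2; case: ifP => [/eqP E1|E1]; rewrite inE /= x0 y0 /=.
    by move: cxy; rewrite /cond /cross E1 polyC1 mul1r derivM.
  rewrite h1 h2 !eqxx ne cxy andbT /=; by move: Heps; rewrite E1.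
apply: leq_trans (subset_leq_card cover) _.
have M1 : (1 <= M2)%N by rewrite expn_gt0 addn_gt0 m0.
have mM : (m <= M2)%N by rewrite /M2; nia.
have nM : (n <= M2)%N by rewrite /M2; nia.
have mnM : (n * m <= M2)%N by rewrite /M2; nia.
apply: card_setU_leq.
  rewrite -mulnA mulSn mul1n; apply: card_setU_leq; last exact: (card_Cc iota1 iota2 n pF cL1 m0).
  apply: leq_trans (card_C0 iota1 iota2 pF cL1 m0 cL2 n0) _ => //.
  apply: (@leq_trans (q ^ ((m + n) %/ 3))); last by rewrite leq_pmull.
  apply: leq_pexp2l => //; rewrite leq_divRL // mulnDl.
  by apply: leq_add; [apply: leq_trans (leq_trunc_div m p)|apply: leq_trans (leq_trunc_div n p)]; rewrite leq_mul2l p2 orbT.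
have -> : (5 * M2 * q ^ X = M2 * q ^ X + M2 * q ^ X + M2 * q ^ X + M2 * q ^ X + M2 * q ^ X)%N by ring.
apply: card_setU_leq; [apply: card_setU_leq; [apply: card_setU_leq; [apply: card_setU_leq|]|]|].
- rewrite /A2; case: ifP => [lt|_]; last by rewrite cards0.
  apply: leq_trans (card_C1 N iota1 iota2 pF cL1 m0 cL2 n0) _ => //.
  rewrite mulnCA -expnD; apply: leq_mul => //; apply: leq_pexp2l => //; exact: degenerate_exponent_le.
- rewrite /A3; case: ifP => [lt|_]; last by rewrite cards0.
  apply: leq_trans (card_C1' N iota1 iota2 pF cL1 m0 cL2 n0) _ => //.
  rewrite -mulnA -expnD; apply: leq_mul => //; apply: leq_pexp2l => //.
  by rewrite addnC /X [(m + n)%N]addnC; apply: degenerate_exponent_le => //; rewrite [(n + m)%N]addnC.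
- rewrite /A5; case: ifP => [lt|_]; last by rewrite cards0.
  have ar : (N %/ p + (m + n - N) <= X)%N by exact: coprime_exponent_le.
  case: ifP => [_|ne].
    apply: leq_trans (card_C11p iota1 iota2 pF p2 cL1 m0 cL2 n0 Ne Heps) _ => //; apply: leq_mul => //; exact: leq_pexp2l.
  apply: leq_trans (card_C11m iota1 iota2 pF p2 cL1 m0 cL2 n0 Ne Heps) _ => //.
  by rewrite mulnC [(m * n)%N]mulnC; rewrite mulnC; apply: leq_mul => //; exact: leq_pexp2l.
- apply: (@leq_trans (n * (m * q ^ X))); last by rewrite mulnA leq_mul.
  rewrite -{1}(card_ord n); apply: card_bigcup_le => l /andP[h1 h2].
  apply: leq_trans (card_C3 iota1 iota2 pF p2 cL1 m0 cL2 n0 Ne Heps l) _ => //.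
  rewrite -expnD; apply: leq_mul => //; apply: leq_pexp2l => //; exact: truncated_exponent_le.
apply: (@leq_trans (m * (n * q ^ X))); last by rewrite mulnA leq_mul // mulnC.
rewrite -{1}(card_ord m); apply: card_bigcup_le => l /andP[h1 h2].
pose sw (z : L1 * L2) := (z.2, z.1).
have swi : injective sw by move=> [a b] [a' b'] [-> ->].
rewrite -(card_imset _ swi).
apply: (@leq_trans #|C3 N iota2 iota1 n m pF eps l|).
  apply: subset_leq_card; apply/subsetP=> w /imsetP[z]; rewrite inE => /and4P[zx zy dz cz] ->.
  by rewrite inE /= zx zy dz /= (cond_sym p Heps cz).
apply: leq_trans (card_C3 iota2 iota1 pF p2 cL2 n0 cL1 m0 Ne Heps l) _ => //.
rewrite -expnD; apply: leq_mul => //; apply: leq_pexp2l => //.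
by rewrite /X [(m + n)%N]addnC; apply: truncated_exponent_le => //; rewrite [(n + m)%N]addnC.
Qed.
End Main.

(** * Averages over [AS_d^0] *)

Section TraceCoef.
Variables (p e : nat) (F L : finFieldType) (iota : {rmorphism F -> L}) (m : nat).
Hypotheses (pF : p \in [pchar F]) (cL : #|L| = (#|F| ^ m)%N) (m0 : (0 < m)%N).
Let q := #|F|.

Definition tc (x : L) i := (lps p e (cpol iota m x))`_i.

Lemma tc_Frobenius x i : (0 < i)%N -> (p * i < p ^ e)%N -> tc x (p * i) = tc x i ^+ p.
Proof.
move=> i0 lt; have p0 := prime_gt0 (pcharf_prime pF).
have fx : x ^+ (q ^ m) = x by exact: frob_top.
have lt' : (i < p ^ e)%N by apply: leq_ltn_trans lt; exact: leq_pmull.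
rewrite /tc !(lps_cpol iota pF) ?muln_gt0 ?p0 //.
apply: (fmorph_inj iota); rewrite rmorphXn /= !(iota_frtr iota pF) //; try exact: frtrX.
have pL : p \in [pchar L] by rewrite (fmorph_pchar iota).
rewrite -(pFrobenius_autE pL) raddf_sum /=; apply: eq_bigr => j _.
by rewrite pFrobenius_autE -!exprM; congr (x ^+ _); ring.
Qed.

End TraceCoef.

Section CondLink.
Variables (p N e : nat) (F L1 L2 : finFieldType).
Variables (iota1 : {rmorphism F -> L1}) (iota2 : {rmorphism F -> L2}) (m n : nat).
Hypotheses (pF : p \in [pchar F]) (p2 : (2 < p)%N).
Hypotheses (cL1 : #|L1| = (#|F| ^ m)%N) (m0 : (0 < m)%N).
Hypotheses (cL2 : #|L2| = (#|F| ^ n)%N) (n0 : (0 < n)%N).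
Hypotheses (Ne : (N < p ^ e)%N).
Variable eps : F.

Lemma eps_p : eps \in [:: 1; -1; 0] -> eps ^+ p = eps.
Proof.
have p_pr := pcharf_prime pF; have op : odd p by case/even_prime: p_pr => // E; move: p2; rewrite E.
rewrite !inE => /or3P[] /eqP ->; rewrite ?expr1n //; last by rewrite expr0n; case: (p) p2.
by rewrite -signr_odd op expr1.
Qed.

(** Frobenius yields the exponents divisible by p from smaller ones, because eps ^ p = eps. The
    value eps = 0 serves the first moment. *)
Lemma tc_cond x y : eps \in [:: 1; -1; 0] ->
  (forall i, (0 < i <= N)%N -> ~~ (p %| i)%N -> tc p e iota1 m x i + eps * tc p e iota2 n y i = 0) ->
  cond N iota1 iota2 m n eps x y.
Proof.
move=> /eps_p He H; have p0 := prime_gt0 (pcharf_prime pF).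
apply: (lps_cross pF (e := e)) => //; [exact: (P0 iota1 pF)|exact: (P0 iota2 pF)|].
elim/ltn_ind=> i IH /andP[i0 iN].
case: (boolP (p %| i)%N) => [/dvdnP[j E]|np]; last by apply: H; rewrite ?i0.
have j0 : (0 < j)%N by move: i0; rewrite E; case: (j).
have lt : (p * j < p ^ e)%N by rewrite mulnC -E; exact: leq_ltn_trans Ne.
have ji : (j < i)%N by rewrite E; nia.
have := IH j ji; rewrite j0 (leq_trans (ltnW ji) iN) => /(_ isT) Ej.
have := tc_Frobenius iota1 pF cL1 x j0 lt; have := tc_Frobenius iota2 pF cL2 y j0 lt.
rewrite /tc E mulnC => -> ->; rewrite -{1}He -exprMn.
rewrite -!(pFrobenius_autE pF) -rmorphD /= Ej; exact: rmorph0.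
Qed.
End CondLink.

Section DiagCount.
Variables (p : nat) (F L : finFieldType) (iota : {rmorphism F -> L}) (m : nat).
Hypotheses (pF : p \in [pchar F]) (cL : #|L| = (#|F| ^ m)%N) (m0 : (0 < m)%N).
Let q := #|F|.
Local Notation pi := (opolF iota pF).
Local Notation deg := (deg iota pF).

Definition diag : {set L * L} := [set z : L * L | pi z.1 == pi z.2].

Lemma opolF_at0 : pi 0 = 1.
Proof.
apply: (map_iota_inj (iota := iota)); rewrite iota_opolF rmorph1 /opol big_seq big1 // => y yc.
suff -> : y = 0 by rewrite scale0r subr0.
move: yc; apply: (conj_ind (P := fun y => y = 0)) => // z ->; exact: rmorph0.
Qed.

Lemma opolF_eq1 x : (pi x == 1) = (x == 0).
Proof.
apply/eqP/eqP=> [E|->]; last exact: opolF_at0.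
apply/eqP/negPn/negP => x0; have := size_opolF iota pF x0; rewrite E size_poly1.
by have := deg_gt0 iota pF x; case: (deg _).
Qed.

Lemma opolF_fr y : pi (frobm iota pF y) = pi y.
Proof.
apply: (map_iota_inj (iota := iota)); rewrite !iota_opolF /opol; apply: perm_big.
apply: uniq_perm; [exact: fingraph.orbit_uniq|exact: fingraph.orbit_uniq|move=> z].
have fi := @fr_inj p F L iota pF.
rewrite /conj -!fingraph.fconnect_orbit; apply: esym.
by apply: (fingraph.same_fconnect1 fi).
Qed.

Lemma diag_ge x : (deg x <= #|[set y : L | pi x == pi y]|)%N.
Proof.
have -> : deg x = size (conj iota pF x) by rewrite /conj fingraph.size_orbit.
rewrite -(card_uniqP (fingraph.orbit_uniq _ _)); apply: subset_leq_card; apply/subsetP=> y yc.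
rewrite inE eq_sym; apply/eqP; move: yc; apply: (conj_ind (P := fun y => pi y = pi x)) => // z <-.
exact: opolF_fr.
Qed.

Lemma diag_le x : (#|[set y : L | pi x == pi y]| <= m)%N.
Proof.
case: (eqVneq x 0) => [->|x0].
  apply: (@leq_trans #|[set (0 : L)]|); last by rewrite cards1.
  by apply: subset_leq_card; apply/subsetP=> y; rewrite !inE opolF_at0 eq_sym opolF_eq1.
apply: leq_trans (card_cpol_fiber iota pF cL m0 (cpol iota m x)).
apply: subset_leq_card; apply/subsetP=> y; rewrite !inE => /eqP E.
have y0 : y != 0 by apply: contraNneq x0 => y0; rewrite -opolF_eq1 E y0 opolF_eq1.
rewrite y0 /= !(cpol_pi iota pF cL) // -E.
have := size_opolF iota pF x0; rewrite E size_opolF // => -[->].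
exact: eqxx.
Qed.

(** A point of full degree m has exactly m partners. The other points have degree at most m / 2, so
    they number at most m q ^ (m / 2), and each falls short by at most m. *)
Lemma card_diag : (#|diag| <= m * q ^ m <= #|diag| + m ^ 2 * q ^ (m %/ 2))%N.
Proof.
have E : #|diag| = (\sum_(x : L) #|[set y : L | pi x == pi y]|)%N.
  rewrite -sum1_card (eq_bigl (fun z : L * L => pi z.1 == pi z.2)); last by move=> z; rewrite inE.
  rewrite -(pair_big_dep xpredT (fun x y => pi x == pi y) (fun _ _ => 1%N)) /=.
  by apply: eq_bigr => x _; rewrite sum1_card; apply: eq_card => y; rewrite inE.
apply/andP; split.
  by rewrite E mulnC -cL -sum_nat_const; apply: leq_sum => x _; exact: diag_le.
pose B := [set x : L | deg x != m].
have cB : (#|B| <= m * q ^ (m %/ 2))%N.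
  apply: (@leq_trans #|\bigcup_(k < m | (0 < k <= m %/ 2)%N) [set x : L | deg x == k]|).
    apply: subset_leq_card; apply/subsetP=> x; rewrite inE => dm.
    have dd := deg_dvdm iota pF cL x; have le := dvdn_leq m0 dd.
    have lt : (deg x < m)%N by rewrite ltn_neqAle dm.
    apply/bigcupP; exists (Ordinal lt) => /=; last by rewrite inE.
    rewrite deg_gt0 /= leq_divRL //; case/dvdnP: dd => a Ea.
    case: a Ea => [|[|a]] Ea; first by move: m0; rewrite {1}Ea.
      by move: lt; rewrite Ea mul1n ltnn.
    by rewrite Ea mulnC leq_mul.
  rewrite -[X in (_ <= X * _)%N](card_ord m); apply: card_bigcup_le => k /andP[_ km].
  apply: leq_trans (card_deg iota pF k) _; exact: leq_pexp2l (ltnW (finNzRing_gt1 _)) km.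
have -> : (m * q ^ m = \sum_(x : L) m)%N by rewrite sum_nat_const cL mulnC.
apply: (@leq_trans (\sum_(x : L) (#|[set y : L | pi x == pi y]| + (x \in B) * m))).
  apply: leq_sum => x _; rewrite inE; case: eqP => [<-|_] /=; last by rewrite mul1n leq_addl.
  by rewrite mul0n addn0 diag_ge.
rewrite big_split /= -E leq_add2l -big_distrl /=.
have -> : (\sum_(x : L) (x \in B) = #|B|)%N by rewrite -[RHS]sum1_card [RHS]big_mkcond; apply: eq_bigr => x _; case: ifP.
by rewrite mulnC -mulnn -mulnA leq_mul2l cB orbT.
Qed.
End DiagCount.

Section Averages.
Variables (p : nat) (F : finFieldType) (C : numClosedFieldType) (Psi : F -> C) (d e : nat).
Hypotheses (pF : p \in [pchar F]) (p2 : (2 < p)%N).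
Hypotheses (PsiD : forall x y, Psi (x + y) = Psi x * Psi y) (Psi0 : Psi 0 = 1)
  (Psi_nt : exists h, Psi h != 1).
Hypotheses (cdp : coprime d p) (d0 : (0 < d)%N) (de : (d < p ^ e)%N).
Let q := #|F|.
Local Notation N := d.-1.
Local Notation A := (ASd0 p F d).
Local Notation IA := (#|A|%:R^-1 : C).

Definition linc (a : {ffun 'I_d.+1 -> F}) (c : nat -> F) : F := \sum_(i < d.+1) a i * c i.

Lemma lincD a c c' : linc a (fun i => c i + c' i) = linc a c + linc a c'.
Proof. by rewrite -big_split /=; apply: eq_bigr => i _; rewrite mulrDr. Qed.

Lemma lincZ a t c : linc a (fun i => t * c i) = t * linc a c.
Proof. by rewrite mulr_sumr; apply: eq_bigr => i _; rewrite mulrCA. Qed.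

Lemma card_ASd0_gt0 : (0 < #|A|)%N.
Proof.
have p_pr := pcharf_prime pF.
apply/card_gt0P; exists [ffun i => if i == ord_max then 1 else 0]; rewrite inE ffunE eqxx oner_neq0 /=.
apply/forallP=> i; apply/implyP=> /andP[i0 pi]; rewrite ffunE; case: (eqVneq i ord_max) => // E.
have : (p %| gcdn d p)%N by rewrite dvdn_gcd dvdnn andbT; move: pi; rewrite E.
by rewrite (eqP cdp) dvdn1; move: (prime_gt1 p_pr); case: (p) => [|[]].
Qed.

Lemma avg_norm (u : {ffun 'I_d.+1 -> F} -> C) B : (forall a, a \in A -> `|u a| <= B) -> `|IA * \sum_(a in A) u a| <= B.
Proof.
move=> H; have c0 : 0 < (#|A|%:R : C) by rewrite ltr0n card_ASd0_gt0.
rewrite normrM normfV (ger0_norm (ltW c0)) ler_pdivrMl //.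
apply: le_trans (ler_norm_sum _ _ _) _; rewrite mulr_natl -sumr_const; exact: ler_sum.
Qed.

(** The coefficient a_j is free in the family and can be shifted. The coefficient a_d cannot, being
    required nonzero, which is why the orthogonality relations stop at N = d - 1. *)
Lemma avg_char0 (c : nat -> F) j : (0 < j < d)%N -> ~~ (p %| j)%N -> c j != 0 ->
  \sum_(a in A) Psi (linc a c) = 0.
Proof.
move=> /andP[j0 jd] pj cj; have jd' : (j < d.+1)%N by exact: ltnW.
pose oj := Ordinal jd'.
pose T (h : F) (a : {ffun 'I_d.+1 -> F}) := [ffun i => a i + (if i == oj then h else 0)].
apply: (sum_shift0 Psi_nt (T := T) (c := c j) (P := fun a => a \in A)) => //.
- move=> h a b /ffunP E; apply/ffunP=> i; have := E i; rewrite !ffunE; exact: addIr.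
- move=> h a; rewrite !inE ffunE; congr (_ && _).
    suff /negbTE -> : ord_max != oj by rewrite addr0.
    by rewrite -val_eqE /= gtn_eqF.
  apply: eq_forallb => i; rewrite ffunE; case: (boolP (i == oj)) => [/eqP ->|_]; last by rewrite addr0.
  by rewrite /= (negbTE pj) andbF.
move=> h a _; rewrite -PsiD; congr Psi; rewrite /linc (bigD1 oj) //= [RHS]addrC [X in _ = X + _](bigD1 oj) //=.
rewrite ffunE eqxx mulrDl [h * _]mulrC -!addrA; congr (_ + _); rewrite addrC; congr (_ + _).
by apply: eq_bigr => i /negbTE ni; rewrite ffunE ni addr0.
Qed.

Lemma avg_char (c : nat -> F) :
  (~ forall i, (0 < i <= N)%N -> ~~ (p %| i)%N -> c i = 0) -> \sum_(a in A) Psi (linc a c) = 0.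
Proof.
move=> H; case: (boolP [exists i : 'I_d, [&& (0 < i)%N, ~~ (p %| i)%N & c i != 0]]).
  by case/existsP=> i /and3P[i0 pi ci]; apply: (avg_char0 (j := i)) => //; rewrite i0 ltn_ord.
move=> E; case: H => i /andP[i0 iN] pi; apply/eqP/negPn/negP => ci; move/negP: E; apply.
have id : (i < d)%N by rewrite -(prednK d0).
by apply/existsP; exists (Ordinal id); rewrite /= i0 pi ci.
Qed.

Lemma avg_char1 (c : nat -> F) : (forall i, c i = 0) -> IA * \sum_(a in A) Psi (linc a c) = 1.
Proof.
move=> H; rewrite (eq_bigr (fun=> 1)) => [|a _].
  by rewrite sumr_const -mulr_natl mulr1 mulVf // pnatr_eq0 -lt0n card_ASd0_gt0.
by rewrite /linc big1 // => i _; rewrite H mulr0.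
Qed.

Section Moments.
Variables (L1 L2 : finFieldType) (iota1 : {rmorphism F -> L1}) (iota2 : {rmorphism F -> L2}) (m n : nat).
Hypotheses (cL1 : #|L1| = (q ^ m)%N) (m0 : (0 < m)%N).
Hypotheses (cL2 : #|L2| = (q ^ n)%N) (n0 : (0 < n)%N).

(** Entry 0 is the trace of 1 and entry i, for i up to d, the trace of x ^ i, so that [linc a]
    returns the trace of the value of the polynomial at x. *)
Definition tcx (L : finFieldType) (iota : {rmorphism F -> L}) k (x : L) i : F :=
  if i == 0%N then k%:R else tc p e iota k x i.

Lemma lin_lpsE (L : finFieldType) (iota : {rmorphism F -> L}) k (x : L) (a : {ffun 'I_d.+1 -> F}) :
  lin_lps p (poly_of a) d e k (cpol iota k x) = linc a (tcx iota k x).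
Proof.
have E i (lt : (i < d.+1)%N) : (poly_of a)`_i = a (Ordinal lt).
  by rewrite coef_poly lt; congr (a _); apply: val_inj; rewrite /= inordK.
rewrite /lin_lps /linc big_ord_recl; congr (_ + _).
  rewrite (E 0%N (ltn0Sn d)) /tcx /= mulr_natr; congr (a _ *+ _); exact: val_inj.
rewrite big_add1 big_mkord; apply: eq_bigr => i _.
have lt : (i.+1 < d.+1)%N by exact: (ltn_ord i).
by rewrite (E _ lt) /tcx lift0 /=; congr (a _ * _); apply: val_inj.
Qed.

Definition Sx (L : finFieldType) (iota : {rmorphism F -> L}) k (a : {ffun 'I_d.+1 -> F}) : C :=
  \sum_(x : L) chi p Psi (poly_of a) d e k (cpol iota k x).

Lemma SxE (L : finFieldType) (iota : {rmorphism F -> L}) k a :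
  Sx iota k a = \sum_(x : L) Psi (linc a (tcx iota k x)).
Proof. by apply: eq_bigr => x _; rewrite /chi lin_lpsE. Qed.

Lemma tcx_pos (L : finFieldType) (iota : {rmorphism F -> L}) k (x : L) i : (0 < i)%N -> tcx iota k x i = tc p e iota k x i.
Proof. by case: i. Qed.

Let Ne : (N < p ^ e)%N. Proof. by apply: leq_ltn_trans de; rewrite leq_pred. Qed.

Lemma first_moment : `|IA * \sum_(a in A) Sx iota1 m a| <= #|cond1 N iota1 m|%:R.
Proof.
rewrite (eq_bigr _ (fun a _ => SxE iota1 m a)) exchange_big /= mulr_sumr.
apply: le_trans (ler_norm_sum _ _ _) _.
rewrite -[X in _ <= X%:R]sum1_card natr_sum [leRHS]big_mkcond /=; apply: ler_sum => x _.
case: ifP => xc.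
  by apply: avg_norm => a _; rewrite (Psi_norm pF).
rewrite avg_char ?mulr0 ?normr0 // => H; move/negbT/negP: xc; apply; rewrite inE.
(* With eps = 0 the second point is a dummy, and the condition reduces to one on the derivative of P
   alone. *)
have := @tc_cond p N e F L1 L1 iota1 iota1 m m pF p2 cL1 m0 cL1 m0 Ne 0 x x.
rewrite /cond /cross polyC0 mul0r addr0.
rewrite !inE eqxx !orbT => /(_ isT) H1.
have H2 : 'X^N %| (cpol iota1 m x)^`() * cpol iota1 m x.
  by apply: H1 => i iN pi; rewrite mul0r addr0 -(H i iN pi) tcx_pos //; case/andP: iN.
by rewrite Gauss_dvdpl // in H2; apply: coprimeXn; apply: (P0 iota1 pF cL1).
Qed.

Definition Seps (eps : bool) k (a : {ffun 'I_d.+1 -> F}) := if eps then Sx iota2 k a else (Sx iota2 k a)^*.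

Definition sgF (eps : bool) : F := if eps then 1 else -1.

Lemma SepsE eps k a : Seps eps k a = \sum_(y : L2) Psi (sgF eps * linc a (tcx iota2 k y)).
Proof.
rewrite /Seps SxE /sgF; case: eps; first by apply: eq_bigr => y _; rewrite mul1r.
by rewrite rmorph_sum; apply: eq_bigr => y _ /=; rewrite mulN1r (PsiN pF).
Qed.

Definition cxy eps x y i := tcx iota1 m x i + sgF eps * tcx iota2 n y i.

Lemma sum_pair eps : IA * \sum_(a in A) Sx iota1 m a * Seps eps n a =
  \sum_(z : L1 * L2) IA * \sum_(a in A) Psi (linc a (cxy eps z.1 z.2)).
Proof.
rewrite -mulr_sumr exchange_big /=; congr (_ * _); apply: eq_bigr => a _.
rewrite SxE SepsE mulr_suml -(pair_big xpredT xpredT (fun x y => Psi (linc a (cxy eps x y)))) /=.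
apply: eq_bigr => x _; rewrite mulr_sumr; apply: eq_bigr => y _.
by rewrite -PsiD -lincZ -lincD.
Qed.

Lemma off_diag_bound eps (P : pred (L1 * L2)) :
  (forall z, P z -> ~~ [&& sgF eps == -1, m == n & opolF iota1 pF z.1 == opolF iota2 pF z.2]) ->
  `|\sum_(z | P z) IA * \sum_(a in A) Psi (linc a (cxy eps z.1 z.2))| <= #|off_diag N iota1 iota2 m n pF (sgF eps)|%:R.
Proof.
move=> HP; apply: le_trans (ler_norm_sum _ _ _) _.
rewrite -[X in _ <= X%:R]sum1_card natr_sum big_mkcond [leRHS]big_mkcond /=; apply: ler_sum => -[x y] _.
case: ifP => Pz; last by case: ifP.
case: ifP => xc; first by apply: avg_norm => a _; rewrite (Psi_norm pF).
rewrite avg_char ?mulr0 ?normr0 // => H; move/negbT/negP: xc; apply; rewrite inE HP // andbT.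
apply: (tc_cond pF p2 cL1 m0 cL2 n0 Ne); first by rewrite /sgF; case: (eps); rewrite !inE eqxx ?orbT.
by move=> i iN pi; rewrite -(H i iN pi) /cxy !tcx_pos //; case/andP: iN.
Qed.

Lemma second_moment eps : ~~ (~~ eps && (m == n)) ->
  `|IA * \sum_(a in A) Sx iota1 m a * Seps eps n a| <= #|off_diag N iota1 iota2 m n pF (sgF eps)|%:R.
Proof.
move=> H; rewrite sum_pair; apply: off_diag_bound => z _.
have p_pr := pcharf_prime pF.
apply: contra H => /and3P[E -> _]; rewrite andbT; move: E; rewrite /sgF; case: eps => //.
rewrite -subr_eq0 opprK -(natrD _ 1 1) => E.
have : (p %| 2)%N by rewrite (dvdn_pcharf pF).
by rewrite dvdn_prime2 // => /eqP Ep; move: p2; rewrite Ep.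
Qed.
End Moments.

(** Pairs with equal reversed minimal polynomials have equal traces of all powers in play, so their
    average is exactly 1 and [card_diag] counts them. All the other pairs fall under [off_diag]. *)
Lemma diag_moment (L : finFieldType) (iota : {rmorphism F -> L}) m : #|L| = (q ^ m)%N -> (0 < m)%N ->
  `|IA * \sum_(a in A) Sx iota m a * (Sx iota m a)^* - (m * q ^ m)%:R| <=
  #|off_diag N iota iota m m pF (-1)|%:R + (m ^ 2 * q ^ (m %/ 2))%:R.
Proof.
move=> cL m0; have := sum_pair (L1 := L) (L2 := L) iota iota m m false.
rewrite /Seps => ->; rewrite (bigID (fun z => z \in diag iota pF)) /=.
set B := \sum_(z | z \notin _) _; set A1 := \sum_(z | _) _.
have -> : A1 = #|diag iota pF|%:R.
  rewrite -sum1_card natr_sum; apply: eq_bigr => -[x y]; rewrite inE => /eqP /= E.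
  apply: avg_char1 => i; rewrite /cxy /sgF /tcx /tc; case: ifP => _; first by rewrite mulN1r subrr.
  suff -> : cpol iota m x = cpol iota m y by rewrite mulN1r subrr.
  case: (eqVneq x 0) => [x0|x0].
    by move/eqP: E; rewrite x0 opolF_at0 eq_sym opolF_eq1 => /eqP ->.
  have y0 : y != 0 by apply: contraNneq x0 => y0; rewrite -(opolF_eq1 iota pF) E y0 opolF_eq1.
  have := size_opolF iota pF x0; rewrite E size_opolF // => -[Ed].
  by rewrite !(cpol_pi iota pF cL) // E Ed.
rewrite addrAC [_ - _ + B]addrC; apply: le_trans (ler_normD _ _) _; apply: lerD.
  apply: (off_diag_bound cL m0 cL m0) => z; rewrite inE => /negbTE ->.
  by rewrite !andbF.
have /andP[h1 h2] := card_diag iota pF cL m0.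
rewrite distrC ger0_norm; last by rewrite subr_ge0 ler_nat.
by rewrite lerBlDl -natrD ler_nat.
Qed.
End Averages.

From mathcomp Require Import all_classical all_reals all_analysis.
From mathcomp Require Import measurable_realfun complex.
Import numFieldNormedType.Exports.
Import Order.TTheory GRing.Theory Num.Theory.
Local Open Scope ring_scope.
Local Open Scope complex_scope.

(** * Complex exponentials, coefficients of the L-function, and the angles *)

Section Cexp.
Variable R : realType.
Local Notation C := R[i].
Implicit Types x y t : R.

Lemma cexp0 : cexp (0 : R) = 1.
Proof. by rewrite /cexp cos0 sin0. Qed.

Lemma cexpD x y : cexp (x + y) = cexp x * cexp y.
Proof. by rewrite /cexp cosD sinD; apply/eqP; rewrite eq_complex /= !eqxx /= addrC. Qed.

Lemma conj_cexp x : (cexp x)^* = cexp (- x).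
Proof. by rewrite /cexp cosN sinN. Qed.

Lemma cexpMn x n : cexp (x *+ n) = cexp x ^+ n.
Proof. by elim: n => [|n IH]; rewrite ?cexp0 ?expr0 // mulrS cexpD IH exprS. Qed.

Lemma unit_cexp (z : C) : `|z| = 1 -> exists t, z = cexp (2 * pi * t).
Proof.
case: z => a b; rewrite normc_def /= => /eqP; rewrite eq_complex /= eqxx andbT => /eqP E.
have E2 : a ^+ 2 + b ^+ 2 = 1 by rewrite -(sqr_sqrtr (addr_ge0 (sqr_ge0 a) (sqr_ge0 b))) E expr1n.
have a1 : -1 <= a <= 1.
  rewrite -ler_norml -(ler_pXn2r (ltn0Sn 1)) ?nnegrE // expr1n real_normK ?num_real //.
  by rewrite -E2 lerDl sqr_ge0.
have pi2 : (2 * pi : R) != 0 by rewrite mulf_neq0 // gt_eqF ?pi_gt0.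
have S : sin (acos a) = `|b|.
  by rewrite sin_acos // -sqrtr_sqr; congr Num.sqrt; rewrite -E2; ring.
exists ((if 0 <= b then acos a else - acos a) / (2 * pi)); rewrite mulrC divfK //.
case: ifP => b0; rewrite /cexp ?cosN ?sinN acosK ?inE //= S; first by rewrite ger0_norm.
by rewrite ltr0_norm ?opprK // ltNge b0.
Qed.

Lemma natC n : (n%:R : C) = (n%:R : R)%:C.
Proof. by rewrite rmorph_nat. Qed.

Lemma archi_complex (z : C) : exists n : nat, `|z| <= n%:R.
Proof.
case: z => a b; rewrite normc_def /=; set s := Num.sqrt _.
exists (Num.Def.archi_bound s); rewrite natC lecR; apply: ltW; apply: archi_boundP; exact: sqrtr_ge0.
Qed.
End Cexp.

Section Lcoef.
Variable R : realType.
Local Notation C := R[i].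
Variable S : nat -> C.

Lemma size_Lseq n : size (Lseq S n) = n.+1.
Proof. by elim: n => //= n IH; rewrite size_rcons IH. Qed.

Lemma nth_Lseq n j : (j <= n)%N -> nth 0 (Lseq S n) j = Lcoef S j.
Proof.
elim: n => [|n IH]; first by rewrite leqn0 => /eqP ->.
rewrite leq_eqVlt => /orP[/eqP ->//|jn].
by rewrite /= nth_rcons size_Lseq jn IH.
Qed.

Lemma Lcoef_rec n : (0 < n)%N -> n%:R * Lcoef S n = \sum_(1 <= k < n.+1) S k * Lcoef S (n - k).
Proof.
case: n => // n _; rewrite /Lcoef /= nth_rcons size_Lseq ltnn eqxx mulrA mulfV ?mul1r ?pnatr_eq0 //.
rewrite big_add1 big_mkord; apply: eq_bigr => k _; congr (_ * _).
by rewrite nth_Lseq ?leq_subr // subSS.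
Qed.

Lemma rec_Lcoef (c : nat -> C) : c 0%N = 1 ->
  (forall n, (0 < n)%N -> n%:R * c n = \sum_(1 <= k < n.+1) S k * c (n - k)%N) -> forall n, c n = Lcoef S n.
Proof.
move=> c0 crec; elim/ltn_ind=> -[|n] IH; first by rewrite c0.
have n0 : (n.+1%:R : C) != 0 by rewrite pnatr_eq0.
apply: (mulfI n0); rewrite crec // Lcoef_rec //; apply: eq_big_nat => k /andP[k1 k2].
by rewrite IH //; lia.
Qed.
End Lcoef.

Section Angles.
Variables (R : realType) (p : nat) (psi : 'F_p -> R[i]).
Local Notation C := R[i].
Hypotheses (psi_char : nontriv_add_char psi).
Let psiD : forall x y, psi (x + y) = psi x * psi y. Proof. by case: psi_char => _ []. Qed.
Let psi_nt : exists x, psi x != 1. Proof. by case: psi_char => _ []. Qed.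
Let psi0 : psi 0 = 1.
Proof.
case: psi_char => nz _; apply: (mulfI (nz 0)); by rewrite -psiD addr0 mulr1.
Qed.

Lemma expsum_ext (F : finFieldType) (pF : p \in [pchar F]) k : (0 < k)%N ->
  exists (L : finFieldType) (iota : {rmorphism F -> L}), #|L| = (#|F| ^ k)%N /\
  forall f : {poly F}, expsum psi f k = \sum_(x : L) PsiL psi (map_poly iota f).[x].
Proof.
move=> k0; rewrite /expsum; case: pselect => [H|[]].
  by exists (projT1 (cid H)), (ext_emb (projT1 (cid H))); split; first exact: ext_card.
by have [L [iota c]] := ext_exists F k0; exists (Ext iota c).
Qed.

Lemma expsum_chi (F : finFieldType) (pF : p \in [pchar F]) k : (0 < k)%N ->
  exists (L : finFieldType) (iota : {rmorphism F -> L}), #|L| = (#|F| ^ k)%N /\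
  forall (f : {poly F}) d e, size f = d.+1 -> (d < p ^ e)%N ->
    expsum psi f k = \sum_(x : L) chi p (PsiL (L := F) psi) f d e k (cpol iota k x).
Proof.
move=> k0; have [L [iota [cL H]]] := expsum_ext pF k0; exists L, iota; split=> // f d e sf de.
rewrite H; apply: eq_bigr => x _; rewrite /chi (PsiL_compat iota pF cL) (frtr_horner pF sf de) //.
exact: frob_top cL x.
Qed.

Variables (F : finFieldType) (f : {poly F}) (m : nat).
Hypotheses (pF : p \in [pchar F]) (szf : size f = m.+2) (cdp : coprime m.+1 p).
Let q := #|F|.
(** A convenient truncation: the power sums up to exponent m + 1 must lie below p ^ e. *)
Let e := m.+1.
Let p_pr : prime p. Proof. exact: pcharf_prime pF. Qed.
Let de : (m.+1 < p ^ e)%N. Proof. by apply: ltn_expl; exact: prime_gt1. Qed.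
Local Notation Psi := (PsiL (L := F) psi).

Lemma expsum_S_ext k : (0 < k)%N -> exists (L : finFieldType) (iota : {rmorphism F -> L}),
  #|L| = (q ^ k)%N /\ expsum psi f k = \sum_(x : L) chi p Psi f m.+1 e k (cpol iota k x).
Proof.
move=> k0; have [L [iota [cL H]]] := expsum_chi pF k0; exists L, iota; split=> //.
by apply: H.
Qed.

Lemma expsum_bound : exists (K : C) (t0 : nat), forall t, (t0 <= t)%N ->
  `|expsum psi f (2 * t)%N| <= K * q%:R ^+ t.
Proof.
exists (2 * (p * m.+1) + 2)%:R, ((p * m.+1) ^ 2 + 3 * (p * m.+1) + 2)%N => t t0.
have q1 : (1 < q)%N := finNzRing_gt1 _.
have tt : (0 < 2 * t)%N by rewrite muln_gt0 /=; apply: leq_trans t0; rewrite addn2.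
have [L [iota [cL H]]] := expsum_ext pF tt.
have pL : p \in [pchar L] by rewrite (fmorph_pchar iota).
have sz : size (map_poly iota f) = m.+2 by rewrite size_map_poly.
rewrite H -natrX -natrM; apply: (weil_stepanov pL _ _ _ _ sz cdp).
- exact: PsiLD.
- exact: PsiL0.
- exact: PsiL_nt.
- exact: PsiL_p.
- by rewrite pnatX /q (cardL pF) pnatX pnat_id // orbT.
- by rewrite -expnM mulnC.
by apply: leq_trans t0 _; apply: ltnW; exact: ltn_expl.
Qed.

Lemma cn_Lcoef n : cn p Psi f m.+1 e n = Lcoef_f psi f n.
Proof.
apply: rec_Lcoef n; first by apply: cn0; exact: PsiL0.
move=> n n0; apply: (Lrec pF _ szf de) => //; [exact: PsiLD|exact: expsum_S_ext].
Qed.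

Lemma angles_exist : exists th : 'I_m -> R, is_angles psi f th.
Proof.
have [w [sw wq wc]] := lfun_roots (@archi_complex R) pF (PsiLD pF psiD) (PsiL0 pF psi0)
  (PsiL_nt pF psi_nt) szf de cdp expsum_S_ext expsum_bound.
have q0 : (0 < q)%N := ltnW (finNzRing_gt1 _).
have s0 : (Num.sqrt (q%:R : R))%:C != 0 :> C.
  by rewrite eq_complex /= eqxx andbT sqrtr_eq0 -ltNge ltr0n.
have H i : (i < m)%N -> exists t, nth 0 w i = (Num.sqrt (q%:R : R))%:C * cexp (2 * pi * t).
  move=> im; have aw : nth 0 w i \in w by apply: mem_nth; rewrite sw.
  have nw : `|nth 0 w i| = (Num.sqrt (q%:R : R))%:C.
    apply/eqP; rewrite -(eqrXn2 (ltn0Sn 1)) ?normr_ge0 ?lecR ?sqrtr_ge0 //.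
    by rewrite wq // -rmorphXn /= sqr_sqrtr ?ler0n // natC.
  have [|t Et] := @unit_cexp R (nth 0 w i / (Num.sqrt (q%:R : R))%:C).
    rewrite normrM normfV nw ger0_norm ?lecR ?sqrtr_ge0 // mulfV //.
  by exists t; rewrite -Et mulrC divfK.
have [th Hth] : exists th : 'I_m -> R, forall i : 'I_m, nth 0 w i = (Num.sqrt (q%:R : R))%:C * cexp (2 * pi * th i).
  exists (fun i : 'I_m => projT1 (cid (H i (ltn_ord i)))) => i; exact: (projT2 (cid (H i (ltn_ord i)))).
exists th => n; rewrite -cn_Lcoef wc /lprod (big_nth 0) big_mkord sw.
by congr (polyseq _)`_ _; apply: eq_bigr => i _; rewrite Hth.
Qed.

Lemma angles_power k : (0 < k)%N ->
  \sum_(i < m) cexp (2 * pi * angles psi f i) ^+ k =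
  - (((Num.sqrt (q%:R : R)) ^- k)%:C * expsum psi f k).
Proof.
move=> k0; have H : is_angles psi f (angles (N := m) psi f).
  by rewrite /angles; case: pselect => [E|[]]; [exact: (projT2 (cid E))|exact: angles_exist].
pose w := [seq (Num.sqrt (q%:R : R))%:C * cexp (2 * pi * angles psi f i) | i : 'I_m <- enum 'I_m].
have Hw n : Lcoef_f psi f n = (lprod w)`_n.
  by rewrite H /lprod /w big_map big_enum.
have := newton_unique Hw (fun n n0 => @Lcoef_rec R (expsum psi f) n n0) k0.
move=> ->; rewrite mulrN opprK /w big_map big_enum mulr_sumr; apply: eq_bigr => i _.
have q0 : (0 < q)%N := ltnW (finNzRing_gt1 _).
rewrite exprMn mulrA -rmorphXn -rmorphM /= mulVf ?rmorph1 ?mul1r //.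
by rewrite expf_neq0 // sqrtr_eq0 -ltNge ltr0n.
Qed.
End Angles.

Local Open Scope classical_set_scope.

(** * Measurability and integrability on the plane *)

Section Plane.
Variable R : realType.
Local Notation mu := (@lebesgue_measure R).
Local Notation mu2 := (@mu2 R).

Lemma floor_approx_cvg (t : R) : (Num.floor (n.+1%:R * t))%:~R / n.+1%:R @[n --> \oo] --> t.
Proof.
apply/cvgrPdist_le => e e0; near=> n.
have n0 : 0 < (n.+1%:R : R) by rewrite ltr0n.
have /andP[h1 h2] := floor_itv (n.+1%:R * t).
have -> : t - (Num.floor (n.+1%:R * t))%:~R / n.+1%:R = (n.+1%:R * t - (Num.floor (n.+1%:R * t))%:~R) / n.+1%:R.
  by field; rewrite addrC natr1 lt0r_neq0.
rewrite ger0_norm ?divr_ge0 ?subr_ge0 //.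
rewrite ler_pdivrMr //; apply: (@le_trans _ _ 1).
  by rewrite lerBlDl ltW // -[X in _ + X]/(1%:~R) -intrD.
rewrite mulrC -ler_pdivrMr // div1r.
have : (n.+1%:R^-1 : R) < e by near: n; exact: (near_infty_natSinv_lt (PosNum e0)).
by move=> H; rewrite -[leRHS]invrK lef_pV2 ?posrE ?invr_gt0 // -[leLHS]invrK; rewrite invrK ltW.
Unshelve. all: by end_near. Qed.

(** A Schwartz function is described through iterated partial derivatives, so separate continuity is
    what is at hand. Rounding the first variable down to a grid gives functions that depend only on
    the second variable in each of countably many strips and that converge pointwise. *)
Lemma measurable_sep (g : R -> R -> R) : (forall s, continuous (g^~ s)) -> (forall t, continuous (g t)) ->
  measurable_fun [set: R * R] (fun z => g z.1 z.2).
Proof.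
move=> c1 c2; pose fl n (t : R) : R := (Num.floor (n.+1%:R * t))%:~R / n.+1%:R.
apply: (@measurable_realfun.measurable_fun_cvg _ _ _ _ (fun n z => g (fl n z.1) z.2)); last first.
  move=> [t s] _; have H := cvg_comp (fun n => fl n t) (g^~ s) (@floor_approx_cvg t) (c1 s t); exact: H.
move=> n _ Y mY; rewrite setTI.
have -> : (fun z : R * R => g (fl n z.1) z.2) @^-1` Y =
   \bigcup_(k in [set: int]) ([set t : R | k%:~R / n.+1%:R <= t < (k + 1)%:~R / n.+1%:R] `*` (g (k%:~R / n.+1%:R) @^-1` Y)).
  have n0 : 0 < (n.+1%:R : R) by rewrite ltr0n.
  apply/seteqP; split=> [[t s]|[t s] [k _ []]] /=.
    exists (Num.floor (n.+1%:R * t)) => //; split=> //=.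
    by have /andP[h1 h2] := floor_itv (n.+1%:R * t); rewrite ler_pdivrMr // ltr_pdivlMr // [t * _]mulrC h1.
  rewrite ler_pdivrMr // ltr_pdivlMr // [t * _]mulrC => H; rewrite /fl.
  by rewrite (floor_def (m := k)).
apply: countable_bigcupT_measurable; first exact: countableP.
move=> k; apply: measurableX.
  have -> : [set t : R | k%:~R / n.+1%:R <= t < (k + 1)%:~R / n.+1%:R] = `[k%:~R / n.+1%:R, (k + 1)%:~R / n.+1%:R[%classic.
    by apply/seteqP; split=> t /=; rewrite in_itv.
  exact: measurable_itv.
have := continuous_measurable_fun (c2 (k%:~R / n.+1%:R)) measurableT mY.
by rewrite setTI.
Qed.

(** The common majorant of all estimates: integrable on the line, summable over the integers, and
    stable up to a constant under affine changes of variable. *)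
Definition wt (x : R) : R := (1 + x ^+ 2)^-1.

Lemma wt_ge0 x : 0 <= wt x. Proof. by rewrite invr_ge0 addr_ge0 ?sqr_ge0. Qed.
Lemma wt_le1 x : wt x <= 1. Proof. by rewrite invf_le1 ?lerDl ?sqr_ge0 // ltr_pwDl ?sqr_ge0. Qed.

Lemma continuous_wt : continuous wt. Proof. exact: continuous_oneDsqrV. Qed.

Lemma integrable_wt : mu.-integrable setT (EFin \o wt).
Proof.
apply/integrableP; split.
  by apply/measurable_EFinP; apply: continuous_measurable_fun; exact: continuous_wt.
have -> : (\int[mu]_x `|(EFin \o wt) x| = \int[mu]_x (wt x)%:E)%E.
  by apply: eq_integral => x _ /=; rewrite ger0_norm ?wt_ge0.
rewrite ge0_symfun_integralT; [|exact: wt_ge0|exact: continuous_wt|by move=> x; rewrite /wt /= sqrrN].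
have -> : [set x : R | 0 <= x] = `[0, +oo[%classic by apply/seteqP; split=> x /=; rewrite in_itv /= andbT.
by rewrite integral0y_oneDsqr -EFinM ltry.
Qed.

Definition wt2 (z : R * R) : R := wt z.1 * wt z.2.

Lemma measurable_wt2 : measurable_fun [set: R * R] wt2.
Proof.
apply: (measurable_sep (g := fun t s => wt t * wt s)) => t x.
  by apply: cvgM; [exact: continuous_wt|exact: cvg_cst].
by apply: cvgM; [exact: cvg_cst|exact: continuous_wt].
Qed.

Lemma integrable_wt2 : mu2.-integrable setT (EFin \o wt2).
Proof.
apply/integrable12ltyP; first by apply/measurable_EFinP; exact: measurable_wt2.
have E x : (\int[mu]_y `|(EFin \o wt2) (x, y)| = (wt x)%:E * \int[mu]_y (wt y)%:E)%E.
  rewrite -ge0_integralZl //.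
  - by apply: eq_integral => y _ /=; rewrite ger0_norm ?EFinM // mulr_ge0 ?wt_ge0.
  - by apply/measurable_EFinP; apply: continuous_measurable_fun; exact: continuous_wt.
  - by move=> y _; rewrite lee_fin wt_ge0.
  by rewrite lee_fin wt_ge0.
have fi : (\int[mu]_y (wt y)%:E)%E \is a fin_num by exact: integrable_fin_num integrable_wt.
have : mu.-integrable setT (fun x => (fine (\int[mu]_y (wt y)%:E))%:E * (wt x)%:E)%E.
  by apply: integrableZl => //; exact: integrable_wt.
move/(integrable_fin_num measurableT); rewrite fin_numE => /andP[_]; rewrite -ltey; apply: le_lt_trans.
rewrite le_eqVlt; apply/orP; left; apply/eqP; apply: eq_integral => x _.
by rewrite E muleC fineK.
Qed.

Lemma integrable2_le (g : R * R -> R) c : measurable_fun setT g -> (forall z, `|g z| <= c * wt2 z) ->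
  mu2.-integrable setT (EFin \o g).
Proof.
move=> mg gb; apply: (@le_integrable _ _ _ mu2 setT measurableT _ (fun z => c%:E * (wt2 z)%:E)%E).
- exact/measurable_EFinP.
- move=> z _ /=; rewrite lee_fin; apply: le_trans (gb z) _; exact: ler_norm.
exact: integrableZl integrable_wt2.
Qed.

Lemma integrable1_le (g : R -> R) c : measurable_fun setT g -> (forall x, `|g x| <= c * wt x) ->
  mu.-integrable setT (EFin \o g).
Proof.
move=> mg gb; apply: (@le_integrable _ _ _ mu setT measurableT _ (fun z => c%:E * (wt z)%:E)%E).
- exact/measurable_EFinP.
- move=> z _ /=; rewrite lee_fin; apply: le_trans (gb z) _; exact: ler_norm.
exact: integrableZl integrable_wt.
Qed.
End Plane.

(** * Poisson summation *)

Section Periodic.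
Variable R : realType.

Lemma cos_sin_2pin (n : nat) : cos (2 * pi * n%:R : R) = 1 /\ sin (2 * pi * n%:R : R) = 0.
Proof.
elim: n => [|n [IHc IHs]]; first by rewrite mulr0 cos0 sin0.
have -> : 2 * pi * n.+1%:R = 2 * pi * n%:R + pi *+ 2 :> R by rewrite -natr1 mulr2n; ring.
by rewrite cosD (sinD (2 * pi * n%:R)) IHc IHs cos2pi sin2pi !mul0r !mul1r ?addr0 ?subr0.
Qed.

Lemma cos_sin_2piz (n : int) : cos (2 * pi * n%:~R : R) = 1 /\ sin (2 * pi * n%:~R : R) = 0.
Proof.
case: n => n; first exact: cos_sin_2pin.
rewrite NegzE mulrNz mulrN cosN sinN; have [-> ->] := cos_sin_2pin n.+1.
by rewrite oppr0.
Qed.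

Lemma cosD2pi_int (x : R) (n : int) : cos (x + 2 * pi * n%:~R) = cos x.
Proof. by have [hc hs] := cos_sin_2piz n; rewrite cosD hc hs mulr0 subr0 mulr1. Qed.

Lemma sinD2pi_int (x : R) (n : int) : sin (x + 2 * pi * n%:~R) = sin x.
Proof. by have [hc hs] := cos_sin_2piz n; rewrite sinD hc hs mulr0 addr0 mulr1. Qed.
End Periodic.

Section Fejer.
Variable R : realType.
Local Notation mu := (@lebesgue_measure R).
Implicit Types (e u x t : R) (M : nat).

(** The Fejer kernel of period 1. As a double sum over differences it displays both its positivity,
    through a sum of two squares, and the Cesaro weights on the frequencies. *)
Definition fej M u : R := M%:R^-1 * \sum_(j < M) \sum_(k < M) cos (2 * pi * ((j%:R - k%:R) * u)).

Let Cs M (a : R) : R := \sum_(j < M) cos (j%:R * a).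
Let Sn M (a : R) : R := \sum_(j < M) sin (j%:R * a).

Lemma sum_cos_sq M u : \sum_(j < M) \sum_(k < M) cos (2 * pi * ((j%:R - k%:R) * u)) =
  Cs M (2 * pi * u) ^+ 2 + Sn M (2 * pi * u) ^+ 2.
Proof.
rewrite !expr2 !big_distrl -big_split /=; apply: eq_bigr => j _.
rewrite !big_distrr -big_split /=; apply: eq_bigr => k _.
by rewrite -cosB; congr cos; ring.
Qed.

Lemma fej_ge0 M u : 0 <= fej M u.
Proof. by rewrite /fej sum_cos_sq mulr_ge0 ?invr_ge0 ?ler0n // addr_ge0 ?sqr_ge0. Qed.

Lemma geom_cos M (a : R) : (1 - cos a) * Cs M a + sin a * Sn M a = 1 - cos (M%:R * a) /\
  (1 - cos a) * Sn M a - sin a * Cs M a = - sin (M%:R * a).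
Proof.
elim: M => [|M [IH1 IH2]]; first by rewrite /Cs /Sn !big_ord0 !mulr0 mul0r cos0 sin0; split; lra.
rewrite /Cs /Sn !big_ord_recr /= -/(Cs M a) -/(Sn M a).
have -> : M.+1%:R * a = M%:R * a + a :> R by rewrite -natr1; ring.
rewrite cosD sinD; split; lra.
Qed.

(** This is |1 - z| ^ 2 |1 + ... + z ^ (M - 1)| ^ 2 = |1 - z ^ M| ^ 2, kept free of division so that
    it also holds at the integers. *)
Lemma fej_cos M u : (0 < M)%N -> (1 - cos (2 * pi * u)) * (M%:R * fej M u) = 1 - cos (2 * pi * (M%:R * u)).
Proof.
move=> M0; have MN : (M%:R : R) != 0 by rewrite pnatr_eq0 -lt0n.
rewrite /fej mulVKf // sum_cos_sq; set a := 2 * pi * u.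
have -> : 2 * pi * (M%:R * u) = M%:R * a by rewrite /a; ring.
have [h1 h2] := geom_cos M a; have e1 := cos2Dsin2 a; have e2 := cos2Dsin2 (M%:R * a).
move: h1 h2 e1 e2; set c := cos a; set s := sin a; set C1 := Cs M a; set S1 := Sn M a.
set c' := cos _; set s' := sin _ => h1 h2 e1 e2.
have : ((1 - c) * C1 + s * S1) ^+ 2 + ((1 - c) * S1 - s * C1) ^+ 2 = (1 - c') ^+ 2 + s' ^+ 2.
  by rewrite h1 h2 sqrrN.
have -> : ((1 - c) * C1 + s * S1) ^+ 2 + ((1 - c) * S1 - s * C1) ^+ 2 = (1 - 2 * c + (c ^+ 2 + s ^+ 2)) * (C1 ^+ 2 + S1 ^+ 2) by ring.
have -> : (1 - c') ^+ 2 + s' ^+ 2 = 1 - 2 * c' + (c' ^+ 2 + s' ^+ 2) by ring.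
rewrite e1 e2 => H.
have {H} : 2 * ((1 - c) * (C1 ^+ 2 + S1 ^+ 2)) = 2 * (1 - c') by rewrite -[RHS]/(2 * (1 - c')); move: H; lra.
by move/mulfI; apply; rewrite pnatr_eq0.
Qed.

Lemma fej_le M u : `|fej M u| <= M%:R.
Proof.
rewrite ger0_norm ?fej_ge0 // /fej; case: M => [|M]; first by rewrite big_ord0 mulr0.
rewrite ler_pdivrMl ?ltr0n //; apply: (@le_trans _ _ (\sum_(j < M.+1) \sum_(k < M.+1) 1)).
  by apply: ler_sum => j _; apply: ler_sum => k _; exact: cos_le1.
by rewrite !sumr_const !card_ord -mulrnA -natrM.
Qed.

(** The bound for the kernel at distance at least e from the integers; it tends to 0 as M grows. *)
Definition eta (e : R) M : R := 2 / (M%:R * (1 - cos (2 * pi * e))).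

Lemma two_pi_itv x : 0 <= x -> x <= 1 / 2 -> 2 * pi * x \in `[0, pi]%R.
Proof. by move=> x0 x1; have p0 := pi_gt0 R; rewrite in_itv /=; apply/andP; split; nra. Qed.

Lemma cos_eps_lt1 e : 0 < e -> e <= 1 / 2 -> 0 < 1 - cos (2 * pi * e).
Proof.
move=> e0 e1; have p0 := pi_gt0 R.
rewrite subr_gt0 -[ltRHS](cos0 R) ltr_cos ?mulr_gt0 //; first by rewrite in_itv /= lexx ltW.
by apply: two_pi_itv => //; exact: ltW.
Qed.

Lemma eta_ge0 e M : 0 < e -> e <= 1 / 2 -> 0 <= eta e M.
Proof. by move=> e0 e1; rewrite divr_ge0 // mulr_ge0 // ltW // cos_eps_lt1. Qed.

Lemma fej_far M e u (c : int) : (0 < M)%N -> 0 < e -> e <= 1 / 2 -> e <= `|u - c%:~R| <= 1 / 2 -> fej M u <= eta e M.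
Proof.
move=> M0 e0 e1 /andP[h1 h2]; have p0 := pi_gt0 R; have M0' : 0 < (M%:R : R) by rewrite ltr0n.
have ce : cos (2 * pi * u) <= cos (2 * pi * e).
  have -> : cos (2 * pi * u) = cos (2 * pi * `|u - c%:~R|).
    rewrite -[2 * pi * `|_|]ger0_norm ?mulr_ge0 // ?ltW // normrM normr_id -normrM.
    have -> : cos `|2 * pi * (u - c%:~R)| = cos (2 * pi * (u - c%:~R)).
      by case: (ler0P (2 * pi * (u - c%:~R))) => _; rewrite ?cosN.
    by rewrite -[RHS](cosD2pi_int _ c); congr cos; ring.
  by rewrite leNgt ltr_cos -?leNgt ?ler_pM2l ?mulr_gt0 // two_pi_itv // ltW.
have D0 := cos_eps_lt1 e0 e1.
have := fej_cos u M0; have l1 := cos_geN1 (2 * pi * (M%:R * u)) => E.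
have f0 := fej_ge0 M u.
rewrite /eta ler_pdivlMr ?mulr_gt0 //.
have : (1 - cos (2 * pi * e)) * (M%:R * fej M u) <= (1 - cos (2 * pi * u)) * (M%:R * fej M u).
  by apply: ler_wpM2r; [rewrite mulr_ge0 // ltW|lra].
rewrite E; lra.
Qed.

Lemma fej_near M e u (c : int) : (0 < M)%N -> 0 < e -> e <= 1 / 2 -> `|u - c%:~R| <= 1 / 2 ->
  `|u - c%:~R| * fej M u <= e * fej M u + eta e M.
Proof.
move=> M0 e0 e1 h; have f0 := fej_ge0 M u; have n0 := eta_ge0 M e0 e1.
have [le|lt] := leP `|u - c%:~R| e.
  by apply: ler_wpDr => //; rewrite ler_wpM2r.
have := fej_far M0 e0 e1 (c := c) (u := u); rewrite (ltW lt) h => /(_ isT) H.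
apply: ler_wpDl; first by rewrite mulr_ge0 // ltW.
by apply: le_trans H; rewrite -[leRHS]mul1r ler_wpM2r //; lra.
Qed.

(** An antiderivative of the kernel. Only the diagonal terms fail to be periodic, and they give mass
    1 per period. *)
Definition fejI M u : R := M%:R^-1 * \sum_(j < M) \sum_(k < M)
  (if j == k then u else sin (2 * pi * ((j%:R - k%:R) * u)) / (2 * pi * (j%:R - k%:R))).

Lemma is_derive_fejI M u : is_derive u 1 (fejI M) (fej M u).
Proof.
pose T (j k : 'I_M) (u : R) : R := if j == k then u else sin (2 * pi * ((j%:R - k%:R) * u)) / (2 * pi * (j%:R - k%:R)).
have -> : fejI M = M%:R^-1 *: \sum_(j < M) \sum_(k < M) T j k.
  apply/funext=> x; rewrite /fejI /= fctE; congr (_ * _); rewrite fct_sumE; apply: eq_bigr => j _.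
  by rewrite fct_sumE.
apply: is_deriveZ; apply: is_derive_sum => j; apply: is_derive_sum => k; rewrite /T.
case: (eqVneq j k) => [->|jk]; first by rewrite subrr mul0r mulr0 cos0; exact: is_derive_id.
have jkN : (j%:R - k%:R : R) != 0 by rewrite subr_eq0 eqr_nat.
have pN : (pi : R) != 0 by rewrite gt_eqF ?pi_gt0.
pose c : R := 2 * pi * (j%:R - k%:R).
have cN : c != 0 by rewrite !mulf_neq0.
have -> : (fun u : R => sin (2 * pi * ((j%:R - k%:R) * u)) / (2 * pi * (j%:R - k%:R))) = c^-1 *: (sin \o (c *: id)).
  apply/funext=> x; rewrite mulrC.
  change ((2 * pi * (j%:R - k%:R))^-1 * sin (2 * pi * ((j%:R - k%:R) * x)) = c^-1 * sin (c * x)).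
  by congr (_ * sin _); rewrite /c; ring.
have -> : cos (2 * pi * ((j%:R - k%:R) * u)) = c^-1 *: (cos (c * u) * (c *: 1)).
  rewrite -[RHS]/(c^-1 * (cos (c * u) * (c * 1))) mulr1 [cos _ * c]mulrC mulKf // /c.
  by congr cos; ring.
by apply: is_deriveZ; apply: is_derive1_comp.
Qed.

Lemma fejI_int M u : (0 < M)%N -> fejI M (u + 1) - fejI M u = 1.
Proof.
move=> M0; have MN : (M%:R : R) != 0 by rewrite pnatr_eq0 -lt0n.
rewrite /fejI -mulrBr -sumrB; apply: (mulfI MN); rewrite mulVKf // mulr1.
rewrite -[in RHS](card_ord M) -sumr_const; apply: eq_bigr => j _.
rewrite -sumrB (bigD1 j) //= eqxx big1 ?addr0; first by ring.
move=> k kj; rewrite eq_sym (negbTE kj); apply/eqP; rewrite subr_eq0; apply/eqP; congr (_ / _).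
rewrite -(sinD2pi_int (2 * pi * ((j%:R - k%:R) * u)) (j%:Z - k%:Z)); congr sin.
by rewrite intrB; ring.
Qed.
End Fejer.

Section Cells.
Variable R : realType.
Local Notation mu := (@lebesgue_measure R).
Variables (N : nat) (t0 : R).
Hypothesis N0 : (0 < N)%N.
Let Nr : 0 < (N%:R : R). Proof. by rewrite ltr0n. Qed.

Lemma derivable_cts (f : R -> R) : (forall x, derivable f x 1) -> continuous f.
Proof. by move=> H x; apply: differentiable_continuous; apply/derivable1_diffP; exact: H. Qed.

Lemma is_derive_cts (f df : R -> R) : (forall x : R, is_derive x 1 f (df x)) -> continuous f.
Proof. by move=> H x; have [d _] := H x; apply: differentiable_continuous; apply/derivable1_diffP. Qed.

Lemma continuous_fej M : continuous (@fej R M).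
Proof.
apply: derivable_cts => u.
have -> : @fej R M = M%:R^-1 *: \sum_(j < M) \sum_(k < M) (cos \o ((2 * pi * (j%:R - k%:R)) *: id)).
  apply/funext=> x; rewrite /fej /= fctE; congr (_ * _); rewrite fct_sumE; apply: eq_bigr => j _.
  by rewrite fct_sumE; apply: eq_bigr => k _; rewrite /= !fctE -[_ *: _]/(_ * _) mulrA.
apply: derivableZ; apply: derivable_sum => j; apply: derivable_sum => k.
apply/derivable1_diffP; apply: differentiable_comp; first by [].
by apply/derivable1_diffP; exact: ex_derive.
Qed.

(** The coordinate v with x = N (t0 + v), in which the arguments of Phi summed in [phiN] sit at the
    integers. *)
Definition vpos (x : R) : R := x / N%:R - t0.
Definition node (c : R) : R := N%:R * (t0 + c).

Lemma vpos_node c : vpos (node c) = c.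
Proof. by rewrite /vpos /node; field; rewrite gt_eqF. Qed.

Lemma node_lt c c' : (node c < node c') = (c < c').
Proof. by rewrite /node ltr_pM2l // ltrD2l. Qed.

Lemma node_le c c' : (node c <= node c') = (c <= c').
Proof. by rewrite /node ler_pM2l // lerD2l. Qed.

Lemma nodeV x : node (vpos x) = x.
Proof. by rewrite /vpos /node; field; rewrite gt_eqF. Qed.

Lemma is_derive_vpos (x : R) : is_derive x 1 vpos N%:R^-1.
Proof.
have -> : vpos = N%:R^-1 *: id + cst (- t0) by apply/funext=> y; rewrite /vpos /= mulrC.
rewrite -[X in is_derive _ _ _ X]addr0 -[X in is_derive _ _ _ (X + _)]mulr1.
by apply: is_deriveD; apply: is_deriveZ; exact: is_derive_id.
Qed.

Lemma continuous_vpos : continuous vpos.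
Proof. exact: is_derive_cts is_derive_vpos. Qed.

Definition ker M (x : R) : R := N%:R^-1 * fej M (vpos x).

Lemma ker_ge0 M x : 0 <= ker M x.
Proof. by rewrite mulr_ge0 ?fej_ge0 // invr_ge0 ltW. Qed.

Lemma ker_le M x : `|ker M x| <= M%:R / N%:R.
Proof. by rewrite normrM gtr0_norm ?invr_gt0 // mulrC ler_pM2r ?invr_gt0 // fej_le. Qed.

Lemma continuous_ker M : continuous (ker M).
Proof.
move=> x; apply: cvgM; first exact: cvg_cst.
apply: (@continuous_comp _ _ _ vpos (@fej R M)); [exact: continuous_vpos|exact: continuous_fej].
Qed.

Lemma integrable_seg (f : R -> R) a b : continuous f -> mu.-integrable `[a, b] (EFin \o f).
Proof.
move=> cf; apply: continuous_compact_integrable; first exact: segment_compact.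
exact: continuous_subspaceT.
Qed.

Lemma int_ker M c : (0 < M)%N -> \int[mu]_(x in `[node (c - 1 / 2), node (c + 1 / 2)]) ker M x = 1.
Proof.
move=> M0; have lt : node (c - 1 / 2) < node (c + 1 / 2) by rewrite node_lt; lra.
have dF (x : R) : is_derive x 1 (fejI M \o vpos) (ker M x).
  by rewrite /ker mulrC; apply: is_derive1_comp; [exact: is_derive_fejI|exact: is_derive_vpos].
have cF : continuous (fejI M \o vpos) by exact: is_derive_cts dF.
rewrite /Rintegral (@continuous_FTC2 _ _ (fejI M \o vpos)) //.
- rewrite -EFinB /= !vpos_node (_ : c + 1 / 2 = c - 1 / 2 + 1); last by lra.
  exact: fejI_int.
- by apply: continuous_subspaceT; exact: continuous_ker.
- split.
  + by move=> x _; have [d _] := dF x.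
  + by apply: cvg_at_right_filter; exact: cF.
  + by apply: cvg_at_left_filter; exact: cF.
by move=> x _; rewrite derive1E; have [_ d] := dF x.
Qed.

Lemma int_cst_cell b c : \int[mu]_(x in `[node (c - 1 / 2), node (c + 1 / 2)]) b = b * N%:R.
Proof.
rewrite Rintegral_cst //; congr (_ * _).
rewrite -[RHS]/(fine (N%:R)%:E); congr fine; apply: etrans; first exact: lebesgue_measure_itv.
rewrite /= lte_fin node_lt ifT; last by lra.
by rewrite -EFinB; congr EFin; rewrite /node; field.
Qed.

(** Within distance e of the node the Lipschitz bound on h is small, and farther away the kernel is
    at most [eta e M]; the mass of the kernel on the cell is exactly 1. *)
Lemma cell_est M e b (h : R -> R) (c : int) : (0 < M)%N -> 0 < e -> e <= 1 / 2 -> 0 <= b -> continuous h ->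
  (forall x, `|vpos x - c%:~R| <= 1 / 2 -> `|h x - h (node c%:~R)| <= b * `|vpos x - c%:~R|) ->
  `|\int[mu]_(x in `[node (c%:~R - 1 / 2), node (c%:~R + 1 / 2)]) (h x * ker M x) - h (node c%:~R)|
   <= b * (e + eta e M).
Proof.
move=> M0 e0 e1 b0 ch Hh; set D := `[_, _]; set h0 := h _.
have cker := @continuous_ker M.
have chk : continuous (fun x => h x * ker M x) by move=> x; apply: cvgM; [exact: ch|exact: cker].
have ck0 : continuous (fun x => h0 * ker M x) by move=> x; apply: cvgM; [exact: cvg_cst|exact: cker].
have cd : continuous (fun x => h x * ker M x - h0 * ker M x) by move=> x; apply: cvgB; [exact: chk|exact: ck0].
have ck1 : continuous (fun x => (b * e) * ker M x) by move=> x; apply: cvgM; [exact: cvg_cst|exact: cker].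
have cc : continuous (fun x : R => b * (eta e M / N%:R)) by move=> x; exact: cvg_cst.
have ck2 : continuous (fun x => (b * e) * ker M x + b * (eta e M / N%:R)) by move=> x; apply: cvgD; [exact: ck1|exact: cc].
have mD : measurable (D : set R) by exact: measurable_itv.
have -> : \int[mu]_(x in D) (h x * ker M x) - h0 = \int[mu]_(x in D) (h x * ker M x - h0 * ker M x).
  rewrite RintegralB //; [|exact: integrable_seg|exact: integrable_seg].
  by rewrite RintegralZl ?int_ker ?mulr1 //; exact: integrable_seg.
apply: le_trans (le_normr_Rintegral _ _) _ => //; first exact: integrable_seg.
have -> : b * (e + eta e M) = \int[mu]_(x in D) ((b * e) * ker M x + b * (eta e M / N%:R)).
  rewrite RintegralD //; [|exact: integrable_seg|exact: integrable_seg].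
  rewrite RintegralZl //; last exact: integrable_seg.
  by rewrite int_ker // int_cst_cell mulr1 mulrDr -mulrA divfK ?gt_eqF.
apply: le_Rintegral => //; [|exact: integrable_seg|].
  by apply: integrable_seg => x; apply: cvg_norm; exact: cd.
move=> x; rewrite /D /= in_itv /= -[x]nodeV !node_le => /andP[x1 x2].
have vx : `|vpos x - c%:~R| <= 1 / 2 by rewrite ler_norml; apply/andP; split; lra.
rewrite -mulrBl normrM (ger0_norm (ker_ge0 _ _)); rewrite nodeV in x1 x2 *.
apply: (@le_trans _ _ (b * `|vpos x - c%:~R| * ker M x)); first by rewrite ler_wpM2r ?ker_ge0 ?Hh.
have := fej_near M0 e0 e1 vx; rewrite /ker; set A := `|_|; set G := fej _ _ => H.
have -> : b * A * (N%:R^-1 * G) = b / N%:R * (A * G) by ring.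
have -> : b * e * (N%:R^-1 * G) + b * (eta e M / N%:R) = b / N%:R * (e * G + eta e M) by ring.
by rewrite ler_wpM2l // mulr_ge0 // invr_ge0 ltW.
Qed.

Lemma int_split (f : R -> R) (y : nat -> R) n : continuous f -> (forall i, y i <= y i.+1) ->
  \int[mu]_(x in `[y 0%N, y n]) f x = \sum_(i < n) \int[mu]_(x in `[y i, y i.+1]) f x.
Proof.
move=> cf yi; elim: n => [|n IH]; first by rewrite big_ord0 set_itv1 Rintegral_set1.
have y0n : y 0%N <= y n by elim: n {IH} => // n IH; exact: le_trans (yi n).
rewrite big_ord_recr /= -IH.
have := @Rintegral_itvB R f (BLeft (y 0%N)) (BRight (y n.+1)) (y n) (integrable_seg _ _ cf).
rewrite !bnd_simp => /(_ y0n (yi n)) /eqP; rewrite subr_eq addrC => /eqP ->; congr (_ + _).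
rewrite Rintegral_itv_obnd_cbnd //.
apply: (@integrableS _ _ _ mu `[y n, y n.+1]) => //; [exact: subset_itv_oc_cc|exact: integrable_seg].
Qed.
End Cells.

Section SymSum.
Variable V : zmodType.
Definition sy J (F : int -> V) : V := \sum_(a < (2 * J).+1) F (a%:Z - J%:Z).

Lemma sy0 F : sy 0 F = F 0.
Proof. by rewrite /sy muln0 big_ord_recl big_ord0 addr0. Qed.

Lemma syS J F : sy J.+1 F = sy J F + (F J.+1%:Z + F (- J.+1%:Z)).
Proof.
rewrite /sy (_ : (2 * J.+1).+1 = (2 * J).+3)%N; last by lia.
rewrite big_ord_recl big_ord_recr /= [LHS]addrC -[LHS]addrA; congr (_ + _).
  by apply: eq_bigr => i _; congr F; rewrite /= /bump /=; lia.
by congr (F _ + F _); rewrite /bump /=; lia.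
Qed.

Lemma sy_tail J J' F : (J <= J')%N -> sy J' F = sy J F + \sum_(J <= i < J') (F i.+1%:Z + F (- i.+1%:Z)).
Proof.
move=> le; rewrite -(subnKC le); elim: (J' - J)%N => [|k IH].
  by rewrite addn0 big_geq // addr0.
by rewrite addnS syS IH big_nat_recr ?leq_addr //= -[LHS]addrA.
Qed.

Lemma sy_D J F G : sy J (fun c => F c + G c) = sy J F + sy J G.
Proof. exact: big_split. Qed.

Lemma sy_B J F G : sy J (fun c => F c - G c) = sy J F - sy J G.
Proof. exact: sumrB. Qed.
End SymSum.

Section SymReal.
Variable R : realType.
Implicit Types F G : int -> R.

Lemma sy_le J F G : (forall c, F c <= G c) -> sy J F <= sy J G.
Proof. by move=> H; apply: ler_sum => i _. Qed.

Lemma sy_norm (V : numDomainType) (W : normedZmodType V) J (F : int -> W) : `|sy J F| <= sy J (fun c => `|F c|).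
Proof. exact: ler_norm_sum. Qed.

Lemma sy_Zl (V : pzRingType) J b (F : int -> V) : sy J (fun c => b * F c) = b * sy J F.
Proof. by rewrite /sy mulr_sumr. Qed.

(** Telescoping: each of the two signs contributes at most 2 / (n + 1) - 2 / (n + 2) at n + 1. *)
Lemma wt_tail J J' : (J <= J')%N -> \sum_(J <= i < J') (wt (i.+1%:Z%:~R : R) + wt (- i.+1%:Z)%:~R) <= 4 / J.+1%:R.
Proof.
move=> le.
suff : \sum_(J <= i < J') (wt (i.+1%:Z%:~R : R) + wt (- i.+1%:Z)%:~R) <= 4 / J.+1%:R - 4 / J'.+1%:R.
  by move/le_trans; apply; rewrite gerBl divr_ge0.
rewrite -(subnKC le); elim: (J' - J)%N => [|k IH]; first by rewrite addn0 big_geq // subrr.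
rewrite addnS big_nat_recr ?leq_addr //=; set n := (J + k)%N in IH *.
apply: le_trans (lerD IH (lexx _)) _.
have n1 : 0 < (n.+1%:R : R) by rewrite ltr0n.
have n2 : 0 < (n.+2%:R : R) by rewrite ltr0n.
suff H : wt (n.+1%:R : R) <= 2 / n.+1%:R - 2 / n.+2%:R.
  have -> : wt ((- n.+1%:Z)%:~R) = wt (n.+1%:R : R) by rewrite /wt mulrNz sqrrN.
  rewrite -pmulrn; move: H; set w := wt _; set a := (n.+1%:R)^-1; set b := (n.+2%:R)^-1; set c := (J.+1%:R)^-1.
  by clear; lra.
have -> : 2 / n.+1%:R - 2 / n.+2%:R = 2 / (n.+1%:R * n.+2%:R) :> R.
  move: n2; rewrite -[n.+2%:R]natr1; move: (n.+1%:R : R) n1 => a a0 b0.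
  by field; rewrite !gt_eqF.
rewrite /wt ler_pdivlMr ?mulr_gt0 // mulrC ler_pdivrMr ?ltr_pwDl ?sqr_ge0 //.
by rewrite -[n.+2%:R]natr1; nra.
Qed.

Lemma sy_wt J : sy J (fun c => wt (c%:~R : R)) <= 5.
Proof.
rewrite (sy_tail _ (leq0n J)) sy0; apply: le_trans (lerD (lexx _) (wt_tail (leq0n J))) _.
by have := wt_le1 (0%:~R : R); lra.
Qed.
End SymReal.

Section Line.
Variable R : realType.
Local Notation mu := (@lebesgue_measure R).
Variables (N : nat) (t0 : R).
Hypothesis N0 : (0 < N)%N.
Let Nr : 0 < (N%:R : R). Proof. by rewrite ltr0n. Qed.
Local Notation vpos := (vpos N t0).
Local Notation node := (node N t0).
Local Notation ker := (ker N t0).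

Lemma cvg_close (u : nat -> R) (l s K : R) J : u n @[n --> \oo] --> l -> (forall n, (J <= n)%N -> `|u n - s| <= K) ->
  `|l - s| <= K.
Proof.
move=> cu H; apply/ler_addgt0Pl => e e0.
have [n Jn un] : exists2 n, (J <= n)%N & `|l - u n| <= e.
  have /cvgrPdist_le /(_ e e0) [M _ HM] := cu.
  by exists (maxn J M); [exact: leq_maxl|apply: HM; exact: leq_maxr].
rewrite (_ : l - s = (l - u n) + (u n - s)); last by ring.
by apply: le_trans (ler_normD _ _) (lerD un (H n Jn)).
Qed.

Definition block J : set R := `[node (- J%:R - 1 / 2), node (J%:R + 1 / 2)].

Lemma cvg_block (f : R -> R) : mu.-integrable setT (EFin \o f) ->
  \int[mu]_(x in block J) f x @[J --> \oo] --> \int[mu]_x f x.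
Proof.
move=> fi; have fin : (\int[mu]_x (f x)%:E)%E \is a fin_num by exact: integrable_fin_num.
have mB J : measurable (block J) by exact: measurable_itv.
apply: fine_cvg; rewrite fineK //.
have -> : (fun J => \int[mu]_(x in block J) (f x)%:E)%E = (fun J => \int[mu]_x ((EFin \o f) \_ (block J)) x)%E.
  by apply/funext => J; rewrite integral_mkcond.
apply: (@dominated_cvg _ _ _ mu setT measurableT _ _ (fun x => `|f x|%:E)%E).
- move=> J; apply: (measurable_restrictT _ (mB J)).1.
  by apply: measurable_funTS; exact: (measurable_int _ fi).
- move=> x _; apply: cvg_near_cst.
  have [n hn] : exists n : nat, `|vpos x| <= n%:R.
    by exists (Num.Def.archi_bound `|vpos x|); rewrite ltW // archi_boundP.
  exists n => //= m /= nm; rewrite patchE ifT //.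
  rewrite inE /block /= in_itv /= -[x](nodeV t0 N0) !node_le //.
  have : (n%:R : R) <= m%:R by rewrite ler_nat.
  by move: hn; rewrite ler_norml => /andP[h1 h2] h3; apply/andP; split; lra.
- by [].
- have := integrable_abse fi; apply: eq_integrable => //.
move=> n x _; rewrite patchE; by case: ifP => _ //=; rewrite normr0 lee_fin.
Qed.

Variables (h : R -> R) (B : R) (M : nat).
Hypotheses (M0 : (0 < M)%N) (B0 : 0 <= B) (ch : continuous h).
Hypothesis (hb : forall x, `|h x| <= B * wt (vpos x)).
Hypothesis (hl : forall x x', `|vpos x - vpos x'| <= 1 / 2 -> `|h x - h x'| <= B * wt (vpos x') * `|vpos x - vpos x'|).
Hypothesis (hi : mu.-integrable setT (EFin \o (fun x => h x * ker M x))).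

(** Integration against the periodized kernel nearly samples h at the nodes. The cell errors carry
    the weights wt c, of total at most 5, and the nodes beyond J cost the tail 4 / (J + 1). *)
Lemma fejer_line e J : 0 < e -> e <= 1 / 2 ->
  `|\int[mu]_x (h x * ker M x) - sy J (fun c => h (node c%:~R))| <= B * (5 * (e + eta e M) + 4 / J.+1%:R).
Proof.
move=> e0 e1; apply: (cvg_close (cvg_block hi) (J := J)) => n Jn.
have ck : continuous (fun x => h x * ker M x) by move=> x; apply: cvgM; [exact: ch|exact: continuous_ker].
have eta0 := eta_ge0 M e0 e1.
pose y i := node (i%:R - n%:R - 1 / 2).
have E : \int[mu]_(x in block n) (h x * ker M x) =
  sy n (fun c => \int[mu]_(x in `[node (c%:~R - 1 / 2), node (c%:~R + 1 / 2)]) (h x * ker M x)).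
  have -> : block n = `[y 0%N, y (2 * n).+1].
    have -> : y 0%N = node (- n%:R - 1 / 2) by rewrite /y sub0r.
    suff -> : y (2 * n).+1 = node (n%:R + 1 / 2) by [].
    by rewrite /y; congr (node _); rewrite -[(2 * n).+1%:R]natr1 natrM; lra.
  rewrite (int_split _ ck) => [|i]; last by rewrite node_le // -natr1; lra.
  apply: eq_bigr => i _; have -> : y i = node ((i%:Z - n%:Z)%:~R - 1 / 2) by rewrite /y intrB.
  suff -> : y i.+1 = node ((i%:Z - n%:Z)%:~R + 1 / 2) by [].
  by rewrite /y intrB -!pmulrn; congr (node _); rewrite -[i.+1%:R]natr1; lra.
rewrite E mulrDr -[X in `|X|](subrKA (sy n (fun c => h (node c%:~R)))).
apply: le_trans (ler_normD _ _) _; apply: lerD.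
  rewrite -sy_B; apply: le_trans (sy_norm _ _) _.
  apply: (@le_trans _ _ (sy n (fun c => B * (e + eta e M) * wt c%:~R))).
    apply: sy_le => c; rewrite mulrAC; apply: cell_est => //.
    - by rewrite mulr_ge0 // wt_ge0.
    by move=> x hx; have := hl (x := x) (x' := node c%:~R); rewrite vpos_node //; apply.
  rewrite sy_Zl [5 * _]mulrC mulrA; apply: ler_wpM2l; last exact: sy_wt.
  by rewrite mulr_ge0 // addr_ge0 // ltW.
rewrite (sy_tail _ Jn) addrAC subrr add0r.
apply: le_trans (ler_norm_sum _ _ _) _.
apply: (@le_trans _ _ (B * \sum_(J <= i < n) (wt (i.+1%:Z%:~R) + wt (- i.+1%:Z)%:~R))).
  rewrite mulr_sumr; apply: ler_sum => i _; apply: le_trans (ler_normD _ _) _; rewrite mulrDr.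
  by apply: lerD; apply: le_trans (hb _) _; rewrite vpos_node.
by rewrite ler_wpM2l // wt_tail.
Qed.
End Line.

Lemma Rintegral_sum (d : measure_display) (T : measurableType d) (R : realType) (m : {measure set T -> \bar R})
  (D : set T) (I : Type) (r : seq I) (f : I -> T -> R) : measurable D ->
  (forall i, m.-integrable D (EFin \o f i)) ->
  m.-integrable D (EFin \o (fun x => \sum_(i <- r) f i x)) /\
  \int[m]_(x in D) (\sum_(i <- r) f i x) = \sum_(i <- r) \int[m]_(x in D) f i x.
Proof.
move=> mD H; elim: r => [|i r [IH1 IH2]].
  split; last by rewrite big_nil /Rintegral; under eq_integral do rewrite big_nil; rewrite integral0.
  have := @integrable0 _ _ R m D; apply: eq_integrable => // x _ /=; by rewrite big_nil.
have E : (fun x => \sum_(j <- i :: r) f j x) = (fun x => f i x + \sum_(j <- r) f j x).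
  by apply/funext=> x; rewrite big_cons.
split.
  rewrite E; have := integrableD mD (H i) IH1; apply: eq_integrable => // x _ /=; by rewrite EFinD.
by rewrite E RintegralD // IH2 big_cons.
Qed.

Section Fubini2.
Variable R : realType.
Local Notation mu := (@lebesgue_measure R).
Local Notation mu2 := (@mu2 R).

Lemma Rfubini (f : R * R -> R) : mu2.-integrable setT (EFin \o f) ->
  (forall x, mu.-integrable setT (EFin \o (fun y => f (x, y)))) ->
  mu.-integrable setT (EFin \o (fun x => \int[mu]_y f (x, y))) /\
  Rintegral mu2 setT f = \int[mu]_x \int[mu]_y f (x, y).
Proof.
move=> fi fy.
have E x : (\int[mu]_y f (x, y))%:E = fubini_F mu (EFin \o f) x.
  by rewrite /fubini_F /Rintegral fineK //; exact: integrable_fin_num (fy x).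
split.
  have := @integrable_fubini_F _ _ _ _ _ mu mu _ fi; apply: eq_integrable => // y _ /=; by rewrite E.
rewrite {1}/Rintegral -[X in fine X](@integral12_prod_meas1 _ _ _ _ _ mu mu _ fi).
by rewrite {1}/Rintegral; congr fine; apply: eq_integral => x _; rewrite E.
Qed.
End Fubini2.

Section Poisson.
Variable R : realType.
Local Notation mu := (@lebesgue_measure R).
Local Notation mu2 := (@mu2 R).
Variables (N : nat) (t0 s0 : R).
Hypothesis N0 : (0 < N)%N.
Let Nr : 0 < (N%:R : R). Proof. by rewrite ltr0n. Qed.
Local Notation v := (vpos N t0).
Local Notation w := (vpos N s0).
Local Notation k1 := (ker N t0).
Local Notation k2 := (ker N s0).
Variables (g : R -> R -> R) (K : R).
Hypotheses (K0 : 0 <= K) (c1 : forall s, continuous (g^~ s)) (c2 : forall t, continuous (g t)).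
Hypothesis gb : forall x y, `|g x y| <= K * wt x * wt y.
Hypothesis gbv : forall x y, `|g x y| <= K * wt (v x) * wt (w y).
Hypothesis g1 : forall x x' y, `|v x - v x'| <= 1 / 2 -> `|g x y - g x' y| <= K * wt (v x') * wt (w y) * `|v x - v x'|.
Hypothesis g2 : forall x y y', `|w y - w y'| <= 1 / 2 -> `|g x y - g x y'| <= K * wt (v x) * wt (w y') * `|w y - w y'|.

Lemma wt_vpos_le (r x : R) : wt x <= (2 + 2 * r ^+ 2) * wt (vpos N r x) /\ wt (vpos N r x) <= (2 * N%:R ^+ 2 * (1 + r ^+ 2)) * wt x.
Proof.
have p1 (a : R) : 0 < 1 + a ^+ 2 by rewrite ltr_pwDl ?sqr_ge0.
have N1 : 1 <= (N%:R : R) by rewrite ler1n.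
have xE : x = N%:R * (vpos N r x + r) by rewrite /vpos; field; rewrite gt_eqF.
set z := vpos N r x in xE *; rewrite {}xE /wt; split.
  rewrite ler_pdivlMr // mulrC ler_pdivrMr //.
  have : (z + r) ^+ 2 <= (N%:R * (z + r)) ^+ 2 by rewrite exprMn ler_peMl ?sqr_ge0 // expr_ge1 // ler0n.
  have := sqr_ge0 (z + 2 * r); have := sqr_ge0 ((z + r) * r); have := sqr_ge0 (N%:R * (z + r) * r); nra.
rewrite ler_pdivlMr // mulrC ler_pdivrMr // exprMn.
have : 1 <= (N%:R : R) ^+ 2 by rewrite expr_ge1 // ler0n.
set n := (N%:R : R) ^+ 2 => n1; have n0 : 0 <= n by lra.
have h1 : 1 + n * (z + r) ^+ 2 <= n * (1 + (z + r) ^+ 2) by rewrite mulrDr mulr1 lerD2r.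
apply: le_trans h1 _; rewrite [2 * n]mulrC -!mulrA ler_wpM2l //.
have := sqr_ge0 (z - r); have := sqr_ge0 (z * r); nra.
Qed.

Lemma ker_integrable r (h : R -> R) B M : continuous h -> (forall x, `|h x| <= B * wt x) ->
  mu.-integrable setT (EFin \o (fun x => h x * ker N r M x)).
Proof.
move=> ch hb; apply: (@integrable1_le _ _ (B * (M%:R / N%:R))).
  apply: continuous_measurable_fun => x; apply: cvgM; [exact: ch|exact: continuous_ker].
move=> x; rewrite normrM mulrAC; apply: ler_pM => //; exact: ker_le.
Qed.

Lemma wt_lip (a b : R) : `|a - b| <= 1 / 2 -> `|wt a - wt b| <= 2 * wt b * `|a - b|.
Proof.
move=> ab; have p1 (z : R) : 0 < 1 + z ^+ 2 by rewrite ltr_pwDl ?sqr_ge0.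
have -> : wt a - wt b = wt b * ((b - a) * ((b + a) * wt a)) by rewrite /wt; field; rewrite !gt_eqF.
rewrite !normrM (ger0_norm (wt_ge0 b)) (ger0_norm (wt_ge0 a)) distrC.
have -> : 2 * wt b * `|a - b| = wt b * (`|a - b| * 2) by ring.
apply: ler_wpM2l; first exact: wt_ge0.
apply: ler_wpM2l => //; rewrite /wt ler_pdivrMr //.
have -> : b + a = 2 * a - (a - b) by ring.
apply: le_trans (ler_normB _ _) _; rewrite normrM (@ger0_norm _ 2) //.
have := sqr_ge0 (`|a| - 1 / 2); rewrite -[a ^+ 2]real_normK ?num_real //; nra.
Qed.

Lemma wt_ker M e : (0 < M)%N -> 0 < e -> e <= 1 / 2 ->
  \int[mu]_y (wt (v y) * k1 M y) <= 9 + 10 * (e + eta e M) /\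
  mu.-integrable setT (EFin \o (fun y => wt (v y) * k1 M y)).
Proof.
move=> M0 e0 e1.
have cw : continuous (fun y => wt (v y)).
  move=> y; apply: (@continuous_comp _ _ _ v (@wt R)); [exact: continuous_vpos|exact: continuous_wt].
have wi : mu.-integrable setT (EFin \o (fun y => wt (v y) * k1 M y)).
  apply: (@ker_integrable t0 _ (2 * N%:R ^+ 2 * (1 + t0 ^+ 2))) => // y.
  by rewrite ger0_norm ?wt_ge0 //; have [] := wt_vpos_le t0 y.
split=> //.
have wb (x : R) : `|wt (v x)| <= 2 * wt (v x) by have h := wt_ge0 (v x); rewrite ger0_norm //; lra.
(* With J = 0 and B = 2, only the node 0 is kept, and the bound is 1 + 2 (5 (e + eta) + 4). *)
have := @fejer_line R N t0 N0 (fun y => wt (v y)) 2 M M0 _ cw wb (fun x x' => @wt_lip (v x) (v x')) wi e 0%N e0 e1.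
rewrite sy0 vpos_node // => /(_ (ler0n _ _)).
rewrite ler_norml => /andP[_]; have := wt_le1 (0 : R).
rewrite -[0%:~R]/(0 : R) divr1; lra.
Qed.

Definition kk M (z : R * R) : R := k1 M z.1 * k2 M z.2.

Lemma measurable_gkk M : measurable_fun [set: R * R] (fun z => g z.1 z.2 * kk M z).
Proof.
apply: (measurable_sep (g := fun x y => g x y * (k1 M x * k2 M y))) => [y x|x y].
  apply: cvgM; first exact: c1.
  by apply: cvgM; [exact: continuous_ker|exact: cvg_cst].
apply: cvgM; first exact: c2.
by apply: cvgM; [exact: cvg_cst|exact: continuous_ker].
Qed.

Lemma integrable_gkk M : mu2.-integrable setT (EFin \o (fun z => g z.1 z.2 * kk M z)).
Proof.
apply: (@integrable2_le _ _ (K * ((M%:R / N%:R) * (M%:R / N%:R)))); first exact: measurable_gkk.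
move=> [x y] /=; rewrite normrM normrM mulrAC; apply: ler_pM => //; first by rewrite /wt2 mulrA; exact: gb.
by apply: ler_pM => //; exact: ker_le.
Qed.

(** The estimate on the line is used in y, uniformly in x, then in x at each node of the second
    variable. The first error is integrated against [wt (v x)] and the kernel, which costs 9 + 10 (e
    + eta); the second is summed over the nodes, which costs 5. *)
Lemma poisson_est M e J : (0 < M)%N -> 0 < e -> e <= 1 / 2 ->
  `|Rintegral mu2 setT (fun z => g z.1 z.2 * kk M z) -
    sy J (fun c => sy J (fun c' => g (node N t0 c%:~R) (node N s0 c'%:~R)))|
  <= K * (5 * (e + eta e M) + 4 / J.+1%:R) * (14 + 10 * (e + eta e M)).
Proof.
move=> M0 e0 e1; set u := 5 * _ + _.
have eta0 := eta_ge0 M e0 e1.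
have u0 : 0 <= u by rewrite addr_ge0 ?divr_ge0 // mulr_ge0 // addr_ge0 // ltW.
have gy x : mu.-integrable setT (EFin \o (fun y => g x y * k2 M y)).
  by apply: (@ker_integrable s0 _ (K * wt x)) => //; exact: c2.
have gx y : mu.-integrable setT (EFin \o (fun x => g x y * k1 M x)).
  by apply: (@ker_integrable t0 _ (K * wt y)) => [|x]; [exact: c1|rewrite mulrAC; exact: gb].
have E0 x y : g x y * kk M (x, y) = k1 M x * (g x y * k2 M y) by rewrite /kk /=; ring.
have fy x : mu.-integrable setT (EFin \o (fun y => g x y * kk M (x, y))).
  have := @integrableZl _ _ R mu setT measurableT (k1 M x) _ (gy x).
  by apply: eq_integrable => // y _ /=; rewrite -EFinM E0.
have [Fi ->] := Rfubini (integrable_gkk M) fy.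
pose G x := \int[mu]_y (g x y * k2 M y).
have EG x : \int[mu]_y (g x y * kk M (x, y)) = G x * k1 M x.
  rewrite mulrC -RintegralZl //.
  by apply: eq_Rintegral => y _; exact: E0.
pose S x := sy J (fun c' => g x (node N s0 c'%:~R)).
have Gi : mu.-integrable setT (EFin \o (fun x => G x * k1 M x)).
  by move: Fi; apply: eq_integrable => // x _ /=; rewrite EG.
have -> : \int[mu]_x \int[mu]_y (g x y * kk M (x, y)) = \int[mu]_x (G x * k1 M x).
  by apply: eq_Rintegral => x _; exact: EG.
have [Si ES] := @Rintegral_sum _ _ R mu setT _ (index_enum 'I_(2 * J).+1)
  (fun a x => g x (node N s0 (a%:Z - J%:Z)%:~R) * k1 M x) measurableT (fun a => gx _).
have SE x : \sum_(a <- index_enum 'I_(2 * J).+1) g x (node N s0 (a%:Z - J%:Z)%:~R) * k1 M x = S x * k1 M x.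
  by rewrite /S /sy mulr_suml.
have {}Si : mu.-integrable setT (EFin \o (fun x => S x * k1 M x)).
  by move: Si; apply: eq_integrable => // x _ /=; rewrite SE.
have {}ES : \int[mu]_x (S x * k1 M x) = sy J (fun c' => \int[mu]_x (g x (node N s0 c'%:~R) * k1 M x)).
  by rewrite -[RHS]ES; apply: eq_Rintegral => x _; rewrite SE.
have GS x : `|G x - S x| <= K * wt (v x) * u.
  apply: (@fejer_line R N s0 N0 (g x) (K * wt (v x)) M M0) => //.
  - by rewrite mulr_ge0 // wt_ge0.
  by move=> y y'; exact: g2.
have [Q1 Q2] := wt_ker M0 e0 e1.
have P1 : `|\int[mu]_x (G x * k1 M x) - \int[mu]_x (S x * k1 M x)| <= K * u * (9 + 10 * (e + eta e M)).
  rewrite -RintegralB //.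
  have di := integrableB measurableT Gi Si.
  have {}di : mu.-integrable setT (EFin \o (fun x => G x * k1 M x - S x * k1 M x)).
    by move: di; apply: eq_integrable => // x _ /=; rewrite EFinB.
  apply: le_trans (le_normr_Rintegral _ di) _ => //.
  apply: le_trans (ler_wpM2l (mulr_ge0 K0 u0) Q1).
  rewrite -RintegralZl //; apply: le_Rintegral => //.
  - by have := integrable_abse di; apply: eq_integrable => // x _.
  - have := @integrableZl _ _ R mu setT measurableT (K * u) _ Q2.
    by apply: eq_integrable => // x _ /=; rewrite EFinM.
  move=> x _; rewrite -mulrBl normrM (ger0_norm (ker_ge0 _ _ _ _)) mulrA.
  by apply: ler_wpM2r; [exact: ker_ge0|rewrite mulrAC].
have P2 : `|\int[mu]_x (S x * k1 M x) - sy J (fun c => sy J (fun c' => g (node N t0 c%:~R) (node N s0 c'%:~R)))| <= K * u * 5.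
  rewrite {1}/sy exchange_big /= -[X in _ - X]/(sy J (fun c' => sy J (fun c => g (node N t0 c%:~R) (node N s0 c'%:~R)))).
  rewrite ES -sy_B; apply: le_trans (sy_norm _ _) _.
  apply: (@le_trans _ _ (sy J (fun c => K * u * wt c%:~R))); last first.
    by rewrite sy_Zl; apply: ler_wpM2l; [rewrite mulr_ge0|exact: sy_wt].
  apply: sy_le => c; rewrite mulrAC.
  apply: (@fejer_line R N t0 N0 (g^~ (node N s0 c%:~R)) (K * wt c%:~R) M M0) => //.
  - by rewrite mulr_ge0 // wt_ge0.
  - by move=> x; rewrite mulrAC; apply: le_trans (gbv _ _) _; rewrite vpos_node.
  by move=> x x' /(g1 (node N s0 c%:~R)); rewrite vpos_node // [K * wt c%:~R * _]mulrAC.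
rewrite -[X in `|X|](subrKA (\int[mu]_x (S x * k1 M x))).
apply: le_trans (ler_normD _ _) _; apply: le_trans (lerD P1 P2) _.
by rewrite -mulrDr (_ : 9 + 10 * (e + eta e M) + 5 = 14 + 10 * (e + eta e M)) //; ring.
Qed.
End Poisson.

Section Schwartz.
Variable R : realType.
Variable g : R -> R -> R.
Hypothesis Sg : schwartz2R g.

Lemma schwartz_wt l : exists2 C : R, 0 <= C & forall x y, `|iter_pd l g x y| <= C * wt x * wt y.
Proof.
have [_ H] := Sg l.
have [m0 H0] := H 0%N 0%N; have [m1 H1] := H 2%N 0%N; have [m2 H2] := H 0%N 2%N; have [m3 H3] := H 2%N 2%N.
have K x y : (1 + x ^+ 2) * (1 + y ^+ 2) * `|iter_pd l g x y| <= m0 + m1 + m2 + m3.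
  have := H0 x y; have := H1 x y; have := H2 x y; have := H3 x y.
  rewrite !expr0 ?mulr1 ?mul1r !real_normK ?num_real //; set a := `|_| => h3 h2 h1 h0; lra.
exists (m0 + m1 + m2 + m3).
  by apply: le_trans (K 0 0); rewrite !mulr_ge0 // addr_ge0 // sqr_ge0.
move=> x y; have p1 (a : R) : 0 < 1 + a ^+ 2 by rewrite ltr_pwDl ?sqr_ge0.
by rewrite /wt -mulrA -invfM ler_pdivlMr ?mulr_gt0 // mulrC; exact: K.
Qed.

Lemma schwartz_c1 s : continuous (g^~ s).
Proof.
move=> t; apply: differentiable_continuous; apply/derivable1_diffP.
by have [H _] := Sg [::]; exact: (H true t s).
Qed.

Lemma schwartz_c2 t : continuous (g t).
Proof.
move=> s; apply: differentiable_continuous; apply/derivable1_diffP.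
by have [H _] := Sg [::]; exact: (H false t s).
Qed.

Lemma mvt_bound (h h' : R -> R) (x x' b : R) : (forall t, derivable h t 1) -> (forall t, derive1 h t = h' t) ->
  continuous h -> (forall t, Num.min x x' <= t <= Num.max x x' -> `|h' t| <= b) -> `|h x - h x'| <= b * `|x - x'|.
Proof.
move=> dh hE ch; wlog le : x x' / x' <= x.
  move=> W hb; case: (leP x' x) => [le|/ltW le]; first exact: W.
  by rewrite distrC [`|x - x'|]distrC; apply: W => // t; rewrite minC maxC; exact: hb.
move=> hb; have [|c] := @MVT_segment R h h' x' x le _ (continuous_subspaceT ch).
  by move=> t _; apply: DeriveDef => //; rewrite -derive1E hE.
rewrite in_itv /= => cx ->; rewrite normrM ler_wpM2r //; apply: hb.
by rewrite (min_idPr le) (max_idPl le).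
Qed.

Variables (N : nat) (t0 s0 : R).
Hypothesis N0 : (0 < N)%N.
Let Nr : 0 < (N%:R : R). Proof. by rewrite ltr0n. Qed.

Lemma wt_near (a b : R) : `|a - b| <= 1 / 2 -> wt a <= 2 * wt b.
Proof.
move=> ab; have p1 (z : R) : 0 < 1 + z ^+ 2 by rewrite ltr_pwDl ?sqr_ge0.
rewrite /wt ler_pdivlMr // mulrC ler_pdivrMr //.
have : (a - b) ^+ 2 <= 1 / 4.
  by rewrite -[(a - b) ^+ 2]real_normK ?num_real //; have := normr_ge0 (a - b); nra.
have := sqr_ge0 (2 * a - b); nra.
Qed.

Lemma vposB (r x x' : R) : x - x' = N%:R * (vpos N r x - vpos N r x').
Proof. by rewrite /vpos; field; rewrite gt_eqF. Qed.

Lemma vpos_between (r x x' t : R) : `|vpos N r x - vpos N r x'| <= 1 / 2 -> Num.min x x' <= t <= Num.max x x' ->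
  `|vpos N r t - vpos N r x'| <= 1 / 2.
Proof.
move=> h /andP[h1 h2].
have vle (a b : R) : a <= b -> vpos N r a <= vpos N r b by move=> ab; rewrite /vpos lerD2r ler_pM2r ?invr_gt0.
case: (leP x x') h1 h2 => [le h1 h2|/ltW le h1 h2].
  apply: le_trans h; rewrite ler_norml; have := vle _ _ h1; have := vle _ _ h2.
  rewrite ler0_norm; last by rewrite subr_le0; exact: vle.
  by move=> a b; apply/andP; split; lra.
apply: le_trans h; rewrite ler_norml; have := vle _ _ h1; have := vle _ _ h2.
rewrite ger0_norm; last by rewrite subr_ge0; exact: vle.
by move=> a b; apply/andP; split; lra.
Qed.

Lemma schwartz_poisson : exists2 K : R, 0 <= K & [/\
  forall x y, `|g x y| <= K * wt x * wt y,
  forall x y, `|g x y| <= K * wt (vpos N t0 x) * wt (vpos N s0 y),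
  forall x x' y, `|vpos N t0 x - vpos N t0 x'| <= 1 / 2 ->
    `|g x y - g x' y| <= K * wt (vpos N t0 x') * wt (vpos N s0 y) * `|vpos N t0 x - vpos N t0 x'| &
  forall x y y', `|vpos N s0 y - vpos N s0 y'| <= 1 / 2 ->
    `|g x y - g x y'| <= K * wt (vpos N t0 x) * wt (vpos N s0 y') * `|vpos N s0 y - vpos N s0 y'|].
Proof.
have [C0 C00 H0] := schwartz_wt [::].
have [C1 C10 H1] := schwartz_wt [:: true].
have [C2 C20 H2] := schwartz_wt [:: false].
have [D _] := Sg [::].
pose C := C0 + C1 + C2; have C_0 : 0 <= C by rewrite !addr_ge0.
pose a := 2 + 2 * t0 ^+ 2; pose b := 2 + 2 * s0 ^+ 2.
have a2 : 2 <= a by rewrite lerDl mulr_ge0 ?sqr_ge0.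
have b2 : 2 <= b by rewrite lerDl mulr_ge0 ?sqr_ge0.
have wv x : wt x <= a * wt (vpos N t0 x) by have [] := wt_vpos_le N0 t0 x.
have ww y : wt y <= b * wt (vpos N s0 y) by have [] := wt_vpos_le N0 s0 y.
have N1 : 1 <= (N%:R : R) by rewrite ler1n.
(* The factors a and b move the weights from x and y to their rescaled coordinates; 2 comes from
   [wt_near] and N from the change of variable in the mean value bound. *)
pose K := 2 * N%:R * (C * (a * b)).
have cab : 0 <= C * (a * b) by rewrite !mulr_ge0 //; lra.
have KC : C * (a * b) <= K by rewrite -[leLHS]mul1r ler_wpM2r //; lra.
have K1 : C <= K by apply: le_trans KC; rewrite ler_peMr //; nra.
have up (c : R) x y : c <= C -> c * wt x * wt y <= C * (a * b) * wt (vpos N t0 x) * wt (vpos N s0 y).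
  move=> cC; have -> : C * (a * b) * wt (vpos N t0 x) * wt (vpos N s0 y) = C * ((a * wt (vpos N t0 x)) * (b * wt (vpos N s0 y))) by ring.
  rewrite -mulrA; apply: (@le_trans _ _ (C * (wt x * wt y))); first by rewrite ler_wpM2r // mulr_ge0 ?wt_ge0.
  by rewrite ler_wpM2l // ler_pM ?wt_ge0.
exists K; first exact: le_trans cab KC.
split.
- move=> x y; apply: le_trans (H0 x y) _; rewrite -[leLHS]mulrA -[leRHS]mulrA; apply: ler_wpM2r; first by rewrite mulr_ge0 ?wt_ge0.
  by apply: le_trans K1; rewrite /C; lra.
- move=> x y; apply: le_trans (H0 x y) _; apply: le_trans (up C0 x y _) _; first by rewrite /C; lra.
  rewrite -[leLHS]mulrA -[leRHS]mulrA; apply: ler_wpM2r; last exact: KC.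
  by rewrite mulr_ge0 ?wt_ge0.
- move=> x x' y h.
  have B t : Num.min x x' <= t <= Num.max x x' -> `|iter_pd [:: true] g t y| <= C * (a * b) * (2 * wt (vpos N t0 x')) * wt (vpos N s0 y).
    move=> ht; apply: le_trans (H1 t y) _; apply: le_trans (up C1 t y _) _; first by rewrite /C; lra.
    by rewrite ler_wpM2r ?wt_ge0 // ler_wpM2l // wt_near // (vpos_between h).
  have := mvt_bound (fun t => D true t y) (fun t => erefl) (@schwartz_c1 y) B.
  rewrite [X in _ * `|X|](vposB t0) normrM (gtr0_norm Nr) => /le_trans; apply.
  by rewrite le_eqVlt; apply/orP; left; apply/eqP; rewrite /K; ring.
move=> x y y' h.
have B t : Num.min y y' <= t <= Num.max y y' -> `|iter_pd [:: false] g x t| <= C * (a * b) * wt (vpos N t0 x) * (2 * wt (vpos N s0 y')).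
  move=> ht; apply: le_trans (H2 x t) _; apply: le_trans (up C2 x t _) _; first by rewrite /C; lra.
  by apply: ler_wpM2l; [apply: mulr_ge0 => //; exact: wt_ge0|apply: wt_near; exact: (vpos_between h)].
have := mvt_bound (fun t => D false x t) (fun t => erefl) (@schwartz_c2 x) B.
rewrite [X in _ * `|X|](vposB s0) normrM (gtr0_norm Nr) => /le_trans; apply.
by rewrite le_eqVlt; apply/orP; left; apply/eqP; rewrite /K; ring.
Qed.

Lemma eta_cvg (e : R) : 0 < e -> e <= 1 / 2 -> forall d, 0 < d -> exists M0 : nat, forall M, (M0 < M)%N -> eta e M <= d.
Proof.
move=> e0 e1 d d0; have c0 := cos_eps_lt1 e0 e1; set c := 1 - _ in c0.
exists (Num.Def.archi_bound (2 / (d * c))) => M MM; have M0 : 0 < (M%:R : R) by rewrite ltr0n; apply: leq_ltn_trans MM.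
rewrite /eta -/c ler_pdivrMr ?mulr_gt0 // mulrCA -ler_pdivrMr ?mulr_gt0 //.
apply: ltW; apply: lt_trans (archi_boundP _) _; first by rewrite divr_ge0 // ltW // mulr_gt0.
by rewrite ltr_nat.
Qed.

(** The estimate [poisson_est] is uniform in J and M, so whatever limit the smoothed integrals have
    is also the limit of the lattice sums. The value of that limit is then computed on the Fourier
    side. *)
Lemma poisson_cvg (P : R) : Rintegral (@mu2 R) setT (fun z => g z.1 z.2 * kk N t0 s0 M z) @[M --> \oo] --> P ->
  sy J (fun c => sy J (fun c' => g (node N t0 c%:~R) (node N s0 c'%:~R))) @[J --> \oo] --> P.
Proof.
move=> cA; have [K K0 [gb gbv g1 g2]] := schwartz_poisson.
apply/cvgrPdist_le => eps eps0.
(* 336 is 14 times 24: when e, eta and 1 / (J + 1) are at most d <= 1/2, the factors of the estimate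
   are K, at most 14 d, and at most 14 + 20 d <= 24. L is made positive to allow division. *)
have [L L0 KL] : exists2 L : R, 0 < L & 336 * K <= L by exists (336 * (K + 1)); lra.
pose d := Num.min (1 / 2) (eps / (2 * L)).
have d0 : 0 < d by rewrite lt_min !divr_gt0 // mulr_gt0.
have d1 : d <= 1 / 2 by rewrite ge_min lexx.
have d2 : d * L <= eps / 2.
  by rewrite -ler_pdivlMr // -mulrA -invfM ge_min lexx orbT.
have [M0 HM0] := eta_cvg d0 d1 d0.
have /cvgrPdist_le /(_ (eps / 2)) := cA; rewrite divr_gt0 // => /(_ isT) [M1 _ HM1].
pose M := (maxn M0 M1).+1.
have M_0 : (0 < M)%N by [].
have hA := HM1 M (leqW (leq_maxr _ _)); have hE := HM0 M (leq_maxl _ _ : (M0 <= maxn M0 M1)%N).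
have eta0 := eta_ge0 M d0 d1.
near=> J.
have hJ : (J.+1%:R^-1 : R) <= d by apply: ltW; near: J; exact: (near_infty_natSinv_lt (PosNum d0)).
have := poisson_est N0 K0 schwartz_c1 schwartz_c2 gb gbv g1 g2 J M_0 d0 d1.
set S := sy J _; set A := Rintegral _ _ _ in hA *.
move=> H; rewrite -(subrKA A); apply: le_trans (ler_normD _ _) _.
rewrite [leRHS](splitr eps); apply: lerD => //; apply: le_trans H _; apply: le_trans d2.
have j0 : 0 <= (J.+1%:R^-1 : R) by [].
move: hJ j0 hE eta0; set j := (J.+1%:R)^-1; set et := eta d M => hJ j0 hE eta0.
apply: (@le_trans _ _ (K * (14 * d) * 24)).
  apply: ler_pM; [apply: mulr_ge0 => //; lra|lra|apply: ler_wpM2l => //; lra|lra].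
by rewrite (_ : K * (14 * d) * 24 = d * (336 * K)); [apply: ler_wpM2l => //; lra|ring].
Unshelve. all: by end_near. Qed.
End Schwartz.

Section ComplexIntegral.
Variable R : realType.
Local Notation C := R[i].
Local Notation mu2 := (@mu2 R).
Local Notation Re := (@complex.Re R).
Local Notation Im := (@complex.Im R).

Lemma cReD (x y : C) : Re (x + y) = Re x + Re y. Proof. by case: x y => a b [c d]. Qed.
Lemma cImD (x y : C) : Im (x + y) = Im x + Im y. Proof. by case: x y => a b [c d]. Qed.
Lemma cReM (x y : C) : Re (x * y) = Re x * Re y - Im x * Im y. Proof. by case: x y => a b [c d]. Qed.
Lemma cImM (x y : C) : Im (x * y) = Re x * Im y + Im x * Re y. Proof. by case: x y => a b [c d]. Qed.
Lemma cReMr (x : C) (r : R) : Re (x * r%:C) = Re x * r. Proof. by rewrite cReM /= mulr0 subr0. Qed.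
Lemma cImMr (x : C) (r : R) : Im (x * r%:C) = Im x * r. Proof. by rewrite cImM /= mulr0 add0r. Qed.
Lemma cRe_sum (I : Type) (r : seq I) (F : I -> C) : Re (\sum_(i <- r) F i) = \sum_(i <- r) Re (F i).
Proof. by elim: r => [|i r IH]; rewrite ?big_nil // !big_cons cReD IH. Qed.
Lemma cIm_sum (I : Type) (r : seq I) (F : I -> C) : Im (\sum_(i <- r) F i) = \sum_(i <- r) Im (F i).
Proof. by elim: r => [|i r IH]; rewrite ?big_nil // !big_cons cImD IH. Qed.
Lemma complexP (x y : C) : Re x = Re y -> Im x = Im y -> x = y.
Proof. by case: x y => a b [c d] /= -> ->. Qed.

Definition icx (g : R -> R -> C) : Prop :=
  mu2.-integrable setT (EFin \o (fun z => Re (g z.1 z.2))) /\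
  mu2.-integrable setT (EFin \o (fun z => Im (g z.1 z.2))).

Lemma Rint_lin (f g : R * R -> R) a b : mu2.-integrable setT (EFin \o f) -> mu2.-integrable setT (EFin \o g) ->
  mu2.-integrable setT (EFin \o (fun z => a * f z + b * g z)) /\
  Rintegral mu2 setT (fun z => a * f z + b * g z) = a * Rintegral mu2 setT f + b * Rintegral mu2 setT g.
Proof.
move=> fi gi.
have zi (h : R * R -> R) c : mu2.-integrable setT (EFin \o h) -> mu2.-integrable setT (EFin \o (fun z => c * h z)).
  by move=> hi; have := @integrableZl _ _ R mu2 setT measurableT c _ hi; apply: eq_integrable.
split; last by rewrite RintegralD ?RintegralZl //; exact: zi.
by have := integrableD measurableT (zi _ a fi) (zi _ b gi); apply: eq_integrable.
Qed.

Lemma intC_Z c g : icx g -> icx (fun x y => c * g x y) /\ intC (fun x y => c * g x y) = c * intC g.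
Proof.
case: c => a b [gr gi].
have [i1 e1] := Rint_lin a (- b) gr gi; have [i2 e2] := Rint_lin a b gi gr.
have E1 : (fun z : R * R => Re ((a +i* b) * g z.1 z.2)) = (fun z => a * Re (g z.1 z.2) + - b * Im (g z.1 z.2)).
  by apply/funext => z; rewrite cReM mulNr.
have E2 : (fun z : R * R => Im ((a +i* b) * g z.1 z.2)) = (fun z => a * Im (g z.1 z.2) + b * Re (g z.1 z.2)).
  by apply/funext => z; rewrite cImM.
split; first by rewrite /icx E1 E2.
by rewrite /intC E1 E2 e1 e2; apply: complexP; rewrite ?cReM ?cImM //= mulNr.
Qed.

Lemma intC_D f g : icx f -> icx g -> icx (fun x y => f x y + g x y) /\
  intC (fun x y => f x y + g x y) = intC f + intC g.
Proof.
move=> [fr fi] [gr gi].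
have [i1 e1] := Rint_lin 1 1 fr gr; have [i2 e2] := Rint_lin 1 1 fi gi.
have E1 : (fun z : R * R => Re (f z.1 z.2 + g z.1 z.2)) = (fun z => 1 * Re (f z.1 z.2) + 1 * Re (g z.1 z.2)).
  by apply/funext => z; rewrite cReD !mul1r.
have E2 : (fun z : R * R => Im (f z.1 z.2 + g z.1 z.2)) = (fun z => 1 * Im (f z.1 z.2) + 1 * Im (g z.1 z.2)).
  by apply/funext => z; rewrite cImD !mul1r.
split; first by rewrite /icx E1 E2.
by rewrite /intC E1 E2 e1 e2 !mul1r; apply: complexP; rewrite ?cReD ?cImD.
Qed.

Lemma icx0 : icx (fun _ _ => 0) /\ intC (fun _ _ => 0 : C) = 0.
Proof.
split; first by split; exact: integrable0.
by rewrite /intC /= /Rintegral integral0.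
Qed.

Lemma intC_sum (I : Type) (r : seq I) (f : I -> R -> R -> C) : (forall i, icx (f i)) ->
  icx (fun x y => \sum_(i <- r) f i x y) /\ intC (fun x y => \sum_(i <- r) f i x y) = \sum_(i <- r) intC (f i).
Proof.
move=> H; elim: r => [|i r [IH1 IH2]].
  rewrite big_nil (_ : (fun x y => \sum_(i <- [::]) f i x y) = fun _ _ => 0); first exact: icx0.
  by apply/funext=> x; apply/funext=> y; rewrite big_nil.
rewrite big_cons (_ : (fun x y => \sum_(j <- i :: r) f j x y) = fun x y => f i x y + \sum_(j <- r) f j x y).
  by rewrite -IH2; exact: intC_D.
by apply/funext=> x; apply/funext=> y; rewrite big_cons.
Qed.

Lemma eq_intC (f g : R -> R -> C) : (forall x y, f x y = g x y) -> intC f = intC g.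
Proof. by move=> H; congr intC; apply/funext=> x; apply/funext=> y. Qed.

Definition bcont (u : R -> R -> R) : Prop :=
  [/\ forall s, continuous (u^~ s), forall t, continuous (u t) & forall x y, `|u x y| <= 1].

Lemma int2_bcont g u : schwartz2R g -> bcont u -> mu2.-integrable setT (EFin \o (fun z => g z.1 z.2 * u z.1 z.2)).
Proof.
move=> Sg [u1 u2 ub]; have [K K0 H] := schwartz_wt Sg [::].
apply: (@integrable2_le _ _ K).
  apply: (measurable_sep (g := fun x y => g x y * u x y)) => [s x|t x]; apply: cvgM.
  - exact: (schwartz_c1 Sg). - exact: u1. - exact: (schwartz_c2 Sg). exact: u2.
move=> [x y] /=; rewrite normrM /wt2 mulrA -[leRHS]mulr1; apply: ler_pM => //; exact: H.
Qed.

Lemma icx_bcont (Phi u : R -> R -> C) : schwartz2 Phi -> bcont (fun x y => Re (u x y)) -> bcont (fun x y => Im (u x y)) ->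
  icx (fun x y => Phi x y * u x y).
Proof.
move=> [S1 S2] b1 b2; have a1 := int2_bcont S1 b1; have a2 := int2_bcont S1 b2.
have a3 := int2_bcont S2 b1; have a4 := int2_bcont S2 b2; split.
  have [i _] := Rint_lin 1 (-1) a1 a4; move: i; apply: eq_integrable => // z _ /=.
  by rewrite cReM mul1r mulN1r.
have [i _] := Rint_lin 1 1 a2 a3; move: i; apply: eq_integrable => // z _ /=.
by rewrite cImM !mul1r.
Qed.

Lemma bcont_trig (a b c : R) : bcont (fun x y => cos (a * x + b * y + c)) /\ bcont (fun x y => sin (a * x + b * y + c)).
Proof.
have l1 s : continuous (fun x : R => a * x + b * s + c).
  by move=> x; apply: cvgD; [apply: cvgD; [apply: cvgM; [exact: cvg_cst|exact: cvg_id]|exact: cvg_cst]|exact: cvg_cst].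
have l2 t : continuous (fun y : R => a * t + b * y + c).
  by move=> x; apply: cvgD; [apply: cvgD; [exact: cvg_cst|apply: cvgM; [exact: cvg_cst|exact: cvg_id]]|exact: cvg_cst].
by split; split=> [s x|t x|x y]; try exact: cos_max; try exact: sin_max;
  apply: (continuous_comp (@l1 _ _)) || apply: (continuous_comp (@l2 _ _)); (exact: continuous_cos || exact: continuous_sin).
Qed.

Lemma icx_cexp (Phi : R -> R -> C) a b c : schwartz2 Phi -> icx (fun x y => Phi x y * cexp (a * x + b * y + c)).
Proof. by move=> S; have [b1 b2] := bcont_trig a b c; apply: icx_bcont. Qed.

Lemma icx_fourier (Phi : R -> R -> C) tau sigma : schwartz2 Phi ->
  icx (fun t s => Phi t s * cexp (- (2 * pi * (tau * t + sigma * s)))).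
Proof.
move=> S; have := icx_cexp (- (2 * pi * tau)) (- (2 * pi * sigma)) 0 S.
rewrite (_ : (fun x y => Phi x y * cexp (- (2 * pi * tau) * x + - (2 * pi * sigma) * y + 0)) =
  (fun t s => Phi t s * cexp (- (2 * pi * (tau * t + sigma * s))))) //.
by apply/funext=> x; apply/funext=> y; congr (_ * cexp _); ring.
Qed.
End ComplexIntegral.

Section Cesaro.
Variable V : zmodType.

(** Passing from M to M + 1 adds each difference c with |c| <= M exactly once. *)
Lemma cesaro (F : int -> V) M : \sum_(j < M) \sum_(k < M) F (j%:Z - k%:Z) = \sum_(k < M) sy k F.
Proof.
elim: M => [|M IH]; first by rewrite !big_ord0.
rewrite big_ord_recr [RHS]big_ord_recr /= -IH.
rewrite (eq_bigr (fun j : 'I_M => \sum_(k < M) F (j%:Z - k%:Z) + F (j%:Z - M%:Z))); last first.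
  by move=> j _; rewrite big_ord_recr.
rewrite big_split /= -addrA; congr (_ + _).
have -> : sy M F = F 0 + (\sum_(i < M) F (- i.+1%:Z) + \sum_(i < M) F i.+1%:Z).
  by rewrite (sy_tail _ (leq0n M)) sy0 big_mkord big_split /= [X in _ + X]addrC.
rewrite big_ord_recr /= subrr addrA addrC; congr (_ + (_ + _)).
  by rewrite (reindex_inj rev_ord_inj) /=; apply: eq_bigr => i _; congr F; have := ltn_ord i; lia.
by rewrite (reindex_inj rev_ord_inj) /=; apply: eq_bigr => i _; congr F; have := ltn_ord i; lia.
Qed.

(** The defect from M copies of the full sum when F vanishes beyond Q. It is independent of M >= Q,
    hence disappears after division by M. *)
Definition cesaro_def Q (F : int -> V) : V := \sum_(k < Q) (sy k F - sy Q F).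

Lemma sy_supp Q k (F : int -> V) : (forall c : int, (Q%:Z < `|c|)%R -> F c = 0) -> (Q <= k)%N -> sy k F = sy Q F.
Proof.
move=> H Qk; rewrite (sy_tail _ Qk) big_nat_cond big1 ?addr0 // => i /andP[/andP[Qi _] _].
by rewrite !H ?addr0 //; lia.
Qed.

Lemma cesaro_supp Q M (F : int -> V) : (forall c : int, (Q%:Z < `|c|)%R -> F c = 0) -> (Q <= M)%N ->
  \sum_(j < M) \sum_(k < M) F (j%:Z - k%:Z) = sy Q F *+ M + cesaro_def Q F.
Proof.
move=> H QM; rewrite cesaro.
have -> : \sum_(k < M) sy k F = \sum_(k < M) (sy Q F + (sy k F - sy Q F)) by apply: eq_bigr => k _; rewrite addrC subrK.
rewrite big_split /= sumr_const card_ord; congr (_ + _); rewrite /cesaro_def.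
rewrite -!(big_mkord xpredT (fun k => sy k F - sy Q F)) (big_cat_nat (leq0n Q) QM) /=.
rewrite [X in _ + X]big_nat_cond [X in _ + X]big1 ?addr0 // => k /andP[/andP[Qk _] _].
by rewrite (sy_supp H Qk) subrr.
Qed.
End Cesaro.

Lemma double_cesaro_id (K : fieldType) (a b c d : K) (n : nat) : (n%:R : K) != 0 ->
  ((a *+ n + b) *+ n + (c *+ n + d)) * n%:R^-1 ^+ 2 = a + (c + b) * n%:R^-1 + d * n%:R^-1 ^+ 2.
Proof.
move=> n0; rewrite -[_ *+ n + b]mulr1 -mulrnAr -(mulr_natr a) -(mulr_natr c).
by move: (n%:R : K) n0 => m m0; field.
Qed.

Lemma cvg_invn (R : realType) : (n%:R^-1 : R) @[n --> \oo] --> (0 : R).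
Proof.
apply/cvgrPdist_le => e e0; near=> n.
have n0 : (0 < n)%N by near: n; exists 1%N.
rewrite sub0r normrN ger0_norm ?invr_ge0 // -(prednK n0) ltW //.
suff : (fun m => (m.+1%:R^-1 : R) < e) n.-1 by [].
near: n; have [m _ H] := near_infty_natSinv_lt (PosNum e0).
exists m.+1 => // k /= mk; apply: H => /=; lia.
Unshelve. all: by end_near. Qed.

Section PoissonFourier.
Variable R : realType.
Local Notation C := R[i].
Local Notation Re := (@complex.Re R).
Local Notation Im := (@complex.Im R).
Variables (Phi : R -> R -> C) (N : nat) (t0 s0 : R).
Hypotheses (SPhi : schwartz2 Phi) (N0 : (0 < N)%N).
Hypothesis Psupp : forall tau sigma, 2 <= `|tau| + `|sigma| -> fourier2 Phi tau sigma = 0.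
Let Nr : 0 < (N%:R : R). Proof. by rewrite ltr0n. Qed.

(** The exponential e(- c v) in the coordinate v = [vpos N r x], written so that its dependence on x
    is that of the Fourier transform at c / N. *)
Definition ech (r : R) (c : int) (x : R) : C := cexp (- (2 * pi * (c%:~R / N%:R * x)) + 2 * pi * (c%:~R * r)).

Lemma ker_cexp r M x : (ker N r M x)%:C =
  (N%:R^-1 * M%:R^-1)%:C * \sum_(j < M) \sum_(k < M) ech r (j%:Z - k%:Z) x.
Proof.
have E c : ech r c x = cos (2 * pi * (c%:~R * vpos N r x)) +i* - sin (2 * pi * (c%:~R * vpos N r x)).
  rewrite /ech /cexp (_ : - (2 * pi * (c%:~R / N%:R * x)) + 2 * pi * (c%:~R * r) = - (2 * pi * (c%:~R * vpos N r x))).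
    by rewrite cosN sinN.
  by rewrite /vpos; ring.
apply: complexP.
  rewrite [in RHS]mulrC cReMr cRe_sum [LHS]/= /ker /fej [LHS]mulrA [LHS]mulrC; congr (_ * _).
  apply: eq_bigr => j _; rewrite cRe_sum; apply: eq_bigr => k _.
  by rewrite E /= intrB.
rewrite [in RHS]mulrC cImMr cIm_sum [X in _ = X * _](_ : _ = 0) ?mul0r //.
set T := \sum_(j <- _) _; suff : T = - T by move/eqP; rewrite -addr_eq0 -mulr2n mulrn_eq0 /= => /eqP.
rewrite /T -sumrN; rewrite [LHS](eq_bigr (fun j : 'I_M => \sum_(k < M) - sin (2 * pi * ((j%:Z - k%:Z)%:~R * vpos N r x)))); last first.
  by move=> j _; rewrite cIm_sum; apply: eq_bigr => k _; rewrite E.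
rewrite exchange_big /=; apply: eq_bigr => j _; rewrite cIm_sum -sumrN; apply: eq_bigr => k _.
rewrite E /= opprK -sinN; congr sin; rewrite !intrB; ring.
Qed.

Definition fcoef (c c' : int) : C :=
  fourier2 Phi (c%:~R / N%:R) (c'%:~R / N%:R) * cexp (2 * pi * (c%:~R * t0 + c'%:~R * s0)).

Lemma intC_ech c c' : icx (fun x y => Phi x y * (ech t0 c x * ech s0 c' y)) /\
  intC (fun x y => Phi x y * (ech t0 c x * ech s0 c' y)) = fcoef c c'.
Proof.
have E : (fun x y => Phi x y * (ech t0 c x * ech s0 c' y)) = (fun x y => cexp (2 * pi * (c%:~R * t0 + c'%:~R * s0)) *
    (Phi x y * cexp (- (2 * pi * (c%:~R / N%:R * x + c'%:~R / N%:R * y))))).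
  apply/funext=> x; apply/funext=> y; rewrite [RHS]mulrCA; congr (_ * _).
  by rewrite /ech -!cexpD; congr cexp; ring.
rewrite E /fcoef [RHS]mulrC; apply: intC_Z; exact: icx_fourier.
Qed.

Lemma intC_kk M : intC (fun x y => Phi x y * (kk N t0 s0 M (x, y))%:C) =
  ((N%:R^-1 * M%:R^-1) ^+ 2)%:C * \sum_(j < M) \sum_(k < M) \sum_(j' < M) \sum_(k' < M) fcoef (j%:Z - k%:Z) (j'%:Z - k'%:Z).
Proof.
pose I := (('I_M * 'I_M) * ('I_M * 'I_M))%type.
pose f (i : I) (x y : R) := Phi x y * (ech t0 (i.1.1%:Z - i.1.2%:Z) x * ech s0 (i.2.1%:Z - i.2.2%:Z) y).
have fi i : icx (f i) by have [] := intC_ech (i.1.1%:Z - i.1.2%:Z) (i.2.1%:Z - i.2.2%:Z).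
have [si se] := intC_sum (index_enum I) fi.
have [zi ze] := intC_Z ((N%:R^-1 * M%:R^-1) ^+ 2)%:C si.
have E : intC (fun x y => Phi x y * (kk N t0 s0 M (x, y))%:C) =
    intC (fun x y => ((N%:R^-1 * M%:R^-1) ^+ 2)%:C * \sum_(i <- index_enum I) f i x y).
  apply: eq_intC => x y.
  rewrite /kk /= rmorphM /= !ker_cexp mulrACA -rmorphM -expr2 [LHS]mulrCA; congr (_ * _).
  rewrite /f -mulr_sumr; congr (_ * _).
  rewrite !pair_bigA /= mulr_suml -(pair_bigA _ (fun i i' : 'I_M * 'I_M => ech t0 (i.1%:Z - i.2%:Z) x * ech s0 (i'.1%:Z - i'.2%:Z) y)) /=.
  by apply: eq_bigr => i _; rewrite mulr_sumr.
rewrite E ze se; congr (_ * _).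
rewrite (eq_bigr (fun i : I => fcoef (i.1.1%:Z - i.1.2%:Z) (i.2.1%:Z - i.2.2%:Z))); last first.
  by move=> i _; have [] := intC_ech (i.1.1%:Z - i.1.2%:Z) (i.2.1%:Z - i.2.2%:Z).
rewrite -(pair_bigA _ (fun i i' : 'I_M * 'I_M => fcoef (i.1%:Z - i.2%:Z) (i'.1%:Z - i'.2%:Z))) /=.
rewrite [RHS]pair_bigA; apply: eq_bigr => i _ /=.
by rewrite [RHS]pair_bigA.
Qed.

Local Notation Q := (2 * N)%N.

Lemma fcoef_supp (c c' : int) : (Q%:Z < `|c|)%R \/ (Q%:Z < `|c'|)%R -> fcoef c c' = 0.
Proof.
move=> H; rewrite /fcoef Psupp ?mul0r //.
have A (d : int) : (Q%:Z < `|d|)%R -> 2 <= `|d%:~R / N%:R : R|.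
  move=> h; rewrite normrM normfV (gtr0_norm Nr) ler_pdivlMr // -intr_norm.
  by rewrite -natrM pmulrn ler_int ltW.
by case: H => /A h; [rewrite -[leLHS]addr0|rewrite -[leLHS]add0r]; apply: lerD.
Qed.

Definition psum : C := sy Q (fun c => sy Q (fun c' => fcoef c c')).

(** The bounded support makes both Cesaro sums affine in M once M exceeds 2 N, so the smoothed
    integral is a polynomial of degree at most 2 in 1 / M. The limit is its constant term. *)
Lemma intC_kk_lim : exists X1 X2 : C, forall M, (Q < M)%N ->
  intC (fun x y => Phi x y * (kk N t0 s0 M (x, y))%:C) =
  (psum + X1 * (M%:R^-1)%:C + X2 * (M%:R^-1 * M%:R^-1)%:C) * (N%:R^-1 ^+ 2)%:C.
Proof.
pose I1 c := sy Q (fcoef c); pose E1 c := cesaro_def Q (fcoef c).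
exists (cesaro_def Q I1 + sy Q E1), (cesaro_def Q E1) => M QM.
have M0 : (M%:R : C) != 0 by rewrite pnatr_eq0; lia.
rewrite intC_kk.
pose D c := I1 c *+ M + E1 c.
have s2 c d : (Q%:Z < `|d|)%R -> fcoef c d = 0 by move=> h; apply: fcoef_supp; right.
have s1 c d : (Q%:Z < `|c|)%R -> fcoef c d = 0 by move=> h; apply: fcoef_supp; left.
have DE (j k : 'I_M) : \sum_(j' < M) \sum_(k' < M) fcoef (j%:Z - k%:Z) (j'%:Z - k'%:Z) = D (j%:Z - k%:Z).
  by rewrite (cesaro_supp (s2 _) (ltnW QM)).
under eq_bigr => j _ do under eq_bigr => k _ do rewrite DE.
have D0 (c : int) : (Q%:Z < `|c|)%R -> D c = 0.
  move=> h; have z : fcoef c = fun=> 0 by apply/funext=> d; exact: s1.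
  rewrite /D /I1 /E1 /cesaro_def z /sy !big1 ?mul0rn ?addr0 // => k _.
  by rewrite !big1 ?subrr.
rewrite (cesaro_supp D0 (ltnW QM)).
have syD : sy Q D = psum *+ M + sy Q E1.
  by rewrite /D sy_D; congr (_ + _); rewrite /psum /sy -sumrMnl.
have syDk k : sy k D = sy k I1 *+ M + sy k E1 by rewrite /D sy_D; congr (_ + _); rewrite /sy -sumrMnl.
have cD : cesaro_def Q D = cesaro_def Q I1 *+ M + cesaro_def Q E1.
  rewrite /cesaro_def -sumrMnl -big_split; apply: eq_bigr => k _ /=.
  by rewrite !syDk mulrnBl; ring.
rewrite syD cD exprMn rmorphM /= mulrC mulrCA mulrC; congr (_ * _).
have MV : ((M%:R^-1 : R))%:C = (M%:R : C)^-1 by rewrite fmorphV rmorph_nat.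
have MV2 : ((M%:R^-1 ^+ 2 : R))%:C = (M%:R : C)^-1 ^+ 2 by rewrite rmorphXn /= MV.
have MV3 : ((M%:R^-1 * M%:R^-1 : R))%:C = (M%:R : C)^-1 * (M%:R : C)^-1 by rewrite rmorphM /= MV.
rewrite MV MV2 ?MV3; exact: double_cesaro_id.
Qed.

Lemma phiN_fourier : phiN Phi N t0 s0 = psum * (N%:R^-1 ^+ 2)%:C.
Proof.
have [X1 [X2 HX]] := intC_kk_lim.
have cpart (f : C -> R) : (forall x y, f (x + y) = f x + f y) -> (forall x (r : R), f (x * r%:C) = f x * r) ->
    f (intC (fun x y => Phi x y * (kk N t0 s0 M (x, y))%:C)) @[M --> \oo] --> f (psum * (N%:R^-1 ^+ 2)%:C).
  move=> fD fM.
  have ci := @cvg_invn R.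
  have : ((f psum + f X1 * M%:R^-1 + f X2 * (M%:R^-1 * M%:R^-1)) * (N%:R^-1 ^+ 2)) @[M --> \oo] -->
     ((f psum + f X1 * 0 + f X2 * (0 * 0)) * (N%:R^-1 ^+ 2)).
    apply: cvgM; last exact: cvg_cst.
    apply: cvgD; first by apply: cvgD; [exact: cvg_cst|apply: cvgM; [exact: cvg_cst|exact: ci]].
    by apply: cvgM; [exact: cvg_cst|apply: cvgM; exact: ci].
  rewrite !mulr0 !addr0 -fM; apply: cvg_trans; apply: near_eq_cvg.
  exists Q.+1 => // M /= QM; rewrite HX // fM !fD !fM //.
have [S1 S2] := SPhi.
have cR := cpart _ (@cReD R) (@cReMr R); have cI := cpart _ (@cImD R) (@cImMr R).
have eR : (fun M => Re (intC (fun x y => Phi x y * (kk N t0 s0 M (x, y))%:C))) =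
    (fun M => Rintegral (@mu2 R) setT (fun z => Re (Phi z.1 z.2) * kk N t0 s0 M z)).
  by apply/funext=> M; rewrite /intC /=; apply: eq_Rintegral => -[x y] _ /=; rewrite cReMr.
have eI : (fun M => Im (intC (fun x y => Phi x y * (kk N t0 s0 M (x, y))%:C))) =
    (fun M => Rintegral (@mu2 R) setT (fun z => Im (Phi z.1 z.2) * kk N t0 s0 M z)).
  by apply/funext=> M; rewrite /intC /=; apply: eq_Rintegral => -[x y] _ /=; rewrite cImMr.
rewrite eR in cR; rewrite eI in cI.
have pR := poisson_cvg S1 N0 cR; have pI := poisson_cvg S2 N0 cI.
rewrite /phiN /limC; apply: complexP => /=.
  apply: cvg_lim => //; move: pR; apply: cvg_trans; apply: near_eq_cvg; near=> J.
  rewrite /sy cRe_sum; apply: eq_bigr => m _; rewrite cRe_sum; apply: eq_bigr => n _.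
  by rewrite /node !intrB.
apply: cvg_lim => //; move: pI; apply: cvg_trans; apply: near_eq_cvg; near=> J.
rewrite /sy cIm_sum; apply: eq_bigr => m _; rewrite cIm_sum; apply: eq_bigr => n _.
by rewrite /node !intrB.
Unshelve. all: by end_near. Qed.
End PoissonFourier.

(** * The limiting density *)

Section Sinc.
Variable R : realType.
Local Notation C := R[i].
Local Notation Re := (@complex.Re R).
Local Notation Im := (@complex.Im R).
Local Notation mu2 := (@mu2 R).

Lemma cos_lip (t : R) : `|cos t - 1| <= `|t|.
Proof.
have := @mvt_bound R cos (fun t => - sin t) t 0 1.
rewrite cos0 subr0 mul1r; apply.
- by move=> x; have [d _] := is_derive_cos x.
- by move=> x; rewrite derive1E; have [_ d] := is_derive_cos x.
- exact: continuous_cos.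
by move=> x _; rewrite normrN; exact: sin_max.
Qed.

Lemma sin_lip (t : R) : `|sin t - t| <= t ^+ 2.
Proof.
have D (x : R) : is_derive x 1 (sin - id : R -> R) (cos x - 1) by exact: is_deriveB.
have := @mvt_bound R (sin - id : R -> R) (fun t => cos t - 1) t 0 `|t|.
rewrite /= !fctE sin0 !subr0 -normrM -expr2 ger0_norm ?sqr_ge0 //; apply.
- by move=> x; have [d _] := D x.
- by move=> x; rewrite derive1E; have [_ d] := D x.
- exact: is_derive_cts D.
move=> x hx; apply: le_trans (cos_lip x) _.
case: (leP t 0) hx => t0 /andP[h1 h2]; rewrite ?(ler0_norm t0) ?(gtr0_norm t0).
  by rewrite ler_norml; apply/andP; split; lra.
by rewrite ler_norml; apply/andP; split; lra.
Qed.

Lemma cvg_nsin (a : R) : n%:R * sin (a / n%:R) @[n --> \oo] --> a.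
Proof.
apply/cvgrPdist_le => e e0.
have := @cvg_invn R; move/cvgrPdist_le => /(_ (e / (a ^+ 2 + 1))).
have a1 : 0 < a ^+ 2 + 1 by rewrite ltr_wpDl ?sqr_ge0.
rewrite divr_gt0 // => /(_ isT) H; near=> n.
have n0 : (0 < n)%N by near: n; exists 1%N.
have nr : 0 < (n%:R : R) by rewrite ltr0n.
have : `|0 - n%:R^-1 : R| <= e / (a ^+ 2 + 1) by near: n.
rewrite sub0r normrN gtr0_norm ?invr_gt0 // ler_pdivlMr // => h.
have -> : a - n%:R * sin (a / n%:R) = - (n%:R * (sin (a / n%:R) - a / n%:R)) by field; rewrite gt_eqF.
rewrite normrN normrM gtr0_norm //.
apply: le_trans (ler_wpM2l (ltW nr) (sin_lip _)) _.
apply: le_trans h; rewrite (_ : n%:R * (a / n%:R) ^+ 2 = n%:R^-1 * a ^+ 2); last by field; rewrite gt_eqF.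
by rewrite ler_pM2l ?invr_gt0 //; lra.
Unshelve. all: by end_near. Qed.

(** The Fejer kernel at scale 1 / n and height at most 1. Its frequencies are c / n with weights n -
    |c|, the same weights as in the averaged pair correlation. *)
Definition fejn (n : nat) (u : R) : R := n%:R^-1 * fej n (u / n%:R).

Lemma fejn_ge0 n u : 0 <= fejn n u.
Proof. by rewrite mulr_ge0 ?fej_ge0 ?invr_ge0. Qed.

Lemma fejn_le1 n u : fejn n u <= 1.
Proof.
case: n => [|n]; first by rewrite /fejn invr0 mul0r.
by rewrite /fejn ler_pdivrMl ?ltr0n // mulr1; apply: le_trans (ler_norm _) (fej_le _ _).
Qed.

Lemma fejn_sinc u : fejn n u @[n --> \oo] --> sinc u ^+ 2.
Proof.
rewrite /sinc; case: eqP => [->|/eqP u0].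
  rewrite expr1n; apply: cvg_near_cst; exists 1%N => // n /= n0.
  have nN : (n%:R : R) != 0 by rewrite pnatr_eq0 -lt0n.
  rewrite /fejn /fej mul0r; under eq_bigr => j _ do under eq_bigr => k _ do rewrite !mulr0 cos0.
  by rewrite !sumr_const !card_ord -mulrnA natrM; field.
have p0 := pi_gt0 R.
have pu : pi * u != 0 by rewrite mulf_neq0 // gt_eqF.
have : (sin (pi * u) / (n%:R * sin (pi * u / n%:R))) ^+ 2 @[n --> \oo] --> (sin (pi * u) / (pi * u)) ^+ 2.
  rewrite expr2; under eq_cvg do rewrite expr2.
  have H : (sin (pi * u) / (n%:R * sin (pi * u / n%:R))) @[n --> \oo] --> (sin (pi * u) / (pi * u)).
    apply: cvgM; first exact: cvg_cst.
    by apply: cvgV => //; exact: cvg_nsin.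
  by apply: cvgM; exact: H.
apply: cvg_trans; apply: near_eq_cvg; near=> n.
have n0 : (0 < n)%N by near: n; exists 1%N.
have nr : 0 < (n%:R : R) by rewrite ltr0n.
have hn : `|u| < n%:R.
  near: n; exists (Num.Def.archi_bound `|u|) => // n /= h.
  by apply: lt_le_trans (archi_boundP _) _ => //; rewrite ler_nat.
set x := pi * u / n%:R.
have sx : sin x != 0.
  have xp : `|x| < pi by rewrite /x !normrM normfV (gtr0_norm p0) (gtr0_norm nr) ltr_pdivrMr // ltr_pM2l.
  have x0 : x != 0 by rewrite /x mulf_neq0 // invr_neq0 // gt_eqF.
  case: (ltP 0 x) => [xp0|xn].
    by rewrite gt_eqF // sin_gt0_pi // xp0 -(gtr0_norm xp0).
  have xl : x < 0 by rewrite lt_neqAle x0.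
  by rewrite -oppr_eq0 -sinN gt_eqF // sin_gt0_pi // oppr_gt0 xl -(ltr0_norm xl).
have cos2 (y : R) : 1 - cos (2 * y) = 2 * sin y ^+ 2.
  rewrite (_ : 2 * y = y + y); last by ring.
  by rewrite cosD -!expr2; have := cos2Dsin2 y; lra.
have := fej_cos (u / n%:R) n0.
have -> : 2 * pi * (u / n%:R) = 2 * x by rewrite /x; ring.
have -> : 2 * pi * (n%:R * (u / n%:R)) = 2 * (pi * u) by field; rewrite gt_eqF.
rewrite !cos2 /fejn; set f := fej _ _; set s := sin (pi * u) => E.
have nN : (n%:R : R) != 0 by rewrite gt_eqF.
have t2 : (2 : R) != 0 by rewrite pnatr_eq0.
have E' : sin x ^+ 2 * (n%:R * f) = s ^+ 2 by apply: (mulfI t2); rewrite -E; ring.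
rewrite expr_div_n -E'; field; by rewrite nN sx.
Unshelve. all: by end_near. Qed.

Lemma bcont_fejn n : bcont (fun x y => 1 - fejn n (x - y)).
Proof.
have cf : continuous (fejn n).
  move=> u; apply: cvgM; first exact: cvg_cst.
  apply: (@continuous_comp _ _ _ (fun u : R => u / n%:R) (@fej R n)); last exact: continuous_fej.
  by apply: cvgM; [exact: cvg_id|exact: cvg_cst].
split=> [s x|t x|x y].
- apply: cvgB; first exact: cvg_cst.
  apply: (@continuous_comp _ _ _ (fun x : R => x - s) (fejn n)); last exact: cf.
  by apply: cvgB; [exact: cvg_id|exact: cvg_cst].
- apply: cvgB; first exact: cvg_cst.
  apply: (@continuous_comp _ _ _ (fun x : R => t - x) (fejn n)); last exact: cf.
  by apply: cvgB; [exact: cvg_cst|exact: cvg_id].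
by rewrite ler_norml; have := fejn_ge0 n (x - y); have := fejn_le1 n (x - y) => h1 h2; apply/andP; split; lra.
Qed.

Lemma int_fejn_cvg g : schwartz2R g -> Rintegral mu2 setT (fun z => g z.1 z.2 * (1 - fejn n (z.1 - z.2))) @[n --> \oo] -->
  Rintegral mu2 setT (fun z => g z.1 z.2 * (1 - sinc (z.1 - z.2) ^+ 2)).
Proof.
move=> Sg.
have one : bcont (fun _ _ : R => 1 : R) by split=> [s x|t x|x y]; rewrite ?normr1 //; exact: cvg_cst.
have gi : mu2.-integrable setT (EFin \o (fun z => g z.1 z.2 : R)).
  by have := int2_bcont Sg one; apply: eq_integrable => // z _ /=; rewrite mulr1.
have fi n := int2_bcont Sg (bcont_fejn n).
have cv (z : R * R) : (g z.1 z.2 * (1 - fejn n (z.1 - z.2))) @[n --> \oo] --> g z.1 z.2 * (1 - sinc (z.1 - z.2) ^+ 2).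
  by apply: cvgM; [exact: cvg_cst|apply: cvgB; [exact: cvg_cst|exact: fejn_sinc]].
have bd n (z : R * R) : `|g z.1 z.2 * (1 - fejn n (z.1 - z.2))| <= `|g z.1 z.2|.
  by rewrite normrM ler_piMr //; have [_ _ H] := bcont_fejn n; exact: H.
have := @dominated_cvg _ _ R mu2 setT measurableT
  (fun n z => (g z.1 z.2 * (1 - fejn n (z.1 - z.2)))%:E) (fun z => (g z.1 z.2 * (1 - sinc (z.1 - z.2) ^+ 2))%:E)
  (fun z => `|g z.1 z.2|%:E) (fun n => measurable_int _ (fi n)).
move=> /(_ _ _ _ _); rewrite /Rintegral => H.
have limi : mu2.-integrable setT (EFin \o (fun z => g z.1 z.2 * (1 - sinc (z.1 - z.2) ^+ 2))).
  apply: (@le_integrable _ _ R mu2 setT measurableT _ (fun z => (g z.1 z.2)%:E)) => //.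
    apply/measurable_EFinP; apply: (@measurable_realfun.measurable_fun_cvg _ _ _ _ (fun n z => g z.1 z.2 * (1 - fejn n (z.1 - z.2)))).
      by move=> n; apply/measurable_EFinP; exact: (measurable_int _ (fi n)).
    by move=> z _; exact: cv.
  move=> z _ /=; rewrite lee_fin; apply/ler_addgt0Pl => e e0.
  have /cvgrPdist_le /(_ e e0) [n _ Hn] := cv z.
  have := Hn n (leqnn n) => /= h; have b := bd n z.
  rewrite -[X in `|X|](subrK (g z.1 z.2 * (1 - fejn n (z.1 - z.2)))).
  by apply: le_trans (ler_normD _ _) (lerD h b).
apply: fine_cvg; rewrite fineK; last exact: (integrable_fin_num _ limi).
apply: H.
- by move=> z _; apply: cvg_EFin; [exact: nearW|exact: cv].
- by [].
- by have := integrable_abse gi; apply: eq_integrable.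
by move=> n z _; rewrite lee_fin; exact: bd.
Qed.

Variable Phi : R -> R -> C.
Hypothesis SPhi : schwartz2 Phi.

Definition main_term (N : nat) : C := fourier2 Phi 0 0 -
  (N%:R^-1 ^+ 2)%:C * \sum_(j < N) \sum_(k < N) fourier2 Phi ((j%:Z - k%:Z)%:~R / N%:R) (- (j%:Z - k%:Z)%:~R / N%:R).

(** Summing the phases before integrating turns the weighted sum of Fourier values into one integral
    against the Fejer kernel. Pointwise convergence and domination by Phi then give the limit. *)
Lemma main_termE N : main_term N = intC (fun t s => Phi t s * (1 - fejn N (t - s))%:C).
Proof.
have ic tau sigma := icx_fourier tau sigma SPhi.
pose I := ('I_N * 'I_N)%type.
pose f (i : I) (t s : R) := Phi t s * cexp (- (2 * pi * ((i.1%:Z - i.2%:Z)%:~R / N%:R * t + - (i.1%:Z - i.2%:Z)%:~R / N%:R * s))).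
have [si se] := intC_sum (index_enum I) (fun i => ic _ _ : icx (f i)).
have [zi ze] := intC_Z (- (N%:R^-1 ^+ 2)%:C) si.
have [_ de] := intC_D (ic 0 0) zi.
rewrite /main_term pair_bigA /= -mulNr.
rewrite [X in _ + _ * X](_ : _ = \sum_(i <- index_enum I) intC (f i)); last by [].
rewrite -se -ze -de; apply: eq_intC => t s.
rewrite /f -mulr_sumr mulrCA -mulrDr; congr (_ * _).
have -> : cexp (- (2 * pi * (0 * t + 0 * s))) = 1 by rewrite !mul0r addr0 mulr0 oppr0 cexp0.
have -> : fejn N (t - s) = ker N 0 N (t - s) by rewrite /ker /vpos subr0.
rewrite rmorphB rmorph1 /= ker_cexp -expr2 mulNr pair_bigA /=; congr (1 - _ * _); apply: eq_bigr => i _.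
by congr cexp; ring.
Qed.

Lemma normC_le (z : C) : `|z| <= (`|Re z| + `|Im z|)%:C.
Proof.
case: z => a b; rewrite normc_def lecR /= -[leRHS]ger0_norm ?addr_ge0 // -sqrtr_sqr.
apply: ler_wsqrtr; rewrite sqrrD !real_normK ?num_real //.
by have := mulr_ge0 (normr_ge0 a) (normr_ge0 b); lra.
Qed.

Lemma main_term_cvg eps : 0 < eps -> exists N0 : nat, forall N, (N0 <= N)%N -> `|main_term N - rhs Phi| < eps%:C.
Proof.
move=> e0; have [S1 S2] := SPhi.
have := int_fejn_cvg S1 => /cvgrPdist_lt /(_ (eps / 2)); rewrite divr_gt0 // => /(_ isT) [N1 _ H1].
have := int_fejn_cvg S2 => /cvgrPdist_lt /(_ (eps / 2)); rewrite divr_gt0 // => /(_ isT) [N2 _ H2].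
exists (maxn N1 N2) => N; rewrite geq_max => /andP[h1 h2].
have {}H1 := H1 N h1; have {}H2 := H2 N h2; rewrite /= in H1 H2.
apply: le_lt_trans (normC_le _) _; rewrite ltcR main_termE [eps]splitr.
have ER (g : R -> R -> R) : Re (intC (fun t s => Phi t s * (g t s)%:C)) = Rintegral mu2 setT (fun z => Re (Phi z.1 z.2) * g z.1 z.2).
  by apply: eq_Rintegral => z _; rewrite cReMr.
have EI (g : R -> R -> R) : Im (intC (fun t s => Phi t s * (g t s)%:C)) = Rintegral mu2 setT (fun z => Im (Phi z.1 z.2) * g z.1 z.2).
  by apply: eq_Rintegral => z _; rewrite cImMr.
have ReB (x y : C) : Re (x - y) = Re x - Re y by case: x y => a b [c d].
have ImB (x y : C) : Im (x - y) = Im x - Im y by case: x y => a b [c d].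
rewrite ReB ImB /rhs !ER !EI; apply: ltrD; rewrite distrC; [exact: H1|exact: H2].
Qed.
End Sinc.

(** * Error terms *)

Section Numeric.
Variable R : realType.
(** For q >= 3, q ^ (- 1/2) is at most (9/10) ^ 3. The cube serves the exponent r / 3: after
    normalization it leaves q ^ (- r / 6), which is then at most zr ^ r. *)
Definition zr : R := 9 / 10.
Lemma zr_gt0 : 0 < zr. Proof. by rewrite /zr; lra. Qed.
Lemma zr_ge0 : 0 <= zr. Proof. by rewrite /zr; lra. Qed.
Lemma zr_le1 : zr <= 1. Proof. by rewrite /zr; lra. Qed.
Lemma zr_lt1 : zr < 1. Proof. by rewrite /zr; lra. Qed.

Lemma zrX_anti m n : (m <= n)%N -> zr ^+ n <= zr ^+ m.
Proof. by move=> le; apply: ler_wiXn2l => //; [exact: zr_ge0|exact: zr_le1]. Qed.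

Definition err (g r : nat) : R := 10 * r%:R ^+ 2 * zr ^+ r + 5 * r%:R ^+ 2 * zr ^+ g.

Variables (q : nat).
Hypothesis q3 : (3 <= q)%N.
Let s : R := Num.sqrt q%:R.
Let s0 : 0 < s. Proof. by rewrite sqrtr_gt0 ltr0n; lia. Qed.
Let s2 : s ^+ 2 = q%:R. Proof. by rewrite sqr_sqrtr ?ler0n. Qed.

Lemma sV_le : s^-1 <= zr ^+ 3.
Proof.
have z0 := zr_gt0.
rewrite -[zr ^+ 3]invrK lef_pV2 ?posrE ?invr_gt0 ?exprn_gt0 //.
rewrite -(ler_pXn2r (ltn0Sn 1)) ?nnegrE ?invr_ge0 ?exprn_ge0 ?ltW // s2.
apply: (@lt_le_trans _ _ 3); last by rewrite ler_nat.
by rewrite exprVn -[ltRHS]invrK ltf_pV2 ?posrE ?invr_gt0 ?exprn_gt0 // /zr; lra.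
Qed.

Lemma sVX_le k : s ^- k <= zr ^+ (3 * k).
Proof.
rewrite exprM -exprVn; apply: lerXn2r; last exact: sV_le.
  by rewrite nnegrE invr_ge0 ltW.
by rewrite nnegrE exprn_ge0 // zr_ge0.
Qed.

Lemma qX_third r : (q ^ (r %/ 3))%:R / s ^+ r <= zr ^+ r.
Proof.
have le : (2 * (r %/ 3) <= r)%N by have := leq_trunc_div r 3; lia.
rewrite natrX -s2 -exprM -{2}(subnKC le) exprD invfM mulrA mulfV ?mul1r; last by rewrite expf_neq0 // gt_eqF.
by apply: le_trans (sVX_le _) (zrX_anti _); have := leq_trunc_div r 3; lia.
Qed.

(** For r <= g the truncated difference is 0 and the decay is in r; otherwise the decay is in g. The
    sum covers both cases. *)
Lemma qX_half r g : (q ^ ((r - g) %/ 2))%:R / s ^+ r <= zr ^+ r + zr ^+ g.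
Proof.
have le : (2 * ((r - g) %/ 2) <= r)%N by have := leq_trunc_div (r - g) 2; lia.
rewrite natrX -s2 -exprM -{2}(subnKC le) exprD invfM mulrA mulfV ?mul1r; last by rewrite expf_neq0 // gt_eqF.
apply: le_trans (sVX_le _) _; have l2 := leq_trunc_div (r - g) 2.
case: (leqP r g) => rg; [apply: ler_wpDr|apply: ler_wpDl]; rewrite ?exprn_ge0 ?zr_ge0 //; apply: zrX_anti; lia.
Qed.

Lemma qX_halfdiag m : (q ^ (m %/ 2))%:R / s ^+ (m + m) <= zr ^+ (m + m).
Proof.
have le : (2 * (m %/ 2) <= m + m)%N by have := leq_trunc_div m 2; lia.
rewrite natrX -s2 -exprM -{1}(subnKC le) exprD invfM mulrA mulfV ?mul1r; last by rewrite expf_neq0 // gt_eqF.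
by apply: le_trans (sVX_le _) (zrX_anti _); have := leq_trunc_div m 2; lia.
Qed.

Lemma err2_bound r g : (2 * r ^ 2 * q ^ (r %/ 3) + 5 * r ^ 2 * q ^ ((r - g) %/ 2))%:R / s ^+ r <=
  7 * r%:R ^+ 2 * zr ^+ r + 5 * r%:R ^+ 2 * zr ^+ g.
Proof.
rewrite -!natrX; move: (r ^ 2)%N => x; rewrite natrD !natrM mulrDl -!mulrA.
have := qX_third r; have := qX_half r g; set a := _ / _; set b := _ / _ => h1 h2.
apply: (@le_trans _ _ (2 * (x%:R * zr ^+ r) + 5 * (x%:R * (zr ^+ r + zr ^+ g)))); last by lra.
by apply: lerD; rewrite ler_pM2l //; apply: ler_wpM2l.
Qed.

Lemma err1_bound r g : (0 < r)%N -> (q ^ (r %/ 3) + r * q ^ ((r - g) %/ 2))%:R / s ^+ r <= err g r.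
Proof.
move=> r1; rewrite natrD !natrM mulrDl -mulrA; have := qX_third r; have := qX_half r g.
set a := _ / _; set b := _ / _ => h1 h2.
have r1' : 1 <= (r%:R : R) by rewrite ler1n.
have rr : (r%:R : R) <= r%:R ^+ 2 by rewrite expr2 ler_peMl //; lra.
have z1 : 0 <= zr ^+ r by rewrite exprn_ge0 ?zr_ge0.
have z2 : 0 <= zr ^+ g by rewrite exprn_ge0 ?zr_ge0.
rewrite /err; apply: (@le_trans _ _ (zr ^+ r + r%:R * (zr ^+ r + zr ^+ g))).
  by apply: lerD => //; rewrite ler_wpM2l //; lra.
move: (zr ^+ r) (zr ^+ g) z1 z2 => u v u0 v0; move: (r%:R : R) r1' rr => x; nra.
Qed.
End Numeric.

Lemma conjCR (R : realType) (x : R) : (x%:C)^*%R = x%:C.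
Proof. by rewrite -[LHS]/(conjc x%:C) /= oppr0. Qed.

(** * Averages of one and of two power sums of the angles *)

Section Moments.
Variables (R : realType) (p : nat) (psi : 'F_p -> R[i]).
Local Notation C := R[i].
Hypotheses (psi_char : nontriv_add_char psi) (p2 : (2 < p)%N).
Variables (F : finFieldType) (m : nat).
Hypotheses (pF : p \in [pchar F]) (cdp : coprime m.+1 p).
Local Notation N := m.
Local Notation d := m.+1.
Local Notation A := (ASd0 p F d).
Local Notation IA := (#|A|%:R^-1 : C).
Let q := #|F|.
Let e := d.
Let p_pr : prime p. Proof. exact: pcharf_prime pF. Qed.
Let de : (d < p ^ e)%N. Proof. by apply: ltn_expl; exact: prime_gt1. Qed.
Local Notation Psi := (PsiL (L := F) psi).
Local Notation s := (Num.sqrt (q%:R : R)).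

Let q3 : (3 <= q)%N.
Proof.
rewrite /q (cardL pF); apply: leq_trans p2 _; rewrite -{1}(expn1 p); apply: leq_pexp2l; first exact: prime_gt0.
exact: logL_gt0.
Qed.

Lemma psi_props : [/\ forall x y, Psi (x + y) = Psi x * Psi y, Psi 0 = 1 & exists h, Psi h != 1].
Proof.
have [nz [psiD psi_nt]] := psi_char.
have psi0 : psi 0 = 1 by apply: (mulfI (nz 0)); rewrite -psiD addr0 mulr1.
by split; [exact: PsiLD|exact: PsiL0|exact: PsiL_nt].
Qed.

Lemma size_poly_of a : a \in A -> size (poly_of a) = d.+1.
Proof.
rewrite inE => /andP[h _]; apply: size_poly_eq; rewrite (_ : inord d = ord_max) //.
by apply: val_inj; rewrite /= inordK.
Qed.

Definition Tz (a : {ffun 'I_d.+1 -> F}) (c : int) : C :=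
  \sum_(i < N) cexp (2 * pi * (c%:~R * angles psi (poly_of a) (N := N) i)).

Lemma Tz0 a : Tz a 0 = N%:R.
Proof.
rewrite /Tz (eq_bigr (fun=> 1)) => [|i _]; last by rewrite mul0r mulr0 cexp0.
by rewrite sumr_const card_ord.
Qed.

Lemma TzN a c : Tz a (- c) = (Tz a c)^*%R.
Proof.
rewrite /Tz rmorph_sum; apply: eq_bigr => i _ /=; rewrite [RHS]conj_cexp; congr cexp.
by rewrite mulrNz; ring.
Qed.

Lemma Tz_ext k : (0 < k)%N -> exists (L : finFieldType) (iota : {rmorphism F -> L}), #|L| = (q ^ k)%N /\
  forall a, a \in A -> Tz a k%:Z = - ((s ^- k)%:C * Sx p Psi e iota k a).
Proof.
move=> k0; have [L [iota [cL H]]] := expsum_chi psi pF k0; exists L, iota; split=> // a aA.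
have sz := size_poly_of aA.
rewrite /Sx -(H _ _ _ sz de) -(angles_power psi_char pF sz cdp k0); apply: eq_bigr => i _.
by rewrite -cexpMn -mulr_natr; congr cexp; rewrite -pmulrn; ring.
Qed.

Definition M1 c : C := IA * \sum_(a in A) Tz a c.
Definition M2 c c' : C := IA * \sum_(a in A) Tz a c * Tz a c'.

Lemma IAN0 : (#|A|%:R : C) != 0.
Proof. by rewrite pnatr_eq0 -lt0n (card_ASd0_gt0 pF). Qed.

Lemma M1_0 : M1 0 = N%:R.
Proof.
rewrite /M1 (eq_bigr (fun=> N%:R)) => [|a _]; last exact: Tz0.
by rewrite sumr_const -[N%:R *+ _]mulr_natl mulKf // IAN0.
Qed.

Lemma M2_0r c : M2 c 0 = N%:R * M1 c.
Proof. by rewrite /M2 /M1 [RHS]mulrCA; congr (_ * _); rewrite mulr_sumr; apply: eq_bigr => a _; rewrite Tz0 mulrC. Qed.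

Lemma M2C c c' : M2 c c' = M2 c' c.
Proof. by congr (_ * _); apply: eq_bigr => a _; rewrite mulrC. Qed.

Lemma IA_conj (z : C) : (IA * z)^*%R = IA * z^*%R.
Proof. by rewrite rmorphM /= fmorphV rmorph_nat. Qed.

Lemma M1N c : `|M1 (- c)| = `|M1 c|.
Proof. by rewrite -[RHS]norm_conjC /M1 IA_conj rmorph_sum; congr `|_ * _|; apply: eq_bigr => a _; rewrite TzN. Qed.

Lemma M2N c c' (x : R) : `|M2 (- c) (- c') - x%:C| = `|M2 c c' - x%:C|.
Proof.
rewrite -[RHS]norm_conjC rmorphB /= /M2 IA_conj rmorph_sum /=; congr `|_ * _ - _|.
  by apply: eq_bigr => a _; rewrite rmorphM /= !TzN.
by rewrite conjCR.
Qed.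

Let sk k : 0 < s ^- k.
Proof. by rewrite invr_gt0 exprn_gt0 // sqrtr_gt0 ltr0n; apply: leq_trans q3. Qed.

Lemma nat_scale k n (x : R) : (n%:R / s ^+ k <= x) -> (s ^- k)%:C * n%:R <= x%:C.
Proof. by move=> h; rewrite natC -rmorphM lecR mulrC. Qed.

Lemma norm_sk k : `|(s ^- k)%:C : C| = (s ^- k)%:C.
Proof. by rewrite ger0_norm // lecR ltW. Qed.

Lemma M1_bound g k : (0 < k)%N -> (p * (k + g) <= (2 * p - 2) * N)%N -> `|M1 k%:Z| <= (err R g k)%:C.
Proof.
move=> k0 Hg; have [L [iota [cL HT]]] := Tz_ext k0; have [PD P0 Pnt] := psi_props.
rewrite /M1 (eq_bigr _ HT) sumrN -mulr_sumr mulrN normrN mulrCA normrM norm_sk.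
have h1 := first_moment pF p2 PD P0 Pnt cdp (ltn0Sn m) de iota cL k0.
have h2 := card_cond1 iota pF cL k0 p2 Hg.
apply: le_trans (ler_wpM2l _ h1) _; first by rewrite lecR ltW.
apply: nat_scale; apply: le_trans (@err1_bound R q q3 k g k0).
by rewrite ler_pM2r // ler_nat.
Qed.

(** The boolean selects T_k T_l, or T_k times the conjugate of T_l. The main term k is q ^ (- k)
    times the k q ^ k diagonal pairs, and it occurs only in the second case with k = l. *)
Lemma M2_bound (b : bool) g k l : (0 < k)%N -> (0 < l)%N -> (p * (k + l + g) <= (2 * p - 2) * N)%N ->
  `|M2 k%:Z (if b then l%:Z else - l%:Z) - (if ~~ b && (k == l) then k%:R else 0)%:C| <= (err R g (k + l))%:C.
Proof.
move=> k0 l0 Hg; have [L1 [iota1 [cL1 HT1]]] := Tz_ext k0; have [PD P0 Pnt] := psi_props.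
have rr : 0 <= ((k + l)%:R : R) ^+ 2 * zr R ^+ (k + l) by rewrite mulr_ge0 ?sqr_ge0 ?exprn_ge0 ?zr_ge0.
case: (boolP (~~ b && (k == l))) => [/andP[bN /eqP kl]|nd].
  rewrite -{}kl (negbTE bN) in Hg rr *.
  have -> : M2 k%:Z (- k%:Z) = (s ^- (k + k))%:C * (IA * \sum_(a in A) Sx p Psi e iota1 k a * (Sx p Psi e iota1 k a)^*%R).
    rewrite /M2 [RHS]mulrCA; congr (_ * _); rewrite mulr_sumr; apply: eq_bigr => a aA.
    rewrite TzN HT1 // rmorphN rmorphM /= mulrNN exprD invfM rmorphM /= mulrACA; congr (_ * _ * _).
    exact: conjCR.
  have kE : (k%:R : R)%:C = (s ^- (k + k))%:C * (k * q ^ k)%:R :> C.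
    have kR : (k%:R : R) = s ^- (k + k) * (k * q ^ k)%:R.
      have sq : s ^+ (k + k) = q%:R ^+ k by rewrite addnn -mul2n exprM sqr_sqrtr ?ler0n.
      by rewrite natrM natrX -sq mulrCA mulVf ?mulr1 // lt0r_neq0 // -invr_gt0 sk.
    by rewrite [(k * q ^ k)%:R]natC -rmorphM /= -kR.
  rewrite kE -mulrBr normrM norm_sk.
  have h1 := diag_moment pF p2 PD P0 Pnt cdp (ltn0Sn m) de iota1 cL1 k0.
  have N1 : ((-1 : F) == 1) || ((-1 : F) == -1) by rewrite eqxx orbT.
  have h2 := card_off_diag iota1 iota1 pF p2 cL1 k0 cL1 k0 (ltnW de : (N < p ^ e)%N) N1 Hg.
  apply: le_trans (ler_wpM2l _ h1) _; first by rewrite lecR ltW.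
  rewrite -natrD; apply: nat_scale.
  have e1 := err2_bound R q3 (k + k) g; have e2 := qX_halfdiag R q3 k.
  apply: (@le_trans _ _ ((2 * (k + k) ^ 2 * q ^ ((k + k) %/ 3) + 5 * (k + k) ^ 2 * q ^ ((k + k - g) %/ 2))%:R / s ^+ (k + k) +
    (k ^ 2)%:R * ((q ^ (k %/ 2))%:R / s ^+ (k + k)))).
    by rewrite mulrA -natrM -mulrDl -natrD ler_pM2r // ler_nat leq_add2r.
  apply: le_trans (lerD e1 (ler_wpM2l _ e2)) _; first by rewrite ler0n.
  rewrite /err natrX; have : (k%:R : R) ^+ 2 <= (k + k)%:R ^+ 2 by rewrite lerXn2r ?nnegrE ?ler0n // ler_nat leq_addr.
  have := exprn_ge0 (k + k) (zr_ge0 R); move: rr.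
  move: ((k + k)%:R ^+ 2) (k%:R ^+ 2 : R) (zr R ^+ (k + k)) => x y z; nra.
rewrite subr0; have [L2 [iota2 [cL2 HT2]]] := Tz_ext l0.
have -> : M2 k%:Z (if b then l%:Z else - l%:Z) = (s ^- (k + l))%:C *
    (IA * \sum_(a in A) Sx p Psi e iota1 k a * Seps p Psi e iota2 b l a).
  rewrite /M2 [RHS]mulrCA; congr (_ * _); rewrite mulr_sumr; apply: eq_bigr => a aA.
  rewrite HT1 // /Seps exprD invfM rmorphM /=; case: b {nd}.
    by rewrite HT2 // mulrNN mulrACA.
  rewrite TzN HT2 // rmorphN rmorphM /= mulrNN mulrACA; congr (_ * _ * _).
  exact: conjCR.
rewrite normrM norm_sk.
have h1 := second_moment pF p2 PD P0 Pnt cdp (ltn0Sn m) de iota1 iota2 cL1 k0 cL2 l0 nd.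
have N1 : ((sgF F b) == 1) || ((sgF F b) == -1) by rewrite /sgF; case: (b); rewrite eqxx ?orbT.
have h2 := card_off_diag iota1 iota2 pF p2 cL1 k0 cL2 l0 (ltnW de : (N < p ^ e)%N) N1 Hg.
apply: le_trans (ler_wpM2l _ h1) _; first by rewrite lecR ltW.
apply: nat_scale; apply: (@le_trans _ _ ((2 * (k + l) ^ 2 * q ^ ((k + l) %/ 3) + 5 * (k + l) ^ 2 * q ^ ((k + l - g) %/ 2))%:R / s ^+ (k + l))).
  by rewrite ler_pM2r // ler_nat.
apply: le_trans (err2_bound R q3 _ _) _; rewrite /err; move: rr.
by move: ((k + l)%:R ^+ 2) (zr R ^+ (k + l)) => x z; nra.
Qed.
End Moments.

Section PolyExp.
Variable R : realType.

Lemma linexp_bound (w : R) r : 0 <= w -> w <= 1 -> r.+1%:R * w ^+ r * (1 - w) <= 1 - w ^+ r.+1.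
Proof.
move=> w0 w1; elim: r => [|r IH]; first by rewrite mul1r expr0 mul1r expr1.
have wr : 0 <= w ^+ r.+1 by rewrite exprn_ge0.
have wr1 : w ^+ r.+1 <= 1 by rewrite exprn_ile1.
have -> : r.+2%:R * w ^+ r.+1 * (1 - w) = w * (r.+1%:R * w ^+ r * (1 - w)) + w ^+ r.+1 * (1 - w).
  by rewrite -[r.+2%:R]natr1 exprS; ring.
apply: le_trans (lerD (ler_wpM2l w0 IH) (lexx _)) _.
rewrite [w ^+ r.+2]exprS; nra.
Qed.

(** Induction on a: half of the decay, a factor [Num.sqrt z ^+ r], is spent on one factor r + 1, and
    the other half is left for the remaining ones. *)
Lemma polyexp_bound (z : R) a : 0 < z -> z < 1 -> exists2 K, 0 <= K & forall r, r.+1%:R ^+ a * z ^+ r <= K.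
Proof.
elim: a z => [|a IH] z z0 z1.
  by exists 1 => // r; rewrite expr0 mul1r exprn_ile1 // ltW.
set w := Num.sqrt z.
have w0 : 0 < w by rewrite sqrtr_gt0.
have w2 : w ^+ 2 = z by rewrite sqr_sqrtr // ltW.
have w1 : w < 1 by rewrite -(ltr_pXn2r (ltn0Sn 1)) ?nnegrE ?ltW // w2 expr1n.
have [K K0 HK] := IH w w0 w1.
have c0 : 0 < 1 - w by rewrite subr_gt0.
exists (K * (1 - w)^-1); first by rewrite mulr_ge0 // invr_ge0 ltW.
move=> r; rewrite -w2 -exprM mulnC exprM expr2 exprSr.
have -> : r.+1%:R ^+ a * r.+1%:R * (w ^+ r * w ^+ r) = (r.+1%:R ^+ a * w ^+ r) * (r.+1%:R * w ^+ r) :> R by ring.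
apply: ler_pM => //; try by rewrite mulr_ge0 ?exprn_ge0 ?ltW.
rewrite -[leRHS]mul1r ler_pdivlMr //; apply: le_trans (linexp_bound r (ltW w0) (ltW w1)) _.
by rewrite gerBl exprn_ge0 // ltW.
Qed.
End PolyExp.

Section SymMore.
Variable R : realType.

Lemma eq_sy (V : zmodType) Q (F G : int -> V) : (forall c : int, (`|c| <= Q)%N -> F c = G c) -> sy Q F = sy Q G.
Proof. by move=> H; apply: eq_bigr => a _; apply: H; have := ltn_ord a; lia. Qed.

Lemma sy_leI Q (F G : int -> R) : (forall c : int, (`|c| <= Q)%N -> F c <= G c) -> sy Q F <= sy Q G.
Proof. by move=> H; apply: ler_sum => a _; apply: H; have := ltn_ord a; lia. Qed.

Lemma sy_normI Q (F : int -> R[i]) (G : int -> R) : (forall c : int, (`|c| <= Q)%N -> `|F c| <= (G c)%:C) ->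
  `|sy Q F| <= (sy Q G)%:C.
Proof.
move=> H; apply: le_trans (ler_norm_sum _ _ _) _; rewrite rmorph_sum.
by apply: ler_sum => a _; apply: H; have := ltn_ord a; lia.
Qed.

Lemma sy_single (V : zmodType) Q (c0 : int) (v : V) : (`|c0| <= Q)%N -> sy Q (fun c => if c == c0 then v else 0) = v.
Proof.
move=> h; have lt : (absz (c0 + Q%:Z)%R < (2 * Q).+1)%N by lia.
rewrite /sy (bigD1 (Ordinal lt)) //= ifT; last by apply/eqP; lia.
rewrite big1 ?addr0 // => i ni; rewrite ifF //; apply/negbTE; apply: contraNneq ni => E.
by apply/eqP/val_inj => /=; lia.
Qed.

Lemma sy_cst Q (x : R) : sy Q (fun=> x) = x * (2 * Q).+1%:R.
Proof. by rewrite /sy sumr_const card_ord mulr_natr. Qed.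

Lemma sy_shift Q (F : int -> R) (k : int) : (forall c, 0 <= F c) -> sy Q (fun c => F (k + c)) <= sy (Q + `|k|) F.
Proof.
move=> F0; rewrite /sy -(big_mkord xpredT (fun a => F (k + (a%:Z - Q%:Z)))) -(big_mkord xpredT (fun a => F (a%:Z - (Q + `|k|)%:Z))).
pose s := absz (k + (absz k)%:Z)%R.
have -> : \sum_(0 <= a < (2 * Q).+1) F (k + (a%:Z - Q%:Z)) = \sum_(0 + s <= b < (2 * Q).+1 + s) F (b%:Z - (Q + `|k|)%:Z).
  by rewrite big_addn addnK; apply: eq_bigr => a _; congr F; rewrite /s; lia.
have le1 : (0 + s <= (2 * Q).+1 + s)%N by lia.
have le2 : ((2 * Q).+1 + s <= (2 * (Q + `|k|)).+1)%N by rewrite /s; lia.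
rewrite (big_cat_nat (leq0n (0 + s)) (leq_trans le1 le2)) /= [X in _ <= _ + X](big_cat_nat le1 le2) /=.
by rewrite addrA ler_wpDr ?sumr_ge0 // ler_wpDl ?sumr_ge0.
Qed.
End SymMore.

Section Gap.
Variables (R : realType) (Phi : R -> R -> R[i]).
Hypothesis SPhi : schwartz2 Phi.

Lemma fourier_bound : exists2 B : R, 0 <= B & forall tau sigma, `|fourier2 Phi tau sigma| <= B%:C.
Proof.
have [S1 S2] := SPhi.
have [C1 C10 H1] := schwartz_wt S1 [::]; have [C2 C20 H2] := schwartz_wt S2 [::].
pose I := Rintegral (@mu2 R) setT (@wt2 R).
have b1 (g : R * R -> R) : (@mu2 R).-integrable setT (EFin \o g) -> (forall z, `|g z| <= (C1 + C2) * wt2 z) -> `|Rintegral (@mu2 R) setT g| <= (C1 + C2) * I.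
  move=> gi gb; apply: le_trans (le_normr_Rintegral _ gi) _ => //.
  rewrite -RintegralZl //; last exact: integrable_wt2.
  apply: le_Rintegral => //.
    by have := integrable_abse gi; apply: eq_integrable.
  have := @integrableZl _ _ R (@mu2 R) setT measurableT (C1 + C2) _ (integrable_wt2 R).
  by apply: eq_integrable.
have I0 : 0 <= I by apply: Rintegral_ge0 => z _; rewrite mulr_ge0 ?wt_ge0.
exists ((C1 + C2) * I + (C1 + C2) * I); first by rewrite addr_ge0 // mulr_ge0 // addr_ge0.
move=> tau sigma; apply: le_trans (normC_le _) _; rewrite lecR.
have [i1 i2] := icx_fourier tau sigma SPhi.
have u0 (z : R * R) : 0 <= wt2 z by rewrite mulr_ge0 ?wt_ge0.
have P1 (z : R * R) : `|complex.Re (Phi z.1 z.2)| <= C1 * wt2 z by rewrite /wt2 mulrA; exact: H1.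
have P2 (z : R * R) : `|complex.Im (Phi z.1 z.2)| <= C2 * wt2 z by rewrite /wt2 mulrA; exact: H2.
apply: lerD; apply: b1 => // z; rewrite ?cReM ?cImM /=.
  apply: le_trans (ler_normB _ _) _; rewrite !normrM [leRHS]mulrDl; apply: lerD.
    by rewrite -[leRHS]mulr1; apply: ler_pM => //; exact: cos_max.
  by rewrite -[leRHS]mulr1; apply: ler_pM => //; exact: sin_max.
apply: le_trans (ler_normD _ _) _; rewrite !normrM [leRHS]mulrDl; apply: lerD.
  by rewrite -[leRHS]mulr1; apply: ler_pM => //; exact: sin_max.
by rewrite -[leRHS]mulr1; apply: ler_pM => //; exact: cos_max.
Qed.

(** The closed support is compact, so |tau| + |sigma| attains its maximum on it, and this maximum is
    strictly below b. *)
Lemma support_gap (b : R) :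
  closure [set x : R * R | fourier2 Phi x.1 x.2 != 0] `<=` [set x : R * R | `|x.1| + `|x.2| < b] ->
  exists2 G : nat, (0 < G)%N & forall tau sigma, fourier2 Phi tau sigma != 0 -> `|tau| + `|sigma| <= b - G%:R^-1.
Proof.
set S := [set x | _] => H.
case: (pselect (S !=set0)) => [S0|S0]; last first.
  by exists 1%N => // tau sigma h; exfalso; apply: S0; exists (tau, sigma).
have cS : compact (closure S).
  have cB : compact (`[- b, b]%classic `*` `[- b, b]%classic : set (R * R)) by apply: compact_setX; exact: segment_compact.
  apply: (subclosed_compact _ cB); first exact: closed_closure.
  move=> [x y] /H /= h; have := normr_ge0 x; have := normr_ge0 y => y0 x0.
  by split; rewrite /= in_itv /= -ler_norml; lra.
have cf : continuous (fun x : R * R => `|x.1| + `|x.2|).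
  move=> x; apply: cvgD; apply: cvg_norm; [exact: cvg_fst|exact: cvg_snd].
have S0' : closure S !=set0 by case: S0 => x xS; exists x; exact: subset_closure.
have [c cin cmax] := compact_EVT_max S0' cS (continuous_subspaceT cf).
have cb : `|c.1| + `|c.2| < b by apply: H; rewrite inE in cin.
set e := b - (`|c.1| + `|c.2|); have e0 : 0 < e by rewrite subr_gt0.
exists (Num.Def.archi_bound e^-1).+1 => // tau sigma h.
have hm : `|tau| + `|sigma| <= `|c.1| + `|c.2|.
  by apply: (cmax (tau, sigma)); rewrite inE; apply: subset_closure.
apply: le_trans hm _; rewrite lerBrDr -lerBrDl -/e -[leRHS]invrK lef_pV2 ?posrE ?invr_gt0 ?ltr0n //.
apply: ltW; apply: lt_trans (archi_boundP _) _; first by rewrite invr_ge0 ltW.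
by rewrite ltr_nat.
Qed.
End Gap.

Section W2.
Variables (R : realType) (Phi : R -> R -> R[i]) (N : nat).
Hypotheses (SPhi : schwartz2 Phi) (N0 : (0 < N)%N).
Hypothesis Psupp : forall tau sigma, 2 <= `|tau| + `|sigma| -> fourier2 Phi tau sigma = 0.
Local Notation Q := (2 * N)%N.
Local Notation C := R[i].

Definition ph (c c' : int) : C := fourier2 Phi (c%:~R / N%:R) (c'%:~R / N%:R).
Definition Tsum (th : 'I_N -> R) (c : int) : C := \sum_(i < N) cexp (2 * pi * (c%:~R * th i)).

Lemma sum_sy (I : finType) (V : zmodType) (F : I -> int -> V) J : \sum_i sy J (F i) = sy J (fun c => \sum_i F i c).
Proof. exact: exchange_big. Qed.

(** The sum over i <> j is the full double sum minus its diagonal. The former produces T_c T_c', the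
    latter T_(c + c'). *)
Lemma W2E (th : 'I_N -> R) : W2 Phi th = (N%:R^-1 ^+ 2)%:C *
  sy Q (fun c => sy Q (fun c' => ph c c' * (Tsum th c * Tsum th c' - Tsum th (c + c')))).
Proof.
have E i : \sum_(j < N | i != j) phiN Phi N (th i) (th j) =
    \sum_(j < N) phiN Phi N (th i) (th j) - phiN Phi N (th i) (th i).
  by rewrite [in RHS](bigD1 i) //= [RHS]addrAC subrr add0r; apply: eq_bigl => j; rewrite eq_sym.
rewrite /W2 (eq_bigr _ (fun i _ => E i)) sumrB.
under eq_bigr => i _ do under eq_bigr => j _ do rewrite (phiN_fourier _ _ SPhi N0 Psupp).
under [X in _ - X]eq_bigr => i _ do rewrite (phiN_fourier _ _ SPhi N0 Psupp).
under eq_bigr => i _ do rewrite -mulr_suml.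
rewrite -!mulr_suml -mulrBl mulrC; congr (_ * _); rewrite /psum.
under eq_bigr => i _ do rewrite sum_sy.
rewrite !sum_sy -sy_B; apply: eq_bigr => a _.
under [X in X - _]eq_bigr => i _ do rewrite sum_sy.
rewrite !sum_sy -sy_B; apply: eq_bigr => a' _; move: (a%:Z - _) (a'%:Z - _) => c c'.
rewrite /fcoef -/(ph c c'); under eq_bigr => i _ do rewrite -mulr_sumr.
rewrite -!mulr_sumr -mulrBr; congr (_ * (_ - _)).
  rewrite /Tsum mulr_suml; apply: eq_bigr => i _; rewrite mulr_sumr; apply: eq_bigr => j _.
  by rewrite -cexpD; congr cexp; ring.
by apply: eq_bigr => i _; congr cexp; rewrite intrD; ring.
Qed.

(** The expected main part of T_c T_c' - T_(c + c') on average: N ^ 2 - N at the origin, and |c| - N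
    elsewhere on the antidiagonal, |c| from the diagonal pairs of points and - N from the terms i =
    j. *)
Definition Dr (c c' : int) : R :=
  if c' == - c then `|c|%N%:R - N%:R + (if c == 0 then N%:R ^+ 2 else 0) else 0.

Lemma cesaro_weight (G : int -> C) M : \sum_(k < M) sy k G = sy M (fun c => (M%:R - `|c|%N%:R) * G c).
Proof.
elim: M => [|M IH]; first by rewrite big_ord0 sy0 subrr mul0r.
rewrite big_ord_recr /= IH syS abszN !absz_nat subrr !mul0r !addr0 -sy_D; apply: eq_bigr => a _.
by rewrite -[M.+1%:R]natr1; ring.
Qed.

Lemma main_termD : main_term Phi N = (N%:R^-1 ^+ 2)%:C * sy Q (fun c => sy Q (fun c' => ph c c' * (Dr c c')%:C)).
Proof.
pose G (c : int) := ph c (- c).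
(* On the antidiagonal |tau| + |sigma| is 2 |c| / N, so a support inside the region below 2 leaves
   only |c| < N, where the Fejer weights are positive. *)
have G0 (c : int) : (N%:Z <= `|c|)%R -> G c = 0.
  move=> h; apply: Psupp; have Nr : 0 < (N%:R : R) by rewrite ltr0n.
  have -> : `|(- c)%:~R / N%:R| = `|c%:~R / N%:R| :> R by rewrite mulrNz mulNr normrN.
  suff : 1 <= `|c%:~R / N%:R : R| by lra.
  by rewrite normrM normfV (gtr0_norm Nr) ler_pdivlMr // mul1r -intr_norm pmulrn ler_int.
have inner c : (`|c| <= Q)%N -> sy Q (fun c' => ph c c' * (Dr c c')%:C) = G c * (Dr c (- c))%:C.
  move=> h; rewrite -[RHS](@sy_single _ Q (- c)); last by rewrite abszN.
  by apply: eq_sy => c' _; rewrite /Dr; case: eqP => [->|_]; rewrite ?eqxx ?rmorph0 ?mulr0.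
rewrite (eq_sy inner) /main_term.
have -> : \sum_(j < N) \sum_(k < N) fourier2 Phi ((j%:Z - k%:Z)%:~R / N%:R) (- (j%:Z - k%:Z)%:~R / N%:R) = sy Q (fun c => (N%:R - `|c|%N%:R) * G c).
  have -> : sy Q (fun c => (N%:R - `|c|%N%:R) * G c) = sy N (fun c => (N%:R - `|c|%N%:R) * G c).
    apply: sy_supp; last by lia.
    by move=> c h; rewrite G0 ?mulr0 // ltW.
  rewrite -cesaro_weight -cesaro; apply: eq_bigr => j _; apply: eq_bigr => k _.
  by rewrite /G /ph mulrNz.
have -> : sy Q (fun c => G c * (Dr c (- c))%:C) = sy Q (fun c => if c == 0 then G 0 * N%:R ^+ 2 else 0) - sy Q (fun c => (N%:R - `|c|%N%:R) * G c).
  rewrite -sy_B; apply: eq_sy => c _; rewrite /Dr eqxx rmorphD rmorphB /= !rmorph_nat.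
  by case: eqP => [->|_]; rewrite ?rmorphXn ?rmorph_nat ?rmorph0 /=; ring.
rewrite sy_single // mulrBr; congr (_ - _).
rewrite /G /ph oppr0 mul0r mulrCA rmorphXn fmorphV rmorph_nat -exprMn mulVf ?expr1n ?mulr1 //.
by rewrite pnatr_eq0 -lt0n.
Qed.
End W2.

(** * Total error of the averaged pair correlation *)

Section Assembly.
Variables (R : realType) (p : nat) (psi : 'F_p -> R[i]) (Phi : R -> R -> R[i]).
Local Notation C := R[i].
Hypotheses (psi_char : nontriv_add_char psi) (p2 : (2 < p)%N) (SPhi : schwartz2 Phi).
Hypothesis Psupp : forall tau sigma, 2 <= `|tau| + `|sigma| -> fourier2 Phi tau sigma = 0.
Variables (F : finFieldType) (N : nat).
Hypotheses (pF : p \in [pchar F]) (cdp : coprime N.+1 p) (N0 : (0 < N)%N).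
Local Notation M1 := (@M1 R p psi F N).
Local Notation M2 := (@M2 R p psi F N).
Local Notation Q := (2 * N)%N.
Local Notation ph := (ph Phi N).
Variable g : nat.
Local Notation E := (err R g).

Lemma err_ge0 r : 0 <= E r.
Proof. by rewrite /err addr_ge0 // !mulr_ge0 ?sqr_ge0 ?exprn_ge0 ?zr_ge0. Qed.

Lemma avgW2E : avgW2 psi Phi F N.+1 = (N%:R^-1 ^+ 2)%:C *
  sy Q (fun c => sy Q (fun c' => ph c c' * (M2 c c' - M1 (c + c')))).
Proof.
rewrite /avgW2 /= (eq_bigr _ (fun a _ => W2E SPhi N0 Psupp _)) -mulr_sumr mulrCA; congr (_ * _).
rewrite /sy exchange_big mulr_sumr; apply: eq_bigr => i _.
rewrite exchange_big mulr_sumr; apply: eq_bigr => j _.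
by rewrite -mulr_sumr mulrCA sumrB mulrBr.
Qed.

Lemma M1_boundz (c : int) : c != 0 -> (p * (`|c|%N + g) <= (2 * p - 2) * N)%N -> `|M1 c| <= (E `|c|%N)%:C.
Proof.
move=> c0 H; have k0 : (0 < `|c|)%N by rewrite absz_gt0.
have := M1_bound psi_char p2 pF cdp k0 H.
by case: (intP c) c0 k0 H => [|k|k] // _ _ _; rewrite ?abszN ?M1N.
Qed.

Lemma M2_boundz (c c' : int) : c != 0 -> c' != 0 -> (p * (`|c|%N + `|c'|%N + g) <= (2 * p - 2) * N)%N ->
  `|M2 c c' - (if c' == - c then `|c|%N%:R else 0)%:C| <= (E (`|c| + `|c'|)%N)%:C.
Proof.
have pos k (x : int) : (0 < k)%N -> x != 0 -> (p * (k + `|x|%N + g) <= (2 * p - 2) * N)%N ->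
    `|M2 k%:Z x - (if x == - k%:Z then k%:R else 0)%:C| <= (E (k + `|x|)%N)%:C.
  move=> k0 x0 H; have l0 : (0 < `|x|)%N by rewrite absz_gt0.
  case: (leP 0 x) => xs.
    have := M2_bound psi_char p2 pF cdp true k0 l0 H; rewrite /= (gez0_abs xs).
    by rewrite (_ : (x == - k%:Z) = false) //; apply/eqP; lia.
  have := M2_bound psi_char p2 pF cdp false k0 l0 H; rewrite /= (_ : - (`|x|%N%:Z) = x); last by lia.
  by rewrite (_ : (k == `|x|%N) = (x == - k%:Z)) //; apply/eqP/eqP; lia.
move=> c0 c'0 H; have k0 : (0 < `|c|)%N by rewrite absz_gt0.
case: (leP 0 c) => cs; first by have := pos _ _ k0 c'0 H; rewrite (gez0_abs cs).
rewrite -M2N; have := pos `|c|%N (- c') k0; rewrite oppr_eq0 abszN => /(_ c'0 H).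
rewrite (_ : `|c|%N%:Z = - c); last by lia.
by rewrite opprK (_ : (- c' == c) = (c' == - c)) // eqr_oppLR.
Qed.

(** When c or c' is 0 the corresponding power sum is exactly N, which costs a factor N; but such
    pairs number only O (N) among the O (N ^ 2) pairs. *)
Definition Ub (c c' : int) : R := E (`|c| + `|c'|)%N + (if c == 0 then N%:R * E `|c'|%N else 0) +
  (if c' == 0 then N%:R * E `|c|%N else 0) + E (absz (c + c')).

Lemma Ub_ge0 c c' : 0 <= Ub c c'.
Proof.
have b (t : bool) r : 0 <= (if t then N%:R * E r else 0) by case: t => //; rewrite mulr_ge0 ?err_ge0.
have h1 := b (c == 0) `|c'|%N; have h2 := b (c' == 0) `|c|%N.
by rewrite /Ub; have h3 := err_ge0 (`|c| + `|c'|); have h4 := err_ge0 (absz (c + c')); lra.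
Qed.

Lemma moment_error c c' : (p * (`|c|%N + `|c'|%N + g) <= (2 * p - 2) * N)%N ->
  `|M2 c c' - M1 (c + c') - (Dr R N c c')%:C| <= (Ub c c')%:C.
Proof.
move=> H; have e0 := err_ge0; have Nr : 0 <= (N%:R : R) by [].
have C1 (x : int) : (p * (`|x|%N + g) <= (2 * p - 2) * N)%N -> x != 0 -> `|N%:R * M1 x - M1 x| <= (N%:R * E `|x|%N + E `|x|%N)%:C.
  move=> hx x0; apply: le_trans (ler_normB _ _) _; rewrite normrM normr_nat rmorphD rmorphM /= rmorph_nat.
  by apply: lerD; [apply: ler_wpM2l => //|]; exact: M1_boundz.
rewrite /Ub /Dr; case: (eqVneq c 0) => [c0|c0]; case: (eqVneq c' 0) => [c'0|c'0].
- rewrite c0 c'0 oppr0 eqxx addr0 M2_0r M1_0 // absz0 rmorphD rmorphB rmorph_nat rmorphXn /= rmorph_nat /=.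
  rewrite (_ : N%:R * N%:R - N%:R - _ = 0); last by rewrite sub0r; ring.
  by rewrite normr0 lecR; have z1 := e0 0%N; have z2 := e0 (0 + 0)%N; have z3 := mulr_ge0 Nr z1; lra.
- rewrite c0 oppr0 (negbTE c'0) add0r M2C M2_0r rmorph0 subr0 absz0 add0n addr0.
  apply: le_trans (C1 c' _ c'0) _; first by apply: leq_trans H; rewrite leq_mul2l; apply/orP; right; lia.
  by rewrite lecR -addrA ler_wpDl.
- rewrite c'0 [0 == _]eq_sym oppr_eq0 (negbTE c0) addr0 M2_0r rmorph0 subr0 absz0 addn0 addr0.
  apply: le_trans (C1 c _ c0) _; first by apply: leq_trans H; rewrite leq_mul2l; apply/orP; right; lia.
  by rewrite lecR -addrA ler_wpDl.
have B2 := M2_boundz c0 c'0 H; rewrite !addr0.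
case: (eqVneq c' (- c)) B2 => [E1|ne] B2.
  rewrite E1 subrr M1_0 // rmorphB /= rmorph_nat.
  rewrite (_ : M2 c (- c) - N%:R - _ = M2 c (- c) - (`|c|%N%:R)%:C); last by rewrite rmorph_nat; ring.
  by rewrite -E1; apply: le_trans B2 _; rewrite lecR ler_wpDr.
rewrite rmorph0 subr0 in B2; rewrite rmorph0 [X in `|X|]subr0 rmorphD.
apply: le_trans (ler_normB _ _) _; apply: lerD => //.
apply: M1_boundz; first by rewrite addrC addr_eq0.
by apply: leq_trans H; rewrite leq_mul2l; apply/orP; right; lia.
Qed.

Variables (K1 K2 B : R).
Hypotheses (K10 : 0 <= K1) (B0 : 0 <= B).
Hypothesis HK1 : forall r : nat, 10 * r%:R ^+ 2 * zr R ^+ r <= K1 * wt (r%:R : R).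
Hypothesis HK2 : N%:R ^+ 4 * zr R ^+ g <= K2.
Hypothesis HB : forall tau sigma, `|fourier2 Phi tau sigma| <= B%:C.
Hypothesis Hg : forall c c', ph c c' != 0 -> (p * (`|c|%N + `|c'|%N + g) <= (2 * p - 2) * N)%N.

(** Bound for the second term of [err]: its index r reaches 4 N, and 5 (4 N) ^ 2 = 80 N ^ 2. *)
Let X : R := 80 * N%:R ^+ 2 * zr R ^+ g.
Let X0 : 0 <= X. Proof. by rewrite !mulr_ge0 ?sqr_ge0 ?exprn_ge0 ?zr_ge0. Qed.

Lemma err_le (r : nat) : (r <= 4 * N)%N -> E r <= K1 * wt (r%:R : R) + X.
Proof.
move=> h; rewrite /err; apply: lerD => //; rewrite /X; apply: ler_wpM2r; first by rewrite exprn_ge0 ?zr_ge0.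
have : (r%:R : R) ^+ 2 <= (4 * N%:R) ^+ 2 by rewrite lerXn2r ?nnegrE ?mulr_ge0 // -natrM ler_nat.
by rewrite exprMn; lra.
Qed.

Lemma wt_abs (c : int) : wt (`|c|%N%:R : R) = wt (c%:~R).
Proof. by rewrite /wt pmulrn abszE intr_norm real_normK ?num_real. Qed.

Lemma Ub_le c c' : (`|c| <= Q)%N -> (`|c'| <= Q)%N -> Ub c c' <= K1 * wt (c'%:~R) + K1 * wt ((c + c')%:~R) +
  (if c == 0 then N%:R * K1 * wt (c'%:~R) else 0) + (if c' == 0 then N%:R * K1 * wt (c%:~R) else 0) + (2 + 2 * N%:R) * X.
Proof.
move=> hc hc'; have Nr : 0 <= (N%:R : R) by [].
have h1 : E (`|c| + `|c'|)%N <= K1 * wt (c'%:~R) + X.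
  apply: le_trans (err_le _) _; first by lia.
  rewrite lerD2r ler_wpM2l // -wt_abs /wt lef_pV2 ?posrE ?ltr_pwDl ?sqr_ge0 // lerD2l.
  by rewrite lerXn2r ?nnegrE // ler_nat leq_addl.
have h2 : E (absz (c + c')) <= K1 * wt ((c + c')%:~R) + X by rewrite -wt_abs; apply: err_le; lia.
have h3 (x : int) : (`|x| <= Q)%N -> N%:R * E `|x|%N <= N%:R * K1 * wt (x%:~R) + N%:R * X.
  by move=> hx; rewrite -mulrA -mulrDr ler_wpM2l // -wt_abs; apply: err_le; lia.
have h4 (b : bool) (x : int) : (`|x| <= Q)%N -> (if b then N%:R * E `|x|%N else 0) <= (if b then N%:R * K1 * wt (x%:~R) else 0) + N%:R * X.
  by move=> hx; case: b; [exact: h3|rewrite add0r mulr_ge0].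
rewrite /Ub; have := h4 (c == 0) c' hc'; have := h4 (c' == 0) c hc; lra.
Qed.

(** The weights wt make one of the two summations bounded, so the total is of order N, and the
    factor N ^ -2 in front leaves an error O (1 / N). The constant 60 collects 10 (4 N + 1) <= 50 N
    and twice 5 N. The product of three factors 20 is 4 times 80 times 25, from 2 + 2 N <= 4 N, from
    X, and from the (4 N + 1) ^ 2 <= 25 N ^ 2 pairs. *)
Lemma sum_Ub : sy Q (fun c => sy Q (fun c' => Ub c c')) <= (60 * K1 + 20 * (20 * (20 * K2))) * N%:R.
Proof.
have N1 : 1 <= (N%:R : R) by rewrite ler1n.
have q1 : (2 * Q).+1%:R = 4 * N%:R + 1 :> R by rewrite -natr1 !natrM; ring.
pose V : R := (2 + 2 * N%:R) * X.
have inner (c : int) : (`|c| <= Q)%N -> sy Q (fun c' => Ub c c') <=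
    10 * K1 + (if c == 0 then N%:R * K1 * 5 else 0) + N%:R * K1 * wt (c%:~R) + V * (4 * N%:R + 1).
  move=> hc; apply: le_trans (sy_leI (fun c' h => Ub_le hc h)) _.
  rewrite !sy_D sy_cst q1 -/V; apply: lerD => //.
  have w5 := sy_wt R Q.
  have s1 : sy Q (fun c' => K1 * wt (c'%:~R : R)) <= K1 * 5 by rewrite sy_Zl ler_wpM2l.
  have s2 : sy Q (fun c' => K1 * wt ((c + c')%:~R : R)) <= K1 * 5.
    rewrite sy_Zl ler_wpM2l //; apply: le_trans (sy_wt R (Q + `|c|)).
    by apply: (@sy_shift R Q (fun c => wt (c%:~R : R)) c) => x; exact: wt_ge0.
  have s3 : sy Q (fun c' => if c == 0 then N%:R * K1 * wt (c'%:~R : R) else 0) <= (if c == 0 then N%:R * K1 * 5 else 0).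
    case: ifP => _; last by rewrite sy_cst mul0r.
    by rewrite sy_Zl ler_wpM2l // mulr_ge0.
  have s4 : sy Q (fun c' => if c' == 0 then N%:R * K1 * wt (c%:~R : R) else 0) = N%:R * K1 * wt (c%:~R) by rewrite sy_single.
  by rewrite s4; lra.
apply: le_trans (sy_leI inner) _; rewrite !sy_D !sy_cst sy_single // sy_Zl q1.
have s5 : N%:R * K1 * sy Q (fun c => wt (c%:~R : R)) <= N%:R * K1 * 5 by rewrite ler_wpM2l ?sy_wt // mulr_ge0.
have kN : K1 <= K1 * N%:R by rewrite ler_peMr.
have VX : V * (4 * N%:R + 1) * (4 * N%:R + 1) <= 20 * (20 * (20 * K2)) * N%:R.
  apply: (@le_trans _ _ ((4 * N%:R) * X * ((5 * N%:R) * (5 * N%:R)))).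
    have V0 : 0 <= V by rewrite /V mulr_ge0 // addr_ge0 // mulr_ge0.
    have L0 : 0 <= 4 * N%:R + 1 :> R by rewrite addr_ge0 // mulr_ge0.
    rewrite -[leLHS]mulrA; apply: ler_pM; [exact: V0|exact: mulr_ge0| |].
      by rewrite /V; apply: ler_wpM2r => //; lra.
    by apply: ler_pM => //; lra.
  rewrite (_ : _ * X * _ = 20 * (20 * (20 * (N%:R ^+ 4 * zr R ^+ g))) * N%:R); last by rewrite /X; ring.
  by apply: ler_wpM2r => //; rewrite !ler_pM2l.
lra.
Qed.

Lemma avg_error : `|avgW2 psi Phi F N.+1 - main_term Phi N| <= (B * (60 * K1 + 20 * (20 * (20 * K2))) / N%:R)%:C.
Proof.
have Nr : 0 < (N%:R : R) by rewrite ltr0n.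
rewrite avgW2E (main_termD N0 Psupp) -mulrBr normrM.
have -> : `|(N%:R^-1 ^+ 2)%:C : C| = (N%:R^-1 ^+ 2)%:C by rewrite ger0_norm // lecR sqr_ge0.
apply: (@le_trans _ _ ((N%:R^-1 ^+ 2)%:C * (B * ((60 * K1 + 20 * (20 * (20 * K2))) * N%:R))%:C)); last first.
  by rewrite -rmorphM lecR /= le_eqVlt; apply/orP; left; apply/eqP; field; rewrite gt_eqF.
apply: ler_wpM2l; first by rewrite lecR sqr_ge0.
rewrite -sy_B; apply: (@le_trans _ _ (sy Q (fun c => sy Q (fun c' => B * Ub c c')))%:C); last first.
  rewrite lecR; under eq_sy => c _ do rewrite sy_Zl.
  by rewrite sy_Zl ler_wpM2l // sum_Ub.
apply: sy_normI => c _; rewrite -sy_B; apply: sy_normI => c' _.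
rewrite -mulrBr normrM rmorphM; case: (eqVneq (ph c c') 0) => [->|nz].
  by rewrite normr0 mul0r -rmorphM lecR mulr_ge0 // Ub_ge0.
by apply: ler_pM => //; [exact: HB|exact: moment_error (Hg nz)].
Qed.
End Assembly.

Theorem theorem1 (R : realType) (p : nat) (psi : 'F_p -> R[i])
    (Phi : R -> R -> R[i]) :
  prime p -> (2 < p)%N ->
  nontriv_add_char psi ->
  schwartz2 Phi ->
  closure [set x : R * R | fourier2 Phi x.1 x.2 != 0]
    `<=` [set x : R * R | `|x.1| + `|x.2| < 2 - 2 / (p%:R : R)] ->
  forall eps : R, 0 < eps ->
  exists d0 : nat,
    forall (F : finFieldType), p \in [pchar F] ->
    forall d : nat, (d0 <= d)%N -> coprime d p ->
      `| avgW2 psi Phi F d - rhs Phi | < eps%:C.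
Proof.
move=> p_pr p2 psi_char SPhi supp eps eps0.
have p0 : 0 < (p%:R : R) by rewrite ltr0n prime_gt0.
have [G G0 HG] := support_gap supp; have Gr : 0 < (G%:R : R) by rewrite ltr0n.
have [B B0 HB] := fourier_bound SPhi.
have Psupp tau sigma : 2 <= `|tau| + `|sigma| -> fourier2 Phi tau sigma = 0.
  move=> h; apply/eqP/negPn/negP => /HG h'.
  have pp : 0 < 2 / (p%:R : R) by rewrite divr_gt0.
  have gp : 0 < (G%:R^-1 : R) by rewrite invr_gt0.
  by move: h h' pp gp; lra.
(* The exponent 4 serves both r ^ 2 (1 + r ^ 2) <= (r + 1) ^ 4 in [HK1] and the factor N ^ 4 in
   [HK2]. *)
have [K K0 HK] := polyexp_bound 4 (zr_gt0 R) (zr_lt1 R).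
have HK1 (r : nat) : 10 * r%:R ^+ 2 * zr R ^+ r <= (10 * K) * wt (r%:R : R).
  rewrite /wt ler_pdivlMr ?ltr_pwDl ?sqr_ge0 //; have := HK r.
  have r0 : 0 <= (r%:R : R) by [].
  have : (r%:R : R) ^+ 2 * (1 + r%:R ^+ 2) <= r.+1%:R ^+ 4.
    by rewrite -[r.+1%:R]natr1; move: (r%:R : R) r0 => x x0; nra.
  have := exprn_ge0 r (zr_ge0 R); move: (zr R ^+ r) => z z0 h1 h2.
  have := ler_wpM2r z0 h1; lra.
pose K2 := G%:R ^+ 4 * K.
have K20 : 0 <= K2 by rewrite mulr_ge0 // exprn_ge0.
have [N1 HN1] := main_term_cvg SPhi (divr_gt0 eps0 (ltr0n R 2)).
pose T := B * (60 * (10 * K) + 20 * (20 * (20 * K2))).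
have T0 : 0 <= T by rewrite mulr_ge0 // addr_ge0 // !mulr_ge0.
pose N2 := Num.Def.archi_bound (T / (eps / 2)).
(* The shift by 2 accounts for d = N + 1 and ensures N > 0. *)
exists (maxn N1 N2).+2 => F pF [|N] //; rewrite ltnS => hd cdp.
have N0 : (0 < N)%N by apply: leq_ltn_trans hd.
have Nr : 0 < (N%:R : R) by rewrite ltr0n.
(* The gap 1 / G of the support, scaled by N: a saving in the exponent of q that grows linearly with
   N. Conversely N <= G (g + 1), so a power of N is absorbed by the decay in g. *)
pose g := (N %/ G)%N.
have Hg c c' : ph Phi N c c' != 0 -> (p * (`|c|%N + `|c'|%N + g) <= (2 * p - 2) * N)%N.
  move=> /HG; rewrite !normrM normfV (gtr0_norm Nr) -mulrDl ler_pdivrMr // -!intr_norm -!abszE -!pmulrn => h.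
  have gN : (g%:R : R) <= N%:R / G%:R by rewrite ler_pdivlMr // -natrM ler_nat leq_trunc_div.
  have : (p * (`|c|%N + `|c'|%N + g) + 2 * N <= 2 * p * N)%N.
    rewrite -(ler_nat R) !natrD !natrM !natrD.
    have h1 : p%:R * (`|c|%N%:R + `|c'|%N%:R) <= p%:R * ((2 - 2 / p%:R - G%:R^-1) * N%:R) :> R by rewrite ler_wpM2l // ltW.
    have h2 : p%:R * g%:R <= p%:R * (N%:R / G%:R) :> R by rewrite ler_wpM2l // ltW.
    have -> : 2 * p%:R * N%:R = p%:R * ((2 - 2 / p%:R - G%:R^-1) * N%:R) + p%:R * (N%:R / G%:R) + 2 * N%:R :> R.
      by field; rewrite !gt_eqF.
    by rewrite mulrDr; lra.
  rewrite mulnBl; move: (p * _)%N (2 * p * N)%N (2 * N)%N => x y z; clear; lia.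
have HK2 : N%:R ^+ 4 * zr R ^+ g <= K2.
  have le : (N%:R : R) <= G%:R * g.+1%:R by rewrite -natrM ler_nat mulnC ltnW // ltn_ceil.
  apply: (@le_trans _ _ ((G%:R * g.+1%:R) ^+ 4 * zr R ^+ g)).
    by rewrite ler_wpM2r ?exprn_ge0 ?zr_ge0 // lerXn2r ?nnegrE ?mulr_ge0.
  by rewrite exprMn -mulrA ler_wpM2l ?exprn_ge0.
have K10 : 0 <= 10 * K by rewrite mulr_ge0.
have A1 := avg_error psi_char p2 SPhi Psupp pF cdp N0 K10 B0 HK1 HK2 HB Hg.
have A2 := HN1 N (leq_trans (leq_maxl _ _) (ltnW hd)).
rewrite -[X in `|X|](subrKA (main_term Phi N)).
apply: le_lt_trans (ler_normD _ _) _; rewrite [eps]splitr rmorphD; apply: ler_ltD => //.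
apply: le_trans A1 _; rewrite lecR -/T ler_pdivrMr // mulrC -ler_pdivrMr ?divr_gt0 //.
apply: ltW; apply: lt_le_trans (archi_boundP _) _; first by rewrite divr_ge0 // divr_ge0 // ltW.
by rewrite ler_nat; apply: leq_trans (leq_maxr _ _) (ltnW hd).
Qed.
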